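(* Let $M$ be a closed connected smooth manifold and let $H:T^*M\to\mathbb{R}$ be a smooth Hamiltonian which is proper and bounded from below. Let $c\in\mathbb{R}$ and suppose that the sublevel set $\{H<c\}$ contains the zero section $M$. Then for every nontrivial free homotopy class $\alpha$ of loops in $T^*M$ there exists a dense subset $S_\alpha\subset(c,\infty)$ such that for every $s\in S_\alpha$ the level set $\{H=s\}$ contains a periodic orbit $z=(x,y)$, of some (unspecified) period $\tau>0$, of the Hamiltonian system $(T^*M,\Omega_{can},H)$, which represents $\alpha$ and satisfies $$\int_0^\tau\langle y(t),\dot x(t)\rangle\,dt>0 .$$
   Context: $T^*M$ is the cotangent bundle with Liouville form $\theta$ (locally $\theta=\sum_i y_i\,dx^i$) and canonical symplectic form $\Omega_{can}=-d\theta$. Points are written $(x,y)$ with $y\in T_x^*M$, and $M$ is identified with the zero section. The Hamiltonian vector field is defined by $dH=\iota(X_H)\Omega_{can}$. A periodic orbit of period $\tau>0$ is a smooth map $z:\mathbb{R}/\tau\mathbb{Z}\to T^*M$ with $\dot z=X_H(z)$ ($\tau$ need not be the minimal period); it represents $\alpha$ if the loop $z$ is in the free homotopy class $\alpha$. A free homotopy class is nontrivial if it is not the class of constant loops. *)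

(* Defs.v *)
From HB Require Import structures.
From mathcomp Require Import all_boot all_order all_algebra.
From mathcomp Require Import all_classical all_reals all_analysis.

Set Implicit Arguments.
Unset Strict Implicit.
Unset Printing Implicit Defensive.

Import Order.TTheory GRing.Theory Num.Theory.
Import numFieldTopology.Exports numFieldNormedType.Exports.

Local Open Scope classical_set_scope.
Local Open Scope ring_scope.

(* [D] is meant to be open and [V] finite-dimensional; [f] is a total function
   whose values outside [D] are irrelevant. In finite dimension, asking that
   every directional derivative be C^k is asking that the differential be C^k. *)
Fixpoint Ck_on (R : realType) (V W : normedModType R) (k : nat) (D : set V)
    (f : V -> W) : Prop :=
  if k is k'.+1 then
    (forall x, D x -> differentiable f x) /\
    (forall v : V, Ck_on k' D (fun x => 'D_v f x))
  else forall x, D x -> {for x, continuous f}.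

Definition smooth_on (R : realType) (V W : normedModType R) (D : set V)
    (f : V -> W) : Prop :=
  forall k, Ck_on k D f.

Record atlas (T E : Type) := Atlas {
  chart : Type ;
  chart_dom : chart -> set T ;
  chart_coord : chart -> T -> E
}.

(* The coordinate expression of [f] in the chart [i], that is, f \o coord_i^-1
   on the image of the chart; the value elsewhere is 0. *)
Definition in_chart (T E : Type) (W : zmodType) (A : atlas T E) (i : chart A)
    (f : T -> W) (p : E) : W :=
  xget 0 [set f x | x in chart_dom i `&` chart_coord i @^-1` [set p]].

Record smooth_manifold (R : realType) (n : nat) (M : topologicalType) :=
  SmoothManifold {
  manifold_atlas :> atlas M 'rV[R]_n ;
  manifold_hausdorff : hausdorff_space M ;
  manifold_second_countable : @second_countable M ;
  manifold_cover : forall x : M, exists i : chart manifold_atlas, chart_dom i x ;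
  manifold_chart_open : forall i : chart manifold_atlas, open (chart_dom i) ;
  manifold_chart_image : forall i : chart manifold_atlas,
    open (chart_coord i @` chart_dom i) ;
  manifold_chart_inj : forall i : chart manifold_atlas,
    set_inj (chart_dom i) (chart_coord i) ;
  manifold_chart_homeo : forall (i : chart manifold_atlas) (U : set M),
    U `<=` chart_dom i -> (open U <-> open (chart_coord i @` U)) ;
  manifold_transition : forall i j : chart manifold_atlas,
    smooth_on (chart_coord i @` (chart_dom i `&` chart_dom j))
              (in_chart i (chart_coord j))
}.

(* Value on the tangent vector sum_k v_k d/dx^k of the covector
   sum_k y_k dx^k. *)
Definition pairing (R : realType) (n : nat) (y v : 'rV[R]_n) : R :=
  \sum_(k < n) y ord0 k * v ord0 k.

(* A point (x, y) of the cotangent bundle: y is given by its components in all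
   the charts around x, subject to the transformation law of covectors. The
   components in the other charts are set to 0, so that equality of records is
   equality of points. *)
Record cotangent (R : realType) (n : nat) (M : topologicalType)
    (S : smooth_manifold R n M) := Cotangent {
  base : M ;
  components : chart S -> 'rV[R]_n ;
  components_change : forall i j : chart S,
    chart_dom i base -> chart_dom j base -> forall v : 'rV[R]_n,
    pairing (components i) v =
    pairing (components j)
      ('D_v (in_chart i (chart_coord j)) (chart_coord i base)) ;
  components_out : forall i : chart S, ~ chart_dom i base -> components i = 0
}.

Definition cotangent_atlas (R : realType) (n : nat) (M : topologicalType)
    (S : smooth_manifold R n M) :
    atlas (cotangent S) ('rV[R]_n * 'rV[R]_n)%type :=
  @Atlas (cotangent S) ('rV[R]_n * 'rV[R]_n)%type (chart S)
    (fun i => [set z | chart_dom i (base z)])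
    (fun i z => (chart_coord i (base z), components z i)).

Section CotangentTopology.
Context (R : realType) (n : nat) (M : topologicalType)
  (S : smooth_manifold R n M).

(* The topology in which the bundle charts are homeomorphisms from open sets
   onto their images. *)
Definition cotangent_open : set_system (cotangent S) :=
  [set U | forall i : chart (cotangent_atlas S),
    exists2 A : set ('rV[R]_n * 'rV[R]_n), open A &
      U `&` chart_dom i = chart_dom i `&` chart_coord i @^-1` A].

Lemma cotangent_openT : cotangent_open [set: cotangent S].
Proof. by move=> i; exists setT; [exact: openT|rewrite setTI setIT]. Qed.

Lemma cotangent_openI : setI_closed cotangent_open.
Proof.
move=> U V oU oV i; have [A oA UA] := oU i; have [B oB VB] := oV i.
exists (A `&` B); first exact: openI.
by rewrite setIIl UA VB preimage_setI -setIIr.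
Qed.

Lemma cotangent_open_bigU (I : Type) (f : I -> set (cotangent S)) :
  (forall i, cotangent_open (f i)) -> cotangent_open (\bigcup_i f i).
Proof.
move=> of_ i.
have /choice[A AP] : forall k, exists A : set ('rV[R]_n * 'rV[R]_n), open A /\
    f k `&` @chart_dom _ _ (cotangent_atlas S) i =
    @chart_dom _ _ (cotangent_atlas S) i `&`
      @chart_coord _ _ (cotangent_atlas S) i @^-1` A.
  by move=> k; have [A ? ?] := of_ k i; exists A.
exists (\bigcup_k A k); first by apply: bigcup_open => k _; have [] := AP k.
rewrite setI_bigcupl preimage_bigcup setI_bigcupr.
by apply: eq_bigcupr => k _; have [] := AP k.
Qed.

HB.instance Definition _ := gen_eqMixin (cotangent S).
HB.instance Definition _ := gen_choiceMixin (cotangent S).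
HB.instance Definition _ := isOpenTopological.Build (cotangent S)
  cotangent_openT cotangent_openI cotangent_open_bigU.

End CotangentTopology.

Lemma zero_change (R : realType) (n : nat) (M : topologicalType)
    (S : smooth_manifold R n M) (x : M) (i j : chart S) :
  chart_dom i x -> chart_dom j x -> forall v : 'rV[R]_n,
  pairing 0 v =
  pairing 0 ('D_v (in_chart i (chart_coord j)) (chart_coord i x)).
Proof. by move=> _ _ v; rewrite /pairing !big1// => k _; rewrite mxE mul0r. Qed.

Definition zero_section (R : realType) (n : nat) (M : topologicalType)
    (S : smooth_manifold R n M) (x : M) : cotangent S :=
  @Cotangent R n M S x (fun=> 0) (@zero_change R n M S x) (fun _ _ => erefl).

Definition smooth_function (R : realType) (T : Type) (E W : normedModType R)
    (A : atlas T E) (f : T -> W) : Prop :=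
  forall i : chart A,
    smooth_on (chart_coord i @` chart_dom i) (in_chart i f).

Definition smooth_curve (R : realType) (T : topologicalType)
    (E : normedModType R) (A : atlas T E) (z : R -> T) : Prop :=
  continuous z /\
  forall i : chart A, smooth_on (z @^-1` chart_dom i) (chart_coord i \o z).

(* A 1-form on a normed module maps a point and a tangent vector to a scalar;
   the formula is that of d(omega)(v, w) for constant vector fields v and w. *)
Definition exterior_derivative (R : realType) (E : normedModType R)
    (omega : E -> E -> R) (p v w : E) : R :=
  'D_v (fun q => omega q w) p - 'D_w (fun q => omega q v) p.

(* theta = sum_k y_k dx^k, in any bundle chart. *)
Definition liouville_form (R : realType) (n : nat)
    (p v : 'rV[R]_n * 'rV[R]_n) : R :=
  pairing p.2 v.1.

Definition canonical_symplectic_form (R : realType) (n : nat)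
    (p v w : 'rV[R]_n * 'rV[R]_n) : R :=
  - exterior_derivative (@liouville_form R n) p v w.

(* [X] represents, in the bundle chart [i], the value at [z] of the vector
   field X_H defined by dH = iota(X_H) Omega_can. *)
Definition hamiltonian_vector (R : realType) (n : nat) (M : topologicalType)
    (S : smooth_manifold R n M) (H : cotangent S -> R)
    (i : chart (cotangent_atlas S)) (z : cotangent S)
    (X : 'rV[R]_n * 'rV[R]_n) : Prop :=
  forall w : 'rV[R]_n * 'rV[R]_n,
    'D_w (in_chart i H) (chart_coord i z) =
    canonical_symplectic_form (chart_coord i z) X w.

(* Maps R/(tau Z) -> T are rendered as tau-periodic maps R -> T. *)
Definition periodic (R : realType) (T : Type) (tau : R) (z : R -> T) : Prop :=
  forall t, z (t + tau) = z t.

Definition periodic_orbit (R : realType) (n : nat) (M : topologicalType)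
    (S : smooth_manifold R n M) (H : cotangent S -> R) (tau : R)
    (z : R -> cotangent S) : Prop :=
  [/\ 0 < tau, periodic tau z, smooth_curve (cotangent_atlas S) z &
    forall (t : R) (i : chart (cotangent_atlas S)), chart_dom i (z t) ->
      hamiltonian_vector H i (z t) (derive1 (chart_coord i \o z) t)].

(* <y(t), x'(t)> for z = (x, y), computed in some chart around x(t); the
   transformation law of covectors makes it independent of the chart. *)
Definition pairing_velocity (R : realType) (n : nat) (M : topologicalType)
    (S : smooth_manifold R n M) (z : R -> cotangent S) (t : R) : R :=
  let i := projT1 (cid (manifold_cover S (base (z t)))) in
  pairing (components (z t) i) (derive1 (chart_coord i \o (@base R n M S \o z)) t).

Definition loop (R : realType) (T : topologicalType) (g : R -> T) : Prop :=
  continuous g /\ periodic 1 g.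

Definition freely_homotopic (R : realType) (T : topologicalType)
    (g h : R -> T) : Prop :=
  exists F : R * R -> T,
    [/\ {within `[0, 1]%classic `*` [set: R], continuous F},
        forall u, 0 <= u <= 1 -> periodic 1 (fun t => F (u, t)),
        forall t, F (0, t) = g t &
        forall t, F (1, t) = h t].

Definition free_homotopy_class (R : realType) (T : topologicalType)
    (alpha : set (R -> T)) : Prop :=
  exists2 g, loop g & alpha = [set h | loop h /\ freely_homotopic g h].

Definition nontrivial_class (R : realType) (T : topologicalType)
    (alpha : set (R -> T)) : Prop :=
  forall p : T, ~ alpha (fun=> p).

Definition represents (R : realType) (T : topologicalType) (tau : R)
    (z : R -> T) (alpha : set (R -> T)) : Prop :=
  alpha (fun s => z (tau * s)).

(* Main.v *)
(* M is embedded in R^K by a C^2 immersion e, and T^*M is the quotient of M x R^K by (x, p) -> p o de_x.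
   For c < a < b, one replaces H by f(H), where f increases from -A on (-oo, a] to 0 on [b, +oo): a
   periodic orbit of f(H) on which f' is positive is, up to a change of time, an orbit of H at a level
   of (a, b). Orbits of f(H) of period 1 are limits, as N -> oo, of critical points of the discrete action
     sum_j <p_j, e(x_{j+1}) - e(x_j)> - 1/N sum_j (f(H(x_j, p_j)) + |normal part of p_j|^2 / 2 + s pen(p_j))
   on N-periodic sequences for which (x_j) follows a loop of the given class; pen is a penalty of linear
   growth that vanishes on {H <= b}. On maps p -> (x, p) that are standard for large p, the
   Poincare-Miranda theorem gives a point with p = 0, where the action is A, so the minimax value is at
   least A; and for an s in a fixed interval it is attained at a point where the mean of pen is bounded
   uniformly in N (Struwe's monotonicity trick). The Euler-Lagrange equations then bound the momenta and the
   increments by O(1) and O(1/N), so the sequences converge along an ultrafilter to Lipschitz curves.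
   If the limit remained in {H >= b}, its action would be bounded independently of A, a contradiction for
   large A; hence H is constant and less than b on it, and more than a as the class is nontrivial. The
   action A + f > 0 gives the sign of the integral of y dx. *)

(* No growth or convexity of H in the momenta is assumed, so the action on loops is unbounded both
   ways and lacks compactness. With N nodes it is a function on a finite-dimensional space, and the
   linking takes place in the momenta only, over the nodes of a reference loop. The linear growth of
   the penalty serves twice. With a coefficient larger than a multiple of the Lipschitz constant of
   the reference loop, it outweighs the pairing with the increments and bounds the minimax value
   from above. Its gradient is bounded and so is <grad pen, p> - pen, hence a limit that stays in {H
   >= b} has action at most a constant depending on the radius r1 and on the coefficient; so A can
   be chosen last. An orbit in {H < b} does not see the penalty, its momenta being shorter than r1.
   The normal part of p, on which H does not depend, is kept under control by the quadratic term:
   its norm is at most N times the normal part of a chord of M, and chords of length O(1/N) are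
   tangent up to o(1/N), so it vanishes in the limit. *)
Require Import Defs.
From HB Require Import structures.
From mathcomp Require Import all_boot all_order all_algebra.
From mathcomp Require Import all_classical all_reals all_analysis.
From mathcomp Require Import ring lra zify.

Set Implicit Arguments.
Unset Strict Implicit.
Unset Printing Implicit Defensive.

Import Order.TTheory GRing.Theory Num.Theory.
Import numFieldTopology.Exports numFieldNormedType.Exports.

Local Open Scope classical_set_scope.
Local Open Scope ring_scope.

(** * Functions of class C^k *)

Section Frechet.
Context {R : realType} {V W : normedModType R}.
Implicit Types (f g : V -> W) (x v : V).

Lemma frechetP f x (df : {linear V -> W}) : continuous df ->
  (forall e, 0 < e -> \forall h \near 0, `|f (h + x) - f x - df h| <= e * `|h|) ->
  differentiable f x /\ 'd f x = df :> (V -> W).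
Proof.
move=> dfc fo.
have H : f \o shift x = cst (f x) + df +o_ 0 id.
  apply/eqaddoP => e e0; have := fo e e0; apply: filterS => h /=.
  by rewrite !fctE opprD addrA.
have dE := diff_unique dfc H.
split=> //; apply/diff_locallyP; split; first by rewrite dE.
by rewrite dE.
Qed.

Lemma frechet_diff f x : differentiable f x ->
  forall e, 0 < e -> \forall h \near 0, `|f (h + x) - f x - 'd f x h| <= e * `|h|.
Proof.
move=> /diff_locally /eqaddoP H e e0; have := H e e0; apply: filterS => h /=.
by rewrite !fctE opprD addrA.
Qed.

Lemma differentiable_near_eq f g x : {near x, f =1 g} ->
  differentiable f x -> differentiable g x.
Proof.
move=> fg df; apply: (proj1 (@frechetP g x ('d f x) (diff_continuous df) _)).
move=> e e0; have := frechet_diff df e0.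
have fg0 : \forall h \near 0, f (h + x) = g (h + x).
  by move: fg; rewrite (near_shift 0) /= subr0; apply: filterS => h.
by apply: filterS2 fg0 => h <-; rewrite -(nbhs_singleton fg).
Qed.

End Frechet.

Lemma derivable_dir (R : realType) (V W : normedModType R) (f : V -> W) x v :
  differentiable f x -> derivable f x v.
Proof. exact: diff_derivable. Qed.
Arguments derivable_dir {R V W f x} v.

Section CkBasics.
Context {R : realType} {V W : normedModType R}.
Implicit Types (D : set V) (f g : V -> W).

Lemma Ck_on_ext k D f g : open D -> (forall x, D x -> f x = g x) ->
  Ck_on k D f -> Ck_on k D g.
Proof.
move=> oD; have near_fg f' g' x : (forall x, D x -> f' x = g' x :> W) -> D x ->
    {near x, f' =1 g'}.
  by move=> fg Dx; near=> y; apply: fg; near: y; exact: open_nbhs_nbhs.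
elim: k f g => [|k IH] f g fg /=.
  move=> cf x Dx; have H : f y @[y --> x] --> f x := cf x Dx.
  suff: g y @[y --> x] --> g x by [].
  rewrite -(fg _ Dx); apply: cvg_trans H; apply: near_eq_cvg.
  by have := near_fg _ _ _ fg Dx; apply: filterS => y ->.
move=> [df kf]; split=> [x Dx|v].
  exact: differentiable_near_eq (near_fg _ _ _ fg Dx) (df x Dx).
apply: IH (kf v) => x Dx; apply: near_eq_derive; exact: near_fg.
Unshelve. all: by end_near. Qed.

Lemma Ck_onS k D f : Ck_on k.+1 D f -> Ck_on k D f.
Proof.
elim: k f => [|k IH] f; first by move=> [df _] x /df /differentiable_continuous.
by move=> [df kf]; split=> // v; exact/IH/kf.
Qed.

Lemma Ck_diff k D f x : Ck_on k.+1 D f -> D x -> differentiable f x.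
Proof. by move=> [H _]; exact: H. Qed.

Lemma Ck_der k D f v : Ck_on k.+1 D f -> Ck_on k D (fun x => 'D_v f x).
Proof. by move=> [_ H]; exact: H. Qed.

Lemma Ck_on_le k l D f : (l <= k)%N -> Ck_on k D f -> Ck_on l D f.
Proof.
move=> /subnK <-; elim: (k - l)%N => [//|m IH]; rewrite addSn => /Ck_onS; exact: IH.
Qed.

Lemma Ck_on_local k D f :
  (forall x, D x -> exists2 U : set V, open_nbhs x U & Ck_on k U f) -> Ck_on k D f.
Proof.
elim: k f => [|k IH] f H /=.
  by move=> x /H[U [_ Ux] /(_ x Ux)].
split=> [x /H[U [_ Ux] [/(_ x Ux)]//]|v].
by apply: IH => x /H[U oU [_ /(_ v)]]; exists U.
Qed.

Lemma Ck_on_cst k D (a : W) : Ck_on k D (cst a).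
Proof.
elim: k D a => [|k IH] D a /=; first by move=> x _; exact: cst_continuous.
split=> [x _|v]; first exact: differentiable_cst.
by rewrite (_ : (fun x => _) = cst 0) //; apply/funext => x; rewrite derive_cst.
Qed.

Lemma Ck_onD k D f g : open D -> Ck_on k D f -> Ck_on k D g ->
  Ck_on k D (fun x => f x + g x).
Proof.
move=> oD; elim: k f g => [|k IH] f g.
  by move=> cf cg x Dx; apply: (@continuousD _ _ _ f g); [exact: cf|exact: cg].
move=> [df kf] [dg kg]; split=> [x Dx|v].
  exact: (differentiableD (df x Dx) (dg x Dx)).
apply: (Ck_on_ext oD _ (IH _ _ (kf v) (kg v))) => x Dx.
by rewrite -(deriveD (@diff_derivable _ _ _ f x v (df x Dx))
  (@diff_derivable _ _ _ g x v (dg x Dx))).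
Qed.

Lemma Ck_onN k D f : open D -> Ck_on k D f -> Ck_on k D (fun x => - f x).
Proof.
move=> oD; elim: k f => [|k IH] f.
  by move=> cf x Dx; apply: (@continuousN _ _ _ f); exact: cf.
move=> [df kf]; split=> [x Dx|v].
  exact: (differentiableN (df x Dx)).
apply: (Ck_on_ext oD _ (IH _ (kf v))) => x Dx.
by rewrite -(deriveN (@diff_derivable _ _ _ f x v (df x Dx))).
Qed.

Lemma Ck_on_sum k D (I : Type) (r : seq I) (P : pred I) (F : I -> V -> W) :
  open D -> (forall i, P i -> Ck_on k D (F i)) ->
  Ck_on k D (fun x => \sum_(i <- r | P i) F i x).
Proof.
move=> oD FC; elim: r => [|i r IH].
  rewrite (_ : (fun x => _) = cst 0); first exact: Ck_on_cst.
  by apply/funext => x; rewrite big_nil.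
case: (boolP (P i)) => Pi.
  rewrite (_ : (fun x => _) = (fun x => F i x + \sum_(i <- r | P i) F i x)).
    exact: Ck_onD (FC _ Pi) IH.
  by apply/funext => x; rewrite big_cons Pi.
rewrite (_ : (fun x => _) = (fun x => \sum_(i <- r | P i) F i x)) //.
by apply/funext => x; rewrite big_cons (negbTE Pi).
Qed.

End CkBasics.

Section CkScalar.
Context {R : realType} {V : normedModType R}.
Implicit Types (D : set V) (f g : V -> R).

Lemma Ck_onM k D f g : open D -> Ck_on k D f -> Ck_on k D g ->
  Ck_on k D (fun x => f x * g x).
Proof.
move=> oD; elim: k f g => [|k IH] f g.
  by move=> cf cg x Dx; apply: (@continuousM _ _ f g); [exact: cf|exact: cg].
move=> Cf Cg; have [df kf] := Cf; have [dg kg] := Cg; split=> [x Dx|v].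
  exact: (differentiableM (df x Dx) (dg x Dx)).
have H := Ck_onD oD (IH _ _ (Ck_onS Cf) (kg v)) (IH _ _ (Ck_onS Cg) (kf v)).
apply: (Ck_on_ext oD _ H) => x Dx.
by rewrite (deriveM (@diff_derivable _ _ _ f x v (df x Dx))
  (@diff_derivable _ _ _ g x v (dg x Dx))).
Qed.

Lemma Ck_on_prod k D (I : Type) (r : seq I) (P : pred I) (F : I -> V -> R) :
  open D -> (forall i, P i -> Ck_on k D (F i)) ->
  Ck_on k D (fun x => \prod_(i <- r | P i) F i x).
Proof.
move=> oD FC; elim: r => [|i r IH].
  rewrite (_ : (fun x => _) = cst 1); first exact: Ck_on_cst.
  by apply/funext => x; rewrite big_nil.
case: (boolP (P i)) => Pi.
  rewrite (_ : (fun x => _) = (fun x => F i x * \prod_(i <- r | P i) F i x)).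
    exact: Ck_onM (FC _ Pi) IH.
  by apply/funext => x; rewrite big_cons Pi.
rewrite (_ : (fun x => _) = (fun x => \prod_(i <- r | P i) F i x)) //.
by apply/funext => x; rewrite big_cons (negbTE Pi).
Qed.

Lemma Ck_onV k D f : open D -> (forall x, D x -> f x != 0) -> Ck_on k D f ->
  Ck_on k D (fun x => (f x)^-1).
Proof.
move=> oD f0; elim: k => [|k IH] Cf.
  by move=> x Dx; apply: continuousV; [exact: f0|exact: Cf].
have [df kf] := Cf; split=> [x Dx|v].
  exact: (differentiableV (df x Dx) (f0 x Dx)).
have Cv := IH (Ck_onS Cf).
have H := Ck_onN oD (Ck_onM oD (Ck_onM oD Cv Cv) (kf v)).
apply: (Ck_on_ext oD _ H) => x Dx.
rewrite (deriveV (f0 x Dx) (@diff_derivable _ _ _ f x v (df x Dx))) /=.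
by rewrite /GRing.scale /= -mulNr expr2 invfM.
Qed.

End CkScalar.

Section CkVector.
Context {R : realType} {V W : normedModType R}.
Implicit Types (D : set V).

Lemma Ck_onZl k D (c : V -> R) (b : W) : open D -> Ck_on k D c ->
  Ck_on k D (fun x => c x *: b).
Proof.
move=> oD; elim: k c => [|k IH] c.
  move=> cc x Dx; have H : c y @[y --> x] --> c x := cc x Dx.
  exact: (@cvgZr_tmp _ _ _ _ _ _ _ b H).
move=> [dc kc]; split=> [x Dx|v].
  exact: (differentiableZl b (dc x Dx)).
apply: (Ck_on_ext oD _ (IH _ (kc v))) => x Dx.
by rewrite (deriveE _ (dc x Dx)) (deriveE _ (differentiableZl b (dc x Dx)))
  (diffZl b (dc x Dx)).
Qed.

Lemma deriveZl (c : V -> R) (b : W) x v : differentiable c x ->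
  'D_v (fun y => c y *: b) x = 'D_v c x *: b.
Proof.
by move=> dc; rewrite (deriveE _ dc) (deriveE _ (differentiableZl b dc)) (diffZl b dc).
Qed.

End CkVector.

Section CkComp.
Context {R : realType} {V E : normedModType R} {I : finType}.
Variables (b : I -> E).
Implicit Types (D : set V).

Lemma differentiable_comb (c : I -> V -> R) x : (forall i, differentiable (c i) x) ->
  differentiable (fun y => \sum_i c i y *: b i) x /\
  forall v, 'D_v (fun y => \sum_i c i y *: b i) x = \sum_i 'D_v (c i) x *: b i.
Proof.
move=> dc; elim: (index_enum I) => [|i r [IH1 IH2]].
  rewrite (_ : (fun y => _) = cst 0); last by apply/funext => y; rewrite big_nil.
  split; first exact: differentiable_cst.
  by move=> v; rewrite derive_cst big_nil.
rewrite (_ : (fun y => _) = (fun y => c i y *: b i) + (fun y => \sum_(i <- r) c i y *: b i));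
  last by apply/funext => y; rewrite big_cons.
have d1 := differentiableZl (b i) (dc i).
split; first exact: differentiableD.
move=> v; rewrite (deriveD (derivable_dir v d1) (derivable_dir v IH1)) IH2.
by rewrite big_cons deriveZl.
Qed.

(** The inner map is given by coordinates on a fixed finite family of vectors, so the derivative of
    the composite is a finite sum of products of scalar functions, and the induction on [k] closes
    with [Ck_onM] and [Ck_on_sum]. *)
Lemma Ck_comp k D (D' : set E) (c : I -> V -> R) (g : E -> R) : open D ->
  (forall x, D x -> D' (\sum_i c i x *: b i)) ->
  (forall i, Ck_on k D (c i)) -> Ck_on k D' g ->
  Ck_on k D (fun x => g (\sum_i c i x *: b i)).
Proof.
move=> oD DD'; elim: k g => [|k IH] g Cc Cg.
  move=> x Dx; apply: (@continuous_comp _ _ _ (fun x => \sum_i c i x *: b i) g).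
    have : Ck_on 0 D (fun x => \sum_i c i x *: b i).
      by apply: Ck_on_sum => // i _; apply: Ck_onZl.
    exact.
  exact/Cg/DD'.
have [dg kg] := Cg.
have dc x : D x -> forall i, differentiable (c i) x by move=> Dx i; exact: Ck_diff (Cc i) Dx.
split=> [x Dx|v].
  apply: (@differentiable_comp _ _ _ _ (fun x => \sum_i c i x *: b i) g).
    by have [] := differentiable_comb (dc x Dx).
  exact/dg/DD'.
have H : Ck_on k D (fun x => \sum_i 'D_v (c i) x * 'D_(b i) g (\sum_i c i x *: b i)).
  apply: Ck_on_sum => // i _; apply: Ck_onM => //; first exact: Ck_der (Cc i).
  apply: (IH (fun y => 'D_(b i) g y)); [by move=> j; exact/Ck_onS/Cc|exact: Ck_der].
apply: (Ck_on_ext oD _ H) => x Dx.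
have [d1 d2] := differentiable_comb (dc x Dx).
have dgx := dg _ (DD' x Dx).
rewrite (deriveE _ (@differentiable_comp _ _ _ _ (fun x => \sum_i c i x *: b i) g x d1 dgx)).
rewrite (@diff_comp _ _ _ _ (fun x => \sum_i c i x *: b i) g x d1 dgx) /=.
rewrite -(deriveE _ d1) d2 linear_sum; apply: eq_bigr => i _.
by rewrite linearZ /= (deriveE _ dgx).
Qed.

End CkComp.

Section RowVectors.
Context {R : realType} {V : normedModType R}.
Implicit Types (D : set V).

Lemma derive_comp_diff (E W : normedModType R) (f : V -> E) (g : E -> W) x v :
  differentiable f x -> differentiable g (f x) ->
  'D_v (g \o f) x = 'D_('D_v f x) g (f x).
Proof.
move=> df dg; rewrite (deriveE _ (differentiable_comp df dg)) (diff_comp df dg) /=.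
by rewrite (deriveE _ dg) (deriveE _ df).
Qed.

Lemma derive_lin (E : normedModType R) (f : V -> E) x (a : R) u v :
  differentiable f x -> 'D_(a *: u + v) f x = a *: 'D_u f x + 'D_v f x.
Proof. by move=> df; rewrite !(deriveE _ df) linearP. Qed.

Lemma derive_sumv (E : normedModType R) (f : V -> E) x (I : finType) (a : I -> R) (u : I -> V) :
  differentiable f x -> 'D_(\sum_i a i *: u i) f x = \sum_i a i *: 'D_(u i) f x.
Proof.
move=> df; rewrite (deriveE _ df) linear_sum; apply: eq_bigr => i _.
by rewrite linearZ (deriveE _ df).
Qed.

Lemma differentiable_rVP n (f : V -> 'rV[R]_n) x :
  differentiable f x <-> forall i, differentiable (fun y => f y ord0 i) x.
Proof.
split=> [df i|df].
  exact: (@differentiable_comp _ _ _ _ f (fun M : 'rV[R]_n => M ord0 i) x df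
    (differentiable_coord _ _ _)).
rewrite (_ : f = fun y => \sum_i f y ord0 i *: delta_mx ord0 i); last first.
  by apply/funext => y; rewrite -row_sum_delta.
exact (proj1 (@differentiable_comb R V 'rV[R]_n 'I_n (fun i => delta_mx ord0 i) (fun i y => f y ord0 i) x df)).
Qed.

Lemma derive_rV n (f : V -> 'rV[R]_n) x v i : differentiable f x ->
  ('D_v f x) ord0 i = 'D_v (fun y => f y ord0 i) x.
Proof. by move=> df; rewrite (derive_mx (derivable_dir v df)) mxE. Qed.

Lemma Ck_on_rVP k n D (f : V -> 'rV[R]_n) : open D ->
  Ck_on k D f <-> forall i, Ck_on k D (fun y => f y ord0 i).
Proof.
move=> oD; split=> [|Cf].
  elim: k f => [|k IH] f.
    move=> cf i x Dx.
    have H : f y @[y --> x] --> f x := cf x Dx.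
    exact: (@cvg_comp _ _ _ f (fun M : 'rV[R]_n => M ord0 i) _ _ _ H (@coord_continuous R 1 n ord0 i (f x))).
  move=> [df kf] i; split=> [x Dx|v]; first exact: (differentiable_rVP _ _).1 (df x Dx) i.
  by apply: (Ck_on_ext oD _ (IH _ (kf v) i)) => x Dx; rewrite derive_rV//; exact: df.
rewrite (_ : f = fun y => \sum_i f y ord0 i *: delta_mx ord0 i); last first.
  by apply/funext => y; rewrite -row_sum_delta.
by apply: Ck_on_sum => // i _; apply: Ck_onZl.
Qed.

Lemma Ck_comp_rV k n D (D' : set 'rV[R]_n) (f : V -> 'rV[R]_n) (g : 'rV[R]_n -> R) : open D ->
  (forall x, D x -> D' (f x)) -> (forall i, Ck_on k D (fun y => f y ord0 i)) ->
  Ck_on k D' g -> Ck_on k D (g \o f).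
Proof.
move=> oD DD' Cf Cg.
have E y : f y = \sum_i f y ord0 i *: delta_mx ord0 i by rewrite -row_sum_delta.
have := @Ck_comp R V _ _ (fun i => delta_mx ord0 i) k D D' (fun i y => f y ord0 i) g oD _ Cf Cg.
rewrite (_ : (fun x => _) = g \o f); last by apply/funext => y /=; rewrite -E.
by apply=> x Dx; rewrite -E; exact: DD'.
Qed.

Lemma derive_coord m n (M v : 'M[R]_(m, n)) i j :
  'D_v (fun N : 'M[R]_(m, n) => N i j) M = v i j.
Proof.
have dM : derivable (id : 'M[R]_(m, n) -> 'M[R]_(m, n)) M v by exact: derivable_id.
by have /matrixP/(_ i j) := derive_mx dM; rewrite derive_id mxE => ->.
Qed.

Lemma Ck_on_coord k m n (D : set 'M[R]_(m, n)) i j :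
  Ck_on k D (fun N : 'M[R]_(m, n) => N i j).
Proof.
case: k => [|k]; first by move=> x _; exact: coord_continuous.
split=> [x _|v]; first exact: differentiable_coord.
rewrite (_ : (fun x => _) = cst (v i j)); first exact: Ck_on_cst.
by apply/funext => x; rewrite derive_coord.
Qed.

End RowVectors.

Lemma derive_rV_sum (R : realType) n (E : normedModType R) (f : 'rV[R]_n -> E) x v :
  differentiable f x -> 'D_v f x = \sum_i v ord0 i *: 'D_(delta_mx ord0 i) f x.
Proof.
move=> df; rewrite {1}(row_sum_delta v).
exact (@derive_sumv R 'rV[R]_n E f x 'I_n (fun i => v ord0 i) (fun i => delta_mx ord0 i) df).
Qed.

(** * Mean values and symmetry of second derivatives *)

Section MeanValue.
Context {R : realType} {V : normedModType R}.

Lemma is_derive_line (W : normedModType R) (f : V -> W) x v (s : R) : derivable f (s *: v + x) v ->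
  is_derive s 1 (fun r : R => f (r *: v + x)) ('D_v f (s *: v + x)).
Proof.
move=> dfv.
have E : (fun h : R => h^-1 *: (((fun r : R => f (r *: v + x)) \o shift s) (h *: 1) - f (s *: v + x)))
  = (fun h : R => h^-1 *: ((f \o shift (s *: v + x)) (h *: v) - f (s *: v + x))).
  by apply/funext => h /=; rewrite [h *: 1]mulr1 scalerDl addrA.
by apply: DeriveDef; rewrite /derivable /derive E.
Qed.

Lemma mvt_line (f : V -> R) x v (s : R) : 0 < s ->
  (forall r, 0 <= r <= s -> derivable f (r *: v + x) v) ->
  exists2 r, 0 < r < s & f (s *: v + x) - f x = s * 'D_v f (r *: v + x).
Proof.
move=> s0 df.
have [||r] := @MVT R (fun r => f (r *: v + x)) (fun r => 'D_v f (r *: v + x)) 0 s s0.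
- move=> r; rewrite in_itv /= => /andP[r0 rs].
  by apply: is_derive_line; apply: df; rewrite !ltW.
- apply: derivable_within_continuous => r; rewrite in_itv /= => rs.
  by have [] := is_derive_line (df r rs).
rewrite in_itv /= => rs; rewrite scale0r add0r subr0 => ->; exists r => //.
by rewrite mulrC.
Qed.

(** The second difference over a small parallelogram is symmetric in [v] and [w]; two applications
    of the mean value theorem express it as s^2 times a second derivative at a nearby point, in
    either order of differentiation. *)
Lemma schwarz (f : V -> R) (D : set V) x v w : open D -> Ck_on 2 D f -> D x ->
  'D_v (fun y => 'D_w f y) x = 'D_w (fun y => 'D_v f y) x.
Proof.
move=> oD C2 Dx; have df y := @Ck_diff R V _ 1 D f y C2; have kf v' := Ck_der v' C2.
wlog suff main : v w / forall e, 0 < e -> exists2 d, 0 < d &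
    forall s, 0 < s < d -> `|(f (s *: v + (s *: w + x)) - f (s *: w + x) - f (s *: v + x) + f x)
      - s ^+ 2 * 'D_w (fun y => 'D_v f y) x| <= s ^+ 2 * e.
  apply/eqP; rewrite -subr_eq0 -normr_le0; apply/ler_addgt0Pl => e e0; rewrite addr0.
  have [d1 d10 H1] := main v w _ (divr_gt0 e0 (ltr0Sn R 1)).
  have [d2 d20 H2] := main w v _ (divr_gt0 e0 (ltr0Sn R 1)).
  pose s := Num.min d1 d2 / 2.
  have m0 : 0 < Num.min d1 d2 by rewrite lt_min d10.
  have s0 : 0 < s by rewrite divr_gt0.
  have sm : s < Num.min d1 d2 by rewrite ltr_pdivrMr// ltr_pMr// ltr1n.
  have := H1 s; rewrite s0 /= (lt_le_trans sm) ?ge_min ?lexx// => /(_ isT) {}H1.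
  have := H2 s; rewrite s0 /= (lt_le_trans sm) ?ge_min ?lexx ?orbT// => /(_ isT) {}H2.
  have s2 : 0 < s ^+ 2 by rewrite exprn_gt0.
  rewrite -(ler_pM2l s2) -{1}(gtr0_norm s2) -normrM.
  move: H1 H2; rewrite (addrCA (s *: w)).
  suff gen a b c d p q : `|a - b - c + d - s ^+ 2 * q| <= s ^+ 2 * (e / 2) ->
      `|a - c - b + d - s ^+ 2 * p| <= s ^+ 2 * (e / 2) -> `|s ^+ 2 * (p - q)| <= s ^+ 2 * e.
    exact: gen.
  move=> {}H1 {}H2; have -> : s ^+ 2 * (p - q) =
    (a - b - c + d - s ^+ 2 * q) - (a - c - b + d - s ^+ 2 * p) by ring.
  rewrite (splitr e) mulrDr; exact: le_trans (ler_normB _ _) (lerD H1 H2).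
move=> e e0.
have cD : {for x, continuous (fun y => 'D_w (fun y => 'D_v f y) y)}.
  exact: (Ck_der w (kf v)).
have oDx : \forall y \near x, D y by exact: open_nbhs_nbhs.
have cDe : \forall y \near x, `|'D_w (fun y => 'D_v f y) x - 'D_w (fun y => 'D_v f y) y| < e.
  by move/cvgrPdist_lt: cD; exact.
have [r /= r0 rH] := (nbhs_ballP _ _).1 (filterI oDx cDe).
(* With [s] below this bound the whole parallelogram spanned by [s *: v] and [s *: w] at [x] stays
   in the ball of radius [r]. *)
pose d := r / (`|v| + `|w| + 1).
have p0 : 0 < `|v| + `|w| + 1 by rewrite ltr_wpDl// addr_ge0.
have d0 : 0 < d by rewrite divr_gt0.
exists d => // s /andP[s0 sd].
have sr : s * (`|v| + `|w| + 1) < r by rewrite -ltr_pdivlMr.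
have inD a b : 0 <= a <= s -> 0 <= b <= s -> ball x r (a *: v + (b *: w + x)).
  move=> /andP[a0 as_] /andP[b0 bs]; rewrite -ball_normE /ball_ /= addrA opprD addrCA subrr addr0.
  rewrite normrN (le_lt_trans (ler_normD _ _))// !normrZ !ger0_norm//.
  apply: le_lt_trans sr; rewrite !mulrDr -addrA; apply: lerD; first exact: ler_wpM2r.
  by rewrite -[leLHS]addr0; apply: lerD; [exact: ler_wpM2r|rewrite mulr1 ltW].
have ss : 0 <= s <= s by rewrite lexx ltW.
have z0 : 0 <= (0 : R) <= s by rewrite lexx ltW.
pose F := fun y => f (s *: w + y) - f y.
have shiftd y : differentiable (fun z => s *: w + z) y.
  exact: (differentiableD (differentiable_cst _ _) (ex_diff (is_diff_def := is_diff_id y))).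
have dshift y : 'D_v (fun z => s *: w + z) y = v.
  rewrite (_ : (fun z => _) = cst (s *: w) + id)//.
  by rewrite deriveD// ?derive_cst ?derive_id ?add0r//; exact: derivable_dir.
have dF a : 0 <= a <= s -> derivable F (a *: v + x) v /\
   'D_v F (a *: v + x) = 'D_v f (s *: w + (a *: v + x)) - 'D_v f (a *: v + x).
  move=> as_.
  have D1 : differentiable f (s *: w + (a *: v + x)).
    by apply: df; rewrite addrCA; have [] := rH _ (inD a s as_ ss).
  have D2 : differentiable f (a *: v + x).
    by apply: df; have [] := rH _ (inD a 0 as_ z0); rewrite scale0r add0r.
  have D3 : differentiable (fun y => f (s *: w + y)) (a *: v + x).
    exact: (@differentiable_comp _ _ _ _ (fun z => s *: w + z) f).
  split; first exact/derivable_dir/(differentiableB D3 D2).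
  rewrite (deriveB (derivable_dir v D3) (derivable_dir v D2)); congr (_ - _).
  by rewrite (@derive_comp_diff _ _ _ _ (fun z => s *: w + z) f)// dshift.
have [a /andP[a0 as_] Fa] := mvt_line s0 (fun a h => (dF a h).1).
have a0s : 0 <= a <= s by rewrite !ltW.
have [b bs fb] : exists2 b, 0 < b < s & 'D_v f (s *: w + (a *: v + x)) - 'D_v f (a *: v + x)
   = s * 'D_w (fun y => 'D_v f y) (b *: w + (a *: v + x)).
  have := @mvt_line (fun y => 'D_v f y) (a *: v + x) w s s0; apply => b bs.
  apply/derivable_dir/(Ck_diff (kf v)); rewrite addrCA.
  by have [] := rH _ (inD a b a0s bs).
have b0s : 0 <= b <= s by case/andP: bs => ? ?; rewrite !ltW.
have -> : f (s *: v + (s *: w + x)) - f (s *: w + x) - f (s *: v + x) + f x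
    = F (s *: v + x) - F x.
  by rewrite /F (addrCA (s *: w)); ring.
rewrite Fa (dF a a0s).2 fb mulrA -expr2 -mulrBr normrM gtr0_norm ?exprn_gt0//.
rewrite ler_pM2l ?exprn_gt0// distrC ltW// addrCA.
by have [] := rH _ (inD a b a0s b0s).
Qed.

End MeanValue.

Lemma near_ord (T : topologicalType) (x : T) m (P : 'I_m -> T -> Prop) :
  (forall i, \forall y \near x, P i y) -> \forall y \near x, forall i, P i y.
Proof. exact: filter_forall. Qed.

(** * First-order estimates that are uniform on small balls *)

Section C1Estimates.
Context {R : realType} {n : nat}.
Implicit Types (D : set 'rV[R]_n).

Lemma mx_entry_le (m k : nat) (x : 'M[R]_(m, k)) i j : `|x i j| <= `|x|.
Proof.
rewrite [leRHS]/Num.Def.normr/= mx_normrE.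
by apply: (le_trans _ (@le_bigmax _ _ _ 0 (fun i : 'I_m * 'I_k => `|x i.1 i.2|) (i, j))).
Qed.

Lemma mx_norm_le (m k : nat) (x : 'M[R]_(m, k)) e : 0 <= e ->
  (forall i j, `|x i j| <= e) -> `|x| <= e.
Proof.
move=> e0 H; rewrite [leLHS]/Num.Def.normr/= mx_normrE.
by apply: bigmax_le => // -[i j] _; exact: H.
Qed.

Lemma ball_convex (V : normedModType R) (x y z : V) r (s : R) : 0 <= s <= 1 ->
  ball x r y -> ball x r z -> ball x r (s *: z + (1 - s) *: y).
Proof.
move=> /andP[s0 s1]; rewrite -ball_normE /ball_ /= => xy xz.
have -> : x - (s *: z + (1 - s) *: y) = s *: (x - z) + (1 - s) *: (x - y).
  rewrite !scalerBr addrACA -scalerDl [s + _]addrC subrK scale1r opprD //.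
have s10 : 0 <= 1 - s by rewrite subr_ge0.
apply: (le_lt_trans (ler_normD _ _)); rewrite !normrZ !ger0_norm//.
have [->|sn0] := eqVneq s 0; first by rewrite mul0r add0r subr0 mul1r.
have sp : 0 < s by rewrite lt_neqAle eq_sym sn0.
rewrite [ltRHS](_ : r = s * r + (1 - s) * r); last by ring.
by apply: ltr_leD; [rewrite ltr_pM2l|apply: ler_wpM2l => //; exact: ltW].
Qed.

Lemma C1_unif_scalar D (f : 'rV[R]_n -> R) x e : open D -> Ck_on 1 D f -> D x -> 0 < e ->
  \forall r \near 0^'+, ball x r `<=` D /\ forall y y', ball x r y -> ball x r y' ->
    `|f y' - f y - 'D_(y' - y) f y| <= e * `|y' - y|.
Proof.
(* On the ball each partial derivative is within [h] of its value at [x], so two of its values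
   differ by at most 2h; the sum over the [n] directions is then at most [e]. The successor covers n
   = 0. *)
move=> oD C1 Dx e0; pose h := e / (2 * n.+1%:R).
have h0 : 0 < h by rewrite divr_gt0// mulr_gt0.
have oDx : \forall y \near x, D y by exact: open_nbhs_nbhs.
have H : \forall y \near x, forall i : 'I_n, `|'D_(delta_mx ord0 i) f x - 'D_(delta_mx ord0 i) f y| < h.
  apply: near_ord => i.
  have c : (fun y => 'D_(delta_mx ord0 i) f y) y @[y --> x] --> 'D_(delta_mx ord0 i) f x.
    exact: (Ck_der (delta_mx ord0 i) C1).
  by move/cvgrPdist_lt: c; exact.
have [r0 /= r00 r0H] := (nbhs_ballP _ _).1 (filterI oDx H).
near=> r.
have r_le : ball x r `<=` ball x r0.
  by apply: le_ball; near: r; exact: nbhs_right_le.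
have rD : ball x r `<=` D by move=> y /r_le /r0H[].
split=> // y y' xy xy'.
have [s /andP[s0 s1]] : exists2 s, 0 < s < 1 & f (1 *: (y' - y) + y) - f y
    = 1 * 'D_(y' - y) f (s *: (y' - y) + y).
  apply: mvt_line => // s s01; apply/derivable_dir/(Ck_diff C1)/rD.
  have := ball_convex s01 xy xy'; congr (ball _ _ _).
  by rewrite scalerBr scalerBl scale1r [RHS]addrAC -addrA [y - _]addrC.
rewrite scale1r subrK mul1r => ->.
set z := s *: (y' - y) + y.
have xz : ball x r z.
  have s01 : 0 <= s <= 1 by rewrite !ltW.
  have := ball_convex s01 xy xy'; congr (ball _ _ _).
  by rewrite /z scalerBr scalerBl scale1r [RHS]addrAC -addrA [y - _]addrC.
have dy : differentiable f y := Ck_diff C1 (rD _ xy).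
have dz : differentiable f z := Ck_diff C1 (rD _ xz).
rewrite !derive_rV_sum//.
rewrite -sumrB; apply: (le_trans (ler_norm_sum _ _ _)).
apply: (@le_trans _ _ (\sum_(i < n) `|y' - y| * (h + h))).
  apply: ler_sum => i _; rewrite -scalerBr normrZ ler_pM//; first exact: mx_entry_le.
  have [_ /(_ i) Hy] := r0H _ (r_le _ xy); have [_ /(_ i) Hz] := r0H _ (r_le _ xz).
  set a := 'D__ f x in Hy Hz; rewrite -(subrKA a) (le_trans (ler_normD _ _))//.
  by rewrite lerD// ltW// distrC.
rewrite sumr_const card_ord -mulrnAr mulrC ler_wpM2r//.
have -> : h + h = e / n.+1%:R.
  have nn : n.+1%:R != 0 :> R by rewrite pnatr_eq0.
  by rewrite /h; move: nn; move: (n.+1%:R : R) => m nn; field.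
rewrite -[leLHS]mulr_natr -mulrA -[leRHS]mulr1 ler_pM2l// mulrC ler_pdivrMr ?mul1r//.
by rewrite ler_nat.
Unshelve. all: by end_near. Qed.

Lemma C1_unif K D (f : 'rV[R]_n -> 'rV[R]_K) x e : open D -> Ck_on 1 D f -> D x -> 0 < e ->
  \forall r \near 0^'+, ball x r `<=` D /\ forall y y', ball x r y -> ball x r y' ->
    `|f y' - f y - 'D_(y' - y) f y| <= e * `|y' - y|.
Proof.
move=> oD C1 Dx e0.
have H : \forall r \near 0^'+, forall j, ball x r `<=` D /\ forall y y', ball x r y -> ball x r y' ->
    `|f y' ord0 j - f y ord0 j - 'D_(y' - y) (fun y => f y ord0 j) y| <= e * `|y' - y|.
  apply: filter_forall => j; apply: C1_unif_scalar => //.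
  exact: (Ck_on_rVP _ _ oD).1 C1 j.
have oDx : \forall y \near x, D y by exact: open_nbhs_nbhs.
have [r0 /= r00 r0H] := (nbhs_ballP _ _).1 oDx.
near=> r; have rD : ball x r `<=` D.
  by apply: subset_trans r0H; apply: le_ball; near: r; exact: nbhs_right_le.
split=> // y y' xy xy'; apply: mx_norm_le => [|i j]; first by rewrite mulr_ge0// ltW.
rewrite !mxE (ord1 i) (derive_rV _ _ (Ck_diff C1 (rD _ xy))).
have Hr : forall j, ball x r `<=` D /\ forall y y', ball x r y -> ball x r y' ->
    `|f y' ord0 j - f y ord0 j - 'D_(y' - y) (fun y => f y ord0 j) y| <= e * `|y' - y|.
  by near: r.
by have [_] := Hr j; exact.
Unshelve. all: by end_near. Qed.

Lemma C1_bound K D (f : 'rV[R]_n -> 'rV[R]_K) x : open D -> Ck_on 1 D f -> D x ->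
  exists2 C, 0 < C & \forall y \near x, forall v, `|'D_v f y| <= C * `|v|.
Proof.
move=> oD C1 Dx.
exists (\sum_(i < n) (`|'D_(delta_mx ord0 i) f x| + 1) + 1).
  by apply: ltr_wpDl => //; apply: sumr_ge0 => i _; rewrite addr_ge0.
have H : \forall y \near x, D y /\ forall i : 'I_n, `|'D_(delta_mx ord0 i) f x - 'D_(delta_mx ord0 i) f y| < 1.
  apply: filterI; first exact: open_nbhs_nbhs.
  apply: (@near_ord 'rV[R]_n x n (fun i y =>
    is_true (`|'D_(delta_mx ord0 i) f x - 'D_(delta_mx ord0 i) f y| < 1))) => i.
  have c : (fun y => 'D_(delta_mx ord0 i) f y) y @[y --> x] --> 'D_(delta_mx ord0 i) f x.
    exact: (Ck_der (delta_mx ord0 i) C1).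
  by move/cvgrPdist_lt: c; exact.
apply: filterS H => y [Dy Hy] v.
rewrite derive_rV_sum; last exact: Ck_diff C1 Dy.
apply: (le_trans (ler_norm_sum _ _ _)); rewrite mulrDl mul1r -[leLHS]addr0 lerD// mulr_suml.
apply: ler_sum => i _; rewrite normrZ mulrC ler_pM//; last exact: mx_entry_le.
have := Hy i; set a := 'D__ f x => ya; set b := 'D__ f y in ya *.
by rewrite -[b](subKr a) (le_trans (ler_normB _ _))// lerD// ltW.
Qed.

Lemma C1_lip K D (f : 'rV[R]_n -> 'rV[R]_K) x : open D -> Ck_on 1 D f -> D x ->
  exists2 C, 0 < C & \forall r \near 0^'+, ball x r `<=` D /\ forall y y', ball x r y -> ball x r y' ->
    `|f y' - f y| <= C * `|y' - y|.
Proof.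
move=> oD C1 Dx; have [C C0 CH] := C1_bound oD C1 Dx.
have [r0 /= r00 r0H] := (nbhs_ballP _ _).1 CH.
exists (C + 1); first by rewrite addr_gt0.
near=> r.
have [rD rH] : ball x r `<=` D /\ forall y y', ball x r y -> ball x r y' ->
    `|f y' - f y - 'D_(y' - y) f y| <= 1 * `|y' - y|.
  by near: r; exact: C1_unif.
split=> // y y' xy xy'.
rewrite -(subrK ('D_(y' - y) f y) (f y' - f y)) (le_trans (ler_normD _ _))//.
rewrite addrC mulrDl lerD//; last exact: rH.
apply: r0H; apply: le_ball xy; near: r; exact: nbhs_right_le.
Unshelve. all: by end_near. Qed.

End C1Estimates.

(** * Charts and embeddings *)

Section Charts.
Context {R : realType} {n : nat} {M : topologicalType} (SM : smooth_manifold R n M).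
Local Notation dom := (@chart_dom _ _ SM).
Local Notation phi := (@chart_coord _ _ SM).

Definition chart_img (i : chart SM) : set 'rV[R]_n := phi i @` dom i.
Local Notation img := chart_img.

Lemma chart_img_open i : open (img i).
Proof. exact: manifold_chart_image. Qed.
Arguments chart_img_open : clear implicits.

Lemma chart_imgP i x : dom i x -> img i (phi i x).
Proof. by exists x. Qed.

Lemma in_chartE (W : zmodType) i (h : M -> W) x : dom i x -> in_chart i h (phi i x) = h x.
Proof.
move=> dx; rewrite /in_chart.
have [y [dy exy] <-] : [set h y | y in dom i `&` phi i @^-1` [set phi i x]]
    (xget 0 [set h y | y in dom i `&` phi i @^-1` [set phi i x]]).
  by apply: xgetPex; exists (h x), x.
by congr h; apply: (manifold_chart_inj (mem_set dy) (mem_set dx)).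
Qed.

Lemma chart_continuous i x : dom i x -> phi i y @[y --> x] --> phi i x.
Proof.
move=> dx A /nbhs_ballP[e /= e0 BA].
pose B := ball (phi i x) e; have oB : open B by exact: ball_open.
have Bx : B (phi i x) by exact: ballxx.
have oU : open (dom i `&` phi i @^-1` B).
  apply/(manifold_chart_homeo (s := SM) (i := i)) => [y []//|].
  rewrite (_ : _ @` _ = B `&` img i); first by apply: openI => //; exact: chart_img_open.
  apply/seteqP; split=> [z [y [dy By] <-]|z [Bz [y dy yz]]].
    by split=> //; exact: chart_imgP.
  by exists y => //; split=> //=; rewrite yz.
rewrite /nbhs /=; apply: (filterS (P := dom i `&` phi i @^-1` B)); last exact: open_nbhs_nbhs.
by move=> y [_] /BA.
Qed.

Lemma chart_nbhs i x : dom i x -> \forall y \near x, dom i y.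
Proof. by move=> dx; apply: open_nbhs_nbhs; split=> //; exact: manifold_chart_open. Qed.

Section Inverse.
Variable x0 : M.

Definition chart_inv i xi : M := xget x0 [set x | dom i x /\ phi i x = xi].

Lemma chart_invP i xi : img i xi -> dom i (chart_inv i xi) /\ phi i (chart_inv i xi) = xi.
Proof.
move=> [x dx <-].
have : [set y | dom i y /\ phi i y = phi i x] (chart_inv i (phi i x)).
  by apply: (xgetPex x0); exists x.
by [].
Qed.

Lemma chart_invK i x : dom i x -> chart_inv i (phi i x) = x.
Proof.
move=> dx; have [d1 e1] := chart_invP (chart_imgP dx).
exact: (manifold_chart_inj (mem_set d1) (mem_set dx)).
Qed.

Lemma in_chart_inv (W : zmodType) i (h : M -> W) xi : img i xi ->
  in_chart i h xi = h (chart_inv i xi).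
Proof. by move=> [x dx <-]; rewrite in_chartE// chart_invK. Qed.

Lemma chart_inv_continuous i xi : img i xi -> chart_inv i eta @[eta --> xi] --> chart_inv i xi.
Proof.
move=> [x dx <-]; rewrite (chart_invK dx) => A; rewrite nbhsE => -[B [oB Bx] BA].
have oU : open (phi i @` (B `&` dom i)).
  apply/(manifold_chart_homeo (s := SM) (i := i)) => [y []//|].
  by apply: openI => //; exact: manifold_chart_open.
apply: (filterS (P := phi i @` (B `&` dom i))).
  by move=> _ [y [By dy] <-] /=; rewrite chart_invK//; exact: BA.
by apply: open_nbhs_nbhs; split=> //; exists x.
Qed.

End Inverse.

Lemma chart_img_openI i (A : set M) : open A -> open (phi i @` (dom i `&` A)).
Proof.
move=> oA; apply/(manifold_chart_homeo (s := SM) (i := i)) => [y []//|].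
by apply: openI => //; exact: manifold_chart_open.
Qed.

Definition CkM (W : normedModType R) k (h : M -> W) :=
  forall i : chart SM, Ck_on k (img i) (in_chart i h).

Lemma chart_lift (W : topologicalType) i (u : 'rV[R]_n -> W) x : dom i x ->
  u xi @[xi --> phi i x] --> u (phi i x) -> u (phi i y) @[y --> x] --> u (phi i x).
Proof. by move=> dx; apply: cvg_comp; exact: chart_continuous. Qed.

Lemma CkM_continuous (W : normedModType R) k (h : M -> W) : CkM k h -> continuous h.
Proof.
move=> Ch x; have [i dx] := manifold_cover SM x.
have C0 : in_chart i h xi @[xi --> phi i x] --> in_chart i h (phi i x).
  exact: (Ck_on_le (leq0n k) (Ch i)) (chart_imgP dx).
have := chart_lift dx C0; rewrite in_chartE// => H.
rewrite /continuous_at; apply: cvg_trans H; apply: near_eq_cvg.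
by have := chart_nbhs dx; apply: filterS => y dy; rewrite in_chartE.
Qed.

Lemma CkM_rVP k m (h : M -> 'rV[R]_m) : CkM k h <-> forall j, CkM k (fun x => h x ord0 j).
Proof.
have E i j xi : img i xi -> in_chart i (fun x => h x ord0 j) xi = in_chart i h xi ord0 j.
  by move=> [x dx <-]; rewrite !in_chartE.
split=> [Ch j i|Ch i].
  have H := (Ck_on_rVP k (in_chart i h) (chart_img_open i)).1 (Ch i) j.
  by apply: (Ck_on_ext (chart_img_open i) _ H) => xi /E.
apply/(Ck_on_rVP k _ (chart_img_open i)) => j.
by apply: (Ck_on_ext (chart_img_open i) _ (Ch j i)) => xi /E.
Qed.

Definition transition (i j : chart SM) : 'rV[R]_n -> 'rV[R]_n := in_chart i (phi j).

Lemma transitionE i j x : dom i x -> transition i j (phi i x) = phi j x.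
Proof. exact: in_chartE. Qed.

Lemma transition_Ck k i j : Ck_on k (phi i @` (dom i `&` dom j)) (transition i j).
Proof. exact: manifold_transition. Qed.

Lemma overlap_open i j : open (phi i @` (dom i `&` dom j)).
Proof. by apply: chart_img_openI; exact: manifold_chart_open. Qed.
Arguments overlap_open : clear implicits.

Lemma transition_near (W : zmodType) i j (h : M -> W) x : dom i x -> dom j x ->
  {near phi i x, in_chart i h =1 in_chart j h \o transition i j}.
Proof.
move=> di dj; apply: (filterS (P := phi i @` (dom i `&` dom j))).
  by move=> _ [y [diy djy] <-] /=; rewrite in_chartE// transitionE// in_chartE.
by apply: open_nbhs_nbhs; split; [exact: overlap_open|exists x].
Qed.

Lemma transition_diff i j x : dom i x -> dom j x -> differentiable (transition i j) (phi i x).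
Proof. by move=> di dj; apply: (Ck_diff (@transition_Ck 1 i j)); exists x. Qed.

Lemma derive_transition (W : normedModType R) i j (h : M -> W) x v : dom i x -> dom j x ->
  differentiable (in_chart j h) (phi j x) ->
  'D_v (in_chart i h) (phi i x) = 'D_('D_v (transition i j) (phi i x)) (in_chart j h) (phi j x).
Proof.
move=> di dj dh; rewrite (near_eq_derive _ (transition_near h di dj)).
rewrite derive_comp_diff ?transitionE//; first exact: transition_diff.
Qed.

Lemma transition_inverse i j x v : dom i x -> dom j x ->
  'D_('D_v (transition i j) (phi i x)) (transition j i) (phi j x) = v.
Proof.
move=> di dj; rewrite /transition -(derive_transition v di dj); last exact: transition_diff.
rewrite -/(transition i i) (near_eq_derive (g := id)) ?derive_id//.
apply: (filterS (P := img i)); last by apply: open_nbhs_nbhs; split; [exact: chart_img_open|exists x].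
by move=> _ [y dy <-]; rewrite /transition in_chartE.
Qed.

End Charts.
Notation img := chart_img.
Arguments chart_img_open {R n M SM} i.
Arguments overlap_open {R n M SM} i j.

(** * Truncated powers *)

Section PosPower.
Context {R : realType}.

(** [pospow m.+1] is of class C^m, which suffices for the C^2 bumps of the embedding and for the C^1
    cutoff and penalty. *)
Definition pospow (m : nat) (s : R) : R := (Num.max 0 s) ^+ m.

Lemma pospow_continuous m : continuous (pospow m.+1).
Proof.
move=> s; apply: (@continuous_comp R R R (fun s => Num.max 0 s) (fun t : R => t ^+ m.+1));
  last exact: exprn_continuous.
exact: (@continuous_max R R (cst 0) id s (@cst_continuous _ _ (0 : R) s) (@cvg_id _ (nbhs s))).
Qed.

Lemma pospow_derive m (s v : R) : differentiable (pospow m.+2) s /\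
  'D_v (pospow m.+2) s = v * (m.+2%:R * pospow m.+1 s).
Proof.
have [s0|s0|s0] := ltgtP s 0.
- have E : {near s, cst 0 =1 pospow m.+2}.
    near=> t; have t0 : t < 0 by near: t; exact: lt_nbhsl.
    by rewrite /pospow max_l ?expr0n// ltW.
  split; first exact: (differentiable_near_eq E (differentiable_cst _ _)).
  rewrite -(near_eq_derive _ E) derive_cst /pospow max_l ?ltW//.
  by rewrite expr0n /= !mulr0.
- have E : {near s, (fun t => t ^+ m.+2) =1 pospow m.+2}.
    near=> t; have t0 : 0 < t by near: t; exact: lt_nbhsr.
    by rewrite /pospow max_r// ltW.
  have dX : differentiable (fun t : R => t ^+ m.+2) s by exact/derivable1_diffP/exprn_derivable.
  split; first exact: (differentiable_near_eq E dX).
  rewrite -(near_eq_derive _ E) exp_derive /pospow max_r ?ltW//.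
  by rewrite /GRing.scale /= mulrC.
- rewrite s0.
  have zc : continuous (\0 : R -> R) by move=> x; exact: cst_continuous.
  have [|d1 d2] := @frechetP R R R (pospow m.+2) 0 \0 zc.
    move=> e e0; near=> h.
    rewrite addr0 /pospow maxxx expr0n /= !subr0 normrX.
    have h1 : `|h| < Num.min 1 e.
      near: h; apply/nbhs_ballP; exists (Num.min 1 e) => /= [|y].
        by rewrite lt_min ltr01.
      by rewrite /ball /= sub0r normrN.
    have mh : `|Num.max 0 h| <= `|h| by case: (leP 0 h) => // ?; rewrite normr0.
    apply: (@le_trans _ _ (`|h| ^+ m.+2)); first by rewrite lerXn2r// nnegrE.
    rewrite exprSr ler_wpM2r// exprSr.
    have : `|h| ^+ m <= 1 by rewrite exprn_ile1// ltW// (lt_le_trans h1)// ge_min lexx.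
    move=> hm; rewrite -[e]mul1r ler_pM// ltW// (lt_le_trans h1)// ge_min lexx orbT//.
  split => //; rewrite (deriveE _ d1) d2 /pospow maxxx expr0n /= !mulr0 //.
Unshelve. all: by end_near. Qed.

Lemma pospow_Ck k : Ck_on k setT (pospow k.+1).
Proof.
suff H m : Ck_on k setT (pospow (m + k).+1) by exact: (H 0%N).
elim: k m => [|k IH] m; first by move=> x _; exact: pospow_continuous.
rewrite addnS; split=> [x _|v]; first exact: (pospow_derive _ x 0).1.
rewrite (_ : (fun x => _) = (fun x => v * ((m + k).+2%:R * pospow (m + k).+1 x))); last first.
  by apply/funext => x; rewrite (pospow_derive _ x v).2.
apply: Ck_onM; [exact: openT|exact: Ck_on_cst|].
by apply: Ck_onM; [exact: openT|exact: Ck_on_cst|exact: IH].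
Qed.

Lemma pospow_ge0 m s : 0 <= pospow m s.
Proof. by rewrite exprn_ge0// le_max lexx. Qed.

Lemma pospow_gt0 m s : (0 < pospow m.+1 s) = (0 < s).
Proof.
rewrite /pospow; case: (ltP 0 s) => s0; first by rewrite exprn_gt0.
by rewrite expr0n ltxx.
Qed.

Lemma pospow_eq0 m s : s <= 0 -> pospow m.+1 s = 0.
Proof. by move=> s0; rewrite /pospow max_l// expr0n. Qed.

End PosPower.

Lemma closed_preimage (T U : topologicalType) (f : T -> U) (A : set U) :
  continuous f -> closed A -> closed (f @^-1` A).
Proof.
move=> cf cA; rewrite -[f @^-1` A]setCK; apply: open_closedC.
exact: (proj1 (continuousP f) cf _ (closed_openC cA)).
Qed.

Lemma compact_finite_cover (T : topologicalType) (A : set T) (f : T -> set T) :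
  compact A -> (forall x, A x -> nbhs x (f x)) ->
  exists s : seq T, (forall x, x \in s -> A x) /\ forall y, A y -> exists2 x, x \in s & f x y.
Proof.
move=> /compact_near_coveringP cA fx.
(* The finite lists of points of [A], directed by inclusion: along this filter the near-covering
   form of compactness yields a finite subcover. *)
pose F : set_system (seq T) := [set S : set (seq T) | exists s : seq T, (forall x, x \in s -> A x) /\
  forall s' : seq T, {subset s <= s'} -> (forall x, x \in s' -> A x) -> S s'].
have FF : Filter F.
  split; first by exists [::].
    move=> S1 S2 [s1 [A1 H1]] [s2 [A2 H2]]; exists (s1 ++ s2); split.
      by move=> x; rewrite mem_cat => /orP[/A1|/A2].
    move=> s' ss' As'; split; [apply: H1|apply: H2] => // x xs; apply: ss';
      by rewrite mem_cat xs ?orbT.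
  by move=> S1 S2 S12 [s [As H]]; exists s; split=> // s' ss' As'; apply/S12/H.
have [|s [As H]] := cA (seq T) F (fun (s : seq T) y => (forall x, x \in s -> A x) /\ exists2 x, x \in s & f x y) FF.
  move=> x Ax; exists (f x, [set s : seq T | (forall x, x \in s -> A x) /\ x \in s]).
    split; first exact: fx.
    exists [:: x]; split=> [y|s' ss' As']; first by rewrite inE => /eqP ->.
    by split=> //; apply: ss'; rewrite inE.
  by move=> [y s'] /= [fxy [As' xs']]; split=> //; exists x.
by exists s; split=> // y Ay; have [] := H s (fun _ h => h) As y Ay.
Qed.

(** * A C^2 embedding of a compact manifold *)

Section Embedding.
Context {R : realType} {n : nat} {M : topologicalType} (SM : smooth_manifold R n M).
Local Notation dom := (@chart_dom _ _ SM).
Local Notation phi := (@chart_coord _ _ SM).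

Definition chart_ext (i : chart SM) (u : 'rV[R]_n -> R) (y : M) : R :=
  if pselect (dom i y) then u (phi i y) else 0.

Lemma chart_extE i u y : dom i y -> chart_ext i u y = u (phi i y).
Proof. by rewrite /chart_ext; case: pselect. Qed.

(** At a point outside the chart the function vanishes nearby: the preimage of the compact set [B]
    in M is compact, hence closed because M is Hausdorff, and it lies in the chart domain, so its
    complement is an open neighbourhood of the point. *)
Lemma chart_ext_Ck k i u (B : set 'rV[R]_n) : compact B -> B `<=` img i ->
  (forall xi, ~ B xi -> u xi = 0) -> Ck_on k setT u -> CkM SM k (chart_ext i u).
Proof.
move=> cB Bi uB Cu j; apply: Ck_on_local => _ [y dj <-].
have [di|ndi] := pselect (dom i y).
  exists (phi j @` (dom j `&` dom i)); first by split; [exact: overlap_open|exists y].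
  have H : Ck_on k (phi j @` (dom j `&` dom i)) (u \o transition j i).
    apply: (Ck_comp_rV (D' := setT)) => //; first exact: overlap_open.
    by apply/(Ck_on_rVP k _ (overlap_open j i)); exact: transition_Ck.
  apply: (Ck_on_ext _ _ H); first exact: overlap_open.
  by move=> _ [z [djz diz] <-] /=; rewrite in_chartE// chart_extE// transitionE.
pose B' := chart_inv y i @` B.
have B'i z : B' z -> dom i z by move=> [xi Bxi <-]; have [] := chart_invP y (Bi _ Bxi).
have cB' : closed B'.
  apply: compact_closed; first exact: manifold_hausdorff SM.
  apply: continuous_compact cB; apply: continuous_in_subspaceT => xi /[!inE] Bxi.
  exact/chart_inv_continuous/Bi.
have oU := chart_img_openI (i := j) (closed_openC cB').
exists (phi j @` (dom j `&` ~` B')); first by split=> //; exists y => //; split=> // /B'i.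
apply: (Ck_on_ext oU _ (@Ck_on_cst _ _ _ k _ (0 : R))) => _ [z [djz nBz] <-].
rewrite in_chartE// /chart_ext; case: pselect => // diz; rewrite uB// => Bz; apply: nBz.
by exists (phi i z) => //; rewrite chart_invK.
Qed.

(** The factor [v] makes one bump provide both itself, for constant [v], and its products with the
    chart coordinates; these are the components of the embedding. *)
Lemma bump_exists (x : M) : exists (i : chart SM) (u : 'rV[R]_n -> R),
  [/\ dom i x, 0 < u (phi i x), forall xi, 0 <= u xi &
    forall v, Ck_on 2 setT v -> CkM SM 2 (chart_ext i (fun xi => u xi * v xi))].
Proof.
have [i dx] := manifold_cover SM x; exists i.
have oi : \forall xi \near phi i x, img i xi.
  by apply: open_nbhs_nbhs; split; [exact: chart_img_open|exact: chart_imgP].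
have [rho /= rho0 rhoi] := (nbhs_ballP _ _).1 oi.
(* The bump is supported in a Euclidean ball of radius [r], contained in the closed ball of the same
   radius for the sup norm; halving [rho] puts it strictly inside the image of the chart. *)
pose r := rho / 2; have r0 : 0 < r by rewrite divr_gt0.
pose c := phi i x; pose q (xi : 'rV[R]_n) := \sum_(k < n) (xi ord0 k - c ord0 k) * (xi ord0 k - c ord0 k).
have Cq k : Ck_on k setT q.
  apply: Ck_on_sum => [|j _]; first exact: openT.
  have H : Ck_on k setT (fun xi : 'rV[R]_n => xi ord0 j - c ord0 j).
    by apply: Ck_onD; [exact: openT|exact: Ck_on_coord|exact: Ck_on_cst].
  by apply: Ck_onM => //; exact: openT.
have q0 xi : 0 <= q xi by apply: sumr_ge0 => j _; rewrite -expr2 sqr_ge0.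
pose u xi := pospow 3 (1 - q xi / r ^+ 2).
have Cu : Ck_on 2 setT u.
  have Cw : Ck_on 2 setT (fun xi => 1 - q xi / r ^+ 2).
    apply: Ck_onD; [exact: openT|exact: Ck_on_cst|].
    apply: Ck_onN; first exact: openT.
    by apply: Ck_onM; [exact: openT|exact: Cq|exact: Ck_on_cst].
  have := @Ck_comp R 'rV[R]_n R unit (fun=> 1) 2 setT setT (fun _ xi => 1 - q xi / r ^+ 2) (pospow 3)
    openT (fun _ _ => I) (fun _ => Cw) (pospow_Ck 2).
  apply: Ck_on_ext => [|xi _]; first exact: openT.
  by rewrite /u (big_pred1 tt) => [|[]//]; rewrite [_ *: _]mulr1.
pose B := [set xi | q xi <= r ^+ 2].
have r20 : 0 < r ^+ 2 by rewrite exprn_gt0.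
have Bball xi : B xi -> ball c rho xi.
  move=> Bxi; rewrite -ball_normE /ball_ /=; apply: (@le_lt_trans _ _ r); last first.
    by rewrite /r ltr_pdivrMr// ltr_pMr// ltr1n.
  apply: mx_norm_le => [|a k]; first exact: ltW.
  rewrite !mxE (ord1 a) -(@ler_pXn2r _ 2) ?nnegrE//; last exact: ltW.
  rewrite real_normK ?num_real//; apply: (le_trans _ (Bxi : q xi <= r ^+ 2)).
  rewrite /q (bigD1 k)//= -expr2 -[X in X ^+ 2]opprB sqrrN lerDl.
  by apply: sumr_ge0 => j _; rewrite -expr2 sqr_ge0.
exists u; split=> //.
- rewrite /u pospow_gt0 subr_gt0 ltr_pdivrMr// mul1r /q big1 // => k _.
  by rewrite subrr mul0r.
- by move=> xi; exact: pospow_ge0.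
move=> v Cv; apply: (@chart_ext_Ck 2 i _ B).
- apply: bounded_closed_compact; last first.
    have cq : continuous q by move=> xi; have := Cq 0%N; apply.
    rewrite (_ : B = q @^-1` [set t | t <= r ^+ 2])//.
    exact: closed_preimage.
  exists (`|c| + rho); split; first exact: num_real.
  move=> m cm xi /Bball; rewrite -ball_normE /ball_ /= => H; rewrite (le_trans _ (ltW cm))//.
  by rewrite -[xi](subKr c) (le_trans (ler_normB _ _))// lerD// ltW.
- by move=> xi /Bball/rhoi.
- move=> xi /negP; rewrite -ltNge => qr; rewrite /u pospow_eq0 ?mul0r//.
  by rewrite subr_le0 ler_pdivlMr// mul1r ltW.
- by apply: Ck_onM => //; exact: openT.
Qed.

(** The components are finitely many bumps, whose positivity sets cover M, and their products with
    chart coordinates. If a bump takes the same positive value at two points, both lie in its chart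
    and the products give equal coordinates. If its differential kills [v], that of its product with
    a coordinate is the bump times the differential of the coordinate, which must then kill [v]
    too. *)
Theorem embedding : compact [set: M] -> exists (K : nat) (e : M -> 'rV[R]_K),
  [/\ injective e, CkM SM 2 e & forall i x v, dom i x ->
     'D_v (in_chart i e) (phi i x) = 0 -> v = 0].
Proof.
move=> cM.
have /choice[ic icP] : forall x : M, exists iu : chart SM * ('rV[R]_n -> R),
  [/\ dom iu.1 x, 0 < iu.2 (phi iu.1 x), forall xi, 0 <= iu.2 xi &
    forall v, Ck_on 2 setT v -> CkM SM 2 (chart_ext iu.1 (fun xi => iu.2 xi * v xi))].
  by move=> x; have [i [u H]] := bump_exists x; exists (i, u).
pose b x := chart_ext (ic x).1 (fun xi => (ic x).2 xi * 1).
pose bk x k := chart_ext (ic x).1 (fun xi => (ic x).2 xi * xi ord0 k).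
have Cb x : CkM SM 2 (b x) by have [_ _ _] := icP x; apply; exact: Ck_on_cst.
have Cbk x k : CkM SM 2 (bk x k) by have [_ _ _] := icP x; apply; exact: Ck_on_coord.
have bE x y : dom (ic x).1 y -> b x y = (ic x).2 (phi (ic x).1 y).
  by move=> d; rewrite /b chart_extE// mulr1.
have bkE x k y : dom (ic x).1 y -> bk x k y = b x y * phi (ic x).1 y ord0 k.
  by move=> d; rewrite /bk bE// chart_extE.
have bdom x y : 0 < b x y -> dom (ic x).1 y.
  move=> bp; have [//|nd] := pselect (dom (ic x).1 y).
  have E : b x y = 0 by rewrite /b /chart_ext; case: (pselect _).
  by move: bp; rewrite E ltxx.
have [|D' [_ Dcov]] := compact_finite_cover (f := fun x => [set y | 0 < b x y]) cM.
  move=> x _; apply: open_nbhs_nbhs; split; last by have [d p _ _] := icP x; rewrite /= bE.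
  apply: (proj1 (continuousP (b x)) (CkM_continuous (Cb x)) [set t | 0 < t]).
  exact: open_gt.
(* [None] indexes the bump itself, [Some k] its product with the k-th coordinate. *)
pose I := (seq_sub D' * option 'I_n)%type.
pose comp (a : I) x := if a.2 is Some k then bk (val a.1) k x else b (val a.1) x.
pose e x : 'rV[R]_#|{: I}| := \row_(j < #|{: I}|) comp (enum_val j) x.
have eE a x : e x ord0 (enum_rank a) = comp a x by rewrite mxE enum_rankK.
have cov y : exists a : seq_sub D', 0 < b (val a) y.
  by have [x xD by0] := Dcov y Logic.I; exists (SeqSub xD).
exists #|{: I}|, e; split.
- move=> x y exy; have [a bx] := cov x.
  have bxy : b (val a) x = b (val a) y.
    by rewrite -[LHS](eE (a, None)) -[RHS](eE (a, None)) exy.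
  have dx := bdom _ _ bx; have by0 : 0 < b (val a) y by rewrite -bxy.
  have dy := bdom _ _ by0.
  apply: (manifold_chart_inj (mem_set dx) (mem_set dy)); apply/rowP => k.
  have : bk (val a) k x = bk (val a) k y.
    by rewrite -[LHS](eE (a, Some k)) -[RHS](eE (a, Some k)) exy.
  rewrite !bkE// -bxy => /mulfI; apply; by rewrite gt_eqF.
- apply/CkM_rVP => j; rewrite (_ : (fun x => _) = comp (enum_val j)).
    by rewrite /comp; case: (enum_val j).2 => [k|]; [exact: Cbk|exact: Cb].
  by apply/funext => x; rewrite mxE.
- move=> i x v dx De0; have [a bx] := cov x; have da := bdom _ _ bx.
  have Ce1 : CkM SM 2 e.
    apply/CkM_rVP => j; rewrite (_ : (fun x => _) = comp (enum_val j)).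
      by rewrite /comp; case: (enum_val j).2 => [k|]; [exact: Cbk|exact: Cb].
    by apply/funext => y; rewrite mxE.
  have de : differentiable (in_chart i e) (phi i x) := Ck_diff (Ce1 i) (chart_imgP dx).
  have Dc a' : 'D_v (in_chart i (comp a')) (phi i x) = 0.
    have := congr1 (fun w : 'rV[R]_#|{: I}| => w ord0 (enum_rank a')) De0.
    rewrite derive_rV// mxE => <-; apply: near_eq_derive.
    apply: (filterS (P := img i)); last by apply: open_nbhs_nbhs; split; [exact: chart_img_open|exists x].
    by move=> _ [y dy <-]; rewrite !in_chartE// eE.
  have dcomp a' : differentiable (in_chart i (comp a')) (phi i x).
    suff H : CkM SM 2 (comp a') by exact: Ck_diff (H i) (chart_imgP dx).
    by rewrite /comp; case: (a'.2) => [k|]; [exact: Cbk|exact: Cb].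
  set ia := (ic (val a)).1 in da *.
  have dt : differentiable (transition i ia) (phi i x) := transition_diff dx da.
  have Dt : 'D_v (transition i ia) (phi i x) = 0.
    apply/rowP => k; rewrite derive_rV// [RHS]mxE.
    have dtk : differentiable (fun y => transition i ia y ord0 k) (phi i x).
      by move/differentiable_rVP: dt; exact.
    have E : 'D_v (in_chart i (comp (a, Some k))) (phi i x) =
       'D_v (fun y => in_chart i (comp (a, None)) y * transition i ia y ord0 k) (phi i x).
      apply: near_eq_derive; apply: (filterS (P := phi i @` (dom i `&` dom ia))).
        by move=> _ [y [diy djy] <-] /=; rewrite !in_chartE//= transitionE// /comp /= bkE.
      by apply: open_nbhs_nbhs; split; [exact: overlap_open|exists x].
    move: E; rewrite Dc (deriveM (derivable_dir v (dcomp (a, None))) (derivable_dir v dtk)).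
    rewrite (Dc (a, None)) scaler0 addr0 in_chartE//= => /esym/eqP.
    by rewrite scaler_eq0 gt_eqF//= => /eqP.
  by rewrite -(transition_inverse v dx da) Dt derive0.
Qed.

End Embedding.

(** * The Poincare-Miranda theorem *)

Section GridDegree.
Variables (D m : nat).
Local Notation G := {ffun 'I_D -> 'I_m.+1}.
Implicit Types (u v w t : G).

Definition gle u w := [forall k, (u k <= w k)%N].
Definition gclose u w := [forall k, (u k <= w k <= (u k).+1)%N].
Definition between u w t := gle u t && gle t w.

Lemma gle_refl u : gle u u. Proof. by apply/forallP. Qed.
Lemma gle_trans v u w : gle u v -> gle v w -> gle u w.
Proof. by move=> /forallP uv /forallP vw; apply/forallP => k; exact: leq_trans (uv k) (vw k). Qed.
Lemma gle_anti u w : gle u w -> gle w u -> u = w.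
Proof.
move=> /forallP uw /forallP wu; apply/ffunP => k; apply/val_inj/eqP.
by rewrite eqn_leq uw wu.
Qed.
Lemma gclose_le u w : gclose u w -> gle u w.
Proof. by move=> /forallP H; apply/forallP => k; have /andP[] := H k. Qed.
Lemma gclose_sub u w v t : gclose u w -> gle u v -> gle v t -> gle t w -> gclose v t.
Proof.
move=> /forallP H /forallP uv /forallP vt /forallP tw; apply/forallP => k.
have /andP[_ h] := H k; rewrite vt /= (leq_trans (tw k))// (leq_trans h)// ltnS; exact: uv.
Qed.

Lemma F2_double (x : 'F_2) : x + x = 0.
Proof. by rewrite -mulr2n -mulr_natl pchar_Fp_0// mul0r. Qed.

(** An interval of a unit cube has an even number of vertices unless it is a point: exchanging [u k]
    and [w k] in a coordinate where they differ pairs them off. This is the relation zeta^2 = 1. *)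
Lemma between_count u w : gclose u w -> u != w -> \sum_(t | between u w t) (1 : 'F_2) = 0.
Proof.
move=> cl /eqP neq.
have /existsP[k uk] : [exists k, (u k < w k)%N].
  apply: contraT; rewrite negb_exists => /forallP H; exfalso; apply: neq.
  apply: gle_anti; first exact: gclose_le.
  by apply/forallP => k; have := H k; rewrite -leqNgt.
pose flip t : G := [ffun j => if j == k then (if t k == u k then w k else u k) else t j].
have ukw : (u k == w k) = false by apply/negP => /eqP E; rewrite E ltnn in uk.
have tk t : between u w t -> (t k == u k) || (t k == w k).
  move=> /andP[/forallP/(_ k) ut /forallP/(_ k) tw].
  have /andP[_ h] := forallP cl k; rewrite -!val_eqE /=; lia.
have flipB t : between u w t -> between u w (flip t).
  move=> /[dup] B /andP[/forallP ut /forallP tw]; apply/andP; split; apply/forallP => j; rewrite ffunE.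
    by case: eqP => [->|_]; [case: ifP => _ //; exact: ltnW|exact: ut].
  by case: eqP => [->|_]; [case: ifP => _ //; exact: ltnW|exact: tw].
have flipK t : between u w t -> flip (flip t) = t.
  move=> /tk B; apply/ffunP => j; rewrite !ffunE; case: eqP => [->|//]; rewrite eqxx.
  by case: (t k =P u k) B => [-> _|_ /= /eqP ->]; rewrite ?eqxx// eq_sym ukw.
rewrite (bigID (fun t => t k == u k)) /= [X in X + _](_ : _ = \sum_(t | between u w t && (t k != u k)) 1).
  exact: F2_double.
rewrite (reindex_onto flip flip) /=; last by move=> t /andP[/flipK].
apply: eq_bigl => t; apply/idP/idP.
  move=> /andP[/andP[Bf Ef] /eqP Et]; have Bt : between u w t by rewrite -Et flipB.
  rewrite Bt /=; move: Ef; rewrite ffunE eqxx; case: (t k == u k) => //.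
  by rewrite eq_sym ukw.
move=> /andP[Bt nt]; rewrite flipB// flipK// eqxx andbT /= ffunE eqxx (negbTE nt) eqxx.
by [].
Qed.

Variable X : nat -> G -> 'F_2.

(* In the incidence algebra of the grid over F_2, with zeta the matrix [between] of a small cube,
   [chains j] is, up to a factor zeta, the product of the commutators of the diagonal matrices [X k]
   with zeta, k < j; these commute with zeta because zeta^2 = 1 in characteristic 2. *)
Fixpoint chains j u w : 'F_2 :=
  if j is j'.+1 then \sum_(v | between u w v) chains j' u v * (X j' v + X j' w)
  else (u == w)%:R.

(** Associativity in the incidence algebra: both sides run over the triples u <= t <= v <= w. *)
Lemma sum_swap_between (u w : G) (F : G -> G -> 'F_2) :
  \sum_(v | between u w v) \sum_(t | between u v t) F t v =
  \sum_(t | between u w t) \sum_(v | between t w v) F t v.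
Proof.
rewrite (exchange_big_dep (between u w)) /=.
  apply: eq_bigr => t /andP[ut tw]; apply: eq_bigl => v; rewrite /between ut /=.
  apply/idP/idP; first by move=> /andP[/andP[_ ->] ->].
  by move=> /andP[tv vw]; rewrite (gle_trans ut tv) vw tv.
move=> v t /andP[uv vw] /andP[ut tv]; rewrite /between ut; exact: gle_trans tv vw.
Qed.

(** In the inductive step the two sides differ, at each [t], by a multiple of X t - X w summed over
    the vertices between [t] and [w]. The summand does not depend on the vertex and the number of
    vertices is even, unless [t = w], where the factor vanishes. *)
Lemma chains_comm j u w : gclose u w ->
  \sum_(v | between u w v) chains j u v = \sum_(v | between u w v) chains j v w.
Proof.
elim: j u w => [|j IH] u w cl.
  have uw := gclose_le cl.
  rewrite /= (bigD1 u) /=; last by rewrite /between gle_refl uw.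
  rewrite [RHS](bigD1 w) /=; last by rewrite /between gle_refl uw.
  rewrite !eqxx !big1 // => v /andP[_]; first by move=> /negbTE ->.
  by rewrite eq_sym => /negbTE; rewrite eq_sym => ->.
rewrite /= sum_swap_between.
have -> : \sum_(v | between u w v) \sum_(t | between v w t) chains j v t * (X j t + X j w)
   = \sum_(t | between u w t) \sum_(v | between t w v) chains j u t * (X j v + X j w).
  rewrite -[LHS](sum_swap_between u w (fun v t => chains j v t * (X j t + X j w))).
  rewrite -(sum_swap_between u w (fun t v => chains j u t * (X j v + X j w))).
  apply: eq_bigr => t /andP[ut tw]; rewrite -!mulr_suml IH//.
  exact: gclose_sub cl (gle_refl u) ut tw.
apply: eq_bigr => t /andP[ut tw]; rewrite -!mulr_sumr; congr (_ * _).
apply/eqP; rewrite -subr_eq0 -sumrB; apply/eqP.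
have E v : X j t + X j v - (X j v + X j w) = (X j t - X j w) * 1.
  by rewrite mulr1 opprD addrA addrK.
rewrite (eq_bigr _ (fun v _ => E v)) -mulr_sumr.
have [->|ntw] := eqVneq t w; first by rewrite subrr mul0r.
rewrite between_count ?mulr0//; exact: gclose_sub cl ut tw (gle_refl w).
Qed.

Lemma chainsS j u w : gclose u w -> chains j.+1 u w =
  \sum_(v | between u w v) chains j u v * X j v + \sum_(v | between u w v) chains j v w * X j w.
Proof.
move=> cl; rewrite /= -[X in _ = _ + X]mulr_suml -chains_comm// mulr_suml -big_split /=.
by apply: eq_bigr => v _; rewrite mulrDr.
Qed.

(** The commutator of zeta with a diagonal matrix that is constant on the interval is zero there,
    and it is one of the factors. *)
Lemma chains_const j k u w (c : 'F_2) : (k < j)%N -> (forall t, between u w t -> X k t = c) ->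
  chains j u w = 0.
Proof.
elim: j w => [//|j IH] w; rewrite ltnS leq_eqVlt => /orP[/eqP ->|kj] Xc /=.
  apply: big1 => v B; rewrite (Xc _ B) (Xc w) ?F2_double ?mulr0//.
  by move: B => /andP[uv vw]; rewrite /between gle_refl (gle_trans uv vw).
apply: big1 => v B; rewrite (IH v) ?mul0r// => t /andP[ut tv]; apply: Xc.
by move: B => /andP[_ vw]; rewrite /between ut (gle_trans tv vw).
Qed.

(** A step from [v] to itself has weight X v + X v = 0, so each of the [j] factors lengthens a chain
    of nonzero weight. *)
Lemma chains_length j u w : chains j u w != 0 -> gle u w /\ (j <= \sum_k (w k - u k))%N.
Proof.
elim: j w => [|j IH] w /=; first by have [->|] := eqVneq u w; rewrite ?gle_refl ?eqxx.
move=> nz.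
have [v B] : exists2 v, between u w v & chains j u v * (X j v + X j w) != 0.
  apply/exists_inP; apply: contraNT nz; rewrite negb_exists => /forallP H.
  by apply/eqP/big1 => v B; have := H v; rewrite B /= negbK => /eqP.
move: B => /andP[uv vw]; have [->|cz] := eqVneq (chains j u v) 0; first by rewrite mul0r eqxx.
have [-> |nvw _] := eqVneq v w; first by rewrite F2_double mulr0 eqxx.
split; first exact: gle_trans uv vw.
have [_ jl] := IH v cz.
have : (\sum_k (v k - u k) < \sum_k (w k - u k))%N.
  have /existsP[k vk] : [exists k, (v k < w k)%N].
    apply: contraT; rewrite negb_exists => /forallP H; exfalso; move/eqP: nvw; apply.
    apply: gle_anti => //; apply/forallP => k; have := H k; by rewrite -leqNgt.
  rewrite (bigD1 k) //= [X in (_ < X)%N](bigD1 k) //=.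
  have h : (\sum_(i < D | i != k) (v i - u i) <= \sum_(i < D | i != k) (w i - u i))%N.
    by apply: leq_sum => i _; apply: leq_sub2r; exact: (forallP vw i).
  rewrite -addSn; apply: leq_add => //; have := forallP uv k; move: vk.
  by move: (nat_of_ord (v k)) (nat_of_ord (u k)) (nat_of_ord (w k)) => a b c; lia.
exact: leq_ltn_trans.
Qed.

Hypothesis m0 : (0 < m)%N.
Hypothesis X0 : forall (k : 'I_D) u, u k = 0 :> nat -> X k u = 0.
Hypothesis Xm : forall (k : 'I_D) u, u k = m :> nat -> X k u = 1.

Definition frozen d u := [forall k : 'I_D, (d <= k)%N ==> (u k == m :> nat)].
(* The cubes of dimension [d] spanned by the first [d] directions in the face where the other
   coordinates are maximal; the sum of [chains d] over them is the degree. *)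
Definition full d u w := [&& frozen d u, frozen d w & [forall k : 'I_D, (k < d)%N ==> (w k == (u k).+1 :> nat)]].

Lemma chains_zero_face d u w (k : 'I_D) : (k < d)%N -> gle u w -> (w k = 0 :> nat \/ u k = m :> nat) ->
  chains d u w = 0.
Proof.
move=> kd uw [wk|uk].
  apply: (chains_const (c := 0) kd) => t /andP[ut tw]; apply: X0.
  have := forallP tw k; lia.
apply: (chains_const (c := 1) kd) => t /andP[ut tw]; apply: Xm.
have := forallP ut k; have := ltn_ord (t k); lia.
Qed.

Definition shift_up d u : G := [ffun k : 'I_D => if (k < d)%N then inord (u k).+1 else u k].
Definition shift_down d u : G := [ffun k : 'I_D => if (k < d)%N then inord (u k).-1 else u k].

Lemma full_close d u w : full d u w -> gclose u w.
Proof.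
move=> /and3P[/forallP fu /forallP fw /forallP f]; apply/forallP => k.
have := fu k; have := fw k; have := f k; case: (ltnP k d) => kd /=.
  by move=> /eqP -> _ _; rewrite leqnSn leqnn.
by move=> _ /eqP -> /eqP ->; rewrite leqnn leqnSn.
Qed.

Lemma full_upE d u w : full d u w = [&& frozen d u, [forall k : 'I_D, (k < d)%N ==> (u k < m)%N] & w == shift_up d u].
Proof.
apply/idP/idP.
  move=> /and3P[fu /forallP fw /forallP f]; rewrite fu /=; apply/andP; split.
    apply/forallP => k; apply/implyP => kd; have := f k; rewrite kd /= => /eqP E.
    by have := ltn_ord (w k); rewrite E ltnS.
  apply/eqP/ffunP => k; rewrite ffunE; case: ltnP => kd; apply: val_inj.
    have := f k; rewrite kd /= => /eqP E; rewrite inordK -?E//.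
  by have := fw k; have := forallP fu k; rewrite kd /= => /eqP -> /eqP.
move=> /and3P[fu /forallP um /eqP ->]; rewrite /full fu /=; apply/andP; split; apply/forallP => k; rewrite ffunE.
  by apply/implyP => dk; rewrite ltnNge dk /=; have := forallP fu k; rewrite dk.
by apply/implyP => kd; rewrite kd inordK// ltnS; have := um k; rewrite kd.
Qed.

Lemma full_downE d u w : full d u w = [&& frozen d w, [forall k : 'I_D, (k < d)%N ==> (0 < w k)%N] & u == shift_down d w].
Proof.
apply/idP/idP.
  move=> /and3P[/forallP fu fw /forallP f]; rewrite fw /=; apply/andP; split.
    by apply/forallP => k; apply/implyP => kd; have := f k; rewrite kd /= => /eqP ->.
  apply/eqP/ffunP => k; rewrite ffunE; case: ltnP => kd; apply: val_inj.
    have := f k; rewrite kd /= => /eqP E; rewrite inordK E //= ltnW//.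
  by have := fu k; have := forallP fw k; rewrite kd /= => /eqP -> /eqP.
move=> /and3P[fw /forallP um /eqP ->]; rewrite /full fw /=; apply/andP; split; apply/forallP => k; rewrite ffunE.
  by apply/implyP => dk; rewrite ltnNge dk /=; have := forallP fw k; rewrite dk.
apply/implyP => kd; have := um k; rewrite kd /= => wk; rewrite inordK ?prednK//.
by have := ltn_ord (w k); lia.
Qed.

(** A discrete Stokes formula modulo 2. By [chainsS] each cube contributes terms [f] on pairs that
    start at its bottom vertex and on pairs that end at its top vertex; over all cubes these pairs
    form [P1] and [P2]. A pair with nonzero [f] lies in [P2], and also in [P1] unless its first
    vertex is in the face where coordinate [d] is maximal. Pairs in both cancel, and on the face
    [X d] is 1, so the degree one dimension lower remains. *)
Lemma degree_step d : (d < D)%N ->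
  \sum_(p : G * G | full d.+1 p.1 p.2) chains d.+1 p.1 p.2 =
  \sum_(p : G * G | full d p.1 p.2) chains d p.1 p.2.
Proof.
move=> dD; pose kd := Ordinal dD.
pose Q (p : G * G) := [&& frozen d.+1 p.1, frozen d.+1 p.2 & gclose p.1 p.2].
pose f (p : G * G) := chains d p.1 p.2 * X d p.2.
pose P1 (p : G * G) := Q p && [forall k : 'I_D, (k < d.+1)%N ==> (p.1 k < m)%N].
pose P2 (p : G * G) := Q p && [forall k : 'I_D, (k < d.+1)%N ==> (0 < p.2 k)%N].
have S1 : \sum_(p : G * G | full d.+1 p.1 p.2) \sum_(v | between p.1 p.2 v) f (p.1, v) = \sum_(p | P1 p) f p.
  pose ok u := frozen d.+1 u && [forall k : 'I_D, (k < d.+1)%N ==> (u k < m)%N].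
  rewrite -(pair_big_dep xpredT (fun u w => full d.+1 u w)
    (fun u w => \sum_(v | between u w v) f (u, v))) /=.
  rewrite [RHS](eq_bigr (fun p => f (p.1, p.2))); last by case.
  rewrite -(pair_big_dep xpredT (fun u w => P1 (u, w)) (fun u w => f (u, w))) /=.
  apply: eq_bigr => u _; under eq_bigl do rewrite full_upE.
  have [/andP[fu um]|nok] := boolP (ok u); last first.
    rewrite !big_pred0// => v; apply/negP.
      by rewrite /P1 /Q /= => /andP[/and3P[fu _ _] um]; move: nok; rewrite /ok fu um.
    by move=> /and3P[fu um _]; move: nok; rewrite /ok fu um.
  rewrite (big_pred1 (shift_up d.+1 u)); last by move=> w; rewrite fu um.
  apply: eq_bigl => v; rewrite /P1 /Q /= fu um andbT /=.
  apply/idP/idP.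
    move=> /andP[/forallP uv /forallP vw]; apply/andP; split; apply/forallP => k.
      apply/implyP => dk; have := uv k; have := forallP fu k; rewrite dk /= => /eqP ->.
      have := ltn_ord (v k); lia.
    have := uv k; have := vw k; rewrite ffunE; case: ltnP => kd'; last lia.
    rewrite inordK; first by move=> -> ->.
    by have := forallP um k; rewrite kd'.
  move=> /andP[/forallP fv /forallP cl]; apply/andP; split; apply/forallP => k.
    by have /andP[] := cl k.
  rewrite ffunE; case: ltnP => kd'.
    rewrite inordK; first by have /andP[] := cl k.
    by have := forallP um k; rewrite kd'.
  by have := fv k; have := forallP fu k; rewrite kd' /= => /eqP -> /eqP ->.
have S2 : \sum_(p : G * G | full d.+1 p.1 p.2) \sum_(v | between p.1 p.2 v) f (v, p.2) = \sum_(p | P2 p) f p.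
  pose ok w := frozen d.+1 w && [forall k : 'I_D, (k < d.+1)%N ==> (0 < w k)%N].
  rewrite -(pair_big_dep xpredT (fun u w => full d.+1 u w)
    (fun u w => \sum_(v | between u w v) f (v, w))) /=.
  rewrite [RHS](eq_bigr (fun p => f (p.1, p.2))); last by case.
  rewrite -(pair_big_dep xpredT (fun u w => P2 (u, w)) (fun u w => f (u, w))) /=.
  rewrite (exchange_big_dep xpredT)//= [RHS](exchange_big_dep xpredT)//=.
  apply: eq_bigr => w _; under eq_bigl do rewrite full_downE.
  have [/andP[fw wm]|nok] := boolP (ok w); last first.
    rewrite !big_pred0// => v; apply/negP.
      by rewrite /P2 /Q /= => /andP[/and3P[_ fw _] wm]; move: nok; rewrite /ok fw wm.
    by move=> /and3P[fw wm _]; move: nok; rewrite /ok fw wm.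
  rewrite (big_pred1 (shift_down d.+1 w)); last by move=> u; rewrite fw wm.
  apply: eq_bigl => v; rewrite /P2 /Q /= fw wm andbT /=.
  apply/idP/idP.
    move=> /andP[/forallP uv /forallP vw]; apply/andP; split; apply/forallP => k.
      apply/implyP => dk; have := uv k; rewrite ffunE ltnNge dk /=.
      have := forallP fw k; rewrite dk /= => /eqP ->; have := ltn_ord (v k); lia.
    have := uv k; have := vw k; rewrite ffunE; case: ltnP => kd'; last lia.
    have := forallP wm k; rewrite kd' /= => w0; rewrite inordK; last by have := ltn_ord (w k); lia.
    lia.
  move=> /andP[/forallP fv /forallP cl]; apply/andP; split; apply/forallP => k; last first.
    by have /andP[] := cl k.
  rewrite ffunE; case: ltnP => kd'.
    rewrite inordK; first by have /andP[] := cl k; lia.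
    by have := ltn_ord (w k); lia.
  by have := fv k; have := forallP fw k; rewrite kd' /= => /eqP -> /eqP ->.
(* Nonzero terms avoid the faces on which a label is constant: by [chains_zero_face] for the
   coordinates below [d], by the factor [X d] for coordinate [d]. *)
have fz p : Q p -> f p != 0 -> (forall k : 'I_D, (k < d.+1)%N -> (0 < p.2 k)%N) /\
    (forall k : 'I_D, (k < d)%N -> (p.1 k < m)%N).
  move=> /and3P[_ _ /gclose_le le12] nz; split=> k kd'.
    rewrite lt0n; apply: contra nz => /eqP p2k; rewrite /f.
    move: kd'; rewrite ltnS leq_eqVlt => /orP[/eqP E|kd'].
      by have := X0 p2k; rewrite E => ->; rewrite mulr0.
    by rewrite (chains_zero_face kd' le12) ?mul0r//; left.
  rewrite ltn_neqAle -ltnS ltn_ord andbT; apply: contra nz => /eqP p1k.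
  by rewrite /f (chains_zero_face kd' le12) ?mul0r//; right.
have -> : \sum_(p : G * G | full d.+1 p.1 p.2) chains d.+1 p.1 p.2 = \sum_(p | P1 p) f p + \sum_(p | P2 p) f p.
  rewrite -S1 -S2 -big_split /=; apply: eq_bigr => -[u w] fuw.
  exact: chainsS (full_close fuw).
pose T (p : G * G) := [&& frozen d p.1, frozen d p.2 & gclose p.1 p.2].
have TQ p : T p = Q p && (p.1 kd == m :> nat).
  apply/idP/idP.
    move=> /and3P[/forallP f1 /forallP f2 cl]; rewrite /Q cl andbT.
    have h (g : G) : (forall k : 'I_D, (d <= k)%N ==> (g k == m :> nat)) -> frozen d.+1 g.
      by move=> H; apply/forallP => k; apply/implyP => dk; apply: (implyP (H k)); exact: ltnW.
    by rewrite !h//=; have := f1 kd; rewrite /= leqnn.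
  move=> /andP[/and3P[/forallP f1 /forallP f2 cl] /eqP E]; apply/and3P; split=> //; apply/forallP => k;
    apply/implyP; rewrite leq_eqVlt => /orP[/eqP dk|dk].
  - have -> : k = kd by exact: val_inj.
    by rewrite E.
  - by apply: (implyP (f1 k)).
  - have -> : k = kd by exact: val_inj.
    have /andP[h _] := forallP cl kd; have := ltn_ord (p.2 kd); rewrite ltnS => h'.
    by rewrite eqn_leq h' -{1}E h.
  - by apply: (implyP (f2 k)).
have -> : \sum_(p | P1 p) f p + \sum_(p | P2 p) f p = \sum_(p | T p) chains d p.1 p.2.
  rewrite big_mkcond [X in _ + X]big_mkcond -big_split /= [RHS]big_mkcond.
  apply: eq_bigr => p _; rewrite /P1 /P2 TQ; have [Qp|//] := boolP (Q p); last by rewrite addr0.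
  rewrite /=; have [f0|nz] := eqVneq (f p) 0.
    rewrite f0 !if_same addr0; case: eqP => // E.
    have E2 : p.2 kd = m :> nat.
      have /and3P[_ _ cl] := Qp.
      by have /andP[h _] := forallP cl kd; have := ltn_ord (p.2 kd); lia.
    by have := f0; rewrite /f (Xm (k := kd) E2) mulr1.
  have [h2 h1] := fz p Qp nz.
  have -> : [forall k : 'I_D, (k < d.+1)%N ==> (0 < p.2 k)%N].
    by apply/forallP => k; apply/implyP; exact: h2.
  have -> : [forall k : 'I_D, (k < d.+1)%N ==> (p.1 k < m)%N] = (p.1 kd != m :> nat).
    apply/idP/idP.
      by move=> /forallP/(_ kd) /=; rewrite ltnSn /= ltn_neqAle => /andP[].
    move=> ne; apply/forallP => k; apply/implyP; rewrite ltnS leq_eqVlt => /orP[/eqP E|]; last exact: h1.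
    have -> : k = kd by exact: val_inj.
    by rewrite ltn_neqAle ne -ltnS ltn_ord.
  case: eqP => /= E; last by rewrite F2_double.
  have E2 : p.2 kd = m :> nat.
    have /and3P[_ _ cl] := Qp.
    by have /andP[h _] := forallP cl kd; have := ltn_ord (p.2 kd); lia.
  by rewrite add0r /f (Xm (k := kd) E2) mulr1.
(* The two vertices differ by at most one in each of the first [d] coordinates and agree in the
   others. By [chains_length] a nonzero weight forces a difference in all of the first [d], so only
   full cubes contribute. *)
rewrite big_mkcond [RHS]big_mkcond; apply: eq_bigr => -[u w] _ /=.
case: ifP => [Tp|nT]; last first.
  case: ifP => // fuw; move: nT; rewrite /T /= (full_close fuw).
  by move: fuw => /and3P[-> -> _].
case: ifP => // nf; apply/eqP; apply: contraFT nf => /chains_length[_ dl].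
move: Tp => /and3P[/= fu fw cl]; apply/and3P; split=> //; apply/forallP => k; apply/implyP => kd'.
apply: contraLR dl => ne; rewrite -ltnNge.
have H (i : 'I_D) : (w i - u i <= (i < d))%N.
  have /andP[_ h] := forallP cl i; case: (ltnP i d) => id_; first by rewrite leq_subLR addn1.
  have := forallP fu i; have := forallP fw i; rewrite id_ /= => /eqP -> /eqP ->.
  by rewrite subnn.
have wk : (w k - u k = 0)%N.
  have /andP[h1 h2] := forallP cl k.
  apply/eqP; rewrite subn_eq0 leqNgt; apply/negP => h; move/negP: ne; apply.
  by rewrite eqn_leq h2 h.
have cnt : (\sum_(i < D) (i < d)%N = d)%N.
  rewrite -(big_mkord xpredT (fun i => nat_of_bool (i < d)%N)).
  have E i : (0 <= i < d)%N -> nat_of_bool (i < d)%N = 1%N by move=> /andP[_ ->].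
  have E2 : (\sum_(d <= i < D) nat_of_bool (i < d)%N = 0)%N.
    by rewrite big_nat_cond big1// => i /andP[/andP[di _] _]; rewrite ltnNge di.
  by rewrite (big_cat_nat (leq0n d) (ltnW dD)) /= E2 addn0 (eq_big_nat _ _ E)
    sum_nat_const_nat subn0 muln1.
suff lt : (\sum_(i < D) (w i - u i) < \sum_(i < D) (i < d)%N)%N by move: lt; rewrite cnt.
rewrite (bigD1 k) //= wk add0n [X in (_ < X)%N](bigD1 k) //= kd' add1n ltnS.
by apply: leq_sum => i _; exact: H.
Qed.

(** For [d = 0] only the vertex with all coordinates maximal is frozen, and [chains 0] is 1
    there. *)
Lemma degree_one d : (d <= D)%N -> \sum_(p : G * G | full d p.1 p.2) chains d p.1 p.2 = 1.
Proof.
elim: d => [_|d IH dD]; last by rewrite degree_step// IH// ltnW.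
pose g : G := [ffun => ord_max].
have frg : frozen 0 g by apply/forallP => k; rewrite ffunE /= eqxx.
have frE v : frozen 0 v -> v = g.
  by move=> /forallP H; apply/ffunP => k; rewrite ffunE; apply/val_inj/eqP; have := H k.
rewrite (big_pred1 (g, g)) /=; first by rewrite eqxx.
move=> [u w] /=; apply/idP/idP; first by move=> /and3P[/frE -> /frE -> _].
by move=> /eqP[-> ->]; rewrite /full frg /=; apply/forallP.
Qed.

(** A cubical Sperner lemma: the degree being nonzero, some unit cube has nonzero [chains], and then
    no label is constant on it. *)
Lemma grid_cell : exists u w, (forall k, w k = (u k).+1 :> nat) /\
  forall k : 'I_D, exists t t', [/\ between u w t, between u w t' & X k t != X k t'].
Proof.
have : \sum_(p : G * G | full D p.1 p.2) chains D p.1 p.2 != 0 by rewrite degree_one.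
move=> nz.
have [[u w] fuw cz] : exists2 p, full D p.1 p.2 & chains D p.1 p.2 != 0.
  apply/exists_inP; apply: contraNT nz; rewrite negb_exists => /forallP H.
  by apply/eqP/big1 => v B; have := H v; rewrite B /= negbK => /eqP.
exists u, w; split.
  by move=> k; move: fuw => /and3P[_ _ /forallP/(_ k)]; rewrite ltn_ord => /eqP.
move=> k; have uw := gclose_le (full_close fuw).
have [t Bt Xt] : exists2 t, between u w t & X k t != X k u.
  apply/exists_inP; apply: contraNT cz; rewrite negb_exists => /forallP H /=.
  apply/eqP; apply: (chains_const (k := k) (c := X k u)) => // t B.
  by have := H t; rewrite B /= negbK => /eqP.
by exists t, u; split=> //; rewrite /between gle_refl.
Qed.

End GridDegree.

Section PoincareMiranda.
Context {R : realType}.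

(** Label the vertices of a grid by the signs of the components of [f], with 0 and 1 imposed on
    opposite faces, which the boundary conditions allow. A cube from [grid_cell] has, for each
    component, vertices of both signs; refine the grid and use compactness. *)
Theorem poincare_miranda D (rho : R) (f : 'rV[R]_D -> 'rV[R]_D) : 0 < rho -> continuous f ->
  (forall (x : 'rV[R]_D) k, `|x| <= rho -> x ord0 k = - rho -> f x ord0 k <= 0) ->
  (forall (x : 'rV[R]_D) k, `|x| <= rho -> x ord0 k = rho -> 0 <= f x ord0 k) ->
  exists2 x, `|x| <= rho & f x = 0.
Proof.
move=> rho0 cf fm fp.
pose K := [set x : 'rV[R]_D | `|x| <= rho].
have cK : compact K.
  apply: bounded_closed_compact.
    by exists rho; split; [exact: num_real|move=> M rM x /= /le_trans; apply; exact: ltW].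
  rewrite (_ : K = Num.norm @^-1` [set t | t <= rho])//.
  by apply: closed_preimage => //; exact: norm_continuous.
pose good (N : nat) x := forall k, exists y y' : 'rV[R]_D,
  [/\ `|y - x| <= 2 * rho / N.+1%:R, `|y' - x| <= 2 * rho / N.+1%:R, 0 <= f y ord0 k & f y' ord0 k <= 0].
have ex_good N : exists2 x, K x & good N x.
  pose m := N.+1; pose G := {ffun 'I_D -> 'I_m.+1}.
  pose pt (u : G) : 'rV[R]_D := \row_k (- rho + 2 * rho * (u k)%:R / m%:R).
  have m0 : 0 < m%:R :> R by rewrite ltr0n.
  have ptK u : `|pt u| <= rho.
    apply: mx_norm_le => [|a k]; first exact: ltW.
    rewrite mxE ler_norml; apply/andP; split; first by rewrite lerDl !mulr_ge0// ?invr_ge0 ltW.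
    rewrite -lerBrDl opprK -mulr2n -[X in _ <= X]mulr_natl -mulrA.
    have r2 : 0 <= 2 * rho by rewrite mulr_ge0// ltW.
    apply: ler_piMr => //.
    by rewrite ler_pdivrMr// mul1r ler_nat -ltnS ltn_ord.
  pose X (k : nat) (u : G) : 'F_2 := if insub k is Some k' then
    (if u k' == 0 :> nat then 0 else if u k' == m :> nat then 1 else (0 < f (pt u) ord0 k')%R%:R) else 0.
  have XE (k : 'I_D) u : X k u = if u k == 0 :> nat then 0 else if u k == m :> nat then 1
      else (0 < f (pt u) ord0 k)%R%:R by rewrite /X valK.
  have [|||u [w [wu H]]] := @grid_cell D m X.
  - by [].
  - by move=> k u uk; rewrite XE uk eqxx.
  - by move=> k u uk; rewrite XE uk eqxx.
  exists (pt u); first exact: ptK.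
  have close t : between u w t -> `|pt t - pt u| <= 2 * rho / N.+1%:R.
    move=> /andP[/forallP ut /forallP tw].
    have r0 : 0 <= 2 * rho / N.+1%:R by rewrite divr_ge0// mulr_ge0// ltW.
    apply: mx_norm_le => // a k; rewrite !mxE.
    have -> : - rho + 2 * rho * (t k)%:R / m%:R - (- rho + 2 * rho * (u k)%:R / m%:R) =
        2 * rho / m%:R * ((t k)%:R - (u k)%:R) by ring.
    rewrite normrM ger0_norm// ler_piMr// -natrB ?ut// ger0_norm// lern1.
    by have := tw k; rewrite wu leq_subLR addn1.
  have sgn t (k : 'I_D) : (X k t = 0 -> f (pt t) ord0 k <= 0) /\ (X k t != 0 -> 0 <= f (pt t) ord0 k).
    rewrite XE; case: eqP => [t0|_].
      split; last by rewrite eqxx.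
      by move=> _; apply: fm; [exact: ptK|rewrite mxE t0 mulr0 mul0r addr0].
    case: eqP => [tm|_].
      split; first by move=> /eqP; rewrite oner_eq0.
      by move=> _; apply: fp; [exact: ptK|rewrite mxE tm mulfK ?gt_eqF//; ring].
    case: ltP => h; split; last by rewrite eqxx.
    - by move=> /eqP; rewrite oner_eq0.
    - by move=> _; exact: ltW.
    - by [].
  move=> k; have [t [t' [Bt Bt' Xtt']]] := H k.
  have [t0|tn] := eqVneq (X k t) 0.
    exists (pt t'), (pt t); split; [exact: close|exact: close| |exact: (sgn t k).1].
    by apply: (sgn t' k).2; apply: contra Xtt' => /eqP ->; rewrite t0.
  have t'0 : X k t' = 0.
    move: Xtt' tn; move: (X k t) (X k t') => [[|[|a]] ha] [[|[|b]] hb] ne nz;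
      first [done | exact: val_inj | by move/eqP: nz; case; exact: val_inj | by move/eqP: ne; case; exact: val_inj].
  exists (pt t), (pt t'); split; [exact: close|exact: close|exact: (sgn t k).2|exact: (sgn t' k).1].
(* Without a zero, some component has constant sign near each point, which excludes [good N] there
   for large N; by compactness no point of the cube is [good] for large N. *)
apply: contrapT => nz.
have fz x : K x -> exists k, f x ord0 k != 0.
  move=> Kx; apply: contrapT => H; apply: nz; exists x => //; apply/rowP => k; rewrite [RHS]mxE.
  by apply: contrapT => /eqP h; apply: H; exists k.
have [|N _ HN] := (proj1 (compact_near_coveringP K)) cK nat \oo (fun N x => ~ good N x).
- move=> x Kx; have [k fk] := fz x Kx.
  have ck : {for x, continuous (fun y => f y ord0 k)}.
    have H : f y @[y --> x] --> f x := cf x.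
    exact: (@cvg_comp _ _ _ f (fun M : 'rV[R]_D => M ord0 k) _ _ _ H (@coord_continuous R 1 D ord0 k (f x))).
  have fk0 : 0 < `|f x ord0 k| by rewrite normr_gt0.
  have ck' : \forall y \near x, `|f x ord0 k - f y ord0 k| < `|f x ord0 k|.
    by move/cvgrPdist_lt: ck; apply.
  have [r /= r0 rH] := (nbhs_ballP _ _).1 ck'.
  have same y : ball x r y -> 0 < f x ord0 k * f y ord0 k.
    move=> /rH /=; rewrite ltr_norml; case: (ltgtP (f x ord0 k) 0) fk => // h _ /andP[h1 h2].
      rewrite ltr0_norm// in h1 h2; rewrite nmulr_rgt0//; lra.
    rewrite gtr0_norm// in h1 h2; rewrite pmulr_rgt0//; lra.
  have Nr : \forall N \near \oo, 2 * rho / N.+1%:R < r / 2.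
    have q0 : 0 < r / (4 * rho) by rewrite divr_gt0// mulr_gt0.
    have := near_infty_natSinv_lt (PosNum q0); apply: filterS => N /=.
    rewrite ltr_pdivlMr ?mulr_gt0// => h.
    rewrite ltr_pdivlMr//.
    by have -> : 2 * rho / N.+1%:R * 2 = N.+1%:R^-1 * (4 * rho) by ring.
  exists (ball x (r / 2), [set N | 2 * rho / N.+1%:R < r / 2]).
    by split=> //; apply: nbhsx_ballx; rewrite divr_gt0.
  move=> [x' N] /= [xx' hN] gd; have [y [y' [yx y'x fy fy']]] := gd k.
  have inb z : `|z - x'| <= 2 * rho / N.+1%:R -> ball x r z.
    move: xx'; rewrite -!ball_normE /ball_ /= => xx' zx'.
    rewrite -(subrKA x') (le_lt_trans (ler_normD _ _))// (splitr r) ltrD//.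
    by rewrite distrC (le_lt_trans zx').
  have := same _ (inb _ yx); have := same _ (inb _ y'x).
  case: (ltgtP (f x ord0 k) 0) fk => // h _.
    by rewrite !nmulr_rgt0// => _ /lt_geF; rewrite fy.
  by rewrite !pmulr_rgt0// => /lt_geF; rewrite fy'.
- have [x Kx gx] := ex_good N; exact: (HN N (leqnn _) x Kx gx).
Qed.

End PoincareMiranda.

(** * Minimax critical points *)

Section StruweSelection.
Context {R : realType}.

(* If all left difference quotients exceeded [K] near every point, then [c] would decrease by at
   least [K (s2 - s1)]. *)
Lemma struwe_selection (c : R -> R) (s1 s2 K : R) : s1 < s2 ->
  (forall s t, s1 <= s -> s <= t -> t <= s2 -> c t <= c s) ->
  c s1 - c s2 < K * (s2 - s1) ->
  exists2 s, s1 < s <= s2 & forall d, 0 < d -> exists t, [/\ s1 <= t, s - d < t, t < s &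
    c t - c s <= K * (s - t)].
Proof.
move=> s12 cm cK; apply: contrapT => H.
have left s : s1 < s <= s2 -> exists2 d, 0 < d & forall t, s1 <= t -> s - d < t -> t < s ->
    c s + K * s < c t + K * t.
  move=> /[dup] ss /andP[s1s ss2]; apply: contrapT => nd; apply: H; exists s => // d d0.
  apply: contrapT => nt; apply: nd; exists d => // t s1t dt ts.
  rewrite ltNge; apply/negP => le; apply: nt; exists t; split=> //; lra.
pose k t := c t + K * t.
have k12 : k s1 < k s2 by rewrite /k; lra.
(* [S] consists of the starting points from which [k] stays above [k s2]. If its infimum were not
   [s1], the condition on left quotients would extend [S] further to the left; if it is [s1], this
   contradicts [k12]. *)
pose S := [set s | s1 <= s <= s2 /\ forall t, s <= t <= s2 -> k s2 <= k t].
have Ss2 : S s2.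
  split; first by rewrite lexx ltW.
  by move=> t; rewrite andbC => /le_anti ->.
have S0 : S !=set0 by exists s2.
have lS : has_lbound S by exists s1 => s [/andP[]].
pose s := inf S.
have s1s : s1 <= s by apply: lb_le_inf => // t [/andP[]].
have ss2 : s <= s2 by apply: ge_inf.
have above t : s < t -> t <= s2 -> k s2 <= k t.
  move=> st ts2; have [a Sa at_] := inf_adherent (eps := t - s) (ltac:(by rewrite subr_gt0)) (conj S0 lS).
  rewrite -/s addrC subrK in at_; have [_] := Sa; apply; by rewrite ltW.
(* As [c] is nonincreasing, just after [s] the function [k] exceeds [k s] by at most K times the
   increment of the argument; so the bound passes to the infimum. *)
have ks : k s2 <= k s.
  have [->//|ne] := eqVneq s s2; have lt : s < s2 by rewrite lt_neqAle ne.
  apply/ler_addgt0Pr => e e0.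
  pose t := Num.min s2 (s + e / (`|K| + 1)).
  have K0 : 0 < `|K| + 1 by rewrite ltr_wpDl.
  have st : s < t by rewrite lt_min lt ltrDl divr_gt0.
  have ts2 : t <= s2 by rewrite ge_min lexx.
  have kt := above t st ts2; have ct := cm s t s1s (ltW st) ts2.
  suff : K * (t - s) <= e.
    by have -> : k s = c s + K * s by []; move: kt; have -> : k t = c t + K * t by []; lra.
  have ts : t - s <= e / (`|K| + 1) by rewrite lerBlDl ge_min lexx orbT.
  have ts0 : 0 <= t - s by rewrite subr_ge0 ltW.
  apply: (@le_trans _ _ ((`|K| + 1) * (t - s))).
    by rewrite ler_wpM2r// (le_trans (ler_norm K))// lerDl.
  by rewrite -ler_pdivlMl// mulrC.
have [E|ne] := eqVneq s s1; first by move: k12; rewrite ltNge -E ks.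
have lt1 : s1 < s by rewrite lt_neqAle eq_sym ne.
have [d d0 dH] := left s (introT andP (conj lt1 ss2)).
pose t := Num.max s1 (s - d / 2).
have ts : t < s by rewrite gt_max lt1 /=; lra.
have St : S t.
  split; first by rewrite le_max lexx /= (le_trans (ltW ts)).
  move=> r /andP[tr rs2]; have [rs|sr|->//] := ltgtP r s; last exact: above.
  apply: (le_trans ks); apply/ltW/dH => //; first by rewrite (le_trans _ tr)// le_max lexx.
  by rewrite (lt_le_trans _ tr)// lt_max; apply/orP; right; lra.
by have := ge_inf lS St; rewrite leNgt ts.
Qed.

End StruweSelection.

Section Minimax.
Context {R : realType} {X Y : topologicalType}.
Variables (X0 : set X) (D : set Y) (Gam : set (Y -> X)) (B g : X -> R).

Definition action_at (s : R) (u : X) : R := B u - s * g u.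
Local Notation F := action_at.

(* Moves replace the flow of the negative gradient: they preserve the class of maps [Gam] and the
   action never increases along them. *)
Definition admissible_move s (Phi : X -> X) :=
  [/\ continuous Phi, forall u, X0 u -> X0 (Phi u),
      forall u, Phi u = u \/ F s (Phi u) < F s u &
      forall gam, Gam gam -> Gam (Phi \o gam)].

Hypotheses (cB : continuous B) (cg : continuous g) (g0 : forall u, 0 <= g u).
Hypothesis cD : compact D.
Hypothesis GamP : forall gam, Gam gam -> continuous gam /\ forall y, X0 (gam y).

Lemma action_at_continuous s : continuous (F s).
Proof.
move=> u; apply: (@continuousB _ _ _ B (fun u => s * g u)) => //; first exact: cB.
by apply: (@continuousM R X (cst s) g); [exact: cst_continuous|exact: cg].
Qed.

Lemma move_le s Phi u : admissible_move s Phi -> F s (Phi u) <= F s u.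
Proof. by move=> [_ _ H _]; case: (H u) => [->//|/ltW]. Qed.

Lemma admissible_move_id s : admissible_move s id.
Proof. by split=> // u; [exact: cvg_id|left]. Qed.

Lemma admissible_move_comp s Phi Psi : admissible_move s Phi -> admissible_move s Psi ->
  admissible_move s (Phi \o Psi).
Proof.
move=> mPhi mPsi; have [c1 x1 m1 G1] := mPhi; have [c2 x2 m2 G2] := mPsi; split=> [u|u /x2/x1//|u|gam /G2/G1//].
  by apply: continuous_comp; [exact: c2|exact: c1].
rewrite /=; have [->|lt2] := m2 u; first exact: m1.
right; exact: le_lt_trans (move_le _ mPhi) lt2.
Qed.

(** A move that lowers the action at [u] lowers it near [u], so finitely many moves serve for [K].
    Their composite still does, because each move either fixes a point or strictly lowers its
    action. *)
Lemma move_compact s (K : set X) : compact K ->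
  (forall u, K u -> exists2 Phi, admissible_move s Phi & F s (Phi u) < F s u) ->
  exists2 Phi, admissible_move s Phi & forall u, K u -> F s (Phi u) < F s u.
Proof.
move=> cK H.
have /choice[Phi PhiP] : forall u, exists Phi, admissible_move s Phi /\ (K u -> F s (Phi u) < F s u).
  move=> u; have [/H[Phi m lt]|nK] := pselect (K u); first by exists Phi.
  by exists id; split=> //; exact: admissible_move_id.
have [|l [_ cov]] := compact_finite_cover (f := fun u => [set v | F s (Phi u v) < F s v]) cK.
  move=> u Ku; apply: open_nbhs_nbhs; split; last exact: (PhiP u).2.
  have c : continuous (fun v => F s v - F s (Phi u v)).
    move=> v; apply: (@continuousB _ _ _ (F s) (F s \o Phi u)); first exact: action_at_continuous.
    apply: continuous_comp; [by have [[cP _ _ _] _] := PhiP u; exact: cP|exact: action_at_continuous].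
  rewrite (_ : [set v | _] = (fun v => F s v - F s (Phi u v)) @^-1` [set t | 0 < t]).
    by apply: (proj1 (continuousP _) c); exact: open_gt.
  by apply/seteqP; split=> v /=; rewrite subr_gt0.
pose Psi := foldr (fun u P => Phi u \o P) id l.
have mPsi : admissible_move s Psi.
  rewrite /Psi; elim: l {cov Psi} => [|u l IH] /=; first exact: admissible_move_id.
  by apply: admissible_move_comp IH; have [] := PhiP u.
exists Psi => // u Ku; have [v vl lt] := cov u Ku.
rewrite /Psi; elim: l vl {cov Psi mPsi} => [//|w l IH]; rewrite inE.
have mo l' : admissible_move s (foldr (fun u P => Phi u \o P) id l').
  elim: l' => [|z l' IH'] /=; first exact: admissible_move_id.
  by apply: admissible_move_comp IH'; have [] := PhiP z.
have le1 := move_le (foldr (fun u P => Phi u \o P) id l u) (PhiP w).1.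
move=> /orP[/eqP E|/IH lt']; last by rewrite /=; exact: le_lt_trans le1 lt'.
rewrite /=; have [_ _ /(_ u) [->|lt'] _] := mo l; first by rewrite -E.
exact: le_lt_trans le1 lt'.
Qed.

Variables (s1 s2 A C eps : R).
Hypotheses (s12 : s1 < s2) (eps0 : 0 < eps) (s10 : 0 <= s1).
Hypothesis link : forall gam, Gam gam -> exists2 y, D y & A <= B (gam y) /\ g (gam y) = 0.
Hypothesis start : exists2 gam, Gam gam & forall y, D y -> F s1 (gam y) <= C.

(** The minimax value lies between A and C on [s1, s2], so its mean decrease there is below [K]; the
    added 1 makes this strict. *)
Let K := (C - A + 1) / (s2 - s1).
Hypothesis sublevel_compact : forall s, s1 <= s <= s2 ->
  compact [set u | [/\ X0 u, g u <= K + 2 & A - eps <= F s u]].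

Let level s := [set a | exists2 gam, Gam gam & forall y, D y -> F s (gam y) <= a].
Let c s := inf (level s).

(* Struwe's monotonicity trick: where the minimax value has left slopes bounded by [K], the almost
   maximal points on almost optimal maps have [g] bounded, hence lie in a compact set; if every
   point of it could be moved down, a finite composition of moves would lower the minimax value. *)
Lemma minimax_critical : exists s u, [/\ s1 <= s <= s2, X0 u, g u <= K + 2, A - eps <= F s u &
  forall Phi, admissible_move s Phi -> F s u <= F s (Phi u)].
Proof.
have Fs s t u : s <= t -> F t u <= F s u.
  by move=> st; rewrite lerD2l lerN2 ler_wpM2r.
have lb s a : level s a -> A <= a.
  move=> [gam Gg H]; have [y Dy [Ay gy]] := link Gg; apply: le_trans (H y Dy).
  by rewrite /F gy mulr0 subr0.
have lev s t a : s <= t -> level s a -> level t a.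
  by move=> st [gam Gg H]; exists gam => // y Dy; exact: le_trans (Fs _ _ _ st) (H y Dy).
have levC s : s1 <= s -> level s C.
  by move=> ss; apply: (lev s1) => //; have [gam Gg H] := start; exists gam.
have hlb s : has_lbound (level s) by exists A => a; exact: lb.
have cA s : s1 <= s -> A <= c s.
  by move=> ss; apply: lb_le_inf; [exists C; exact: levC|exact: lb].
have cm s t : s1 <= s -> s <= t -> t <= s2 -> c t <= c s.
  move=> ss st _; apply: lb_le_inf; first by exists C; exact: levC.
  by move=> a /(lev _ _ _ st) /(ge_inf (hlb t)).
have d0 : 0 < s2 - s1 by rewrite subr_gt0.
have cK : c s1 - c s2 < K * (s2 - s1).
  rewrite /K divfK ?gt_eqF//.
  have := cA s2 (ltW s12); have : c s1 <= C by apply: ge_inf => //; exact: levC.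
  lra.
have [s /andP[s1s ss2] near_s] := struwe_selection s12 cm cK.
have s1s' := ltW s1s.
apply: contrapT => ncrit.
pose Kset := [set u | [/\ X0 u, g u <= K + 2 & A - eps <= F s u]].
have cKs : compact Kset by apply: sublevel_compact; rewrite s1s' ss2.
have [|Phi mPhi PhiK] := move_compact (s := s) cKs.
  move=> u [Xu gu Au]; apply: contrapT => nm; apply: ncrit; exists s, u; split=> //.
    by rewrite s1s' ss2.
  by move=> Phi m; rewrite leNgt; apply/negP => lt; apply: nm; exists Phi.
have [eta eta0 etaK] : exists2 eta, 0 < eta & forall u, Kset u -> F s (Phi u) <= F s u - eta.
  have [E|/set0P[u0 Ku0]] := eqVneq Kset set0; first by exists 1 => // u; rewrite E.
  have cPhi : continuous Phi by have [] := mPhi.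
  have cc : continuous (fun v => F s v - F s (Phi v)).
    move=> v; apply: (@continuousB _ _ _ (F s) (F s \o Phi)); first exact: action_at_continuous.
    by apply: continuous_comp; [exact: cPhi|exact: action_at_continuous].
  have [||v] := @compact_EVT_min X R (fun v => F s v - F s (Phi v)) Kset _ cKs.
  - by exists u0.
  - exact: continuous_subspaceT.
  move=> /set_mem Kv H; exists (F s v - F s (Phi v)); first by rewrite subr_gt0; exact: PhiK.
  by move=> u Ku; have := H u (mem_set Ku); lra.
(* A step h < d satisfies h < eps and (K + 2) h < eta. Since c t <= c s + K h, and the map below is
   optimal at [t] up to [h], its values at [t] are below c s + (K + 1) h. *)
pose d := Num.min (Num.min 1 eps) (eta / (`|K| + 3)).
have K3 : 0 < `|K| + 3 by rewrite ltr_wpDl.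
have dpos : 0 < d by rewrite !lt_min ltr01 eps0 divr_gt0.
have [t [s1t dt ts ct]] := near_s d dpos.
pose h := s - t; have h0 : 0 < h by rewrite subr_gt0.
have hd : h < d by rewrite /h; lra.
have he : h < eps by rewrite (lt_le_trans hd)// !ge_min lexx orbT.
have hK : (K + 2) * h < eta.
  have h1 : h < eta / (`|K| + 3) by rewrite (lt_le_trans hd)// !ge_min lexx orbT.
  rewrite ltr_pdivlMr// in h1; apply: le_lt_trans h1; rewrite mulrC.
  by apply: ler_wpM2l; [exact: ltW|apply: lerD; [exact: ler_norm|rewrite ler_nat]].
have hasinf : has_inf (level t) by split; [exists C; exact: levC|exact: hlb].
have [a [gam Gg Ha] ac] := inf_adherent h0 hasinf.
have ac' : a < c s + (K + 1) * h.
  have e1 : c t <= c s + K * h by move: ct; rewrite /h; lra.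
  by have : a < c t + h by []; lra.
have : level s (c s - h / 2).
  exists (Phi \o gam); first by have [_ _ _] := mPhi; apply.
  move=> y Dy /=; have [cgam Xgam] := GamP Gg.
  (* On [Kset] the move gains [eta]. Off it, either [g] exceeds K + 2, and passing from [t] to [s]
     gains more than (K + 2) h, or the action is already below A - eps, hence below c s - h. In all
     cases it ends below c s - h / 2. *)
  have Ft := Ha y Dy; have [Ky|nK] := pselect (Kset (gam y)).
    have := etaK _ Ky; have := Fs _ _ (gam y) (ltW ts); nra.
  apply: (le_trans (move_le (gam y) mPhi)).
  have [gK|gK] := leP (g (gam y)) (K + 2); last first.
    have -> : F s (gam y) = F t (gam y) - h * g (gam y) by rewrite /F /h; ring.
    nra.
  have [AF|AF] := leP (A - eps) (F s (gam y)); first by exfalso; apply: nK; split.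
  have := cA s s1s'; lra.
move=> /(ge_inf (hlb s)); rewrite -/(c s); lra.
Qed.

End Minimax.

(** * Orthogonal projections *)

Section MatrixLimits.
Context {R : realType} {T : Type} {F : set_system T} {FF : Filter F}.

Lemma sum_cvg (I : Type) (r : seq I) (P : pred I) (f : I -> T -> R) (l : I -> R) :
  (forall i, P i -> f i t @[t --> F] --> l i) ->
  \sum_(i <- r | P i) f i t @[t --> F] --> \sum_(i <- r | P i) l i.
Proof.
move=> H; elim: r => [|i r IH].
  by rewrite big_nil; under eq_fun do rewrite big_nil; exact: cvg_cst.
rewrite big_cons; under eq_fun do rewrite big_cons.
by case: ifP => // Pi; apply: cvgD => //; exact: H.
Qed.

Lemma mx_cvg m k (A : T -> 'M[R]_(m, k)) (A0 : 'M[R]_(m, k)) :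
  (forall i j, A t i j @[t --> F] --> A0 i j) -> A t @[t --> F] --> A0.
Proof.
move=> H; apply/cvgrPdist_le => e e0.
have : \forall t \near F, forall ij : 'I_m * 'I_k, `|A0 ij.1 ij.2 - A t ij.1 ij.2| <= e.
  apply: filter_forall => -[i j] /=; have := H i j; move/cvgrPdist_le; exact.
apply: filterS => t h; apply: mx_norm_le => [|i j]; first exact: ltW.
by rewrite !mxE; exact: h (i, j).
Qed.

Lemma mx_entry_cvg m k (A : T -> 'M[R]_(m, k)) (A0 : 'M[R]_(m, k)) i j :
  A t @[t --> F] --> A0 -> A t i j @[t --> F] --> A0 i j.
Proof.
move=> H; exact: (@cvg_comp _ _ _ A (fun M : 'M[R]_(m, k) => M i j) _ _ _ H (@coord_continuous R m k i j A0)).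
Qed.

Lemma mulmx_cvg m k l (A : T -> 'M[R]_(m, k)) (B : T -> 'M[R]_(k, l)) (A0 : 'M[R]_(m, k)) (B0 : 'M[R]_(k, l)) :
  A t @[t --> F] --> A0 -> B t @[t --> F] --> B0 -> A t *m B t @[t --> F] --> A0 *m B0.
Proof.
move=> HA HB; apply: mx_cvg => i j; rewrite mxE; under eq_fun do rewrite mxE.
by apply: sum_cvg => c _; apply: cvgM; exact: mx_entry_cvg.
Qed.

Lemma trmx_cvg m k (A : T -> 'M[R]_(m, k)) (A0 : 'M[R]_(m, k)) : A t @[t --> F] --> A0 -> (A t)^T @[t --> F] --> A0^T.
Proof. by move=> HA; apply: mx_cvg => i j; rewrite mxE; under eq_fun do rewrite mxE; exact: mx_entry_cvg. Qed.

Lemma pairing_cvg m (a b : T -> 'rV[R]_m) (a0 b0 : 'rV[R]_m) : a t @[t --> F] --> a0 -> b t @[t --> F] --> b0 ->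
  pairing (a t) (b t) @[t --> F] --> pairing a0 b0.
Proof. by move=> Ha Hb; apply: sum_cvg => c _; apply: cvgM; exact: mx_entry_cvg. Qed.

End MatrixLimits.

Lemma pairingE (R : realType) m (a b : 'rV[R]_m) : pairing a b = (a *m b^T) ord0 ord0.
Proof. by rewrite mxE; apply: eq_bigr => k _; rewrite mxE. Qed.

Section Pairing.
Context {R : realType} {m : nat}.
Implicit Types (a b c : 'rV[R]_m).

Lemma pairingC a b : pairing a b = pairing b a.
Proof. by apply: eq_bigr => k _; rewrite mulrC. Qed.

Lemma pairing_mulmx k (a : 'rV[R]_k) (b : 'rV[R]_m) (A : 'M[R]_(k, m)) :
  pairing (a *m A) b = pairing a (b *m A^T).
Proof. by rewrite !pairingE trmx_mul trmxK mulmxA. Qed.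

Lemma pairingDl a b c : pairing (a + b) c = pairing a c + pairing b c.
Proof. by rewrite !pairingE mulmxDl mxE. Qed.

Lemma pairingNl a c : pairing (- a) c = - pairing a c.
Proof. by rewrite !pairingE mulNmx mxE. Qed.

Lemma pairingBl a b c : pairing (a - b) c = pairing a c - pairing b c.
Proof. by rewrite pairingDl pairingNl. Qed.

Lemma pairingZl s a c : pairing (s *: a) c = s * pairing a c.
Proof. by rewrite !pairingE -scalemxAl mxE. Qed.

Lemma pairingDr a b c : pairing c (a + b) = pairing c a + pairing c b.
Proof. by rewrite ![pairing c _]pairingC pairingDl. Qed.

Lemma pairingBr a b c : pairing c (a - b) = pairing c a - pairing c b.
Proof. by rewrite ![pairing c _]pairingC pairingBl. Qed.

Lemma pairingZr s a c : pairing c (s *: a) = s * pairing c a.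
Proof. by rewrite ![pairing c _]pairingC pairingZl. Qed.

Lemma pairing0l c : pairing 0 c = 0 :> R.
Proof. by rewrite pairingE mul0mx mxE. Qed.

Lemma pairing0r c : pairing c 0 = 0 :> R.
Proof. by rewrite pairingC pairing0l. Qed.

Lemma pairing_delta a k : pairing a (delta_mx ord0 k) = a ord0 k.
Proof.
rewrite /pairing (bigD1 k)//= mxE !eqxx mulr1 big1 ?addr0// => j /negbTE jk.
by rewrite mxE eqxx jk mulr0.
Qed.

Lemma pairing_ge0 a : 0 <= pairing a a.
Proof. by apply: sumr_ge0 => k _; rewrite -expr2 sqr_ge0. Qed.

Lemma pairing_eq0 a : pairing a a = 0 -> a = 0.
Proof.
move=> /eqP; rewrite psumr_eq0 => [/allP H|k _]; last by rewrite -expr2 sqr_ge0.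
apply/rowP => k; have := H k (mem_index_enum k); rewrite -expr2 sqrf_eq0 mxE.
by move=> /eqP.
Qed.

Lemma pairing_inj a b : (forall c, pairing a c = pairing b c) -> a = b.
Proof.
move=> H; apply/subr0_eq/pairing_eq0; rewrite pairingBl H subrr //.
Qed.

Lemma pairing_norm_le a b : `|pairing a b| <= m%:R * (`|a| * `|b|).
Proof.
apply: (le_trans (ler_norm_sum _ _ _)).
apply: (@le_trans _ _ (\sum_(i < m) (`|a| * `|b|))).
  by apply: ler_sum => i _; rewrite normrM ler_pM//; exact: mx_entry_le.
by rewrite sumr_const card_ord mulr_natl.
Qed.

End Pairing.

Section OrthogonalProjection.
Context {R : realType} {n K : nat} (D : 'M[R]_(n, K)).
Hypothesis freeD : forall v : 'rV[R]_n, v *m D = 0 -> v = 0.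

Definition gram := D *m D^T.
(** For [D] with independent rows, the orthogonal projection onto its row space, acting on row
    vectors from the right. *)
Definition rowproj := D^T *m invmx gram *m D.

Lemma gram_unit : gram \in unitmx.
Proof.
rewrite -row_free_unit; apply: inj_row_free => v; rewrite /gram mulmxA => H.
apply: freeD; apply: pairing_eq0; rewrite pairing_mulmx [_ *m D *m _]H.
exact: pairing0r.
Qed.

Lemma gram_sym : gram^T = gram.
Proof. by rewrite /gram trmx_mul trmxK. Qed.

Lemma rowproj_sym : rowproj^T = rowproj.
Proof. by rewrite /rowproj !trmx_mul trmxK trmx_inv gram_sym mulmxA. Qed.

Lemma mul_rowproj : D *m rowproj = D.
Proof. by rewrite /rowproj !mulmxA -/gram mulmxV ?gram_unit// mul1mx. Qed.

Lemma rowproj_idem : rowproj *m rowproj = rowproj.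
Proof. by rewrite {1}/rowproj -mulmxA mul_rowproj. Qed.

End OrthogonalProjection.

(** Matrices with the same row space have the same projection: P' P = P' and P P' = P, and
    transposing one of these identities, P and P' being symmetric, identifies them. *)
Lemma rowproj_eq (R : realType) n K (D D' : 'M[R]_(n, K)) (J J' : 'M[R]_n) :
  (forall v : 'rV[R]_n, v *m D = 0 -> v = 0) -> (forall v : 'rV[R]_n, v *m D' = 0 -> v = 0) ->
  D = J *m D' -> D' = J' *m D -> rowproj D = rowproj D'.
Proof.
move=> fD fD' DJ DJ'.
have H1 : rowproj D' *m rowproj D = rowproj D'.
  have E : D' *m rowproj D = D' by rewrite {1}DJ' -mulmxA mul_rowproj// -DJ'.
  by rewrite {1}/rowproj -mulmxA E.
have H2 : rowproj D *m rowproj D' = rowproj D.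
  have E : D *m rowproj D' = D by rewrite {1}DJ -mulmxA mul_rowproj// -DJ.
  by rewrite {1}/rowproj -mulmxA E.
by rewrite -H2 -[in LHS](rowproj_sym D) -[in LHS](rowproj_sym D') -trmx_mul H1 rowproj_sym.
Qed.

Section CkMatrix.
Context {R : realType} {V : normedModType R}.
Implicit Types (U : set V).

Lemma Ck_on_det k m U (A : V -> 'M[R]_m) : open U -> (forall i j, Ck_on k U (fun x => A x i j)) ->
  Ck_on k U (fun x => \det (A x)).
Proof.
move=> oU CA; apply: Ck_on_sum => // s _; apply: Ck_onM => //; first exact: Ck_on_cst.
by apply: Ck_on_prod.
Qed.

Lemma Ck_on_inv k m U (A : V -> 'M[R]_m) : open U -> (forall x, U x -> A x \in unitmx) ->
  (forall i j, Ck_on k U (fun x => A x i j)) -> forall i j, Ck_on k U (fun x => invmx (A x) i j).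
Proof.
move=> oU uA CA i j.
have H : Ck_on k U (fun x => (\det (A x))^-1 * cofactor (A x) j i).
  apply: Ck_onM => //.
    apply: Ck_onV => //; last exact: Ck_on_det.
    by move=> x /uA; rewrite unitmxE unitfE.
  apply: Ck_onM => //; first exact: Ck_on_cst.
  apply: Ck_on_det => // a b; under eq_fun do rewrite !mxE; exact: CA.
apply: (Ck_on_ext oU _ H) => x /uA Ux.
by rewrite /invmx Ux !mxE.
Qed.

Lemma Ck_on_mulmx k m l r U (A : V -> 'M[R]_(m, l)) (B : V -> 'M[R]_(l, r)) : open U ->
  (forall i j, Ck_on k U (fun x => A x i j)) -> (forall i j, Ck_on k U (fun x => B x i j)) ->
  forall i j, Ck_on k U (fun x => (A x *m B x) i j).
Proof.
move=> oU CA CB i j; under eq_fun do rewrite mxE.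
by apply: Ck_on_sum => // c _; apply: Ck_onM.
Qed.

Lemma Ck_on_rowproj k m r U (A : V -> 'M[R]_(m, r)) : open U ->
  (forall x, U x -> forall v : 'rV[R]_m, v *m A x = 0 -> v = 0) ->
  (forall i j, Ck_on k U (fun x => A x i j)) -> forall i j, Ck_on k U (fun x => rowproj (A x) i j).
Proof.
move=> oU fA CA; have CT i j : Ck_on k U (fun x => (A x)^T i j).
  by under eq_fun do rewrite mxE; exact: CA.
apply: (@Ck_on_mulmx k _ _ _ U (fun x => (A x)^T *m invmx (gram (A x))) A) => //.
apply: Ck_on_mulmx => //; apply: Ck_on_inv => //.
  by move=> x /fA; exact: gram_unit.
exact: Ck_on_mulmx.
Qed.

End CkMatrix.

(** * The cotangent bundle of an embedded manifold *)

Lemma pair_cvg (T : Type) (U V : topologicalType) (F : set_system T) (f : T -> U) (g : T -> V) (a : U) (b : V) :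
  Filter F -> f t @[t --> F] --> a -> g t @[t --> F] --> b -> (f t, g t) @[t --> F] --> (a, b).
Proof. by move=> FF Hf Hg; exact: (cvg_pair Hf Hg). Qed.

Section Geometry.
Context {R : realType} {n : nat} {M : topologicalType} {SM : smooth_manifold R n M}.
Context {K : nat} {e : M -> 'rV[R]_K}.
Local Notation dom := (@chart_dom _ _ SM).
Local Notation phi := (@chart_coord _ _ SM).
Hypotheses (Ce : CkM SM 2 e)
  (imm : forall i x v, dom i x -> 'D_v (in_chart i e) (phi i x) = 0 -> v = 0).

Implicit Types (i j : chart SM).

Definition dE (i : chart SM) (xi : 'rV[R]_n) : 'M[R]_(n, K) :=
  \matrix_(k, j) ('D_(delta_mx ord0 k) (in_chart i e) xi) ord0 j.

Lemma e_diff i xi : img i xi -> differentiable (in_chart i e) xi.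
Proof. exact: Ck_diff (Ce i). Qed.

Lemma dE_mul i xi v : img i xi -> v *m dE i xi = 'D_v (in_chart i e) xi.
Proof.
move=> ixi; rewrite (derive_rV_sum _ (e_diff ixi)); apply/rowP => j.
rewrite !mxE summxE; apply: eq_bigr => k _; by rewrite !mxE.
Qed.

Lemma dE_Ck i (k : 'I_n) (j : 'I_K) : Ck_on 1 (img i) (fun xi => dE i xi k j).
Proof.
under eq_fun do rewrite mxE.
exact: (Ck_on_rVP 1 (fun xi => 'D_(delta_mx ord0 k) (in_chart i e) xi) (chart_img_open i)).1
  (Ck_der _ (Ce i)) j.
Qed.

Lemma dE_free i x (v : 'rV[R]_n) : dom i x -> v *m dE i (phi i x) = 0 -> v = 0.
Proof. by move=> dx; rewrite dE_mul; [exact: imm|exact: chart_imgP]. Qed.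

Lemma dE_free' i xi : img i xi -> forall v : 'rV[R]_n, v *m dE i xi = 0 -> v = 0.
Proof. by move=> [x dx <-] v; exact: dE_free. Qed.

Definition chart_jac (i j : chart SM) (xi : 'rV[R]_n) : 'M[R]_n :=
  \matrix_(k, l) ('D_(delta_mx ord0 k) (transition i j) xi) ord0 l.

Lemma chart_jac_mul i j x v : dom i x -> dom j x ->
  v *m chart_jac i j (phi i x) = 'D_v (transition i j) (phi i x).
Proof.
move=> di dj; rewrite (derive_rV_sum _ (transition_diff di dj)); apply/rowP => l.
rewrite !mxE summxE; apply: eq_bigr => k _; by rewrite !mxE.
Qed.

Lemma dE_change i j x : dom i x -> dom j x ->
  dE i (phi i x) = chart_jac i j (phi i x) *m dE j (phi j x).
Proof.
move=> di dj; apply/row_matrixP => k; rewrite !rowE mulmxA (chart_jac_mul _ di dj).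
rewrite !dE_mul; try exact: chart_imgP.
by rewrite (derive_transition _ di dj)//; apply: e_diff; exact: chart_imgP.
Qed.

Definition some_chart (x : M) : chart SM := projT1 (cid (manifold_cover SM x)).

Lemma some_chartP x : dom (some_chart x) x.
Proof. exact: projT2 (cid (manifold_cover SM x)). Qed.

(** The orthogonal projection of R^K onto the tangent space of e(M) at e(x); the choice of chart is
    immaterial by [PmE]. *)
Definition Pm (x : M) : 'M[R]_K := rowproj (dE (some_chart x) (phi (some_chart x) x)).

Lemma PmE i x : dom i x -> Pm x = rowproj (dE i (phi i x)).
Proof.
move=> dx; have dx' := some_chartP x.
by apply: rowproj_eq; [move=> v; exact: dE_free|move=> v; exact: dE_free|exact: dE_change|exact: dE_change].
Qed.

Lemma Pm_sym x : (Pm x)^T = Pm x.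
Proof. exact: rowproj_sym. Qed.

Lemma Pm_idem x : Pm x *m Pm x = Pm x.
Proof. by apply: rowproj_idem => v; apply: dE_free; exact: some_chartP. Qed.

Lemma dE_Pm i x : dom i x -> dE i (phi i x) *m Pm x = dE i (phi i x).
Proof. by move=> dx; rewrite (PmE dx); apply: mul_rowproj => v; exact: dE_free. Qed.

Lemma Pm_dE i x : dom i x -> Pm x *m (dE i (phi i x))^T = (dE i (phi i x))^T.
Proof. by move=> dx; rewrite -{1}Pm_sym -trmx_mul dE_Pm. Qed.

Lemma Pm_Ck a b : CkM SM 1 (fun x => Pm x a b).
Proof.
move=> i; have H := Ck_on_rowproj (chart_img_open i) (@dE_free' i) (@dE_Ck i) a b.
apply: (Ck_on_ext (chart_img_open i) _ H) => _ [x dx <-].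
by rewrite (in_chartE _ dx) (PmE dx).
Qed.

Lemma Pm_cvg x : Pm y @[y --> x] --> Pm x.
Proof.
apply: (@mx_cvg R _ (nbhs x) (nbhs_filter x)) => a b.
have H0 : CkM SM 1 (fun x => Pm x a b) := @Pm_Ck a b.
have H1 := CkM_continuous H0; exact (H1 x).
Qed.

Lemma dE_cvg i xi : img i xi -> dE i eta @[eta --> xi] --> dE i xi.
Proof.
move=> ixi; apply: (@mx_cvg R _ (nbhs xi) (nbhs_filter xi)) => a b.
exact: (Ck_on_le (leq0n 1) (dE_Ck i a b)).
Qed.

(* The covector at [x] given by p \o de_x, that is, [x, de_x^* p]. *)
Definition cov_components (x : M) (p : 'rV[R]_K) (i : chart SM) : 'rV[R]_n :=
  if pselect (dom i x) then p *m (dE i (phi i x))^T else 0.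

Lemma cov_componentsE x p i : dom i x -> cov_components x p i = p *m (dE i (phi i x))^T.
Proof. by rewrite /cov_components; case: pselect. Qed.

Lemma cov_change x p i j : dom i x -> dom j x -> forall v : 'rV[R]_n,
  pairing (cov_components x p i) v = pairing (cov_components x p j)
    ('D_v (in_chart i (phi j)) (phi i x)).
Proof.
have H i' w : dom i' x -> pairing (cov_components x p i') w = pairing p (w *m dE i' (phi i' x)).
  by move=> d; rewrite (cov_componentsE p d) pairing_mulmx trmxK.
move=> di dj v; rewrite (H _ _ di) (H _ _ dj).
rewrite dE_mul; last exact: chart_imgP.
rewrite (derive_transition v di dj); last by apply: e_diff; exact: chart_imgP.
by rewrite dE_mul//; exact: chart_imgP.
Qed.

Lemma cov_out x p i : ~ dom i x -> cov_components x p i = 0.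
Proof. by rewrite /cov_components; case: pselect. Qed.

Definition cov (x : M) (p : 'rV[R]_K) : cotangent SM := Cotangent (@cov_change x p) (@cov_out x p).

Lemma cotangent_eq (z z' : cotangent SM) : base z = base z' ->
  (forall i, components z i = components z' i) -> z = z'.
Proof.
case: z z' => [b c h1 h2] [b' c' h1' h2'] /= eb; case: _ / eb h1' h2' => h1' h2' /funext ec.
case: _ / ec h1' h2' => h1' h2'.
by rewrite (Prop_irrelevance h1 h1') (Prop_irrelevance h2 h2').
Qed.

Lemma cov_comp i x p : dom i x -> components (cov x p) i = p *m (dE i (phi i x))^T.
Proof. exact: cov_componentsE. Qed.

Lemma cov_proj x p : cov x (p *m Pm x) = cov x p.
Proof.
apply: cotangent_eq => // i; have [dx|ndx] := pselect (dom i x).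
  by rewrite !cov_comp// -mulmxA Pm_dE.
by rewrite !components_out.
Qed.

Lemma cov0 x : cov x 0 = zero_section SM x.
Proof.
apply: cotangent_eq => // i /=; rewrite /cov_components; case: pselect => // dx.
by rewrite mul0mx.
Qed.

(** With D the differential of [e] in a chart and G = D D^T, the covector of components y is
    represented by the momentum y G^-1 D. *)
Lemma cot_lift (z : cotangent SM) : exists p, z = cov (base z) p.
Proof.
have dx := some_chartP (base z); set i := some_chart (base z) in dx.
pose D := dE i (phi i (base z)).
exists (components z i *m invmx (gram D) *m D).
apply: cotangent_eq => // j; have [dj|ndj] := pselect (dom j (base z)); last first.
  by rewrite (components_out ndj) /= cov_out.
rewrite cov_comp//; apply: pairing_inj => v.
rewrite (components_change dj dx) pairing_mulmx trmxK dE_mul; last exact: chart_imgP.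
rewrite (derive_transition (h := e) v dj dx); last by apply: e_diff; exact: chart_imgP.
rewrite -dE_mul; last exact: chart_imgP.
rewrite -[X in pairing _ (_ *m X)]trmxK -pairing_mulmx -!mulmxA -/D -/(gram D) mulVmx ?mulmx1//.
by apply: gram_unit => w; exact: dE_free.
Qed.

(** The tangential representative of a covector, independent of the lift by [ellE]. It is inverse to
    [cov] on tangential momenta and measures the size of a covector. *)
Definition ell (z : cotangent SM) : 'rV[R]_K := projT1 (cid (cot_lift z)) *m Pm (base z).

Lemma cov_ell z : cov (base z) (ell z) = z.
Proof. by rewrite /ell cov_proj; exact: (esym (projT2 (cid (cot_lift z)))). Qed.

Lemma ellE i z : dom i (base z) -> ell z =
  components z i *m invmx (gram (dE i (phi i (base z)))) *m dE i (phi i (base z)).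
Proof.
move=> dx; have := projT2 (cid (cot_lift z)); rewrite /ell; set p := projT1 _ => E.
have -> : components z i = p *m (dE i (phi i (base z)))^T by rewrite [in LHS]E cov_comp.
by rewrite (PmE dx) /rowproj !mulmxA.
Qed.

Lemma ell_cov x p : ell (cov x p) = p *m Pm x.
Proof.
have dx := some_chartP x.
rewrite (@ellE (some_chart x) (cov x p) dx) cov_comp//= /Pm /rowproj.
by rewrite !mulmxA.
Qed.

Lemma cov_cvg (T : Type) (F : set_system T) (x : T -> M) (p : T -> 'rV[R]_K) x0 (p0 : 'rV[R]_K) : Filter F ->
  x t @[t --> F] --> x0 -> p t @[t --> F] --> p0 -> cov (x t) (p t) @[t --> F] --> cov x0 p0.
Proof.
move=> FF xx pp A; rewrite nbhsE => -[B [oB Bz] BA].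
have dx := some_chartP x0; set i := some_chart x0 in dx.
have [A' oA' E] := oB i.
have ix := chart_imgP dx.
have cx : phi i (x t) @[t --> F] --> phi i x0.
  exact: (@cvg_comp _ _ _ x (phi i) F _ _ xx (chart_continuous dx)).
have cD : dE i (phi i (x t)) @[t --> F] --> dE i (phi i x0).
  exact: (@cvg_comp _ _ _ (fun t => phi i (x t)) (dE i) F _ _ cx (dE_cvg ix)).
have cc : (phi i (x t), p t *m (dE i (phi i (x t)))^T) @[t --> F] --> (phi i x0, p0 *m (dE i (phi i x0))^T).
  apply: (pair_cvg FF cx).
  by apply: mulmx_cvg => //; exact: trmx_cvg.
have : A' (phi i x0, p0 *m (dE i (phi i x0))^T).
  have : (B `&` @chart_dom _ _ (cotangent_atlas SM) i) (cov x0 p0) by [].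
  by rewrite E => -[_]; rewrite /= cov_componentsE.
move=> A'0; have nA : nbhs (phi i x0, p0 *m (dE i (phi i x0))^T) A' by apply: open_nbhs_nbhs.
have nd : \forall t \near F, dom i (x t) by apply: xx; exact: chart_nbhs.
have nA' : \forall t \near F, A' (phi i (x t), p t *m (dE i (phi i (x t)))^T) := cc _ nA.
rewrite /nbhs /=; near=> t; apply: BA.
have At : A' (phi i (x t), p t *m (dE i (phi i (x t)))^T) by near: t.
have dt : dom i (x t) by near: t.
suff : (B `&` @chart_dom _ _ (cotangent_atlas SM) i) (cov (x t) (p t)) by case.
by rewrite E; split=> //=; rewrite cov_componentsE.
Unshelve. all: by end_near. Qed.

Lemma cot_continuous (W : topologicalType) (h : cotangent SM -> W)
  (g : chart SM -> 'rV[R]_n * 'rV[R]_n -> W) :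
  (forall i z, dom i (base z) -> h z = g i (phi i (base z), components z i)) ->
  (forall i xi y, img i xi -> {for (xi, y), continuous (g i)}) -> continuous h.
Proof.
move=> hg cg; apply/continuousP => A oA; suff: cotangent_open (h @^-1` A) by [].
move=> i; pose Q := [set q : 'rV[R]_n * 'rV[R]_n | img i q.1 /\ A (g i q)].
exists Q; last first.
  apply/seteqP; split=> z /=.
    by move=> [Az dz]; split=> //; split; [exact: chart_imgP|rewrite -hg].
  by move=> [dz [_ gA]]; split=> //; rewrite (hg i).
rewrite openE => -[xi y] [/= ixi Ag]; apply: filterI.
  have : (\forall q \near (xi, y), img i q.1).
    have c : fst q @[q --> (xi, y)] --> xi by exact: cvg_fst.
    by apply: c; apply: open_nbhs_nbhs; split; [exact: chart_img_open|].
  exact.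
have := cg i xi y ixi; apply; exact: open_nbhs_nbhs.
Qed.

Lemma ell_continuous : continuous ell.
Proof.
apply: (@cot_continuous _ _ (fun i q => q.2 *m invmx (gram (dE i q.1)) *m dE i q.1)).
  by move=> i z dz; rewrite (ellE dz).
move=> i xi y ixi.
have c1 : fst q @[q --> (xi, y)] --> xi by exact: cvg_fst.
have c2 : snd q @[q --> (xi, y)] --> y by exact: cvg_snd.
have cD : dE i q.1 @[q --> (xi, y)] --> dE i xi.
  exact: (@cvg_comp _ _ _ (fun q : 'rV[R]_n * 'rV[R]_n => q.1) (dE i) _ _ _ c1 (dE_cvg ixi)).
apply: mulmx_cvg => //; apply: mulmx_cvg => //.
have CG a b : Ck_on 1 (img i) (fun xi => invmx (gram (dE i xi)) a b).
  apply: Ck_on_inv; [exact: chart_img_open|by move=> z iz; apply: gram_unit; exact: dE_free'|].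
  apply: Ck_on_mulmx; [exact: chart_img_open|exact: dE_Ck|].
  by move=> c d; under eq_fun do rewrite mxE; exact: dE_Ck.
have cG : invmx (gram (dE i eta)) @[eta --> xi] --> invmx (gram (dE i xi)).
  apply: (@mx_cvg R _ (nbhs xi) (nbhs_filter xi)) => a b; exact: (Ck_on_le (leq0n 1) (CG a b)).
exact: (@cvg_comp _ _ _ (fun q : 'rV[R]_n * 'rV[R]_n => q.1) (fun eta => invmx (gram (dE i eta))) _ _ _ c1 cG).
Qed.

Lemma base_continuous : continuous (@base R n M SM).
Proof.
apply/continuousP => A oA; suff: cotangent_open (@base R n M SM @^-1` A) by [].
move=> i; exists [set q | (phi i @` (dom i `&` A)) q.1].
  rewrite openE => -[xi y] /= H.
  have c : fst q @[q --> (xi, y)] --> xi by exact: cvg_fst.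
  apply: (c (phi i @` (dom i `&` A))).
  by apply: open_nbhs_nbhs; split; [exact: chart_img_openI|].
apply/seteqP; split=> z /=.
  by move=> [Az dz]; split=> //; exists (base z).
move=> [dz [y [dy Ay] exy]]; split=> //; congr A: Ay.
by apply: (manifold_chart_inj (mem_set dy) (mem_set dz)).
Qed.

Lemma cot_imgP (i : chart SM) xi y : img i xi ->
  (@chart_coord _ _ (cotangent_atlas SM) i @` @chart_dom _ _ (cotangent_atlas SM) i) (xi, y).
Proof.
move=> [x dx <-]; pose D := dE i (phi i x).
exists (cov x (y *m invmx (gram D) *m D)) => //=.
rewrite cov_componentsE// -!mulmxA -/D -/(gram D) mulVmx ?mulmx1//.
by apply: gram_unit => w; exact: dE_free.
Qed.

Lemma cot_img_open (i : chart SM) :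
  open (@chart_coord _ _ (cotangent_atlas SM) i @` @chart_dom _ _ (cotangent_atlas SM) i).
Proof.
rewrite openE => _ [z dz <-] /=.
have c : fst q @[q --> (phi i (base z), components z i)] --> phi i (base z) by exact: cvg_fst.
have : \forall q \near (phi i (base z), components z i), img i q.1.
  by apply: c; apply: open_nbhs_nbhs; split; [exact: chart_img_open|exact: chart_imgP].
by apply: filterS => -[xi y] ixi; exact: cot_imgP.
Qed.

Lemma cot_chart_inj (i : chart SM) (z z' : cotangent SM) : dom i (base z) -> dom i (base z') ->
  phi i (base z) = phi i (base z') -> components z i = components z' i -> z = z'.
Proof.
move=> dz dz' eb ec.
have bb : base z = base z' by apply: (manifold_chart_inj (mem_set dz) (mem_set dz')).
have el : ell z = ell z' by rewrite (ellE dz) (ellE dz') bb ec.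
by rewrite -[LHS]cov_ell -[RHS]cov_ell bb el.
Qed.

Lemma in_chart_cot (W : zmodType) (i : chart SM) (H : cotangent SM -> W) z : dom i (base z) ->
  @in_chart _ _ W (cotangent_atlas SM) i H (phi i (base z), components z i) = H z.
Proof.
move=> dz; pose z0 := (phi i (base z), components z i).
pose S := [set z' : cotangent SM | dom i (base z') /\ (phi i (base z'), components z' i) = z0].
pose Q : set W := [set H z' | z' in S].
have : Q (xget 0 Q).
  by apply: (xgetPex 0); exists (H z); exists z.
case=> z' [dz' [eb ec]] E.
have -> : @in_chart _ _ W (cotangent_atlas SM) i H z0 = xget 0 Q by exact (erefl (xget 0 Q)).
by rewrite -E; congr H; exact: cot_chart_inj dz' dz eb ec.
Qed.

End Geometry.

Lemma mulmx_norm_le (R : realType) m k l (A : 'M[R]_(m, k)) (B : 'M[R]_(k, l)) :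
  `|A *m B| <= k%:R * (`|A| * `|B|).
Proof.
apply: mx_norm_le => [|i j]; first by rewrite !mulr_ge0.
rewrite mxE (le_trans (ler_norm_sum _ _ _))//.
apply: (@le_trans _ _ (\sum_(c < k) (`|A| * `|B|))).
  by apply: ler_sum => c _; rewrite normrM ler_pM//; exact: mx_entry_le.
by rewrite sumr_const card_ord mulr_natl.
Qed.

Section C1Center.
Context {R : realType} {n : nat}.

Lemma C1_deriv_near K (D : set 'rV[R]_n) (f : 'rV[R]_n -> 'rV[R]_K) x e : open D -> Ck_on 1 D f -> D x -> 0 < e ->
  \forall y \near x, forall v, `|'D_v f x - 'D_v f y| <= e * `|v|.
Proof.
move=> oD C1 Dx e0; pose h := e / n.+1%:R.
have h0 : 0 < h by rewrite divr_gt0.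
have H : \forall y \near x, D y /\ forall i : 'I_n, `|'D_(delta_mx ord0 i) f x - 'D_(delta_mx ord0 i) f y| < h.
  apply: filterI; first exact: open_nbhs_nbhs.
  apply: (@near_ord 'rV[R]_n x n (fun i y =>
    is_true (`|'D_(delta_mx ord0 i) f x - 'D_(delta_mx ord0 i) f y| < h))) => i.
  have c : (fun y => 'D_(delta_mx ord0 i) f y) y @[y --> x] --> 'D_(delta_mx ord0 i) f x.
    exact: (Ck_der (delta_mx ord0 i) C1).
  by move/cvgrPdist_lt: c; exact.
apply: filterS H => y [Dy Hy] v.
rewrite (derive_rV_sum _ (Ck_diff C1 Dx)) (derive_rV_sum _ (Ck_diff C1 Dy)) -sumrB.
apply: (le_trans (ler_norm_sum _ _ _)).
apply: (@le_trans _ _ (\sum_(i < n) `|v| * h)).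
  apply: ler_sum => i _; rewrite -scalerBr normrZ ler_pM//; first exact: mx_entry_le.
  exact/ltW/Hy.
rewrite sumr_const card_ord -mulrnAr mulrC; apply: ler_wpM2r => //.
rewrite /h -[leLHS]mulr_natr -mulrA -[leRHS]mulr1 ler_pM2l// mulrC ler_pdivrMr ?mul1r//.
by rewrite ler_nat.
Qed.

Lemma C1_unif_center K (D : set 'rV[R]_n) (f : 'rV[R]_n -> 'rV[R]_K) x e : open D -> Ck_on 1 D f -> D x -> 0 < e ->
  \forall r \near 0^'+, ball x r `<=` D /\ forall y y', ball x r y -> ball x r y' ->
    `|f y' - f y - 'D_(y' - y) f x| <= e * `|y' - y|.
Proof.
move=> oD C1 Dx e0; have e20 : 0 < e / 2 by rewrite divr_gt0.
have [r0 /= r00 r0H] := (nbhs_ballP _ _).1 (C1_deriv_near oD C1 Dx e20).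
near=> r.
have [rD rH] : ball x r `<=` D /\ forall y y', ball x r y -> ball x r y' ->
    `|f y' - f y - 'D_(y' - y) f y| <= (e / 2) * `|y' - y|.
  by near: r; exact: C1_unif.
split=> // y y' xy xy'.
have h1 := rH _ _ xy xy'.
have h2 : `|'D_(y' - y) f x - 'D_(y' - y) f y| <= (e / 2) * `|y' - y|.
  by apply: r0H; apply: le_ball xy; near: r; exact: nbhs_right_le.
rewrite -(subrKA ('D_(y' - y) f y)) (le_trans (ler_normD _ _))//.
by rewrite [X in _ <= X * _](splitr e) mulrDl; apply: lerD; [exact: h1|rewrite distrC].
Unshelve. all: by end_near. Qed.

(** Near [x] the map differs from its linear part at [x] by a small multiple of the distance, and
    the linear part has the left inverse [Li]. *)
Lemma immersion_lip K (D : set 'rV[R]_n) (f : 'rV[R]_n -> 'rV[R]_K) x : open D -> Ck_on 1 D f -> D x ->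
  (forall v, 'D_v f x = 0 -> v = 0) ->
  exists2 C, 0 < C & \forall r \near 0^'+, ball x r `<=` D /\ forall y y', ball x r y -> ball x r y' ->
    `|f y' - f y| <= C * `|y' - y| /\ `|y' - y| <= C * `|f y' - f y|.
Proof.
move=> oD C1 Dx inj.
pose J : 'M[R]_(n, K) := \matrix_(k, j) ('D_(delta_mx ord0 k) f x) ord0 j.
have Jmul v : v *m J = 'D_v f x.
  rewrite (derive_rV_sum _ (Ck_diff C1 Dx)); apply/rowP => j.
  rewrite !mxE summxE; apply: eq_bigr => k _; by rewrite !mxE.
have freeJ (v : 'rV[R]_n) : v *m J = 0 -> v = 0 by rewrite Jmul; exact: inj.
pose Li := J^T *m invmx (gram J).
have JL : J *m Li = 1%:M by rewrite /Li mulmxA -/(gram J) mulmxV// gram_unit.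
pose c := K%:R * `|Li| + 1; have c0 : 0 < c by rewrite ltr_wpDl// mulr_ge0.
have [C C0 HC] := C1_lip oD C1 Dx.
(* With this accuracy the error, after multiplication by the bound [c] for the left inverse, is half
   of [|y' - y|] and can be absorbed. *)
have e0 : 0 < (2 * c)^-1 by rewrite invr_gt0 mulr_gt0.
exists (Num.max C (2 * c)); first by rewrite lt_max C0.
near=> r.
have [rD rH] : ball x r `<=` D /\ forall y y', ball x r y -> ball x r y' -> `|f y' - f y| <= C * `|y' - y|.
  by near: r.
split=> // y y' xy xy'; split.
  by rewrite (le_trans (rH _ _ xy xy'))// ler_wpM2r// le_max lexx.
have [_ rU] : ball x r `<=` D /\ forall y y', ball x r y -> ball x r y' ->
    `|f y' - f y - 'D_(y' - y) f x| <= (2 * c)^-1 * `|y' - y|.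
  by near: r; exact: C1_unif_center.
have h := rU _ _ xy xy'.
have ev : y' - y = 'D_(y' - y) f x *m Li by rewrite -Jmul -mulmxA JL mulmx1.
have h1 : `|y' - y| <= c * `|'D_(y' - y) f x|.
  rewrite {1}ev (le_trans (mulmx_norm_le _ _))// mulrCA mulrC ler_wpM2r//.
  by rewrite /c lerDl.
have h2 : `|'D_(y' - y) f x| <= `|f y' - f y| + (2 * c)^-1 * `|y' - y|.
  rewrite -[X in `|X| <= _](subKr (f y' - f y)) (le_trans (ler_normB _ _))// lerD//.
have h3 : c * `|'D_(y' - y) f x| <= c * `|f y' - f y| + `|y' - y| / 2.
  have -> : `|y' - y| / 2 = c * ((2 * c)^-1 * `|y' - y|) by field; rewrite gt_eqF.
  by rewrite -mulrDr ler_pM2l.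
apply: (@le_trans _ _ (2 * c * `|f y' - f y|)); first by lra.
by rewrite ler_wpM2r// le_max lexx orbT.
Unshelve. all: by end_near. Qed.

End C1Center.

Lemma compact_uniform_pos (R : realType) (T : topologicalType) (P : R -> T -> Prop) : compact [set: T] ->
  (forall x : T, \forall y \near x & d \near (0:R)^'+, P d y) -> exists2 d : R, 0 < d & forall y, P d y.
Proof.
move=> /compact_near_coveringP cT H.
have : \forall d \near (0:R)^'+, [set: T] `<=` P d by apply: cT => x _; exact: H.
move=> Hd; near (0:R)^'+ => d; exists d; first by near: d; exact: nbhs_right_gt.
by move=> y; have H' : [set: T] `<=` P d; [near: d|exact: H'].
Unshelve. all: by end_near. Qed.

Section LocalGeometry.
Context {R : realType} {n : nat} {M : topologicalType} {SM : smooth_manifold R n M}.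
Context {K : nat} {e : M -> 'rV[R]_K}.
Local Notation dom := (@chart_dom _ _ SM).
Local Notation phi := (@chart_coord _ _ SM).
Hypotheses (cM : compact [set: M]) (Ce : CkM SM 2 e) (einj : injective e)
  (imm : forall i x v, dom i x -> 'D_v (in_chart i e) (phi i x) = 0 -> v = 0).
Implicit Types (i : chart SM).

Lemma e_continuous : continuous e.
Proof. exact (CkM_continuous Ce). Qed.

Lemma e_dist_continuous x : continuous (fun y => `|e y - e x|).
Proof.
move=> y; apply: (@cvg_norm _ _ _ (nbhs y) _ (fun y => e y - e x)).
by apply: (@cvgB _ _ _ (nbhs y) _ e (fun _ => e x)); [exact: e_continuous|exact: cvg_cst].
Qed.
Arguments e_dist_continuous : clear implicits.

(** M carries no distance; closeness is measured through [e]. On the complement of an open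
    neighbourhood of [x], which is compact, the distance to [e x] has a positive minimum because [e]
    is injective. *)
Lemma e_nbhs x (U : set M) : nbhs x U -> exists2 r, 0 < r & forall y, `|e y - e x| < r -> U y.
Proof.
rewrite nbhsE => -[B [oB Bx] BU].
have cC : compact (~` B).
  by rewrite -[~` B]setTI; apply: compact_closedI => //; exact: open_closedC.
have [E|/set0P ne] := eqVneq (~` B) set0.
  exists 1 => // y _; apply: BU; apply: contrapT => nB.
  by have : (~` B) y by []; rewrite E.
have [z zB zmin] := @compact_EVT_min M R (fun y => `|e y - e x|) (~` B) ne cC
  (continuous_subspaceT (e_dist_continuous x)).
exists `|e z - e x|.
  rewrite normr_gt0 subr_eq0; apply/eqP => /einj zx.
  by move: zB; rewrite inE zx => /(_ Bx).
move=> y yz; apply: BU; apply: contrapT => nB.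
by have := zmin y (mem_set nB); rewrite leNgt yz.
Qed.

Lemma chart_ball i x : dom i x -> exists C rho r : R, [/\ [/\ 0 < C, 0 < rho & 0 < r],
  ball (phi i x) rho `<=` img i,
  (forall xi xi', ball (phi i x) rho xi -> ball (phi i x) rho xi' ->
    `|in_chart i e xi' - in_chart i e xi| <= C * `|xi' - xi| /\
    `|xi' - xi| <= C * `|in_chart i e xi' - in_chart i e xi|) &
  (forall y, `|e y - e x| < r -> dom i y /\ ball (phi i x) rho (phi i y))].
Proof.
move=> dx.
have [C C0 HC] := immersion_lip (chart_img_open i) (Ck_on_le (leqnSn 1) (Ce i)) (chart_imgP dx)
  (fun v => imm dx).
have : exists rho : R, 0 < rho /\ (ball (phi i x) rho `<=` img i /\
  forall xi xi', ball (phi i x) rho xi -> ball (phi i x) rho xi' ->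
    `|in_chart i e xi' - in_chart i e xi| <= C * `|xi' - xi| /\
    `|xi' - xi| <= C * `|in_chart i e xi' - in_chart i e xi|).
  near (0:R)^'+ => rho; exists rho; split; last by near: rho.
  by near: rho; exact: nbhs_right_gt.
move=> [rho [rho0 [rD rH]]].
have nU : nbhs x (fun y => dom i y /\ ball (phi i x) rho (phi i y)).
  apply: filterI; first exact: chart_nbhs.
  by apply: (chart_continuous dx); exact: nbhsx_ballx.
by have [r r0 rU] := e_nbhs nU; exists C, rho, r; split.
Unshelve. all: by end_near. Qed.

(** Nearby points lie in one chart ball, where a segment joins them, and the two-sided estimates of
    the chart make it Lipschitz. One [d] is both the radius and, inverted, the constant: decreasing
    it only weakens the claim, so compactness gives a uniform one. *)
Lemma path_exists : exists2 d : R, 0 < d & forall y y', `|e y - e y'| < d ->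
  exists gam : R -> M, [/\ continuous gam, gam 0 = y, gam 1 = y' &
    forall s t, 0 <= s <= 1 -> 0 <= t <= 1 -> `|e (gam s) - e (gam t)| <= d^-1 * `|e y - e y'| * `|s - t|].
Proof.
apply: (compact_uniform_pos (P := fun d y => forall y', `|e y - e y'| < d ->
  exists gam : R -> M, [/\ continuous gam, gam 0 = y, gam 1 = y' &
    forall s t, 0 <= s <= 1 -> 0 <= t <= 1 -> `|e (gam s) - e (gam t)| <= d^-1 * `|e y - e y'| * `|s - t|])).
  exact: cM.
move=> x.
have dx := some_chartP (SM := SM) x; set i := some_chart x in dx.
have [C [rho [r [[C0 rho0 r0] rD rC rU]]]] := chart_ball dx.
have r20 : 0 < r / 2 by rewrite divr_gt0.
have nx : \forall y \near x, `|e y - e x| < r / 2.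
  have := e_dist_continuous x; move=> /(_ x) /cvgrPdist_lt /(_ _ r20).
  by apply: filterS => y; rewrite subrr normr0 sub0r normrN normr_id.
have nd : \forall d \near (0:R)^'+, 0 < d /\ d < r / 2 /\ d < (C * C)^-1.
  near=> d; split; first by near: d; exact: nbhs_right_gt.
  split; near: d; apply: nbhs_right_lt => //.
  by rewrite invr_gt0 mulr_gt0.
exists ([set y | `|e y - e x| < r / 2], [set d | 0 < d /\ d < r / 2 /\ d < (C * C)^-1]) => //.
move=> [y d] /= [yx [d0 [dr dC]]] y' yy'.
have rr : r / 2 < r by rewrite ltr_pdivrMr// mulr_natr mulr2n ltrDl.
have [dy by_] := rU y (lt_trans yx rr).
have y'x : `|e y' - e x| < r.
  rewrite -(subrKA (e y)) (le_lt_trans (ler_normD _ _))// (splitr r) ltrD// distrC.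
  exact: lt_trans yy' dr.
have [dy' by'] := rU y' y'x.
pose cl (s : R) := Num.min 1 (Num.max 0 s).
have cl01 s : 0 <= cl s <= 1 by rewrite /cl le_min ler01 le_max lexx /= ge_min lexx.
have clE s : 0 <= s <= 1 -> cl s = s by move=> /andP[s0 s1]; rewrite /cl max_r// min_r.
have ccl : continuous cl.
  move=> s; apply: (@continuous_min R R (cst 1) (fun s => Num.max 0 s) s); first exact: cst_continuous.
  exact: (@continuous_max R R (cst 0) id s (@cst_continuous _ _ (0 : R) s) (@cvg_id _ (nbhs s))).
pose xi s := cl s *: phi i y' + (1 - cl s) *: phi i y.
have bxi s : ball (phi i x) rho (xi s) by apply: ball_convex.
have cxi : continuous xi.
  move=> s; apply: (@cvgD _ _ _ (nbhs s) _ (fun s => cl s *: phi i y') (fun s => (1 - cl s) *: phi i y)).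
    by apply: cvgZr_tmp; exact: ccl.
  by apply: cvgZr_tmp; apply: cvgB; [exact: cvg_cst|exact: ccl].
have E s : e (chart_inv x i (xi s)) = in_chart i e (xi s) by rewrite (in_chart_inv x)//; exact: rD.
exists (fun s => chart_inv x i (xi s)); split.
- move=> s; apply: (@continuous_comp _ _ _ xi (chart_inv x i)); first exact: cxi.
  by apply: chart_inv_continuous; exact: rD.
- have -> : xi 0 = phi i y.
    by rewrite /xi (_ : cl 0 = 0) ?scale0r ?add0r ?subr0 ?scale1r//; apply: clE; rewrite lexx ler01.
  exact: chart_invK.
- have -> : xi 1 = phi i y'.
    by rewrite /xi (_ : cl 1 = 1) ?subrr ?scale0r ?addr0 ?scale1r//; apply: clE; rewrite lexx ler01.
  exact: chart_invK.
move=> s t s01 t01; rewrite !E.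
have [h1 _] := rC _ _ (bxi t) (bxi s); apply: (le_trans h1).
have [_ h2] := rC _ _ by' by_.
have -> : xi s - xi t = (s - t) *: (phi i y' - phi i y).
  by rewrite /xi !clE//; apply/rowP => k; rewrite !mxE; ring.
rewrite normrZ mulrCA mulrC.
apply: ler_wpM2r => //; apply: (@le_trans _ _ (C * (C * `|e y - e y'|))).
  rewrite ler_pM2l// distrC; have [_ ] := rC _ _ by_ by'; rewrite -distrC.
  by rewrite !in_chartE// [X in _ <= _ * X]distrC [X in X <= _]distrC.
rewrite mulrA ler_wpM2r// -[C * C]invrK lef_pV2 ?posrE// ?ltW// invr_gt0 mulr_gt0//.
Unshelve. all: by end_near. Qed.

End LocalGeometry.

(** * Free homotopies and close loops *)

Section Clamp.
Context {R : realType}.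

Definition clamp (s : R) : R := Num.min 1 (Num.max 0 s).

Lemma clamp01 s : 0 <= clamp s <= 1.
Proof. by rewrite /clamp le_min ler01 le_max lexx /= ge_min lexx. Qed.

Lemma clamp0 s : s <= 0 -> clamp s = 0.
Proof. by move=> s0; rewrite /clamp max_l// min_r. Qed.

Lemma clamp1 s : 1 <= s -> clamp s = 1.
Proof. by move=> s1; rewrite /clamp max_r ?(le_trans ler01)// min_l. Qed.

Lemma clamp_continuous : continuous clamp.
Proof.
move=> s; apply: (@continuous_min R R (cst 1) (fun s => Num.max 0 s) s); first exact: cst_continuous.
exact: (@continuous_max R R (cst 0) id s (@cst_continuous _ _ (0 : R) s) (@cvg_id _ (nbhs s))).
Qed.

Lemma clamp_cvg (T : Type) (F : set_system T) (f : T -> R) (a : R) : Filter F ->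
  f t @[t --> F] --> a -> clamp (f t) @[t --> F] --> clamp a.
Proof. by move=> FF H; apply: (@cvg_comp _ _ _ f clamp _ _ _ H); exact: clamp_continuous. Qed.

End Clamp.

Section Contraction.
Context {R : realType} {n : nat} {M : topologicalType} {SM : smooth_manifold R n M}.
Context {K : nat} {e : M -> 'rV[R]_K}.
Local Notation dom := (@chart_dom _ _ SM).
Local Notation phi := (@chart_coord _ _ SM).
Hypotheses (cM : compact [set: M]) (Ce : CkM SM 2 e) (einj : injective e)
  (imm : forall i x v, dom i x -> 'D_v (in_chart i e) (phi i x) = 0 -> v = 0).
Implicit Types (i : chart SM).

(* One step of the contraction moves the first point towards the second one along a
   segment of a single chart, with a cutoff that makes it the identity away from the
   centre of that chart. *)
Lemma contract_step (x : M) : exists (T : R -> M -> M -> M) (r L : R), [/\ 0 < r /\ 0 < L,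
  forall y y', T 0 y y' = y,
  forall t y y', `|e y - e y'| < r -> `|e (T t y y') - e y'| <= L * `|e y - e y'|,
  forall y y', `|e y - e y'| < r -> `|e y' - e x| < r -> T 1 y y' = y' &
  forall (Z : topologicalType) (g h : Z -> M), continuous g -> continuous h ->
    (forall z, `|e (g z) - e (h z)| < r) ->
    continuous (fun p : R * Z => T p.1 (g p.2) (h p.2))].
Proof.
have dx := some_chartP (SM := SM) x; set i := some_chart x in dx.
have [C [rho [r [[C0 rho0 r0] rD rC rU]]]] := chart_ball cM Ce einj imm dx.
(* [b] is 1 within r / 4 of the centre and 0 beyond r / 2. For points closer than r / 8 to each
   other, both lie in the chart ball where [b] may be nonzero, and [b] is 1 at the first one if the
   second is within r / 8 of the centre. *)
pose b (y : M) := clamp (2 - 4 * `|e y - e x| / r).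
pose xi t y y' := (clamp t * b y) *: phi i y' + (1 - clamp t * b y) *: phi i y.
pose T t y y' := if `|e y - e x| < r / 2 then chart_inv x i (xi t y y') else y.
have r8 : 0 < r / 8 by rewrite divr_gt0.
have L0 : 0 < Num.max 1 (C * C) by rewrite lt_max ltr01.
have b01 t y : 0 <= clamp t * b y <= 1.
  have /andP[t0 t1] := clamp01 t; have /andP[b0 b1] := clamp01 (2 - 4 * `|e y - e x| / r).
  by rewrite mulr_ge0//= mulr_ile1.
have Tout t y y' : r / 2 <= `|e y - e x| -> T t y y' = y.
  by move=> h; rewrite /T ltNge h.
have near y y' : `|e y - e y'| < r / 8 -> `|e y - e x| < 3 * r / 4 -> `|e y' - e x| < r.
  move=> h1 h2; rewrite -(subrKA (e y)) (le_lt_trans (ler_normD _ _))// distrC; lra.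
have b_out y : r / 2 <= `|e y - e x| -> b y = 0.
  move=> h; apply: clamp0; have : 2 <= 4 * `|e y - e x| / r by rewrite ler_pdivlMr//; lra.
  lra.
have Tin t y y' : `|e y - e x| < 3 * r / 4 -> T t y y' = chart_inv x i (xi t y y').
  move=> h; rewrite /T; case: ltP => // h2.
  have yr : `|e y - e x| < r by lra.
  have [dy _] := rU y yr; rewrite /xi b_out// mulr0 scale0r add0r subr0 scale1r.
  by rewrite chart_invK.
exists T, (r / 8), (Num.max 1 (C * C)); split.
- by [].
- move=> y y'; have [h|h] := leP (r / 2) `|e y - e x|; first exact: Tout.
  rewrite Tin; last lra.
  have yr : `|e y - e x| < r by lra.
  have [dy _] := rU y yr.
  by rewrite /xi clamp0// mul0r scale0r add0r subr0 scale1r chart_invK.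
- move=> t y y' yy'; have [h|h] := leP (r / 2) `|e y - e x|.
    by rewrite Tout// ler_peMl// le_max lexx.
  have h' : `|e y - e x| < 3 * r / 4 by lra.
  rewrite Tin//.
  have yr : `|e y - e x| < r by lra.
  have [dy by_] := rU y yr; have [dy' by'] := rU y' (near _ _ yy' h').
  have bx : ball (phi i x) rho (xi t y y') by apply: ball_convex.
  rewrite (_ : e (chart_inv x i _) = in_chart i e (xi t y y')); last first.
    by rewrite (in_chart_inv x)//; exact: rD.
  rewrite -[X in _ - e X](chart_invK x dy') (_ : e (chart_inv x i _) = in_chart i e (phi i y')); last first.
    by rewrite (in_chart_inv x)//; exact: rD.
  have [h1 _] := rC _ _ by' bx; apply: (le_trans h1).
  have -> : xi t y y' - phi i y' = (1 - clamp t * b y) *: (phi i y - phi i y').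
    by apply/rowP => k; rewrite !mxE; ring.
  have [_ h2] := rC _ _ by' by_.
  rewrite !in_chartE// in h2.
  rewrite normrZ ger0_norm; last by rewrite subr_ge0; case/andP: (b01 t y).
  apply: (@le_trans _ _ (C * `|phi i y - phi i y'|)).
    by rewrite ler_pM2l// ler_piMl// gerBl; case/andP: (b01 t y).
  apply: (@le_trans _ _ (C * (C * `|e y - e y'|))); first by rewrite ler_pM2l.
  by rewrite mulrA ler_wpM2r// le_max lexx orbT.
- move=> y y' yy' y'x.
  have yx : `|e y - e x| < r / 4.
    rewrite -(subrKA (e y')) (le_lt_trans (ler_normD _ _))//; lra.
  rewrite Tin; last lra.
  have b1 : b y = 1.
    apply: clamp1; have : 4 * `|e y - e x| / r <= 1 by rewrite ler_pdivrMr//; lra.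
    lra.
  have y'r : `|e y' - e x| < r by lra.
  have [dy' _] := rU y' y'r.
  by rewrite /xi b1 clamp1// mulr1 subrr scale0r addr0 scale1r chart_invK.
- move=> Z g h cg ch gh [t z].
  have cgp : g p.2 @[p --> (t, z)] --> g z by apply: (@cvg_comp _ _ _ snd g); [exact: cvg_snd|exact: cg].
  have chp : h p.2 @[p --> (t, z)] --> h z by apply: (@cvg_comp _ _ _ snd h); [exact: cvg_snd|exact: ch].
  have cgx : `|e (g p.2) - e x| @[p --> (t, z)] --> `|e (g z) - e x|.
    apply: (@cvg_comp _ _ _ (fun p : R * Z => g p.2) (fun y => `|e y - e x|) _ _ _ cgp).
    exact: e_dist_continuous.
  have [lt|ge] := ltP `|e (g z) - e x| (3 * r / 4).
    have gr : `|e (g z) - e x| < r by lra.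
    have [dg bg] := rU _ gr; have [dh bh] := rU _ (near _ _ (gh z) lt).
    have cxi : xi p.1 (g p.2) (h p.2) @[p --> (t, z)] --> xi t (g z) (h z).
      have cc : clamp p.1 * b (g p.2) @[p --> (t, z)] --> clamp t * b (g z).
        apply: cvgM; first by apply: clamp_cvg; exact: cvg_fst.
        apply: clamp_cvg; apply: cvgB; first exact: cvg_cst.
        by apply: cvgMl; apply: cvgMr.
      have c1 : phi i (g p.2) @[p --> (t, z)] --> phi i (g z).
        exact: (@cvg_comp _ _ _ (fun p : R * Z => g p.2) (phi i) _ _ _ cgp (chart_continuous dg)).
      have c2 : phi i (h p.2) @[p --> (t, z)] --> phi i (h z).
        exact: (@cvg_comp _ _ _ (fun p : R * Z => h p.2) (phi i) _ _ _ chp (chart_continuous dh)).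
      by apply: cvgD; apply: cvgZ => //; apply: cvgB => //; exact: cvg_cst.
    have ixi : img i (xi t (g z) (h z)) by apply: rD; exact: ball_convex.
    have := @cvg_comp _ _ _ (fun p : R * Z => xi p.1 (g p.2) (h p.2)) (chart_inv x i) _ _ _ cxi (@chart_inv_continuous _ _ _ _ x i _ ixi).
    rewrite /continuous_at /= Tin//; apply: cvg_trans; apply: near_eq_cvg.
    near=> p; rewrite /= Tin//; near: p.
    exact: (cvgr_lt _ cgx).
  have E : T t (g z) (h z) = g z by apply: Tout; lra.
  rewrite /continuous_at /= E; apply: cvg_trans cgp; apply: near_eq_cvg.
  near=> p; rewrite /= Tout//; apply: ltW; near: p.
  apply: (cvgr_gt _ cgx); lra.
Unshelve. all: by end_near. Qed.

(** Compose the steps of finitely many charts. Each multiplies the distance to y' by at most a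
    constant, so the admissible radius shrinks accordingly. At time 1 the step of a chart around y'
    reaches y', and the steps applied afterwards keep it there because their estimate has right side
    0. *)
Lemma local_contraction : exists (c : R -> M -> M -> M) (r L : R), [/\ 0 < r /\ 0 < L,
  forall y y', c 0 y y' = y,
  forall t y y', `|e y - e y'| < r -> `|e (c t y y') - e y'| <= L * `|e y - e y'|,
  forall y y', `|e y - e y'| < r -> c 1 y y' = y' &
  forall (Z : topologicalType) (g h : Z -> M), continuous g -> continuous h ->
    (forall z, `|e (g z) - e (h z)| < r) ->
    continuous (fun p : R * Z => c p.1 (g p.2) (h p.2))].
Proof.
have /choice[T /choice[rad /choice[Lip HT]]] := contract_step.
have [x _|l [_ lcov]] := compact_finite_cover (f := fun x => [set y | `|e y - e x| < rad x]) cM.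
  have [[r0 _] _ _ _ _] := HT x.
  have := @e_dist_continuous _ _ _ _ _ _ Ce x; move=> /(_ x) /cvgrPdist_lt /(_ _ r0).
  by apply: filterS => y; rewrite subrr normr0 sub0r normrN normr_id.
have H : exists (c : R -> M -> M -> M) (r L : R), [/\ 0 < r /\ 0 < L,
  forall y y', c 0 y y' = y,
  forall t y y', `|e y - e y'| < r -> `|e (c t y y') - e y'| <= L * `|e y - e y'|,
  forall y y', `|e y - e y'| < r -> (exists2 x, x \in l & `|e y' - e x| < rad x) -> c 1 y y' = y' &
  forall (Z : topologicalType) (g h : Z -> M), continuous g -> continuous h ->
    (forall z, `|e (g z) - e (h z)| < r) ->
    continuous (fun p : R * Z => c p.1 (g p.2) (h p.2))].
  elim: l {lcov} => [|x l [c [r [L [[r0 L0] c0 cL c1 cc]]]]].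
    exists (fun _ y _ => y), 1, 1; split=> //.
    - by move=> t y y' _; rewrite mul1r.
    - by move=> y y' _ [].
    - by move=> Z g h cg _ _ p; apply: (@continuous_comp _ _ _ snd g); [exact: cvg_snd|exact: cg].
  have [[rx0 Lx0] T0 TL T1 Tc] := HT x.
  pose r' := Num.min r (rad x / L); have r'0 : 0 < r' by rewrite lt_min r0 divr_gt0.
  have r'r y y' : `|e y - e y'| < r' -> `|e y - e y'| < r by move=> /lt_le_trans; apply; rewrite ge_min lexx.
  have cx t y y' : `|e y - e y'| < r' -> `|e (c t y y') - e y'| < rad x.
    move=> h; apply: (le_lt_trans (cL _ _ _ (r'r _ _ h))).
    by rewrite mulrC -ltr_pdivlMr// (lt_le_trans h)// ge_min lexx orbT.
  exists (fun t y y' => T x t (c t y y') y'), r', (Lip x * L); split.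
  - by rewrite r'0 mulr_gt0.
  - by move=> y y'; rewrite T0 c0.
  - move=> t y y' h; apply: (le_trans (TL _ _ _ (cx _ _ _ h))).
    by rewrite -mulrA ler_pM2l//; exact: cL (r'r _ _ h).
  - move=> y y' h [z]; rewrite inE => /orP[/eqP ->|zl] zy'; first exact: T1 (cx _ _ _ h) zy'.
    rewrite c1; [|exact: r'r|by exists z].
    have := TL 1 y' y'; rewrite subrr normr0 mulr0 => /(_ rx0); rewrite normr_le0 subr_eq0.
    by move=> /eqP/einj.
  - move=> Z g h cg ch gh.
    have cF := cc Z g h cg ch (fun z => r'r _ _ (gh z)).
    have ch2 : continuous (fun p : R * Z => h p.2).
      by move=> p; apply: (@continuous_comp _ _ _ snd h); [exact: cvg_snd|exact: ch].
    have := Tc (R * Z)%type (fun p => c p.1 (g p.2) (h p.2)) (fun p => h p.2) cF ch2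
      (fun p => cx p.1 _ _ (gh p.2)).
    move=> cT [t z].
    apply: (@continuous_comp _ _ _ (fun p : R * Z => (p.1, p))
      (fun q : R * (R * Z) => T x q.1 (c q.2.1 (g q.2.2) (h q.2.2)) (h q.2.2)) (t, z)); last exact: cT.
    by apply: pair_cvg; [exact: cvg_fst|exact: cvg_id].
have [c [r [L [rL c0 cL c1 cc]]]] := H.
exists c, r, L; split=> // y y' yy'; apply: c1 => //.
by have [x xl xy] := lcov y' Logic.I; exists x.
Qed.

End Contraction.

Section FreeHomotopy.
Context {R : realType} {T : topologicalType}.
Implicit Types (g h : R -> T).

(** A form of [freely_homotopic] with continuity and periodicity for all real parameters; clamping
    the parameters then allows concatenation. *)
Definition homotopic g h := exists F : R * R -> T, [/\ continuous F,
  forall u, Defs.periodic 1 (fun t => F (u, t)), forall t, F (0, t) = g t & forall t, F (1, t) = h t].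

Lemma homotopic_freely g h : homotopic g h -> freely_homotopic g h.
Proof. by move=> [F [cF pF F0 F1]]; exists F; split=> //; exact: continuous_subspaceT. Qed.

Lemma homotopic_trans g h k : homotopic g h -> homotopic h k -> homotopic g k.
Proof.
move=> [F [cF pF F0 F1]] [G [cG pG G0 G1]].
pose F' (p : R * R) := F (clamp (2 * p.1), p.2).
pose G' (p : R * R) := G (clamp (2 * p.1 - 1), p.2).
have cF' : continuous F'.
  move=> [u t]; apply: (@continuous_comp _ _ _ (fun p : R * R => (clamp (2 * p.1), p.2)) F); last exact: cF.
  by apply: pair_cvg; [apply: clamp_cvg; apply: cvgMr; exact: cvg_fst|exact: cvg_snd].
have cG' : continuous G'.
  move=> [u t]; apply: (@continuous_comp _ _ _ (fun p : R * R => (clamp (2 * p.1 - 1), p.2)) G); last exact: cG.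
  apply: pair_cvg; last exact: cvg_snd.
  by apply: clamp_cvg; apply: cvgB; [apply: cvgMr; exact: cvg_fst|exact: cvg_cst].
have FG t : F' (1 / 2, t) = G' (1 / 2, t).
  have E2 : 2 * (1 / 2) = 1 :> R by lra.
  by rewrite /F' /G' /= E2 subrr clamp1// clamp0// F1 G0.
exists (fun p => if p.1 <= 1 / 2 then F' p else G' p); split.
- move=> [u t] A /=; have [lt|gt|E] := ltgtP u (1 / 2).
  + move=> nA; have := cF' (u, t) A nA; rewrite /nbhs /= => nF.
    near=> p; have p12 : p.1 < 1 / 2.
      near: p; have c : fst p @[p --> (u, t)] --> u by exact: cvg_fst.
      exact: (cvgr_lt _ c).
    by rewrite /= ltW//; near: p.
  + move=> nA; have := cG' (u, t) A nA; rewrite /nbhs /= => nF.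
    near=> p; have p12 : 1 / 2 < p.1.
      near: p; have c : fst p @[p --> (u, t)] --> u by exact: cvg_fst.
      exact: (cvgr_gt _ c).
    by rewrite /= leNgt p12 /=; near: p.
  + rewrite E => nA; have nF := cF' (1 / 2, t) A nA; rewrite FG in nA; have nG := cG' (1 / 2, t) A nA.
    have nF' : \forall p \near ((1 / 2 : R), (t : R)), A (F' p) := nF.
    have nG' : \forall p \near ((1 / 2 : R), (t : R)), A (G' p) := nG.
    have H : \forall p \near ((1 / 2 : R), (t : R)), A (if p.1 <= 1 / 2 then F' p else G' p).
      by apply: filterS2 nF' nG' => p hF hG; case: ifP.
    exact: H.
- by move=> u t /=; case: ifP => _; [exact: pF|exact: pG].
- by move=> t /=; rewrite divr_ge0// /F' /= mulr0 clamp0.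
- move=> t /=; rewrite ifF; first by rewrite /G' /= mulr1 clamp1// lerBrDr.
  by apply/negP; rewrite leNgt ltr_pdivrMr// mul1r ltr1n.
Unshelve. all: by end_near. Qed.

End FreeHomotopy.

(** * Estimates for pairs of nearby points *)

Section UniformGeometry.
Context {R : realType} {n : nat} {M : topologicalType} {SM : smooth_manifold R n M}.
Context {K : nat} {e : M -> 'rV[R]_K}.
Local Notation dom := (@chart_dom _ _ SM).
Local Notation phi := (@chart_coord _ _ SM).
Hypotheses (cM : compact [set: M]) (Ce : CkM SM 2 e) (einj : injective e)
  (imm : forall i x v, dom i x -> 'D_v (in_chart i e) (phi i x) = 0 -> v = 0).
Implicit Types (i : chart SM).

(** [C] is fixed before [Q], so that the accuracy demanded by [Q] may depend on it. *)
Lemma chart_ball_small i x : dom i x -> exists2 C : R, 0 < C &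
  forall Q : R -> Prop, (\forall rho \near 0^'+, Q rho) -> exists rho r : R,
  [/\ [/\ 0 < rho, 0 < r & Q rho], ball (phi i x) rho `<=` img i,
  (forall xi xi', ball (phi i x) rho xi -> ball (phi i x) rho xi' ->
    `|in_chart i e xi' - in_chart i e xi| <= C * `|xi' - xi| /\
    `|xi' - xi| <= C * `|in_chart i e xi' - in_chart i e xi|) &
  (forall y, `|e y - e x| < r -> dom i y /\ ball (phi i x) rho (phi i y))].
Proof.
move=> dx.
have [C C0 HC] := immersion_lip (chart_img_open i) (Ck_on_le (leqnSn 1) (Ce i)) (chart_imgP dx)
  (fun v => imm dx).
exists C => // Q HQ.
have : exists rho : R, [/\ 0 < rho, Q rho & (ball (phi i x) rho `<=` img i /\
  forall xi xi', ball (phi i x) rho xi -> ball (phi i x) rho xi' ->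
    `|in_chart i e xi' - in_chart i e xi| <= C * `|xi' - xi| /\
    `|xi' - xi| <= C * `|in_chart i e xi' - in_chart i e xi|)].
  near (0:R)^'+ => rho; exists rho; split; [|by near: rho|by near: rho].
  by near: rho; exact: nbhs_right_gt.
move=> [rho [rho0 Qr [rD rH]]].
have nU : nbhs x (fun y => dom i y /\ ball (phi i x) rho (phi i y)).
  apply: filterI; first exact: chart_nbhs.
  by apply: (chart_continuous dx); exact: nbhsx_ballx.
by have [r r0 rU] := e_nbhs cM Ce einj nU; exists rho, r; split.
Unshelve. all: by end_near. Qed.

(* Nearby pairs of points are contained in one ball, by compactness. *)
Lemma uniform_pairs (P : R -> M -> M -> Prop) :
  (forall x, exists2 r : R, 0 < r & forall (d : R) y y', 0 < d -> d < r -> `|e y - e x| < r -> `|e y' - e x| < r ->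
     `|e y' - e y| < d -> P d y y') ->
  exists2 d : R, 0 < d & forall y y', `|e y' - e y| < d -> P d y y'.
Proof.
move=> H; apply: (@compact_uniform_pos _ _ (fun d y => forall y', `|e y' - e y| < d -> P d y y') cM) => x.
have [r r0 Hr] := H x.
have nx : \forall y \near x, `|e y - e x| < r / 2.
  have c : {for x, continuous (fun y => `|e y - e x|)} := @e_dist_continuous _ _ _ _ _ _ Ce x x.
  by apply: (cvgr_lt _ c); rewrite subrr normr0 divr_gt0.
near=> y d => y' yy'.
have dr : d < r / 2 by near: d; apply: nbhs_right_lt; rewrite divr_gt0.
have yx : `|e y - e x| < r / 2 by near: y.
have d0 : 0 < d by near: d; exact: nbhs_right_gt.
move: d0 dr yx yy' => /= d0 dr yx yy'; have y'x : `|e y' - e x| < r by rewrite -(subrKA (e y)) (le_lt_trans (ler_normD _ _))//; lra.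
by apply: Hr => //; lra.
Unshelve. all: by end_near. Qed.

Lemma CkM_lip m (h : M -> 'rV[R]_m) : CkM SM 1 h ->
  exists2 d : R, 0 < d & forall y y', `|e y' - e y| < d -> `|h y' - h y| <= d^-1 * `|e y' - e y|.
Proof.
move=> Ch; apply: uniform_pairs => x.
have dx := some_chartP (SM := SM) x; set i := some_chart x in dx.
have [C C0 /(_ _ _)HC] := chart_ball_small dx.
have [L L0 HL] := C1_lip (chart_img_open i) (Ch i) (chart_imgP dx).
have [rho [r [[rho0 r0 [_ Qr]] rD rH rU]]] := HC _ HL.
exists (Num.min r (L * C)^-1); first by rewrite lt_min r0 invr_gt0 mulr_gt0.
move=> d y y' d0; rewrite !lt_min => /andP[_ dLC] /andP[/rU[dy by_] _] /andP[/rU[dy' by'] _] _.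
have := Qr _ _ by_ by'; rewrite !in_chartE//; move=> /le_trans; apply.
have [_] := rH _ _ by_ by'; rewrite !in_chartE//; move=> h2.
apply: (@le_trans _ _ (L * (C * `|e y' - e y|))); first by rewrite ler_pM2l.
rewrite mulrA ler_wpM2r// -[leLHS]invrK lef_pV2 ?posrE ?invr_gt0 ?mulr_gt0//; exact: ltW.
Qed.

Lemma Pm_lip : exists2 d : R, 0 < d & forall y y', `|e y' - e y| < d ->
  `|Pm (SM := SM) (e := e) y' - Pm (SM := SM) (e := e) y| <= d^-1 * `|e y' - e y|.
Proof.
pose h y : 'rV[R]_(K * K) := mxvec (Pm (SM := SM) (e := e) y).
have [|d d0 H] := @CkM_lip _ h.
  apply/CkM_rVP => j; case/mxvec_indexP: j => a b.
  rewrite (_ : (fun x => _) = (fun x => Pm (SM := SM) (e := e) x a b)); first exact: Pm_Ck.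
  by apply/funext => x; rewrite /h mxvecE.
exists d => // y y' yy'; apply: mx_norm_le => [|a b].
  by rewrite mulr_ge0// invr_ge0 ltW.
apply: le_trans (H _ _ yy').
have -> : h y' - h y = mxvec (Pm (SM := SM) (e := e) y' - Pm (SM := SM) (e := e) y) by rewrite [RHS]raddfB.
by have := mx_entry_le (mxvec (Pm (SM := SM) (e := e) y' - Pm (SM := SM) (e := e) y)) ord0 (mxvec_index a b); rewrite mxvecE.
Qed.

(** The linear part of the chord is tangent at [y], so only the remainder of the first-order
    expansion has a normal component. This is what makes the normal momenta of critical sequences
    tend to 0. *)
Lemma chord_tangent eps : 0 < eps -> exists2 d : R, 0 < d & forall y y', `|e y' - e y| < d ->
  `|(e y' - e y) *m (1%:M - Pm (SM := SM) (e := e) y)| <= eps * `|e y' - e y|.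
Proof.
move=> eps0.
have [|d d0 H] := @uniform_pairs (fun d y y' =>
  `|(e y' - e y) *m (1%:M - Pm (SM := SM) (e := e) y)| <= eps * `|e y' - e y|); last by exists d.
move=> x; have dx := some_chartP (SM := SM) x; set i := some_chart x in dx.
have [C C0 /(_ _ _)HC] := chart_ball_small dx.
pose c1 : R := `|1%:M - Pm (SM := SM) (e := e) x| + 1.
have c10 : 0 < c1 by rewrite ltr_pwDr.
(* The remainder gets multiplied by K from the matrix product, by [c1] from the normal projection
   and by [C] from comparing chart distance with embedded distance. *)
have e'0 : 0 < eps / (K.+1%:R * c1 * C) by rewrite divr_gt0// mulr_gt0// mulr_gt0// ltr0Sn.
have [rho [r [[rho0 r0 [_ Qr]] rD rH rU]]] := HC _
  (C1_unif (chart_img_open i) (Ck_on_le (leqnSn 1) (Ce i)) (chart_imgP dx) e'0).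
have nP : nbhs x (fun y => `|1%:M - Pm (SM := SM) (e := e) y| < c1).
  have c : (1%:M - Pm (SM := SM) (e := e) y) @[y --> x] --> (1%:M - Pm (SM := SM) (e := e) x).
    by apply: cvgB; [exact: cvg_cst|exact: Pm_cvg].
  by apply: (cvgr_lt _ (cvg_norm c)); rewrite /c1 ltrDl.
have [r' r'0 rP] := e_nbhs cM Ce einj nP.
exists (Num.min r r'); first by rewrite lt_min r0.
move=> d y y' d0 _; rewrite !lt_min => /andP[/rU[dy by_] yr'] /andP[/rU[dy' by'] _] _.
have := Qr _ _ by_ by'; rewrite !in_chartE//.
have iy : img i (phi i y) by exact: rD.
rewrite -(dE_mul Ce)//; set Rm := _ - _ *m _ => hR.
have -> : (e y' - e y) *m (1%:M - Pm (SM := SM) (e := e) y) = Rm *m (1%:M - Pm (SM := SM) (e := e) y).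
  by rewrite /Rm [RHS]mulmxBl -[in RHS]mulmxA [dE _ _ *m (_ - _)]mulmxBr mulmx1 (dE_Pm Ce imm dy) subrr mulmx0 subr0.
apply: (le_trans (mulmx_norm_le _ _)).
have [_] := rH _ _ by_ by'; rewrite !in_chartE//; move=> h2.
apply: (@le_trans _ _ (K.+1%:R * ((eps / (K.+1%:R * c1 * C) * (C * `|e y' - e y|)) * c1))).
  apply: ler_pM => //; first by rewrite ler_nat.
  apply: ler_pM => //; last by apply: ltW; exact: rP.
  by apply: (le_trans hR); rewrite ler_pM2l.
rewrite le_eqVlt; apply/orP; left; apply/eqP; field.
by rewrite lt0r_neq0// lt0r_neq0//= nat1r pnatr_eq0.
Qed.

End UniformGeometry.

(** * Cutoff and penalty functions *)

Section ScalarDerivative.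
Context {R : realType}.

Lemma derive_scalar (g : R -> R) (x v d : R) : is_derive x 1 g d -> differentiable g x /\ 'D_v g x = v * d.
Proof.
move=> H; have dg : differentiable g x by apply/derivable1_diffP; exact: ex_derive.
split=> //; have -> : v = v *: (1 : R) + 0 by rewrite addr0 [_ *: _]mulr1.
rewrite (derive_lin v (1 : R) 0 dg) [X in _ *: X]derive_val.
by rewrite deriveE// linear0 addr0 addr0 [_ *: 1]mulr1.
Qed.

Lemma pospow_shift_derive m (c t v : R) : differentiable (fun t => pospow m.+2 (t - c)) t /\
  'D_v (fun t => pospow m.+2 (t - c)) t = v * (m.+2%:R * pospow m.+1 (t - c)).
Proof.
have ds : is_derive t 1 (fun t : R => t - c) 1 by apply: is_derive_eq; rewrite subr0.
have [d1 E1] := derive_scalar v ds; have [d2 E2] := pospow_derive m (t - c) v.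
split; first exact: (differentiable_comp d1 d2).
by rewrite (derive_comp_diff (f := fun t => t - c) (g := pospow m.+2) v d1 d2) E1 mulr1 E2.
Qed.

End ScalarDerivative.

Section Cutoff.
Context {R : realType}.
Variables (A a b : R).
Hypotheses (A0 : 0 < A) (ab : a < b).

(** The cubic 3 t^2 - 2 t^3 on [0, 1]; beyond 1 the terms in t - 1 compensate it to the constant 1,
    keeping class C^1. *)
Definition smooth_step (t : R) : R := 3 * pospow 2 t - 2 * pospow 3 t + 3 * pospow 2 (t - 1) + 2 * pospow 3 (t - 1).
Definition smooth_step' (t : R) : R := 6 * (pospow 1 t - pospow 2 t + pospow 1 (t - 1) + pospow 2 (t - 1)).

Lemma smooth_step_derive t v : differentiable smooth_step t /\ 'D_v smooth_step t = v * smooth_step' t.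
Proof.
have [d2 e2] := pospow_derive 0 t v; have [d3 e3] := pospow_derive 1 t v.
have [d2' e2'] := pospow_shift_derive 0 1 t v; have [d3' e3'] := pospow_shift_derive 1 1 t v.
have z (k : R) (f : R -> R) : differentiable f t -> differentiable (fun t => k * f t) t /\ 'D_v (fun t => k * f t) t = k * 'D_v f t.
  by move=> df; split; [exact: (differentiableZ k df)|rewrite (deriveZ k (derivable_dir v df))].
have [d2z e2z] := z 3 _ d2; have [d3z e3z] := z 2 _ d3; have [d2z' e2z'] := z 3 _ d2'; have [d3z' e3z'] := z 2 _ d3'.
have D1 := differentiableB d2z d3z; have D2 := differentiableD D1 d2z'.
split; first exact: (differentiableD D2 d3z').
rewrite (deriveD (derivable_dir v D2) (derivable_dir v d3z')) (deriveD (derivable_dir v D1) (derivable_dir v d2z')).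
rewrite (deriveB (derivable_dir v d2z) (derivable_dir v d3z)) e2z e3z e2z' e3z' e2 e3 e2' e3' /smooth_step'; ring.
Qed.

Lemma pospow_pos m t : 0 <= t -> pospow m t = t ^+ m :> R.
Proof. by move=> t0; rewrite /pospow max_r. Qed.

Lemma smooth_step_cases t : [\/ t <= 0 /\ (smooth_step t = 0 /\ smooth_step' t = 0),
  1 <= t /\ (smooth_step t = 1 /\ smooth_step' t = 0) |
  [/\ 0 < t < 1, 0 < smooth_step t, smooth_step t < 1 & 0 < smooth_step' t]].
Proof.
rewrite /smooth_step /smooth_step'; have [t0|t0] := leP t 0.
  have t1 : t - 1 <= 0 by lra.
  by apply: Or31; rewrite !pospow_eq0//; split=> //; split; ring.
have [t1|t1] := leP 1 t.
  by apply: Or32; rewrite !pospow_pos; [split=> //; split; ring|lra..].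
apply: Or33; rewrite !(@pospow_eq0 _ _ (t - 1))//; [|lra..].
rewrite !pospow_pos; [|lra..].
have h1 : 0 < t * t by rewrite mulr_gt0.
have h2 : 0 < (1 - t) * (1 - t) by rewrite mulr_gt0// subr_gt0.
have h3 : 0 < t * (1 - t) by rewrite mulr_gt0// subr_gt0.
by split; [lra|nra|nra|nra].
Qed.

Definition cutoff (h : R) : R := A * smooth_step ((b - a)^-1 * (h - a)) - A.
Definition cutoff' (h : R) : R := A * (b - a)^-1 * smooth_step' ((b - a)^-1 * (h - a)).

Lemma cutoff_derive h v : differentiable cutoff h /\ 'D_v cutoff h = v * cutoff' h.
Proof.
pose l (h : R) := (b - a)^-1 * (h - a).
have ds : is_derive h 1 l (b - a)^-1.
  by apply: is_derive_eq; rewrite subr0 [_ *: _]mulr1.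
have [d1 E1] := derive_scalar v ds; have [d2 E2] := smooth_step_derive (l h) ('D_v l h).
have d3 := differentiable_comp d1 d2; have d4 := differentiableZ A d3.
split; first exact: (differentiableB d4 (differentiable_cst A h)).
rewrite (deriveB (derivable_dir v d4) (derivable_cst A h v)) derive_cst subr0 (deriveZ A (derivable_dir v d3)).
rewrite (derive_comp_diff v d1 d2) E2 E1 /cutoff' -/(l h) [_ *: _]mulrA; ring.
Qed.

Lemma cutoff'_continuous : continuous cutoff'.
Proof.
move=> h; apply: cvgMr.
pose l (h : R) := (b - a)^-1 * (h - a).
have cl : l h' @[h' --> h] --> l h by apply: cvgMr; apply: cvgB; [exact: cvg_id|exact: cvg_cst].
have cl1 : l h' - 1 @[h' --> h] --> l h - 1 by apply: cvgB => //; exact: cvg_cst.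
have c m : pospow m.+1 (l h') @[h' --> h] --> pospow m.+1 (l h).
  by apply: (cvg_comp _ _ cl); exact: pospow_continuous.
have c1 m : pospow m.+1 (l h' - 1) @[h' --> h] --> pospow m.+1 (l h - 1).
  by apply: (cvg_comp _ _ cl1); exact: pospow_continuous.
by apply: cvgMr; apply: cvgD; [apply: cvgD; [apply: cvgB|]|].
Qed.

Lemma cutoff_cases h : [\/ h <= a /\ (cutoff h = - A /\ cutoff' h = 0),
  b <= h /\ (cutoff h = 0 /\ cutoff' h = 0) | [/\ a < h < b, - A < cutoff h, cutoff h < 0 & 0 < cutoff' h]].
Proof.
have ba : 0 < b - a by rewrite subr_gt0.
have ba' : 0 < (b - a)^-1 by rewrite invr_gt0.
rewrite /cutoff /cutoff'; have [[t0 [-> ->]]|[t0 [-> ->]]|[]] := smooth_step_cases ((b - a)^-1 * (h - a)).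
- apply: Or31; move: t0; rewrite pmulr_rle0// subr_le0 => ->; split=> //; split; ring.
- apply: Or32; move: t0; rewrite mulrC ler_pdivlMr// mul1r lerD2r => ->; split=> //; split; ring.
rewrite pmulr_rgt0// subr_gt0 mulrC ltr_pdivrMr// mul1r ltrD2r mulrC => hh s0 s1 s'.
have h1 : A * smooth_step ((b - a)^-1 * (h - a)) < A * 1 by rewrite ltr_pM2l.
have h0 : 0 < A * smooth_step ((b - a)^-1 * (h - a)) by rewrite mulr_gt0.
by apply: Or33; split=> //; [lra|lra|apply: mulr_gt0 => //; exact: mulr_gt0].
Qed.

End Cutoff.

Section Penalty.
Context {R : realType} {K : nat}.
Variable r1 : R.
Hypothesis r10 : 0 < r1.
Implicit Types (p w : 'rV[R]_K).

Definition eucl p : R := Num.sqrt (pairing p p).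

Lemma eucl_ge0 p : 0 <= eucl p. Proof. exact: sqrtr_ge0. Qed.

Lemma eucl_sqr p : eucl p ^+ 2 = pairing p p.
Proof. by rewrite sqr_sqrtr// pairing_ge0. Qed.

Lemma norm_le_eucl p : `|p| <= eucl p.
Proof.
apply: mx_norm_le => [|i j]; first exact: eucl_ge0.
rewrite -[`|_|]ger0_norm// -(@ler_pXn2r _ 2)// ?nnegrE//; last exact: eucl_ge0.
rewrite eucl_sqr ger0_norm// real_normK ?num_real// (ord1 i) /pairing (bigD1 j)//= -expr2 lerDl.
by apply: sumr_ge0 => k _; rewrite -expr2 sqr_ge0.
Qed.

Lemma pairing_self_derive p w : differentiable (fun p => pairing p p) p /\
  'D_w (fun p => pairing p p) p = 2 * pairing p w.
Proof.
have d k : differentiable (fun p : 'rV[R]_K => p ord0 k * p ord0 k) p.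
  have C : Ck_on 1 setT (fun p : 'rV[R]_K => p ord0 k) by exact: Ck_on_coord.
  exact: (Ck_diff (Ck_onM openT C C)).
have E : (fun p => pairing p p) = \sum_(k < K) (fun p : 'rV[R]_K => p ord0 k * p ord0 k).
  by apply/funext => q; rewrite /pairing fct_sumE.
rewrite E; split; first exact: differentiable_sum.
rewrite derive_sum; last by move=> k; exact: derivable_dir.
rewrite /pairing mulr_sumr; apply: eq_bigr => k _.
have dk : derivable (fun p : 'rV[R]_K => p ord0 k) p w.
  by apply: derivable_dir; apply: (Ck_diff (k := 0) (D := setT)) => //; exact: Ck_on_coord.
by rewrite (deriveM dk dk) derive_coord /GRing.scale /=; ring.
Qed.

Lemma pairing_self_continuous : continuous (fun p => pairing p p).
Proof. by move=> p; exact: differentiable_continuous (pairing_self_derive p 0).1. Qed.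

Lemma eucl_continuous : continuous eucl.
Proof. by move=> p; apply: continuous_comp; [exact: pairing_self_continuous|exact: sqrt_continuous]. Qed.

Lemma eucl_derive p w : 0 < eucl p -> differentiable eucl p /\ 'D_w eucl p = (eucl p)^-1 * pairing p w.
Proof.
move=> p0; have pp0 : 0 < pairing p p by rewrite -sqrtr_gt0.
have [d1 E1] := pairing_self_derive p w.
have [d2 E2] := derive_scalar ('D_w (fun p => pairing p p) p) (is_derive1_sqrt pp0).
split; first exact: (differentiable_comp d1 d2).
rewrite (derive_comp_diff (f := fun p => pairing p p) w d1 d2) E2 E1 -/(eucl p).
by field; rewrite gt_eqF.
Qed.

(* A C^1 function of linear growth, vanishing on the ball of radius [r1]. *)
Definition huber (t : R) : R := 2^-1 * (pospow 2 (t - r1) - pospow 2 (t - (r1 + 1))).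
Definition huber' (t : R) : R := pospow 1 (t - r1) - pospow 1 (t - (r1 + 1)).

Lemma huber_derive t v : differentiable huber t /\ 'D_v huber t = v * huber' t.
Proof.
have [d1 e1] := pospow_shift_derive 0 r1 t v; have [d2 e2] := pospow_shift_derive 0 (r1 + 1) t v.
have d3 := differentiableB d1 d2.
split; first exact: (differentiableZ 2^-1 d3).
rewrite (deriveZ 2^-1 (derivable_dir v d3)) (deriveB (derivable_dir v d1) (derivable_dir v d2)) e1 e2 /huber' /GRing.scale /=.
by field.
Qed.

Lemma huber_cases t : [\/ t <= r1 /\ (huber t = 0 /\ huber' t = 0),
  [/\ r1 < t <= r1 + 1, huber t = (t - r1) ^+ 2 / 2 & huber' t = t - r1] |
  [/\ r1 + 1 < t, huber t = t - r1 - 2^-1 & huber' t = 1]].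
Proof.
rewrite /huber /huber'; have [t0|t0] := leP t r1.
  apply: Or31; rewrite !pospow_eq0 ?subr_le0//; [split=> //; split; ring|lra|lra].
have [t1|t1] := leP t (r1 + 1).
  apply: Or32; rewrite !(@pospow_eq0 _ _ (t - (r1 + 1))) ?subr_le0// !pospow_pos ?subr_ge0//; [|lra..].
  by split=> //; field.
apply: Or33; rewrite !pospow_pos ?subr_ge0; [|lra..].
by split=> //; field.
Qed.

Definition pen p : R := huber (eucl p).
Definition pen_grad p : 'rV[R]_K := (huber' (eucl p) / eucl p) *: p.

Lemma pen_derive p w : differentiable pen p /\ 'D_w pen p = pairing (pen_grad p) w.
Proof.
(* The Euclidean norm is not differentiable at 0, but inside the ball of radius [r1] the penalty is
   locally zero. *)
have [lt|ge] := ltP (eucl p) r1.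
  have E : {near p, cst 0 =1 pen}.
    near=> q; rewrite /pen; have h : eucl q < r1 by near: q; exact: (cvgr_lt _ (@eucl_continuous p)).
    have [[_ [-> _]]//|[/andP[h1 _]]|[h1]] := huber_cases (eucl q); exfalso; lra.
  split; first exact: (differentiable_near_eq E (differentiable_cst _ _)).
  rewrite -(near_eq_derive _ E) derive_cst /pen_grad.
  have [[_ [_ ->]]|[/andP[h _]]|[h]] := huber_cases (eucl p); [by rewrite mul0r scale0r pairing0l|exfalso; lra|exfalso; lra].
have p0 : 0 < eucl p by exact: lt_le_trans ge.
have [d1 E1] := eucl_derive w p0; have [d2 E2] := huber_derive (eucl p) ('D_w eucl p).
split; first exact: (differentiable_comp d1 d2).
rewrite (derive_comp_diff (f := eucl) w d1 d2) E2 E1 /pen_grad pairingZl; ring.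
Unshelve. all: by end_near. Qed.

Lemma pen_continuous : continuous pen.
Proof. by move=> p; exact: differentiable_continuous (pen_derive p 0).1. Qed.

Lemma huber'_ge0 t : 0 <= huber' t <= 1.
Proof. by have [[_ [_ ->]]|[/andP[h1 h2] _ ->]|[_ _ ->]] := huber_cases t; lra. Qed.

Lemma huber'_continuous : continuous huber'.
Proof.
move=> t; have c (d : R) : pospow 1 (t' - d) @[t' --> t] --> pospow 1 (t - d).
  apply: (@cvg_comp _ _ _ (fun t : R => t - d) (pospow 1) _ (nbhs (t - d))); last exact: pospow_continuous.
  by apply: cvgB; [exact: cvg_id|exact: cvg_cst].
by apply: cvgB.
Qed.

Lemma pen_grad_continuous p : pen_grad q @[q --> p] --> pen_grad p.
Proof.
have [lt|ge] := ltP (eucl p) r1.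
  have E : {near p, cst 0 =1 pen_grad}.
    near=> q; rewrite /pen_grad; have h' : eucl q < r1 by near: q; exact: (cvgr_lt _ (@eucl_continuous p)).
    have [[_ [_ ->]]|[/andP[h _] _ _]|[h _ _]] := huber_cases (eucl q); [by rewrite mul0r scale0r|exfalso; lra|exfalso; lra].
  have -> : pen_grad p = 0 by have := @nbhs_singleton _ p _ E.
  have c0 : cst (0 : 'rV[R]_K) q @[q --> p] --> (0 : 'rV[R]_K) by exact: (@cst_continuous 'rV[R]_K 'rV[R]_K 0 p).
  apply: cvg_trans c0; exact: (@near_eq_cvg _ _ (nbhs p) (nbhs_filter p) _ _ E).
have p0 : eucl p != 0 by rewrite gt_eqF// (lt_le_trans r10).
have c1 : {for p, continuous (huber' \o eucl)}.
  by apply: continuous_comp; [exact: eucl_continuous|exact: huber'_continuous].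
have c2 : {for p, continuous (fun q => (eucl q)^-1)}.
  by apply: continuousV => //; exact: eucl_continuous.
have c3 := @continuousM R _ (huber' \o eucl) (fun q => (eucl q)^-1) p c1 c2.
have c4 : {for p, continuous (fun q : 'rV[R]_K => q)} by [].
exact: (continuousZ c3 c4).
Unshelve. all: by end_near. Qed.

Lemma pen_ge0 p : 0 <= pen p.
Proof. by rewrite /pen; have [[_ [-> _]]|[_ -> _]|[h -> _]] := huber_cases (eucl p); [|rewrite divr_ge0// sqr_ge0|lra]. Qed.

Lemma pen_zero p : eucl p <= r1 -> pen p = 0 /\ pen_grad p = 0.
Proof.
rewrite /pen /pen_grad => h'; have [[_ [-> ->]]|[/andP[h _] _ _]|[h _ _]] := huber_cases (eucl p); [|exfalso; lra|exfalso; lra].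
by rewrite mul0r scale0r.
Qed.

Lemma pen_ge p : `|p| - r1 - 1 <= pen p.
Proof.
apply: (@le_trans _ _ (eucl p - r1 - 1)); first by rewrite !lerD2r norm_le_eucl.
rewrite /pen; have [[h [-> _]]|[_ -> _]|[_ -> _]] := huber_cases (eucl p); [lra| |lra].
have := sqr_ge0 (eucl p - r1 - 1); nra.
Qed.

Lemma pen_grad_scale p : exists2 c, 0 <= c & pen_grad p = c *: p.
Proof.
exists (huber' (eucl p) / eucl p) => //.
by rewrite divr_ge0// ?eucl_ge0//; case/andP: (huber'_ge0 (eucl p)).
Qed.

Lemma pen_grad_norm p : `|pen_grad p| <= 1.
Proof.
rewrite normrZ normrM normfV (ger0_norm (eucl_ge0 p)); have /andP[h0 h1] := huber'_ge0 (eucl p).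
rewrite (ger0_norm h0); have := eucl_ge0 p; rewrite le_eqVlt => /orP[/eqP <-|p0].
  by rewrite invr0 mulr0 mul0r.
by rewrite mulrAC ler_pdivrMr// mul1r (le_trans _ (norm_le_eucl p))// ler_piMl.
Qed.

(** This is where linear growth counts: the left side is the contribution of the penalty to the
    action density of a critical sequence, and it is bounded whatever the size of the momentum. *)
Lemma pen_euler p : pairing (pen_grad p) p - pen p <= r1 + 1.
Proof.
have -> : pairing (pen_grad p) p = huber' (eucl p) * eucl p.
  rewrite pairingZl -eucl_sqr; have := eucl_ge0 p; rewrite le_eqVlt => /orP[/eqP <-|p0]; first by rewrite !(mulr0, expr0n).
  by field; rewrite gt_eqF.
rewrite /pen; have [[h [-> ->]]|[/andP[h1 h2] -> ->]|[h -> ->]] := huber_cases (eucl p).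
- by rewrite mul0r subr0 addr_ge0// ltW.
- have v1 : (eucl p - r1) ^+ 2 <= 1 by rewrite expr_le1//; lra.
  have v2 : r1 * (eucl p - r1) <= r1 * 1 by rewrite ler_pM2l//; lra.
  have -> : (eucl p - r1) * eucl p = (eucl p - r1) ^+ 2 + r1 * (eucl p - r1) by ring.
  lra.
- by rewrite mul1r; lra.
Qed.

End Penalty.

(** * Derivatives of the discrete action *)

Section HasDerivative.
Context {R : realType}.

(** [L] is a plain function rather than a bundled linear map, so that derivatives compose and can be
    replaced by pointwise equal expressions. *)
Definition has_derivative (V W : normedModType R) (f : V -> W) (x : V) (L : V -> W) :=
  differentiable f x /\ forall v, 'D_v f x = L v.

Lemma hd_eq (V W : normedModType R) (f : V -> W) x L L' : has_derivative f x L ->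
  (forall v, L v = L' v) -> has_derivative f x L'.
Proof. by move=> [d E] h; split=> // v; rewrite E h. Qed.

Lemma hd_comp (V E W : normedModType R) (f : V -> E) (g : E -> W) x L L' :
  has_derivative f x L -> has_derivative g (f x) L' -> has_derivative (g \o f) x (L' \o L).
Proof.
move=> [df Ef] [dg Eg]; split=> [|v]; first exact: differentiable_comp.
by rewrite (derive_comp_diff v df dg) Ef Eg.
Qed.

Lemma hd_lin (V W : normedModType R) (f : {linear V -> W}) x : continuous f -> has_derivative f x f.
Proof.
move=> cf; have df := linear_differentiable x cf.
by split=> // v; rewrite (deriveE v df) (diff_lin x cf).
Qed.

Lemma hd_id (V : normedModType R) (x : V) : has_derivative (fun y => y) x (fun v => v).
Proof. by apply: (hd_lin (f := idfun)) => y; exact: cvg_id. Qed.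

Lemma hd_fst (V W : normedModType R) (z : V * W) : has_derivative fst z fst.
Proof. by apply: (hd_lin (f := fst)) => y; exact: cvg_fst. Qed.

Lemma hd_snd (V W : normedModType R) (z : V * W) : has_derivative snd z snd.
Proof. by apply: (hd_lin (f := snd)) => y; exact: cvg_snd. Qed.

Lemma hd_cst (V W : normedModType R) (a : W) (x : V) : has_derivative (cst a) x (cst 0).
Proof. by split=> [|v]; [exact: differentiable_cst|exact: derive_cst]. Qed.

Lemma hd_add (V W : normedModType R) (f g : V -> W) x L L' : has_derivative f x L -> has_derivative g x L' ->
  has_derivative (fun y => f y + g y) x (fun v => L v + L' v).
Proof.
move=> [df Ef] [dg Eg]; split=> [|v]; first exact: differentiableD.
by rewrite (deriveD (derivable_dir v df) (derivable_dir v dg)) Ef Eg.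
Qed.

Lemma hd_sub (V W : normedModType R) (f g : V -> W) x L L' : has_derivative f x L -> has_derivative g x L' ->
  has_derivative (fun y => f y - g y) x (fun v => L v - L' v).
Proof.
move=> [df Ef] [dg Eg]; split=> [|v]; first exact: differentiableB.
by rewrite (deriveB (derivable_dir v df) (derivable_dir v dg)) Ef Eg.
Qed.

Lemma hd_scale (V W : normedModType R) (k : R) (f : V -> W) x L : has_derivative f x L ->
  has_derivative (fun y => k *: f y) x (fun v => k *: L v).
Proof.
move=> [df Ef]; split=> [|v]; first exact: (differentiableZ k df).
by rewrite (deriveZ k (derivable_dir v df)) Ef.
Qed.

Lemma hd_mul (V : normedModType R) (f g : V -> R) x L L' : has_derivative f x L -> has_derivative g x L' ->
  has_derivative (fun y => f y * g y) x (fun v => f x * L' v + g x * L v).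
Proof.
move=> [df Ef] [dg Eg]; split=> [|v]; first exact: differentiableM.
by rewrite (deriveM (derivable_dir v df) (derivable_dir v dg)) Ef Eg.
Qed.

Lemma hd_sum (V W : normedModType R) m (f : 'I_m -> V -> W) x (L : 'I_m -> V -> W) :
  (forall k, has_derivative (f k) x (L k)) -> has_derivative (fun y => \sum_k f k y) x (fun v => \sum_k L k v).
Proof.
move=> H; have -> : (fun y => \sum_k f k y) = \sum_k f k by apply/funext => y; rewrite fct_sumE.
split=> [|v]; first by apply: differentiable_sum => k; have [] := H k.
rewrite derive_sum; first by apply: eq_bigr => k _; have [] := H k.
by move=> k; apply: derivable_dir; have [] := H k.
Qed.

Lemma hd_rV (V : normedModType R) m (f : V -> 'rV[R]_m) x (L : 'I_m -> V -> R) :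
  (forall k, has_derivative (fun y => f y ord0 k) x (L k)) -> has_derivative f x (fun v => \row_k L k v).
Proof.
move=> H; have df : differentiable f x by apply/differentiable_rVP => k; have [] := H k.
by split=> // v; apply/rowP => k; rewrite (derive_rV v k df) mxE; have [] := H k.
Qed.

Lemma hd_entry (V : normedModType R) m (f : V -> 'rV[R]_m) x L k : has_derivative f x L ->
  has_derivative (fun y => f y ord0 k) x (fun v => L v ord0 k).
Proof.
move=> [df Ef]; split=> [|v]; first exact: ((differentiable_rVP f x).1 df k).
by rewrite -(derive_rV v k df) Ef.
Qed.

Lemma hd_pairing (V : normedModType R) m (f g : V -> 'rV[R]_m) x L L' :
  has_derivative f x L -> has_derivative g x L' ->
  has_derivative (fun y => pairing (f y) (g y)) x (fun v => pairing (L v) (g x) + pairing (f x) (L' v)).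
Proof.
move=> Hf Hg.
have H k := hd_mul (hd_entry k Hf) (hd_entry k Hg).
apply: hd_eq (hd_sum H) _ => v.
by rewrite /pairing -big_split; apply: eq_bigr => k _; rewrite addrC [X in X + _]mulrC.
Qed.

Lemma hd_pair (V W W' : normedModType R) (f : V -> W) (g : V -> W') x L L' :
  has_derivative f x L -> has_derivative g x L' -> has_derivative (fun y => (f y, g y)) x (fun v => (L v, L' v)).
Proof.
move=> [df Ef] [dg Eg]; have d := differentiable_pair df dg; split=> // v.
by rewrite (deriveE v d) (diff_pair df dg) -(deriveE v df) -(deriveE v dg) Ef Eg.
Qed.

End HasDerivative.

(** * The Hamiltonian, covectors and normal parts in a chart *)

Section CotangentGradients.
Context {R : realType} {n : nat} {M : topologicalType} {SM : smooth_manifold R n M}.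
Context {K : nat} {e : M -> 'rV[R]_K}.
Local Notation dom := (@chart_dom _ _ SM).
Local Notation phi := (@chart_coord _ _ SM).
Local Notation dE := (dE (SM := SM) (e := e)).
Hypotheses (Ce : CkM SM 2 e)
  (imm : forall i x v, dom i x -> 'D_v (in_chart i e) (phi i x) = 0 -> v = 0).
Variable H : cotangent SM -> R.
Hypothesis sH : smooth_function (cotangent_atlas SM) H.
Implicit Types (i : chart SM).

Definition ham_chart i : 'rV[R]_n * 'rV[R]_n -> R := @in_chart _ _ _ (cotangent_atlas SM) i H.
Definition ham_x i (z : 'rV[R]_n * 'rV[R]_n) : 'rV[R]_n := \row_k 'D_(delta_mx ord0 k, 0) (ham_chart i) z.
Definition ham_y i (z : 'rV[R]_n * 'rV[R]_n) : 'rV[R]_n := \row_k 'D_(0, delta_mx ord0 k) (ham_chart i) z.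

Lemma ham_chart_hd i xi y : img i xi ->
  has_derivative (ham_chart i) (xi, y) (fun v => pairing (ham_x i (xi, y)) v.1 + pairing (ham_y i (xi, y)) v.2).
Proof.
move=> ixi; have d : differentiable (ham_chart i) (xi, y).
  have C : Ck_on 1 (@chart_coord _ _ (cotangent_atlas SM) i @` @chart_dom _ _ (cotangent_atlas SM) i) (ham_chart i) := sH i 1%N.
  exact: (Ck_diff C (cot_imgP Ce imm y ixi)).
split=> // -[v w] /=.
have -> : (v, w) = \sum_k v ord0 k *: (delta_mx ord0 k : 'rV[R]_n, 0 : 'rV[R]_n) + \sum_k w ord0 k *: (0 : 'rV[R]_n, delta_mx ord0 k : 'rV[R]_n).
  have s1 (a : 'I_n -> R) (u1 u2 : 'I_n -> 'rV[R]_n) : \sum_k a k *: (u1 k, u2 k) = (\sum_k a k *: u1 k, \sum_k a k *: u2 k).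
    by apply: (big_ind3 (fun x y z => x = (y, z))) => // ? a' b' ? a'' b'' -> ->.
  rewrite !s1 -!row_sum_delta; congr (_, _).
  - by rewrite [X in _ + X]big1 ?addr0// => k _; rewrite scaler0.
  - by rewrite [X in X + _]big1 ?add0r// => k _; rewrite scaler0.
rewrite -[X in 'D_(X + _) _ _]scale1r (derive_lin _ _ _ d) scale1r !(derive_sumv _ _ d).
by congr (_ + _); apply: eq_bigr => k _; rewrite mxE mulrC.
Qed.

Lemma ham_grad_cvg (T : Type) (F : set_system T) (FF : Filter F) i (f g : T -> 'rV[R]_n) xi y : img i xi ->
  f t @[t --> F] --> xi -> g t @[t --> F] --> y ->
  [/\ ham_chart i (f t, g t) @[t --> F] --> ham_chart i (xi, y),
    ham_x i (f t, g t) @[t --> F] --> ham_x i (xi, y) & ham_y i (f t, g t) @[t --> F] --> ham_y i (xi, y)].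
Proof.
move=> ixi cf cg; have cz := pair_cvg FF cf cg.
have Z := cot_imgP Ce imm y ixi.
split.
- have c : {for (xi, y), continuous (ham_chart i)} := sH i 0%N _ Z.
  exact: (cvg_comp _ _ cz c).
- apply: mx_cvg => a k; rewrite (ord1 a) mxE.
  have c : {for (xi, y), continuous (fun z => 'D_(delta_mx ord0 k, 0) (ham_chart i) z)} := (sH i 1%N).2 _ _ Z.
  by under eq_cvg do rewrite mxE; exact: (cvg_comp _ _ cz c).
- apply: mx_cvg => a k; rewrite (ord1 a) mxE.
  have c : {for (xi, y), continuous (fun z => 'D_(0, delta_mx ord0 k) (ham_chart i) z)} := (sH i 1%N).2 _ _ Z.
  by under eq_cvg do rewrite mxE; exact: (cvg_comp _ _ cz c).
Qed.

Definition erow i (k : 'I_n) (xi : 'rV[R]_n) : 'rV[R]_K := row k (dE i xi).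
Definition prow i (m : 'I_K) (xi : 'rV[R]_n) : 'rV[R]_K := row m (rowproj (dE i xi)).

Lemma erow_Ck i k : Ck_on 1 (img i) (erow i k).
Proof.
apply/(Ck_on_rVP _ _ (chart_img_open i)) => j.
by rewrite (_ : (fun y => _) = (fun xi => dE i xi k j)); [exact: dE_Ck|apply/funext => xi; rewrite mxE].
Qed.

Lemma prow_Ck i m : Ck_on 1 (img i) (prow i m).
Proof.
apply/(Ck_on_rVP _ _ (chart_img_open i)) => j.
rewrite (_ : (fun y => _) = (fun xi => rowproj (dE i xi) m j)); last by apply/funext => xi; rewrite mxE.
apply: Ck_on_rowproj; [exact: chart_img_open|move=> x ix v; exact: (dE_free' Ce imm ix)|exact: dE_Ck].
Qed.

Lemma Ck1_hd m i (f : 'rV[R]_n -> 'rV[R]_m) xi : Ck_on 1 (img i) f -> img i xi ->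
  has_derivative f xi (fun v => 'D_v f xi).
Proof. by move=> C ixi; split=> //; exact: (Ck_diff C ixi). Qed.

(** [dymap] and [drem] are the derivatives in the position of [ymap] and of the tangential part of
    [p]; as [nrem] is [p] minus that part, [drem] enters [rem_hd] with a minus sign. *)
Definition ymap i xi (p : 'rV[R]_K) : 'rV[R]_n := p *m (dE i xi)^T.
Definition dymap i xi (p : 'rV[R]_K) (v : 'rV[R]_n) : 'rV[R]_n := \row_k pairing p ('D_v (erow i k) xi).
Definition nrem i xi (p : 'rV[R]_K) : 'rV[R]_K := p - p *m rowproj (dE i xi).
Definition drem i xi (p : 'rV[R]_K) (v : 'rV[R]_n) : 'rV[R]_K := \row_m pairing p ('D_v (prow i m) xi).

Lemma ymap_entry i xi p k : ymap i xi p ord0 k = pairing p (erow i k xi).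
Proof. by rewrite /ymap mxE; apply: eq_bigr => j _; rewrite !mxE. Qed.

Lemma dymap_entry i xi p v k : dymap i xi p v ord0 k = pairing p ('D_v (erow i k) xi).
Proof. by rewrite mxE. Qed.

Lemma drem_entry i xi p v m : drem i xi p v ord0 m = pairing p ('D_v (prow i m) xi).
Proof. by rewrite mxE. Qed.

Lemma rem_entry i xi p m : img i xi -> nrem i xi p ord0 m = p ord0 m - pairing p (prow i m xi).
Proof.
move=> ixi; rewrite /nrem mxE; congr (_ + _); rewrite mxE; congr (- _).
rewrite mxE; apply: eq_bigr => j _; rewrite [in RHS]mxE.
by rewrite -[in LHS](rowproj_sym (dE i xi)) [in LHS]mxE.
Qed.

Lemma hd_proj_fst m i (f : 'rV[R]_n -> 'rV[R]_m) xi (p : 'rV[R]_K) : Ck_on 1 (img i) f -> img i xi ->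
  has_derivative (fun z : 'rV[R]_n * 'rV[R]_K => f z.1) (xi, p) (fun v => 'D_(v.1) f xi).
Proof. by move=> C ixi; exact: (hd_comp (hd_fst (xi, p)) (Ck1_hd C ixi)). Qed.

Lemma ymap_hd i xi p : img i xi -> has_derivative (fun z => ymap i z.1 z.2) (xi, p)
  (fun v => ymap i xi v.2 + dymap i xi p v.1).
Proof.
move=> ixi; have Hk k : has_derivative (fun z : 'rV[R]_n * 'rV[R]_K => ymap i z.1 z.2 ord0 k) (xi, p)
    (fun v => pairing v.2 (erow i k xi) + pairing p ('D_(v.1) (erow i k) xi)).
  rewrite (_ : (fun z => _) = (fun z => pairing z.2 (erow i k z.1))); last first.
    by apply/funext => z; rewrite ymap_entry.
  exact: (hd_pairing (hd_snd (xi, p)) (hd_proj_fst p (@erow_Ck i k) ixi)).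
apply: hd_eq (hd_rV Hk) _ => v; apply/rowP => k.
by rewrite !mxE -ymap_entry mxE.
Qed.

Lemma rem_hd i xi p : img i xi -> has_derivative (fun z => nrem i z.1 z.2) (xi, p)
  (fun v => nrem i xi v.2 - drem i xi p v.1).
Proof.
move=> ixi; have Hk k : has_derivative (fun z : 'rV[R]_n * 'rV[R]_K => z.2 ord0 k - pairing z.2 (prow i k z.1)) (xi, p)
    (fun v => v.2 ord0 k - (pairing v.2 (prow i k xi) + pairing p ('D_(v.1) (prow i k) xi))).
  apply: hd_sub; first exact: (hd_entry k (hd_snd (xi, p))).
  exact: (hd_pairing (hd_snd (xi, p)) (hd_proj_fst p (@prow_Ck i k) ixi)).
have E : {near (xi, p), (fun z : 'rV[R]_n * 'rV[R]_K => \row_k (z.2 ord0 k - pairing z.2 (prow i k z.1))) =1 (fun z => nrem i z.1 z.2)}.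
  have : \forall z \near (xi, p), img i z.1.
    have c : fst z @[z --> (xi, p)] --> xi by exact: cvg_fst.
    by apply: c; apply: open_nbhs_nbhs; split=> //; exact: chart_img_open.
  by apply: filterS => z iz; apply/rowP => k; rewrite mxE -rem_entry.
have Hk' k : has_derivative (fun z : 'rV[R]_n * 'rV[R]_K => (\row_k (z.2 ord0 k - pairing z.2 (prow i k z.1)) : 'rV[R]_K) ord0 k) (xi, p)
    (fun v => v.2 ord0 k - (pairing v.2 (prow i k xi) + pairing p ('D_(v.1) (prow i k) xi))).
  by rewrite (_ : (fun z => _) = (fun z : 'rV[R]_n * 'rV[R]_K => z.2 ord0 k - pairing z.2 (prow i k z.1)))//; apply/funext => z; rewrite mxE.
have [d Ed] := hd_rV Hk'.
split; first exact: (differentiable_near_eq E d).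
move=> v; rewrite -(near_eq_derive _ E) Ed; apply/rowP => k.
by rewrite !mxE opprD addrA -rem_entry// !mxE.
Qed.

Lemma rem_proj i xi p : img i xi -> nrem i xi p *m rowproj (dE i xi) = 0.
Proof.
move=> ixi; rewrite /nrem mulmxBl -mulmxA (rowproj_idem (fun v => @dE_free' _ _ _ _ _ _ Ce imm i xi ixi v)).
by rewrite subrr.
Qed.

Lemma rem_pairing i xi p w : img i xi -> pairing (nrem i xi w) (nrem i xi p) = pairing w (nrem i xi p).
Proof.
by move=> ixi; rewrite {1}/nrem pairingBl pairing_mulmx rowproj_sym rem_proj// pairing0r subr0.
Qed.

(* The part of the discrete action that depends on the node [(xi, p)]; [a] and [c] are the
   embedded images of the next and previous nodes, [q] the previous momentum, [h] the step. *)
Section Node.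
Variables (A a b r1 : R).
Hypothesis (ab : a < b) (r10 : 0 < r1).

Definition pot i xi p : R := cutoff A a b (ham_chart i (xi, ymap i xi p)) + 2^-1 * pairing (nrem i xi p) (nrem i xi p).

Definition dpot i xi p v w : R := cutoff' A a b (ham_chart i (xi, ymap i xi p)) *
    (pairing (ham_x i (xi, ymap i xi p)) v + pairing (ham_y i (xi, ymap i xi p)) (ymap i xi w + dymap i xi p v)) +
  (pairing w (nrem i xi p) - pairing (drem i xi p v) (nrem i xi p)).

Definition node i (h s : R) (a' c q : 'rV[R]_K) xi p : R := pairing p (a' - in_chart i e xi) + pairing q (in_chart i e xi - c) -
  h * (pot i xi p + s * pen r1 p).

Definition dnode i (h s : R) (a' q : 'rV[R]_K) xi p v w : R :=
  pairing w (a' - in_chart i e xi) - pairing p (v *m dE i xi) + pairing q (v *m dE i xi) -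
  h * (dpot i xi p v w + s * pairing (pen_grad r1 p) w).

Lemma pot_hd i xi p : img i xi -> has_derivative (fun z => pot i z.1 z.2) (xi, p) (fun v => dpot i xi p v.1 v.2).
Proof.
move=> ixi; have Hy := hd_pair (hd_fst (xi, p)) (@ymap_hd i xi p ixi).
have Hh := hd_comp (f := fun z : 'rV[R]_n * 'rV[R]_K => (z.1, ymap i z.1 z.2)) Hy (@ham_chart_hd i xi _ ixi).
have Hc : has_derivative (cutoff A a b) (ham_chart i (xi, ymap i xi p))
    (fun v => v * cutoff' A a b (ham_chart i (xi, ymap i xi p))).
  by split=> [|v]; [exact: (cutoff_derive A a b _ 0).1|exact: (cutoff_derive A a b _ v).2].
have H1 := hd_comp (f := fun z : 'rV[R]_n * 'rV[R]_K => ham_chart i (z.1, ymap i z.1 z.2)) Hh Hc.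
have Hr := @rem_hd i xi p ixi.
have H2 := hd_scale 2^-1 (hd_pairing Hr Hr).
apply: hd_eq (hd_add H1 H2) _ => -[v w] /=; rewrite /dpot.
rewrite [pairing (nrem i xi p) (_ - _)]pairingC pairingBl rem_pairing// /GRing.scale /=.
by rewrite mulrC; congr (_ + _); field.
Qed.

Lemma node_hd i h s a' c q xi p : img i xi ->
  has_derivative (fun z => node i h s a' c q z.1 z.2) (xi, p) (fun v => dnode i h s a' q xi p v.1 v.2).
Proof.
move=> ixi.
have He : has_derivative (fun z : 'rV[R]_n * 'rV[R]_K => in_chart i e z.1) (xi, p) (fun v => v.1 *m dE i xi).
  apply: hd_eq (hd_proj_fst p (Ck_on_le (leqnSn 1) (Ce i)) ixi) _ => v.
  by rewrite (dE_mul Ce).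
have Hp := hd_snd (xi, p).
have H1 := hd_pairing Hp (hd_sub (hd_cst a' (xi, p)) He).
have H2 := hd_pairing (hd_cst q (xi, p)) (hd_sub He (hd_cst c (xi, p))).
have Hpen : has_derivative (fun z : 'rV[R]_n * 'rV[R]_K => pen r1 z.2) (xi, p) (fun v => pairing (pen_grad r1 p) v.2).
  apply: (hd_comp (f := snd) Hp); split=> [|w]; [exact: (pen_derive r10 p 0).1|exact: (pen_derive r10 p w).2].
have H3 := hd_scale h (hd_add (@pot_hd i xi p ixi) (hd_scale s Hpen)).
apply: hd_eq (hd_sub (hd_add H1 H2) H3) _ => -[v w] /=; rewrite /dnode /cst /= sub0r subr0 pairing0l add0r.
by rewrite [pairing p (- _)]pairingC pairingNl [pairing _ p]pairingC.
Qed.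

Lemma derive_cvg (T : Type) (F : set_system T) (FF : Filter F) m i (g : 'rV[R]_n -> 'rV[R]_m) (f : T -> 'rV[R]_n) xi v :
  Ck_on 1 (img i) g -> img i xi -> f t @[t --> F] --> xi -> 'D_v g (f t) @[t --> F] --> 'D_v g xi.
Proof.
move=> C ixi cf; have c : {for xi, continuous (fun y => 'D_v g y)} := C.2 v _ ixi.
exact: (cvg_comp _ _ cf c).
Qed.

(** Joint continuity in the node and its neighbours is what keeps a direction of descent valid on a
    whole neighbourhood of a discrete loop. *)
Lemma dnode_cvg (T : Type) (F : set_system T) (FF : Filter F) i h s (a' q : T -> 'rV[R]_K) (f : T -> 'rV[R]_n)
   (g : T -> 'rV[R]_K) a0 q0 xi p v w : img i xi ->
  a' t @[t --> F] --> a0 -> q t @[t --> F] --> q0 -> f t @[t --> F] --> xi -> g t @[t --> F] --> p ->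
  dnode i h s (a' t) (q t) (f t) (g t) v w @[t --> F] --> dnode i h s a0 q0 xi p v w.
Proof.
move=> ixi ca cq cf cg.
have cE : dE i (f t) @[t --> F] --> dE i xi by exact: (cvg_comp _ _ cf (dE_cvg Ce ixi)).
have ce : in_chart i e (f t) @[t --> F] --> in_chart i e xi.
  have c : {for xi, continuous (in_chart i e)} := Ck_on_le (leq0n 2) (Ce i) _ ixi.
  exact: (cvg_comp _ _ cf c).
have cEt : (dE i (f t))^T @[t --> F] --> (dE i xi)^T by exact: trmx_cvg cE.
have cw : cst w t @[t --> F] --> w by exact: cvg_cst.
have cvc : cst v t @[t --> F] --> v by exact: cvg_cst.
have cy : ymap i (f t) (g t) @[t --> F] --> ymap i xi p by exact: (mulmx_cvg cg cEt).
have cyw : ymap i (f t) w @[t --> F] --> ymap i xi w by exact: (mulmx_cvg cw cEt).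
have cdy : dymap i (f t) (g t) v @[t --> F] --> dymap i xi p v.
  apply: (@mx_cvg R _ F FF _ _ (fun t => dymap i (f t) (g t) v)) => j k; rewrite (ord1 j) [X in _ --> X]dymap_entry.
  rewrite (_ : (fun t => _) = (fun t => pairing (g t) ('D_v (erow i k) (f t)))).
    exact: (pairing_cvg cg (derive_cvg (v := v) FF (@erow_Ck i k) ixi cf)).
  by apply/funext => t; rewrite dymap_entry.
have cr : nrem i (f t) (g t) @[t --> F] --> nrem i xi p.
  apply: (@mx_cvg R _ F FF _ _ (fun t => nrem i (f t) (g t))) => j m; rewrite (ord1 j) [X in _ --> X](rem_entry _ _ ixi).
  have cm : prow i m (f t) @[t --> F] --> prow i m xi.
    have c : {for xi, continuous (prow i m)} := Ck_on_le (leq0n 1) (@prow_Ck i m) _ ixi.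
    exact: (cvg_comp _ _ cf c).
  have nD : \forall t \near F, img i (f t).
    by apply: cf; apply: open_nbhs_nbhs; split=> //; exact: chart_img_open.
  have c1 : (g t ord0 m - pairing (g t) (prow i m (f t))) @[t --> F] --> p ord0 m - pairing p (prow i m xi).
    exact: (cvgB (@mx_entry_cvg R T F _ _ g p ord0 m cg) (pairing_cvg cg cm)).
  apply: cvg_trans c1; apply: near_eq_cvg; apply: filterS nD => t it.
  by rewrite rem_entry.
have cdr : drem i (f t) (g t) v @[t --> F] --> drem i xi p v.
  apply: (@mx_cvg R _ F FF _ _ (fun t => drem i (f t) (g t) v)) => j k; rewrite (ord1 j) [X in _ --> X]drem_entry.
  rewrite (_ : (fun t => _) = (fun t => pairing (g t) ('D_v (prow i k) (f t)))).
    exact: (pairing_cvg cg (derive_cvg (v := v) FF (@prow_Ck i k) ixi cf)).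
  by apply/funext => t; rewrite drem_entry.
have [ch chx chy] := ham_grad_cvg FF ixi cf cy.
have cc : cutoff' A a b (ham_chart i (f t, ymap i (f t) (g t))) @[t --> F] --> cutoff' A a b (ham_chart i (xi, ymap i xi p)).
  apply: (cvg_comp _ _ ch); exact: cutoff'_continuous.
have cv : v *m dE i (f t) @[t --> F] --> v *m dE i xi by exact: (mulmx_cvg cvc cE).
have cpen : pen_grad r1 (g t) @[t --> F] --> pen_grad r1 p.
  by apply: (cvg_comp _ _ cg); exact: pen_grad_continuous.
apply: cvgB.
  apply: cvgD; last exact: (pairing_cvg cq cv).
  apply: cvgB; last exact: (pairing_cvg cg cv).
  exact: (pairing_cvg cw (cvgB ca ce)).
apply: cvgMr; apply: cvgD.
  apply: cvgD.
    apply: (cvgM cc); apply: cvgD; first exact: (pairing_cvg chx cvc).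
    exact: (pairing_cvg chy (cvgD cyw cdy)).
  by apply: cvgB; [exact: (pairing_cvg cw cr)|exact: (pairing_cvg cdr cr)].
by apply: cvgMr; exact: (pairing_cvg cpen cw).
Qed.

End Node.

End CotangentGradients.

(** * Discrete loops *)

Section Concatenation.
Context {R : realType}.

Lemma concat_continuous (T : topologicalType) (gam : int -> R -> T) : (forall k, continuous (gam k)) ->
  (forall k, gam k 1 = gam (k + 1) 0) -> continuous (fun t : R => gam (Num.floor t) (t - (Num.floor t)%:~R)).
Proof.
move=> cg g10 t.
have sh (k : int) s : gam k (t' - k%:~R) @[t' --> s] --> gam k (s - k%:~R).
  have c1 : (t' - k%:~R) @[t' --> s] --> s - k%:~R by apply: cvgB; [exact: cvg_id|exact: cvg_cst].
  exact: (cvg_comp _ _ c1 (cg k (s - k%:~R))).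
pose k := Num.floor t; have /andP[kt tk] := floor_itv t; rewrite -/k intrD mulr1z in kt tk.
move: kt; rewrite le_eqVlt => /orP[/eqP kt|kt]; last first.
  have E : {near t, (fun t' => gam k (t' - k%:~R)) =1 (fun t' => gam (Num.floor t') (t' - (Num.floor t')%:~R))}.
    near=> t'; rewrite (@floor_def _ t' k)// intrD mulr1z; apply/andP; split.
      by apply: ltW; near: t'; exact: lt_nbhsr.
    by near: t'; exact: lt_nbhsl.
  by move: (sh k t); apply: cvg_trans; exact: near_eq_cvg.
rewrite /continuous_at -/k => A nA.
have nA' : nbhs (gam (k - 1) (t - (k - 1)%:~R)) A.
  rewrite -kt -intrB opprB addrCA subrr addr0 mulr1z g10 subrK.
  by move: nA; rewrite -kt subrr.
have H1 : \forall t' \near t, A (gam k (t' - k%:~R)) := sh k t A nA.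
have H2 : \forall t' \near t, A (gam (k - 1) (t' - (k - 1)%:~R)) := sh (k - 1) t A nA'.
have H : \forall t' \near t, A (gam (Num.floor t') (t' - (Num.floor t')%:~R)).
  near=> t'; have [h|h] := leP k%:~R t'.
    rewrite (@floor_def _ t' k); first by near: t'.
    rewrite h intrD mulr1z /=; near: t'; exact: lt_nbhsl.
  rewrite (@floor_def _ t' (k - 1)); first by near: t'.
  rewrite subrK h andbT; apply: ltW; near: t'; apply: lt_nbhsr.
  by rewrite intrB mulr1z kt ltrBlDr ltrDl.
exact: H.
Unshelve. all: by end_near. Qed.

Lemma floor_addn (t : R) (N : nat) : Num.floor (t + N%:R) = (Num.floor t + N%:Z)%R.
Proof. by rewrite -[N%:R]/(N%:~R) floorDrz ?intrKfloor//; apply/intrP; exists N. Qed.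

Lemma floor_mul_shift (t : R) (N : nat) : Num.floor (N%:R * (t + 1)) = (Num.floor (N%:R * t) + N%:Z)%R.
Proof. by rewrite mulrDr mulr1 floor_addn. Qed.

Lemma frac_bounds (t : R) : 0 <= t - (Num.floor t)%:~R <= 1.
Proof.
by have /andP[h1 h2] := floor_itv t; rewrite subr_ge0 h1 lerBlDr addrC; move: h2; rewrite intrD mulr1z => /ltW.
Qed.

Lemma periodic_int (T : Type) (g : R -> T) (k : int) t : Defs.periodic 1 g -> g (t + k%:~R) = g t.
Proof.
move=> pg; have Hn (m : nat) s : g (s + m%:R) = g s.
  by elim: m s => [|m IH] s; [rewrite addr0|rewrite -natr1 addrA pg].
case: k => m; first exact: Hn.
by rewrite NegzE mulrNz -[in RHS](subrK m.+1%:R t) Hn.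
Qed.

Lemma loop_unif_cont K (f : R -> 'rV[R]_K) (eta : R) : continuous f -> Defs.periodic 1 f -> 0 < eta ->
  exists2 d : R, 0 < d & forall s t, `|s - t| < d -> `|f s - f t| < eta.
Proof.
move=> cf pf eta0.
have /compact_near_coveringP cI := @segment_compact R 0 1.
have : \forall d \near (0:R)^'+, `[0, 1]%classic `<=` (fun t => forall s, `|s - t| < d -> `|f s - f t| < eta).
  apply: cI => t0 _.
  have /cvgrPdist_lt/(_ (eta / 2)) : f t @[t --> t0] --> f t0 by exact: cf.
  rewrite divr_gt0// => /(_ isT) [r /= r0 Hr].
  near=> t d => s /= st.
  have dr : d < r / 2 by near: d; apply: nbhs_right_lt; rewrite divr_gt0.
  have tr : `|t0 - t| < r / 2.
    near: t; have c : (t0 - t) @[t --> t0] --> t0 - t0 by apply: cvgB; [exact: cvg_cst|exact: cvg_id].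
    by rewrite subrr in c; move: c => /cvg_norm; rewrite normr0 => c; apply: (cvgr_lt _ c); rewrite divr_gt0.
  have h1 : `|f t0 - f t| < eta / 2 by apply: Hr; rewrite /ball_ /=; lra.
  have h2 : `|f t0 - f s| < eta / 2.
    by apply: Hr; rewrite /ball_ /= -(subrKA t) (le_lt_trans (ler_normD _ _))// [X in _ + X]distrC /=; lra.
  by rewrite -(subrKA (f t0)) (le_lt_trans (ler_normD _ _))// distrC; lra.
move=> Hd; near (0:R)^'+ => d.
have d0 : 0 < d by near: d; exact: nbhs_right_gt.
have Hd2 : `[0, 1]%classic `<=` (fun t => forall s, `|s - t| < d -> `|f s - f t| < eta) by near: d.
exists d => // s t st.
have E (u : R) : f u = f (u - (Num.floor t)%:~R) by rewrite -mulrNz (periodic_int _ _ pf).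
rewrite (E s) (E t); apply: Hd2; first by rewrite /= in_itv /= frac_bounds.
by rewrite opprB addrA subrK.
Unshelve. all: by end_near. Qed.

End Concatenation.

Section DiscreteLoops.
Context {R : realType} {n : nat} {M : topologicalType} {SM : smooth_manifold R n M}.
Context {K : nat} {e : M -> 'rV[R]_K}.
Hypotheses (cM : compact [set: M]) (Ce : CkM SM 2 e) (einj : injective e)
  (imm : forall (i : chart SM) x (v : 'rV[R]_n), chart_dom i x -> 'D_v (in_chart i e) (chart_coord i x) = 0 -> v = 0).

(* [y : int -> M] represents an N-periodic discrete loop, [y k] being at time k/N. *)
Definition follows (N : nat) (y : int -> M) (rho : R) (h : R -> M) :=
  forall t, `|e (h t) - e (y (Num.floor (N%:R * t)))| <= rho.

Definition discrete_class (g : R -> M) (rho : R) (N : nat) (y : int -> M) :=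
  exists h, [/\ loop h, homotopic g h & follows N y rho h].

(** Three facts at one scale [rho]: close loops are homotopic, the class of a discrete loop is
    stable under small displacements of its nodes, and every loop has arbitrarily fine
    discretizations with steps O(1/N). The loop is merely continuous, so it is first replaced by [m]
    Lipschitz arcs, each of which is cut into [l] steps; hence N is a multiple of [m] and the
    constant does not depend on [l]. *)
Lemma discrete_loops : exists rho0 : R, 0 < rho0 /\ forall rho : R, 0 < rho -> rho <= rho0 ->
  [/\ forall g h : R -> M, loop g -> loop h -> (forall t, `|e (g t) - e (h t)| <= 3 * rho) -> homotopic g h,
   (exists2 delta : R, 0 < delta & forall g N y y', discrete_class g rho N y ->
    (forall k, `|e (y k) - e (y' k)| <= rho) -> (forall k, y' (k + N%:Z) = y' k) ->
    (forall k, `|e (y' (k + 1)) - e (y' k)| <= delta) -> discrete_class g rho N y') &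
   forall g : R -> M, loop g -> exists (m : nat) (C : R), (0 < m)%N /\ forall l, (0 < l)%N ->
     exists y : int -> M, [/\ discrete_class g rho (m * l) y, forall k, y (k + (m * l)%N%:Z) = y k &
       forall k, `|e (y (k + 1)) - e (y k)| <= C / (m * l)%N%:R]].
Proof.
have [c [r [L [[r0 L0] c0 cL c1 cc]]]] := local_contraction cM Ce einj imm.
have [d d0 Hd] := path_exists cM Ce einj imm.
have close (g h : R -> M) : loop g -> loop h -> (forall t, `|e (g t) - e (h t)| < r) -> homotopic g h.
  move=> [cg pg] [ch ph] gh; exists (fun p => c p.1 (g p.2) (h p.2)); split=> [|u t /=|t|t].
  - exact: cc.
  - by rewrite pg ph.
  - by rewrite /= c0.
  - by rewrite /= c1.
have /choice[P /= HP] : forall yy : M * M, exists gam : R -> M, `|e yy.1 - e yy.2| < d ->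
    [/\ continuous gam, gam 0 = yy.1, gam 1 = yy.2 &
    forall s t, 0 <= s <= 1 -> 0 <= t <= 1 -> `|e (gam s) - e (gam t)| <= d^-1 * `|e yy.1 - e yy.2| * `|s - t|].
  move=> [y y']; have [/Hd[gam H]|] := pselect (`|e y - e y'| < d); first by exists gam.
  by exists (fun _ => y).
pose G (y : int -> M) (k : int) := P (y k, y (k + 1)).
have interp N (y : int -> M) : (forall k, y (k + N%:Z) = y k) -> (forall k, `|e (y (k + 1)) - e (y k)| < d) ->
    let h t := G y (Num.floor (N%:R * t)) (N%:R * t - (Num.floor (N%:R * t))%:~R) in
    loop h /\ forall t, `|e (h t) - e (y (Num.floor (N%:R * t)))| <=
      d^-1 * `|e (y (Num.floor (N%:R * t) + 1)) - e (y (Num.floor (N%:R * t)))|.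
  move=> py yd h; have yd' k : `|e (y k) - e (y (k + 1))| < d by rewrite distrC.
  split; last first.
    move=> t; rewrite /h; set k := Num.floor _; have [_ G0 _ GL] := HP (y k, y (k + 1)) (yd' k).
    have f01 := frac_bounds (N%:R * t); rewrite -/k in f01.
    have := GL _ 0 f01; rewrite lexx ler01 => /(_ isT); rewrite -/(G y k) -{1}/(G y k 0) /G G0 => /le_trans; apply.
    rewrite distrC ler_piMr//; first by rewrite mulr_ge0// invr_ge0 ltW.
    by rewrite subr0 ger0_norm; case/andP: f01.
  split.
    have cG : continuous (fun t : R => G y (Num.floor t) (t - (Num.floor t)%:~R)).
      apply: concat_continuous => k; first by have [] := HP (y k, y (k + 1)) (yd' k).
      by rewrite /G; have [_ _ -> _] := HP (y k, y (k + 1)) (yd' k); have [_ -> _ _] := HP (y (k + 1), y ((k + 1) + 1)) (yd' (k + 1)).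
    move=> t; apply: (@continuous_comp _ _ _ (fun t : R => N%:R * t) (fun t : R => G y (Num.floor t) (t - (Num.floor t)%:~R))); last exact: cG.
    by apply: cvgMr; exact: cvg_id.
  move=> t; rewrite /h floor_mul_shift /G addrAC !py; congr (P _ _).
  by rewrite mulrDr mulr1 intrD; lra.
(* The sum of three distances of at most [rho] must stay below the radius [r] of the contraction. *)
exists (r / 4); split; first by rewrite divr_gt0.
move=> rho rho0 rhor; split.
- by move=> g h lg lh H; apply: close => // t; apply: le_lt_trans (H t) _; lra.
- pose delta := Num.min (d / 2) (d * rho).
  exists delta; first by rewrite lt_min divr_gt0// mulr_gt0.
  move=> g N y y' [h [lh gh Hh]] yy' py' yd.
  have yd2 k : `|e (y' (k + 1)) - e (y' k)| < d.
    by apply: le_lt_trans (yd k) _; rewrite /delta gt_min; apply/orP; left; lra.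
  have [lh' Hh'] := interp N y' py' yd2; set h' := (fun t => _) in lh' Hh'.
  have Hr t : `|e (h' t) - e (y' (Num.floor (N%:R * t)))| <= rho.
    apply: le_trans (Hh' t) _; rewrite ler_pdivrMl//; apply: le_trans (yd _) _.
    by rewrite /delta ge_min lexx orbT.
  exists h'; split=> //; apply: homotopic_trans gh _; apply: close => // t.
  set k := Num.floor (N%:R * t).
  have h1 := Hh t; have h2 := Hr t; have h3 := yy' k; rewrite -/k in h1 h2.
  have -> : e (h t) - e (h' t) = (e (h t) - e (y k)) + (e (y k) - e (y' k)) - (e (h' t) - e (y' k)).
    by apply/rowP => j; rewrite !mxE; ring.
  rewrite (le_lt_trans (ler_normB _ _))//.
  have := ler_normD (e (h t) - e (y k)) (e (y k) - e (y' k)); lra.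
(* The three bounds keep consecutive samples within reach of [path_exists], each arc within [rho] of
   its points, and the loop of arcs within [r] of [g]. *)
- move=> g lg; pose eta := Num.min (d / 2) (Num.min (d * rho) (r / 4)).
  have eta0 : 0 < eta by rewrite !lt_min !divr_gt0// mulr_gt0.
  have [eta1 [eta2 eta3]] : eta <= d / 2 /\ (eta <= d * rho /\ eta <= r / 4).
    by split; [|split]; rewrite /eta !ge_min lexx ?orbT.
  have [cg pg] := lg.
  have [w w0 Hw] : exists2 w : R, 0 < w & forall s t, `|s - t| < w -> `|e (g s) - e (g t)| < eta.
    apply: (@loop_unif_cont _ _ (e \o g)) => // [t|t]; last by rewrite /= pg.
    by apply: continuous_comp; [exact: cg|exact: (e_continuous Ce)].
  pose m := (Num.bound w^-1).+1; have mw : m%:R^-1 < w.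
    rewrite -[ltRHS]invrK ltf_pV2 ?posrE ?invr_gt0 ?ltr0Sn//.
    apply: lt_le_trans (archi_boundP (_ : 0 <= w^-1)) _; first by rewrite invr_ge0 ltW.
    by rewrite ler_nat.
  have m0 : (0 : R) < m%:R by rewrite ltr0Sn.
  pose y0 (k : int) := g (k%:~R / m%:R).
  have py0 k : y0 (k + m%:Z) = y0 k.
    by rewrite /y0 intrD mulrDl divff ?gt_eqF// pg.
  have y0d k : `|e (y0 (k + 1)) - e (y0 k)| < eta.
    apply: Hw; rewrite -mulrBl intrD mulr1z addrAC subrr add0r div1r gtr0_norm ?invr_gt0//.
  have y0d' k : `|e (y0 (k + 1)) - e (y0 k)| < d by apply: lt_le_trans (y0d k) _; lra.
  have y0d'' k : `|e (y0 k) - e (y0 (k + 1))| < d by rewrite distrC.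
  have [lh Hh] := interp m y0 py0 y0d'; set h := (fun t => _) in lh Hh.
  have gh : homotopic g h.
    apply: close => // t; set k := Num.floor (m%:R * t).
    have h1 : `|e (g t) - e (y0 k)| < eta.
      apply: Hw; have /andP[f0 f1] := floor_itv (m%:R * t); rewrite -/k intrD mulr1z in f0 f1.
      have -> : t - k%:~R / m%:R = (m%:R * t - k%:~R) / m%:R by field; rewrite gt_eqF.
      rewrite normrM normfV (gtr0_norm m0) ltr_pdivrMr// ger0_norm ?subr_ge0//.
      apply: (@lt_trans _ _ 1); first by rewrite ltrBlDl.
      by rewrite -ltr_pdivrMr// div1r.
    have h2 := Hh t; rewrite -/k in h2.
    have h3 : d^-1 * `|e (y0 (k + 1)) - e (y0 k)| <= d^-1 * eta by rewrite ler_pM2l ?invr_gt0// ltW.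
    have h4 : d^-1 * eta <= rho by rewrite ler_pdivrMl.
    rewrite -(subrKA (e (y0 k))) (le_lt_trans (ler_normD _ _))// [X in _ + X]distrC; lra.
  exists m, (d^-1 * eta * m%:R); split=> // l l0.
  have l0' : (0 : R) < l%:R by rewrite ltr0n.
  have lz : l%:Z != 0 by rewrite eqz_nat -lt0n.
  pose y (k : int) := G y0 (k %/ l%:Z)%Z ((k %% l%:Z)%Z%:~R / l%:R).
  have r01 (k : int) : 0 <= ((k %% l%:Z)%Z%:~R / l%:R : R) <= 1.
    have h1 := modz_ge0 k lz; have h2 := ltz_mod k lz; rewrite divr_ge0 ?ler0n ?ler0z//= ler_pdivrMr// mul1r.
    by rewrite -[leRHS]/(l%:Z%:~R) ler_int ltW.
  have Gl (q : int) s t : 0 <= s <= 1 -> 0 <= t <= 1 -> `|e (G y0 q s) - e (G y0 q t)| <= d^-1 * eta * `|s - t|.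
    move=> s01 t01; have [_ _ _ GL] := HP (y0 q, y0 (q + 1)) (y0d'' q); apply: le_trans (GL _ _ s01 t01) _.
    by rewrite ler_wpM2r// ler_pM2l ?invr_gt0// distrC; exact: ltW (y0d q).
  exists y; split.
  + exists h; split=> // t; set x := m%:R * t.
    have El : (Num.floor ((m * l)%N%:R * t) %/ l%:Z)%Z = Num.floor x.
      have /andP[f0 f1] := floor_itv x; rewrite intrD mulr1z in f1.
      set F := Num.floor _; set q := Num.floor x in f0 f1 *.
      have xE : (m * l)%N%:R * t = l%:Z%:~R * x by rewrite /x natrM mulrCA mulrA.
      have F0 : (l%:Z * q <= F)%R by rewrite /F floor_ge_int xE intrM ler_pM2l.
      have F1 : (F < l%:Z * (q + 1))%R by rewrite /F floor_lt_int xE intrM ltr_pM2l// intrD mulr1z.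
      have -> : F = (q * l%:Z + (F - l%:Z * q))%R by ring.
      rewrite divzMDl// divz_small ?addr0//; clear -F0 F1; lia.
    rewrite /y El /h -/x; apply: (le_trans (Gl _ _ _ (frac_bounds x) (r01 _))).
    apply: (@le_trans _ _ (d^-1 * eta)); last by rewrite ler_pdivrMl.
    apply: ler_piMr; first by apply: mulr_ge0; [rewrite invr_ge0 ltW|exact: ltW].
    have /andP[a0 a1] := frac_bounds x; have /andP[b0 b1] := r01 (Num.floor ((m * l)%N%:R * t)).
    by rewrite ler_norml; apply/andP; split; lra.
  + move=> k; rewrite /y /G PoszM addrC divzMDl// modzMDl.
    by rewrite [(m%:Z + _)%R]addrC addrAC !py0.
  + move=> k; have -> : d^-1 * eta * m%:R / (m * l)%:R = d^-1 * eta * l%:R^-1 by rewrite natrM; field; rewrite !gt_eqF.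
    have h1 := modz_ge0 k lz; have h2 := ltz_mod k lz; have kE := divz_eq k l%:Z.
    set q := (k %/ l%:Z)%Z in kE; set r' := (k %% l%:Z)%Z in h1 h2 kE.
    have step s t : 0 <= s <= 1 -> 0 <= t <= 1 -> s - t = l%:R^-1 -> `|e (G y0 q s) - e (G y0 q t)| <= d^-1 * eta * l%:R^-1.
      move=> s01 t01 st; apply: (le_trans (Gl _ _ _ s01 t01)).
      by rewrite st ger0_norm// invr_ge0 ltW.
    (* Inside an arc the next node is one step further; after the last step it is the start of the
       next arc, which is the point of this arc at time 1. *)
    have [lt|ge] := ltP (r' + 1)%R l%:Z.
      have E1 : ((k + 1) %/ l%:Z)%Z = q by rewrite kE -addrA divzMDl// divz_small ?addr0//; clear -h1 h2 lt; lia.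
      have E2 : ((k + 1) %% l%:Z)%Z = (r' + 1)%R by rewrite kE -addrA modzMDl modz_small//; clear -h1 h2 lt; lia.
      have := r01 (k + 1); rewrite /y E1 E2 -/q -/r' => r1'; apply: (step _ _ r1' (r01 k)).
      by rewrite -/r' -mulrBl intrD mulr1z addrAC subrr add0r div1r.
    have rE : (r' + 1)%R = l%:Z by clear -h1 h2 ge; lia.
    have E1 : ((k + 1) %/ l%:Z)%Z = (q + 1)%R by rewrite kE -addrA rE -[X in (_ + X)%R]mul1r -mulrDl mulzK.
    have E2 : ((k + 1) %% l%:Z)%Z = 0 by rewrite kE -addrA rE -[X in (_ + X)%R]mul1r -mulrDl modzMl.
    rewrite /y E1 E2 mul0r -/q -/r'.
    have -> : G y0 (q + 1) 0 = G y0 q 1.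
      by have [_ _ X _] := HP (y0 q, y0 (q + 1)) (y0d'' q); have [_ Y _ _] := HP (y0 (q + 1), y0 ((q + 1) + 1)) (y0d'' (q + 1)); rewrite /G X Y.
    apply: step; [by rewrite ler01 lexx|exact: (r01 k)|].
    rewrite -/r' (_ : r' = l%:Z - 1); last by rewrite -rE addrK.
    by rewrite intrB mulr1z mulrBl divff ?gt_eqF// opprB addrC subrK div1r.
Qed.

End DiscreteLoops.

(** * The discrete action and its critical points *)

Section PointwiseTopology.

Lemma ptws_cvgP (I : Type) (T : topologicalType) (F : set_system {ptws I -> T}) (u : {ptws I -> T}) :
  Filter F -> (forall i, (fun v : {ptws I -> T} => v i) @ F --> u i) -> F --> u.
Proof.
move=> FF HF; apply/cvg_sup => i A /= [_ [[B oB <-] Bu] BA].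
have FB : F ((fun v : {ptws I -> T} => v i) @^-1` B) by apply: HF; exact: open_nbhs_nbhs.
by rewrite nbhs_filterE; apply: filterS BA FB.
Qed.

Lemma ptws_eval (I : eqType) (T : topologicalType) (i : I) : continuous (fun v : {ptws I -> T} => v i).
Proof. exact: (@proj_continuous I (fun=> T) i). Qed.

Lemma ptws_continuous (I : Type) (T Z : topologicalType) (f : Z -> {ptws I -> T}) z :
  (forall i, f z' i @[z' --> z] --> f z i) -> f z' @[z' --> z] --> f z.
Proof. by move=> H; apply: ptws_cvgP => i; exact: H. Qed.

End PointwiseTopology.

(** With at least two nodes, the terms of the action at [j] and at its predecessor are distinct, and
    a change of node [j] affects exactly these two. *)
Lemma ordS_neq (N0 : nat) (j : 'I_N0.+2) : ordS j != j.
Proof.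
apply/eqP => /(congr1 val) /=; have := ltn_ord j; rewrite leq_eqVlt => /orP[/eqP E|lt].
  by rewrite E modnn => E0; rewrite -E0 in E.
by rewrite modn_small//; lia.
Qed.

Section DiscreteAction.
Context {R : realType} {n : nat} {M : topologicalType} {SM : smooth_manifold R n M}.
Context {K : nat} {e : M -> 'rV[R]_K}.
Local Notation dom := (@chart_dom _ _ SM).
Local Notation phi := (@chart_coord _ _ SM).
Local Notation Pm := (Pm (SM := SM) (e := e)).
Hypotheses (cM : compact [set: M]) (Ce : CkM SM 2 e) (einj : injective e)
  (imm : forall (i : chart SM) x (v : 'rV[R]_n), dom i x -> 'D_v (in_chart i e) (phi i x) = 0 -> v = 0).
Local Notation cov := (cov Ce).
Variable H : cotangent SM -> R.
Hypothesis sH : smooth_function (cotangent_atlas SM) H.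
Variables (A a b r1 : R).
Hypotheses (ab : a < b) (A0 : 0 < A) (r10 : 0 < r1).
Variable N0 : nat.
Local Notation N := N0.+2.
Local Notation X := {ptws 'I_N -> (M * 'rV[R]_K)%type}.
Implicit Types (u : X) (i : chart SM) (j : 'I_N).

Lemma ham_continuous : continuous H.
Proof.
apply: (@cot_continuous _ _ _ _ _ H (fun i => ham_chart H i)) => [i z dz|i xi y ixi].
  by rewrite /ham_chart (in_chart_cot Ce imm H dz).
exact: (sH i 0%N _ (cot_imgP Ce imm y ixi)).
Qed.

Definition normal_part (x : M) (p : 'rV[R]_K) : 'rV[R]_K := p - p *m Pm x.
(* Momenta range over the whole of R^K; the quadratic term forces them to be almost tangent. *)
Definition potM (x : M) (p : 'rV[R]_K) : R :=
  cutoff A a b (H (cov x p)) + 2^-1 * pairing (normal_part x p) (normal_part x p).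

Lemma rem_normal i x p : dom i x -> nrem (SM := SM) (e := e) i (phi i x) p = normal_part x p.
Proof. by move=> dx; rewrite /nrem /normal_part (PmE Ce imm dx). Qed.

Lemma ham_chart_cov i x p : dom i x -> ham_chart H i (phi i x, ymap (SM := SM) (e := e) i (phi i x) p) = H (cov x p).
Proof.
move=> dx; rewrite /ymap -(cov_comp Ce p dx) /ham_chart.
exact: (in_chart_cot Ce imm H (z := cov x p) dx).
Qed.

Lemma pot_potM i x p : dom i x -> pot (SM := SM) (e := e) H A a b i (phi i x) p = potM x p.
Proof. by move=> dx; rewrite /pot (ham_chart_cov p dx) (rem_normal p dx). Qed.

Definition xs u j : M := (u j).1.
Definition ps u j : 'rV[R]_K := (u j).2.
Local Notation h := (N%:R^-1 : R).

Definition actB u : R := \sum_j (pairing (ps u j) (e (xs u (ordS j)) - e (xs u j)) - h * potM (xs u j) (ps u j)).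
Definition actg u : R := h * \sum_j pen r1 (ps u j).
Local Notation F := (action_at actB actg).

Section Convergence.
Context {T : Type} {G : set_system T} {FG : Filter G} (U : T -> X) (u : X).
Hypotheses (cx : forall j, xs (U t) j @[t --> G] --> xs u j) (cp : forall j, ps (U t) j @[t --> G] --> ps u j).

Lemma exs_cvg j : e (xs (U t) j) @[t --> G] --> e (xs u j).
Proof.
have c : {for xs u j, continuous e} := e_continuous Ce (x := xs u j).
exact: (cvg_comp _ _ (@cx j) c).
Qed.

Lemma potM_cvg j : potM (xs (U t) j) (ps (U t) j) @[t --> G] --> potM (xs u j) (ps u j).
Proof.
have cc : cov (xs (U t) j) (ps (U t) j) @[t --> G] --> cov (xs u j) (ps u j) by exact: (@cov_cvg _ _ _ _ _ _ Ce T G _ _ _ _ FG (@cx j) (@cp j)).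
have cH0 : {for cov (xs u j) (ps u j), continuous H} by exact: ham_continuous.
have cH := cvg_comp _ _ cc cH0.
have cP0 : {for xs u j, continuous Pm} by exact: Pm_cvg.
have cP : Pm (xs (U t) j) @[t --> G] --> Pm (xs u j) := cvg_comp _ _ (@cx j) cP0.
have cn : normal_part (xs (U t) j) (ps (U t) j) @[t --> G] --> normal_part (xs u j) (ps u j).
  exact: (cvgB (@cp j) (mulmx_cvg (@cp j) cP)).
apply: cvgD; last by apply: cvgMr; exact: (pairing_cvg cn cn).
have cf : {for H (cov (xs u j) (ps u j)), continuous (cutoff A a b)}.
  exact: differentiable_continuous (cutoff_derive A a b _ 0).1.
exact: (cvg_comp _ _ cH cf).
Qed.

Lemma actB_cvg : actB (U t) @[t --> G] --> actB u.
Proof.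
apply: sum_cvg => j _; apply: cvgB; last by apply: cvgMr; exact: potM_cvg.
exact: (pairing_cvg (@cp j) (cvgB (@exs_cvg (ordS j)) (@exs_cvg j))).
Qed.

Lemma actg_cvg : actg (U t) @[t --> G] --> actg u.
Proof.
apply: cvgMr; apply: sum_cvg => j _.
have c : {for ps u j, continuous (pen r1)} := pen_continuous r10 (x := ps u j).
exact: (cvg_comp _ _ (@cp j) c).
Qed.

Lemma dist_cvg u0 : \sum_j (`|e (xs (U t) j) - e (xs u0 j)| + `|ps (U t) j - ps u0 j|) @[t --> G] -->
  \sum_j (`|e (xs u j) - e (xs u0 j)| + `|ps u j - ps u0 j|).
Proof.
apply: sum_cvg => j _; apply: cvgD.
  exact: (cvg_norm (cvgB (@exs_cvg j) (cvg_cst (e (xs u0 j))))).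
exact: (cvg_norm (cvgB (@cp j) (cvg_cst (ps u0 j)))).
Qed.

End Convergence.

Lemma xs_cvg u j : xs v j @[v --> u] --> xs u j.
Proof. by apply: (@continuous_comp _ _ _ (fun v : X => v j) fst); [exact: ptws_eval|exact: cvg_fst]. Qed.

Lemma ps_cvg u j : ps v j @[v --> u] --> ps u j.
Proof. by apply: (@continuous_comp _ _ _ (fun v : X => v j) snd); [exact: ptws_eval|exact: cvg_snd]. Qed.

Lemma actB_continuous : continuous actB.
Proof. by move=> u; exact: (@actB_cvg X (nbhs u) (nbhs_filter u) id u (@xs_cvg u) (@ps_cvg u)). Qed.

Lemma actg_continuous : continuous actg.
Proof. by move=> u; exact: (@actg_cvg X (nbhs u) (nbhs_filter u) id u (@ps_cvg u)). Qed.

Lemma actg_ge0 u : 0 <= actg u.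
Proof. by apply: mulr_ge0; [rewrite invr_ge0|apply: sumr_ge0 => j _; exact: pen_ge0]. Qed.

Definition node_at s u j (x : M) (p : 'rV[R]_K) : R :=
  pairing p (e (xs u (ordS j)) - e x) + pairing (ps u (ord_pred j)) (e x - e (xs u (ord_pred j))) -
  h * (potM x p + s * pen r1 p).

Lemma node_atE s u j i x p : dom i x -> node_at s u j x p =
  node (SM := SM) (e := e) H A a b r1 i h s (e (xs u (ordS j))) (e (xs u (ord_pred j))) (ps u (ord_pred j)) (phi i x) p.
Proof. by move=> dx; rewrite /node_at /node pot_potM// in_chartE. Qed.

Definition upd u j (z : M * 'rV[R]_K) : X := fun k => if k == j then z else u k.

Lemma upd_id u j : upd u j (u j) = u.
Proof. by apply/funext => k; rewrite /upd; case: eqP => [->|]. Qed.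

Lemma action_upd s u j z : F s (upd u j z) - F s u = node_at s u j z.1 z.2 - node_at s u j (xs u j) (ps u j).
Proof.
have Sj := ordS_neq j; have Pj : ord_pred j != j by rewrite -[X in _ != X]ord_predK eq_sym ordS_neq.
have SP k : k != ord_pred j -> ordS k != j by move=> hk; apply: contra hk => /eqP <-; rewrite ordSK.
pose T s u k := pairing (ps u k) (e (xs u (ordS k)) - e (xs u k)) - h * potM (xs u k) (ps u k) - s * (h * pen r1 (ps u k)).
have FE s' u' : F s' u' = \sum_k T s' u' k.
  by rewrite /action_at /actB /actg !mulr_sumr -sumrB.
have D u' : \sum_k T s u' k = T s u' j + (T s u' (ord_pred j) + \sum_(k | (k != j) && (k != ord_pred j)) T s u' k).
  by rewrite (bigD1 j)//= (bigD1 (ord_pred j)).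
rewrite !FE !D.
have -> : \sum_(k | (k != j) && (k != ord_pred j)) T s (upd u j z) k = \sum_(k | (k != j) && (k != ord_pred j)) T s u k.
  apply: eq_bigr => k /andP[kj kp]; rewrite /T /ps /xs /upd (negPf kj) (negPf (SP _ kp)); by [].
rewrite /T /node_at /ps /xs /upd eqxx (negPf Sj) (negPf Pj) ord_predK eqxx.
set S := \sum_(_ | _) _; set P1 := pairing z.2 _; set P2 := pairing _ (e z.1 - _).
set V1 := potM z.1 _; set W1 := pen _ z.2; set Q1 := pairing (u j).2 _; set Q2 := pairing _ _.
set V2 := potM (u (ord_pred j)).1 _; set W2 := pen _ (u (ord_pred j)).2; set V3 := potM _ _; set W3 := pen _ _.
by clearbody S P1 P2 V1 W1 Q1 Q2 V2 W2 V3 W3; ring.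
Qed.

(* [dist u] measures the distance to [u]; its balls form a basis of neighbourhoods. *)
Definition dist u (v : X) : R := \sum_j (`|e (xs v j) - e (xs u j)| + `|ps v j - ps u j|).

Lemma dist_continuous u : continuous (dist u).
Proof. by move=> v; exact: (@dist_cvg X (nbhs v) (nbhs_filter v) id v (@xs_cvg v) (@ps_cvg v) u). Qed.

Lemma dist_id u : dist u u = 0.
Proof. by rewrite /dist big1// => j _; rewrite !subrr !normr0 addr0. Qed.

Lemma dist_le u v j : `|e (xs v j) - e (xs u j)| <= dist u v /\ `|ps v j - ps u j| <= dist u v.
Proof.
rewrite /dist (bigD1 j)//=; set S := \sum_(_ | _) _.
have S0 : 0 <= S by apply: sumr_ge0 => k _; rewrite addr_ge0.
have := normr_ge0 (e (xs v j) - e (xs u j)); have := normr_ge0 (ps v j - ps u j); lra.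
Qed.

(** The balls of [dist] generate a filter; it converges to [u] in the product topology because it
    does so in each position, by [e_nbhs], and in each momentum. *)
Lemma dist_nbhs u (W : set X) : nbhs u W -> exists2 r : R, 0 < r & forall v, dist u v < r -> W v.
Proof.
pose B r := [set v | dist u v < r].
have FB : Filter (filter_from [set r : R | 0 < r] B).
  apply: filter_from_filter; first by exists 1 => /=.
  move=> r r' r0 r'0; exists (Num.min r r') => /=; first by rewrite lt_min r0.
  by move=> v; rewrite /B /= lt_min => /andP.
have FU : filter_from [set r : R | 0 < r] B --> u.
  apply: ptws_cvgP => j.
  have c1 : xs v j @[v --> filter_from [set r : R | 0 < r] B] --> xs u j.
    move=> V /(e_nbhs cM Ce einj)[r r0 Hr]; exists r => // v vr.
    by apply: Hr; apply: le_lt_trans vr; have [] := dist_le u v j.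
  have c2 : ps v j @[v --> filter_from [set r : R | 0 < r] B] --> ps u j.
    apply/cvgrPdist_lt => eps eps0; exists eps => // v vr /=.
    by rewrite distrC; apply: le_lt_trans vr; have [] := dist_le u v j.
  have -> : (fun v : X => v j) = (fun v => (xs v j, ps v j)) by apply/funext => v; rewrite /xs /ps -surjective_pairing.
  have -> : u j = (xs u j, ps u j) by rewrite /xs /ps -surjective_pairing.
  exact: pair_cvg.
by move=> /FU [r r0 Hr]; exists r.
Qed.

End DiscreteAction.

(** * Admissible moves of a discrete loop *)

Section Moves.
Context {R : realType} {n : nat} {M : topologicalType} {SM : smooth_manifold R n M}.
Context {K : nat} {e : M -> 'rV[R]_K}.
Local Notation dom := (@chart_dom _ _ SM).
Local Notation phi := (@chart_coord _ _ SM).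
Hypotheses (cM : compact [set: M]) (Ce : CkM SM 2 e) (einj : injective e)
  (imm : forall (i : chart SM) x (v : 'rV[R]_n), dom i x -> 'D_v (in_chart i e) (phi i x) = 0 -> v = 0).
Variable H : cotangent SM -> R.
Hypothesis sH : smooth_function (cotangent_atlas SM) H.
Variables (A a b r1 : R).
Hypotheses (ab : a < b) (A0 : 0 < A) (r10 : 0 < r1).
Variable N0 : nat.
Local Notation N := N0.+2.
Local Notation X := {ptws 'I_N -> (M * 'rV[R]_K)%type}.
Implicit Types (u : X) (i : chart SM) (j : 'I_N).

Local Notation xs := (@xs R M K N0).
Local Notation ps := (@ps R M K N0).
Local Notation h := (N%:R^-1 : R).
Local Notation actB := (@actB R n M SM K e Ce H A a b N0).
Local Notation actg := (@actg R M K r1 N0).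
Local Notation F := (action_at actB actg).
Local Notation dist := (@dist R M K e N0).
Local Notation dnode := (dnode (SM := SM) (e := e) H A a b r1).
Local Notation node := (node (SM := SM) (e := e) H A a b r1).

Variables (delta rho : R) (g0 : R -> M).
Hypothesis rho0 : 0 < rho.
Hypothesis trans : forall y y', discrete_class (e := e) g0 rho N y ->
    (forall k, `|e (y k) - e (y' k)| <= rho) -> (forall k, y' (k + N%:Z) = y' k) ->
    (forall k, `|e (y' (k + 1)) - e (y' k)| <= delta) -> discrete_class (e := e) g0 rho N y'.

Definition idx (k : int) : 'I_N := inord `|(k %% N%:Z)%Z|%N.

Lemma idxS k : idx (k + 1) = ordS (idx k).
Proof.
have NN : N%:Z != 0 by [].
have lt (q : int) : (`|(q %% N%:Z)%Z| < N)%N.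
  by rewrite -ltz_nat gez0_abs ?modz_ge0// ltz_pmod.
apply: val_inj; rewrite /idx /= !inordK//.
have [q E] : exists q : nat, (k %% N%:Z)%Z = q%:Z by exists `|(k %% N%:Z)%Z|%N; rewrite gez0_abs// modz_ge0.
by rewrite -modzDml E -[1]/(1%:Z) -PoszD modz_nat !absz_nat addn1.
Qed.

Lemma idxN k : idx (k + N%:Z) = idx k.
Proof. by rewrite /idx modzDr. Qed.

(** The bound on the increments lets the class survive small displacements of the nodes. The set is
    closed, so positions are varied only where this bound is strict. *)
Definition X0 u := (forall j, `|e (xs u (ordS j)) - e (xs u j)| <= delta) /\
  discrete_class (e := e) g0 rho N (fun k => xs u (idx k)).

Lemma X0_transfer u v : X0 u -> (forall j, `|e (xs u j) - e (xs v j)| <= rho) ->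
  (forall j, `|e (xs v (ordS j)) - e (xs v j)| <= delta) -> X0 v.
Proof.
move=> [_ cu] uv dv; split=> //; apply: trans cu _ _ _ => k //; first by rewrite idxN.
by rewrite idxS.
Qed.

Lemma X0_closed : closed [set u : X | X0 u].
Proof.
move=> u cu.
have du j : `|e (xs u (ordS j)) - e (xs u j)| <= delta.
  rewrite leNgt; apply/negP => lt.
  have c : `|e (xs v (ordS j)) - e (xs v j)| @[v --> u] --> `|e (xs u (ordS j)) - e (xs u j)|.
    apply: (@cvg_norm _ _ _ (nbhs u) (nbhs_filter u)); apply: (@cvgB _ _ _ (nbhs u) (nbhs_filter u)).
      exact: (@exs_cvg _ _ _ _ _ _ Ce N0 X (nbhs u) id u (@xs_cvg _ _ _ _ u) _).
    exact: (@exs_cvg _ _ _ _ _ _ Ce N0 X (nbhs u) id u (@xs_cvg _ _ _ _ u) _).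
  have nv : \forall v \near u, delta < `|e (xs v (ordS j)) - e (xs v j)| by exact: (cvgr_gt _ c _ lt).
  by have [v [[dv _] /=]] := cu _ nv; rewrite ltNge dv.
have nd : \forall v \near u, dist u v < rho.
  have c := @dist_continuous _ _ _ _ _ _ Ce N0 u u.
  by apply: (cvgr_lt _ c); rewrite dist_id.
have [v [Xv /= dv]] := cu _ nd.
apply: (X0_transfer Xv) => // j; apply: ltW; apply: le_lt_trans dv.
by have [] := dist_le (e := e) u v j.
Qed.

Lemma scale_cvg (T : Type) (G : set_system T) (FG : Filter G) (W : normedModType R) (f : T -> R) (l : R) (w : W) :
  f t @[t --> G] --> l -> f t *: w @[t --> G] --> l *: w.
Proof. by move=> cf; apply: cvgZr_tmp. Qed.

Section Move.
Context {Y : topologicalType}.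
Variables (Far : set Y) (base_map : Y -> X) (G0 : R).
Hypothesis far : forall y, Far y -> G0 <= actg (base_map y).

(** The maps are prescribed where the penalty of the base map is large; moves act only where the
    penalty is small and hence preserve this condition. *)
Definition Gam : set (Y -> X) := [set gam | [/\ continuous gam, forall y, X0 (gam y) & forall y, Far y -> gam y = base_map y]].

(** A node with negative differential in the direction (v, w) is displaced by [T u] times that
    direction, the time [T] being a cutoff supported near [u0]. Moving the position requires strict
    inequalities for the two adjacent increments, in order to stay in [X0]; moving the momentum
    alone, v = 0, is always allowed. The bound on [actg] keeps the support away from the base maps
    over [Far]. *)
Lemma exists_move s u0 j i v w : X0 u0 -> dom i (xs u0 j) -> actg u0 < G0 ->
  (v = 0 \/ (`|e (xs u0 (ordS j)) - e (xs u0 j)| < delta /\ `|e (xs u0 j) - e (xs u0 (ord_pred j))| < delta)) ->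
  dnode i h s (e (xs u0 (ordS j))) (ps u0 (ord_pred j)) (phi i (xs u0 j)) (ps u0 j) v w < 0 ->
  exists2 Phi : X -> X, admissible_move X0 Gam actB actg s Phi & F s (Phi u0) < F s u0.
Proof.
move=> X0u0 dx gu0 vd dneg.
pose x0 := xs u0 j.
pose pos (t : R) u := t *: v + phi i (xs u j).
pose mom (t : R) u := t *: w + ps u j.
pose nx t u := chart_inv x0 i (pos t u).
have cxi u : dom i (xs u j) -> phi i (xs u' j) @[u' --> u] --> phi i (xs u j).
  by move=> d; have c := chart_continuous d; exact: (cvg_comp _ _ (@xs_cvg _ _ _ _ u j) c).
(* the conditions which make the move by [t (v, w)] possible are open *)
pose FF := nbhs ((0 : R), u0); have fF : Filter FF := nbhs_filter _.
have near_ok : \forall p \near FF, [/\ dom i (xs p.2 j) /\ img i (pos p.1 p.2),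
    dnode i h s (e (xs p.2 (ordS j))) (ps p.2 (ord_pred j)) (pos p.1 p.2) (mom p.1 p.2) v w < 0,
    `|e (xs p.2 j) - e (nx p.1 p.2)| < rho,
    v = 0 \/ (`|e (xs p.2 (ordS j)) - e (nx p.1 p.2)| < delta /\ `|e (nx p.1 p.2) - e (xs p.2 (ord_pred j))| < delta) &
    actg p.2 < G0].
  have c2 : snd p @[p --> FF] --> u0 by exact: cvg_snd.
  have c1 : fst p @[p --> FF] --> (0 : R) by exact: cvg_fst.
  have cx k : xs p.2 k @[p --> FF] --> xs u0 k by exact: (cvg_comp _ _ c2 (@xs_cvg _ _ _ _ u0 k)).
  have cp k : ps p.2 k @[p --> FF] --> ps u0 k by exact: (cvg_comp _ _ c2 (@ps_cvg _ _ _ _ u0 k)).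
  have cex k : e (xs p.2 k) @[p --> FF] --> e (xs u0 k) by exact: (@exs_cvg _ _ _ _ _ _ Ce N0 _ FF snd u0 cx k).
  have cpos : pos p.1 p.2 @[p --> FF] --> phi i (xs u0 j).
    have h1 : p.1 *: v @[p --> FF] --> (0 : R) *: v by apply: cvgZr_tmp; exact: c1.
    have h2 : phi i (xs p.2 j) @[p --> FF] --> phi i (xs u0 j) by exact: (cvg_comp _ _ c2 (cxi _ dx)).
    by have h3 := cvgD h1 h2; rewrite scale0r add0r in h3; exact: h3.
  have cmom : mom p.1 p.2 @[p --> FF] --> ps u0 j.
    have h1 : p.1 *: w @[p --> FF] --> (0 : R) *: w by apply: cvgZr_tmp; exact: c1.
    by have h3 := cvgD h1 (cp j); rewrite scale0r add0r in h3; exact: h3.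
  have i0 := chart_imgP dx.
  have cnx : nx p.1 p.2 @[p --> FF] --> xs u0 j.
    have c := @chart_inv_continuous _ _ _ _ x0 i _ i0; rewrite chart_invK// in c.
    exact: (cvg_comp _ _ cpos c).
  have cenx : e (nx p.1 p.2) @[p --> FF] --> e (xs u0 j).
    have c : {for xs u0 j, continuous e} := e_continuous Ce (x := xs u0 j).
    exact: (cvg_comp _ _ cnx c).
  have n1 : \forall p \near FF, dom i (xs p.2 j) := cx j _ (chart_nbhs dx).
  have n2 : \forall p \near FF, img i (pos p.1 p.2).
    by apply: cpos; apply: open_nbhs_nbhs; split=> //; exact: chart_img_open.
  have n3 : \forall p \near FF, dnode i h s (e (xs p.2 (ordS j))) (ps p.2 (ord_pred j)) (pos p.1 p.2) (mom p.1 p.2) v w < 0.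
    have c := dnode_cvg Ce imm sH r10 fF i0 (cex (ordS j)) (cp (ord_pred j)) cpos cmom.
    exact: (cvgr_lt _ (c A a b h s v w) _ dneg).
  have n4 : \forall p \near FF, `|e (xs p.2 j) - e (nx p.1 p.2)| < rho.
    have c : `|e (xs p.2 j) - e (nx p.1 p.2)| @[p --> FF] --> `|e (xs u0 j) - e (xs u0 j)| by exact: (cvg_norm (cvgB (cex j) cenx)).
    by apply: (cvgr_lt _ c); rewrite subrr normr0.
  have n5 : \forall p \near FF, v = 0 \/ (`|e (xs p.2 (ordS j)) - e (nx p.1 p.2)| < delta /\ `|e (nx p.1 p.2) - e (xs p.2 (ord_pred j))| < delta).
    case: vd => [->|[l1 l2]]; first by apply: nearW => ?; left.
    have c : `|e (xs p.2 (ordS j)) - e (nx p.1 p.2)| @[p --> FF] --> `|e (xs u0 (ordS j)) - e (xs u0 j)|.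
      by exact: (cvg_norm (cvgB (cex (ordS j)) cenx)).
    have c' : `|e (nx p.1 p.2) - e (xs p.2 (ord_pred j))| @[p --> FF] --> `|e (xs u0 j) - e (xs u0 (ord_pred j))|.
      by exact: (cvg_norm (cvgB cenx (cex (ord_pred j)))).
    have m1 : \forall p \near FF, `|e (xs p.2 (ordS j)) - e (nx p.1 p.2)| < delta by exact: (cvgr_lt _ c _ l1).
    have m2 : \forall p \near FF, `|e (nx p.1 p.2) - e (xs p.2 (ord_pred j))| < delta by exact: (cvgr_lt _ c' _ l2).
    by apply: filterS2 m1 m2 => p; right.
  have n6 : \forall p \near FF, actg p.2 < G0.
    have c0 : {for u0, continuous actg} by exact: actg_continuous.
    have c : actg p.2 @[p --> FF] --> actg u0 by exact: (cvg_comp _ _ c2 c0).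
    exact: (cvgr_lt _ c _ gu0).
  have n12 : \forall p \near FF, dom i (xs p.2 j) /\ img i (pos p.1 p.2) by exact: filterI.
  have n123 := filterI n12 (filterI n3 (filterI n4 (filterI n5 n6))).
  by apply: filterS (n123 fF fF fF fF) => p [? [? [? []]]].
have [tau [r [tau0 r0 ok]]] : exists tau r : R, [/\ 0 < tau, 0 < r & forall t u, 0 <= t <= tau -> dist u0 u < r ->
   [/\ dom i (xs u j) /\ img i (pos t u),
    dnode i h s (e (xs u (ordS j))) (ps u (ord_pred j)) (pos t u) (mom t u) v w < 0,
    `|e (xs u j) - e (nx t u)| < rho,
    v = 0 \/ (`|e (xs u (ordS j)) - e (nx t u)| < delta /\ `|e (nx t u) - e (xs u (ord_pred j))| < delta) &
    actg u < G0]].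
  case: near_ok => -[P Q] [/= /nbhs_ballP[tau /= tau0 HP] nQ] HPQ.
  have [r r0 Hr] := dist_nbhs cM Ce einj nQ.
  exists (tau / 2), r; split=> [||t u /andP[t0 tt] ur]; [by rewrite divr_gt0|by []|].
  apply: (HPQ (t, u)); split=> /=; last exact: Hr.
  by apply: HP; rewrite /ball /= sub0r normrN ger0_norm//; lra.
(* The displacement has full time at [u0] and stops at distance r / 2, half the radius on which the
   conditions hold, so that [Phi] is continuous. *)
pose beta u := clamp (1 - 2 * dist u0 u / r).
pose T u := tau * beta u.
have T01 u : 0 <= T u <= tau.
  have /andP[b0 b1] := clamp01 (1 - 2 * dist u0 u / r); rewrite /T /beta.
  apply/andP; split; first by apply: mulr_ge0 => //; exact: ltW.
  by rewrite -[leRHS]mulr1 ler_pM2l.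
pose Phi u : X := if dist u0 u < r then upd u j (nx (T u) u, mom (T u) u) else u.
have betaout u : r / 2 <= dist u0 u -> T u = 0.
  move=> hr; rewrite /T /beta clamp0 ?mulr0// subr_le0 ler_pdivlMr// mul1r; lra.
have Tid u : dist u0 u < r -> T u = 0 -> upd u j (nx (T u) u, mom (T u) u) = u.
  move=> ur ->; have := ok 0 u; rewrite lexx ltW// => /(_ isT ur)[[du _] _ _ _ _].
  by rewrite /nx /mom /pos !scale0r !add0r chart_invK// /xs /ps -surjective_pairing upd_id.
have Phi_out u : r / 2 < dist u0 u -> Phi u = u.
  move=> hr; rewrite /Phi; case: ltP => // ur; apply: Tid => //; apply: betaout; exact: ltW.
have dec u : dist u0 u < r -> 0 < T u -> F s (Phi u) < F s u.
  move=> ur T0; rewrite /Phi ur -subr_lt0 (action_upd _ _ _ _ _ _ _ _) /=; [|assumption ..].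
  have [[du iu] _ _ _ _] := ok (T u) u (T01 u) ur.
  have [dn pn] := chart_invP x0 iu.
  rewrite (node_atE Ce imm _ _ _ _ _ _ _ _ _ dn) (node_atE Ce imm _ _ _ _ _ _ _ _ _ du) -/(nx _ _) pn; [|assumption ..].
  pose f (z : 'rV[R]_n * 'rV[R]_K) := node i h s (e (xs u (ordS j))) (e (xs u (ord_pred j))) (ps u (ord_pred j)) z.1 z.2.
  have lin t : t *: (v, w) + (phi i (xs u j), ps u j) = (pos t u, mom t u) by [].
  have fd t : 0 <= t <= T u -> has_derivative f (pos t u, mom t u)
      (fun d => dnode i h s (e (xs u (ordS j))) (ps u (ord_pred j)) (pos t u) (mom t u) d.1 d.2).
    move=> /andP[t0 tT]; apply: (node_hd Ce imm sH).
      exact: r10.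
    have tt : 0 <= t <= tau by rewrite t0 (le_trans tT)//; case/andP: (T01 u).
    by have [[]] := ok t u tt ur.
  have [t|t tT E] := mvt_line (f := f) (x := (phi i (xs u j), ps u j)) (v := (v, w)) T0.
    by move=> /fd [df _]; rewrite lin; exact: derivable_dir.
  move: E; rewrite !lin => E.
  rewrite -[X in X - _]/(f (pos (T u) u, mom (T u) u)) -[X in _ - X]/(f (phi i (xs u j), ps u j)) E.
  have /andP[t0 t1] := tT; have t01 : 0 <= t <= T u by rewrite !ltW.
  rewrite (fd t t01).2 pmulr_rlt0//=.
  have tt : 0 <= t <= tau by rewrite ltW//= (le_trans (ltW t1))//; case/andP: (T01 u).
  by have [] := ok t u tt ur.
have xsPhi (u' : X) (k : 'I_N) : k != j -> xs (Phi u') k = xs u' k.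
  by move=> kj; rewrite /Phi; case: ifP => // _; rewrite /xs /upd (negPf kj).
have cPhi : continuous Phi.
  move=> u; have [ur|ur] := ltP (dist u0 u) r; last first.
    have E : {near u, id =1 Phi}.
      near=> u'; rewrite Phi_out//; near: u'.
      have c := @dist_continuous _ _ _ _ _ _ Ce N0 u0 u.
      by apply: (cvgr_gt _ c); lra.
    rewrite /continuous_at (_ : Phi u = u); last by rewrite /Phi ltNge ur.
    exact: (@near_eq_cvg _ _ (nbhs u) (nbhs_filter u) _ _ E).
  have E : {near u, (fun u => upd u j (nx (T u) u, mom (T u) u)) =1 Phi}.
    near=> u'; rewrite /Phi ifT//; near: u'.
    have c := @dist_continuous _ _ _ _ _ _ Ce N0 u0 u.
    exact: (cvgr_lt _ c).
  have [[du iu] _ _ _ _] := ok (T u) u (T01 u) ur.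
  have c : (upd u' j (nx (T u') u', mom (T u') u') : X) @[u' --> u] --> (upd u j (nx (T u) u, mom (T u) u) : X).
    apply: ptws_continuous => k; rewrite /upd; case: eqP => [_|_]; last exact: ptws_eval.
    have cT : T u' @[u' --> u] --> T u.
      have ck : {for dist u0 u, continuous (fun d : R => tau * clamp (1 - 2 * d / r))}.
        apply: cvgMr; apply: clamp_cvg; apply: cvgB; first exact: cvg_cst.
        by apply: cvgMl; apply: cvgMr; exact: cvg_id.
      have cd : {for u, continuous (dist u0)} by exact: dist_continuous.
      exact: (cvg_comp _ _ cd ck).
    have c1 : pos (T u') u' @[u' --> u] --> pos (T u) u.
      have h1 : T u' *: v @[u' --> u] --> T u *: v by exact: (scale_cvg (nbhs_filter u) cT).
      exact: (cvgD h1 (cxi _ du)).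
    have c2 : mom (T u') u' @[u' --> u] --> mom (T u) u.
      have h1 : T u' *: w @[u' --> u] --> T u *: w by exact: (scale_cvg (nbhs_filter u) cT).
      exact: (cvgD h1 (@ps_cvg _ _ _ _ u j)).
    apply: (pair_cvg (nbhs_filter u)); last exact: c2.
    have ci : {for pos (T u) u, continuous (chart_inv x0 i)} := @chart_inv_continuous _ _ _ _ x0 i _ iu.
    exact: (cvg_comp _ _ c1 ci).
  rewrite /continuous_at {2}/Phi ur; apply: cvg_trans c.
  exact: (@near_eq_cvg _ _ (nbhs u) (nbhs_filter u) _ _ E).
have XPhi u : X0 u -> X0 (Phi u).
  move=> Xu; have [ur|ur] := ltP (dist u0 u) r; last by rewrite /Phi ltNge ur.
  have [[du iu] _ l1 l2 _] := ok (T u) u (T01 u) ur.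
  have xj : xs (Phi u) j = nx (T u) u by rewrite /Phi ur /xs /upd eqxx.
  have [v0|[l3 l4]] := l2.
    have same k : xs (Phi u) k = xs u k.
      have [->|/xsPhi//] := eqVneq k j.
      by rewrite xj /nx /pos v0 scaler0 add0r chart_invK.
    apply: (X0_transfer Xu) => [k|k]; rewrite !same; [by rewrite subrr normr0; exact: ltW|exact: Xu.1].
  apply: (X0_transfer Xu) => k.
    have [->|/xsPhi->] := eqVneq k j; first by rewrite xj; exact: ltW l1.
    by rewrite subrr normr0; exact: ltW.
  have [->|kj] := eqVneq k j; first by rewrite xj (xsPhi u (ordS j) (ordS_neq j)); exact: ltW l3.
  have [Sk|Sk] := eqVneq (ordS k) j; last by rewrite (xsPhi u _ kj) (xsPhi u _ Sk); exact: Xu.1.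
  have kP : k = ord_pred j by rewrite -Sk ordSK.
  by rewrite Sk xj (xsPhi u _ kj) kP; exact: ltW l4.
exists Phi; last first.
  apply: dec; first by rewrite dist_id.
  by rewrite /T /beta dist_id mulr0 mul0r subr0 clamp1// mulr1.
split=> //.
- move=> u; have [ur|ur] := ltP (dist u0 u) r; last by left; rewrite /Phi ltNge ur.
  have /andP[T0 _] := T01 u; move: T0; rewrite le_eqVlt => /orP[/eqP T0|T0]; last by right; exact: dec.
  by left; rewrite /Phi ur Tid.
- move=> gam [cg Xg fg]; split=> [y|y|y Fy] /=.
  + by apply: continuous_comp; [exact: cg|exact: cPhi].
  + exact: XPhi.
  + rewrite fg// /Phi; case: ifP => // ur; have [_ _ _ _] := ok (T (base_map y)) _ (T01 _) ur.
    by rewrite ltNge far.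
Unshelve. all: by end_near. Qed.

End Move.

End Moves.

(** * Critical points of the discrete action *)

Section DiscreteCritical.
Context {R : realType} {n : nat} {M : topologicalType} {SM : smooth_manifold R n M}.
Context {K : nat} {e : M -> 'rV[R]_K}.
Local Notation dom := (@chart_dom _ _ SM).
Local Notation phi := (@chart_coord _ _ SM).
Hypotheses (cM : compact [set: M]) (Ce : CkM SM 2 e) (einj : injective e)
  (imm : forall (i : chart SM) x (v : 'rV[R]_n), dom i x -> 'D_v (in_chart i e) (phi i x) = 0 -> v = 0).
Local Notation cov := (cov Ce).
Variable H : cotangent SM -> R.
Hypothesis sH : smooth_function (cotangent_atlas SM) H.
Variables (A a b r1 : R).
Hypotheses (ab : a < b) (A0 : 0 < A) (r10 : 0 < r1).
Variable N0 : nat.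
Local Notation N := N0.+2.
Local Notation X := {ptws 'I_N -> (M * 'rV[R]_K)%type}.
Implicit Types (u : X) (i : chart SM) (j : 'I_N).

Local Notation xs := (@xs R M K N0).
Local Notation ps := (@ps R M K N0).
Local Notation h := (N%:R^-1 : R).
Local Notation actB := (@actB R n M SM K e Ce H A a b N0).
Local Notation actg := (@actg R M K r1 N0).
Local Notation F := (action_at actB actg).
Local Notation dnode := (dnode (SM := SM) (e := e) H A a b r1).

Variables (delta rho : R) (g0 : R -> M).
Hypothesis rho0 : 0 < rho.
Hypothesis trans : forall y y', discrete_class (e := e) g0 rho N y ->
    (forall k, `|e (y k) - e (y' k)| <= rho) -> (forall k, y' (k + N%:Z) = y' k) ->
    (forall k, `|e (y' (k + 1)) - e (y' k)| <= delta) -> discrete_class (e := e) g0 rho N y'.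

Local Notation X0 := (X0 (e := e) (N0 := N0) delta rho g0).
Variables (x0 : 'I_N -> M) (Lc : R).
Hypothesis x0X : (forall j, `|e (x0 (ordS j)) - e (x0 j)| <= delta) /\
  discrete_class (e := e) g0 rho N (fun k => x0 (idx N0 k)).
Hypothesis x0L : forall j, `|e (x0 (ordS j)) - e (x0 j)| <= Lc / N%:R.
Hypothesis Lc0 : 0 <= Lc.
Hypothesis H0 : forall x, H (cov x 0) <= a.

(** Over the reference loop the pairing at a node is at most K Lc |p| / N, by [pairing_norm_le]; a
    coefficient larger by 1 makes the penalty outweigh it, and the action is at most A + slope (r1 +
    1). *)
Definition slope : R := K%:R * Lc + 1.
(** The constant [K] of [minimax_critical] for C = A + slope (r1 + 1) and a parameter interval of
    length 1. A cancels in it, which is why the bounds on the penalty do not depend on A. *)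
Definition gbound : R := slope * (r1 + 1) + 1.

Let slope0 : 0 < slope.
Proof. by rewrite ltr_pwDr// mulr_ge0. Qed.

Let N00 : (0 : R) < N%:R.
Proof. by rewrite ltr0Sn. Qed.

Let base_map (y : 'rV[R]_(N * K)) : X := fun j => (x0 j, row j (vec_mx y)).
(** Beyond this radius some momentum is so large that [actg] is at least gbound + 3, above the level
    gbound + 2 that the critical points may reach. *)
Let Rd : R := N%:R * (gbound + 3) + r1 + 2.
Let Far : set 'rV[R]_(N * K) := [set y | Rd <= `|y|].
Let D : set 'rV[R]_(N * K) := [set y | forall k, `[- Rd, Rd]%classic (y ord0 k)].

Let gbound0 : 0 < gbound.
Proof. by apply: ltr_wpDl => //; apply: mulr_ge0; [exact: ltW|apply: addr_ge0 => //; exact: ltW]. Qed.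

Let Rd0 : 0 < Rd.
Proof. by rewrite /Rd; have := mulr_gt0 N00 (addr_gt0 gbound0 (ltr0Sn R 2)); move: r10; lra. Qed.

Lemma ps_bound u G j : actg u <= G -> `|ps u j| <= N%:R * G + r1 + 1.
Proof.
move=> gu; have h1 := pen_ge r1 (ps u j).
suff : pen r1 (ps u j) <= N%:R * G by move: h1; lra.
apply: le_trans (_ : \sum_k pen r1 (ps u k) <= _).
  by rewrite (bigD1 j)//= lerDl sumr_ge0// => k _; exact: pen_ge0.
by move: gu; rewrite /actg ler_pdivrMl.
Qed.

Let base_norm y G : (forall j, `|ps (base_map y) j| <= G) -> 0 <= G -> `|y| <= G.
Proof.
move=> H1 G1; apply: mx_norm_le => // i k; rewrite (ord1 i); case/mxvec_indexP: k => j k.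
have -> : y ord0 (mxvec_index j k) = ps (base_map y) j ord0 k.
  by rewrite /ps /base_map /= !mxE.
exact: le_trans (mx_entry_le _ _ _) (H1 j).
Qed.

Let far y : Far y -> gbound + 3 <= actg (base_map y).
Proof.
move=> Fy; rewrite leNgt; apply/negP => lt.
have := @base_norm y (N%:R * (gbound + 3) + r1 + 1) (fun j => ps_bound j (ltW lt)).
have := Fy; rewrite /Far /= /Rd; have := mulr_gt0 N00 (addr_gt0 gbound0 (ltr0Sn R 2)); move: r10 => ? ? ? H1.
by have := H1 ltac:(lra); lra.
Qed.

Lemma potM_ge x p : - A <= potM (SM := SM) Ce H A a b x p.
Proof.
rewrite /potM; have := pairing_ge0 (normal_part (SM := SM) (e := e) x p).
by have [[_ [-> _]]|[_ [-> _]]|[_ ? _ _]] := cutoff_cases (a := a) (b := b) A0 ab (H (cov x p)); move: A0; lra.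
Qed.

Lemma actB_zero u : (forall j, ps u j = 0) -> actB u = A.
Proof.
move=> pu; rewrite /actB (eq_bigr (fun=> h * A)) => [|j _].
  by rewrite sumr_const card_ord -[LHS]mulr_natl mulrA divff ?gt_eqF// mul1r.
rewrite pu pairing0l sub0r /potM /normal_part mul0mx subr0 pairing0l mulr0 addr0.
have [[_ [-> _]]|[bH _]|[/andP[aH _] _ _ _]] := cutoff_cases (a := a) (b := b) A0 ab (H (cov (xs u j) 0)).
- by rewrite mulrN opprK.
- by have := H0 (xs u j); move: ab; lra.
- by have := H0 (xs u j); lra.
Qed.

Lemma actg_zero u : (forall j, ps u j = 0) -> actg u = 0.
Proof.
move=> pu; rewrite /actg big1 ?mulr0// => j _; rewrite pu.
by have [] := pen_zero (r1 := r1) (p := 0 : 'rV[R]_K) _; rewrite // /eucl pairing0l sqrtr0 ltW.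
Qed.

Let start y : F slope (base_map y) <= A + slope * (r1 + 1).
Proof.
rewrite /action_at /actB /actg !mulr_sumr -sumrB.
apply: (@le_trans _ _ (\sum_(j < N) h * (A + slope * (r1 + 1)))).
  apply: ler_sum => j _; set p := ps _ j.
  have h1 : pairing p (e (x0 (ordS j)) - e (x0 j)) <= h * (K%:R * Lc * `|p|).
    apply: le_trans (ler_norm _) _; apply: le_trans (pairing_norm_le _ _) _.
    have -> : h * (K%:R * Lc * `|p|) = K%:R * (`|p| * (Lc / N%:R)) by ring.
    by rewrite ler_wpM2l// ler_wpM2l.
  have h2 := potM_ge (x0 j) p; have h3 := pen_ge r1 p.
  have hN : 0 < h by rewrite invr_gt0.
  have h4 : h * (slope * (`|p| - r1 - 1)) <= h * (slope * pen r1 p) by rewrite !ler_pM2l.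
  have h5 : h * (- A) <= h * potM (SM := SM) Ce H A a b (x0 j) p by rewrite ler_pM2l.
  have h6 : 0 <= h * `|p| by rewrite mulr_ge0// ltW.
  have key : pairing p (e (x0 (ordS j)) - e (x0 j)) - h * potM (SM := SM) Ce H A a b (x0 j) p - slope * (h * pen r1 p) <=
      h * (K%:R * Lc * `|p|) - h * (- A) - h * (slope * (`|p| - r1 - 1)).
    have -> : slope * (h * pen r1 p) = h * (slope * pen r1 p) by ring.
    by apply: lerB; [apply: lerB|].
  apply: le_trans key _.
  have -> : h * (K%:R * Lc * `|p|) - h * - A - h * (slope * (`|p| - r1 - 1)) = h * (A + slope * (r1 + 1)) - h * `|p|.
    by rewrite /slope; ring.
  by rewrite gerBl.
by rewrite sumr_const card_ord -[leLHS]mulr_natl mulrA divff ?gt_eqF// mul1r.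
Qed.

Let base_continuous_map : continuous base_map.
Proof.
move=> y; apply: ptws_continuous => j; apply: (pair_cvg (nbhs_filter y)); first exact: cvg_cst.
apply: (@mx_cvg R _ (nbhs y) (nbhs_filter y)) => i k; rewrite !mxE.
rewrite (_ : (fun t => _) = (fun y : 'rV[R]_(N * K) => y ord0 (mxvec_index j k))); last by apply/funext => t; rewrite !mxE.
exact: (@coord_continuous R _ _ ord0 (mxvec_index j k) y).
Qed.

(** The momenta of [gam y], as a function of [y], are the identity on the faces of a large cube, so
    the Poincare-Miranda theorem gives a zero. Where all momenta vanish, H <= a and the cutoff is
    -A, so the discrete action equals A. *)
Let link gam : Gam (e := e) delta rho g0 Far base_map gam -> exists2 y, D y & A <= actB (gam y) /\ actg (gam y) = 0.
Proof.
move=> [cg Xg fg].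
pose f (y : 'rV[R]_(N * K)) : 'rV[R]_(N * K) := mxvec (\matrix_(j, k) ps (gam y) j ord0 k).
have fE y j k : f y ord0 (mxvec_index j k) = ps (gam y) j ord0 k by rewrite /f mxvecE mxE.
have cf : continuous f.
  move=> y; apply: (@mx_cvg R _ (nbhs y) (nbhs_filter y)) => i k; rewrite (ord1 i); case/mxvec_indexP: k => j k.
  rewrite (_ : (fun t => _) = (fun y => ps (gam y) j ord0 k)); last by apply/funext => t; rewrite fE.
  rewrite fE; have c : {for gam y, continuous (fun u : X => ps u j)} by exact: ps_cvg.
  have cc : ps (gam y') j @[y' --> y] --> ps (gam y) j by exact: (cvg_comp _ _ (cg y) c).
  by apply: (@mx_entry_cvg R _ (nbhs y) _ _ (fun y' => ps (gam y') j) (ps (gam y) j) ord0 k); exact: cc.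
have face y : Rd <= `|y| -> f y = y.
  move=> Fy; apply/rowP => k; case/mxvec_indexP: k => j k.
  by rewrite fE fg// /ps /base_map /= !mxE.
have nk (y : 'rV[R]_(N * K)) k : `|y ord0 k| = Rd -> Rd <= `|y| by move=> <-; exact: mx_entry_le.
have [y yR f0] := poincare_miranda Rd0 cf
  (fun y k _ yk => ltac:(rewrite (face y (nk y k _)) ?yk ?normrN ?gtr0_norm// oppr_le0 ltW//))
  (fun y k _ yk => ltac:(rewrite (face y (nk y k _)) ?yk ?gtr0_norm// ltW//)).
have p0 j : ps (gam y) j = 0.
  by apply/rowP => k; rewrite -fE f0 !mxE.
exists y; last by rewrite actB_zero// actg_zero.
by move=> k; rewrite /= in_itv /= -ler_norml; exact: le_trans (mx_entry_le _ _ _) yR.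
Qed.

Let compact_sub s eps : compact [set u | [/\ X0 u, actg u <= gbound + 2 & A - eps <= F s u]].
Proof.
pose G := N%:R * (gbound + 2) + r1 + 1.
pose B : set 'rV[R]_K := [set p | forall k, `[- G, G]%classic (p ord0 k)].
have cB : compact B by apply: (@rV_compact R K (fun=> `[- G, G]%classic)) => k; exact: segment_compact.
have cMB : compact ([set: M] `*` B) by exact: compact_setX.
have cT := tychonoff (fun _ : 'I_N => cMB).
apply: (subclosed_compact _ cT); last first.
  move=> u [_ gu _] j; split=> //= k; rewrite /= in_itv /= -ler_norml.
  exact: le_trans (mx_entry_le _ _ _) (ps_bound j gu).
have cF : continuous (F s) by apply: action_at_continuous; [exact: actB_continuous|exact: actg_continuous].
have c1 : closed (actg @^-1` [set x | x <= gbound + 2]).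
  by apply: closed_preimage; [exact: actg_continuous|exact: closed_le].
have c2 : closed (F s @^-1` [set x | A - eps <= x]).
  by apply: closed_preimage; [exact: cF|exact: closed_ge].
rewrite (_ : [set u | _] = [set u | X0 u] `&` (actg @^-1` [set x | x <= gbound + 2]) `&` (F s @^-1` [set x | A - eps <= x])).
  by apply: closedI => //; apply: closedI => //; exact: X0_closed.
by apply/seteqP; split=> u /=; [move=> []|move=> [[]]].
Qed.

Lemma discrete_critical eps : 0 < eps -> exists s u, [/\ slope <= s <= slope + 1, X0 u, actg u <= gbound + 2, A - eps <= F s u &
  forall j i v w, dom i (xs u j) ->
    (v = 0 \/ (`|e (xs u (ordS j)) - e (xs u j)| < delta /\ `|e (xs u j) - e (xs u (ord_pred j))| < delta)) ->
    dnode i h s (e (xs u (ordS j))) (ps u (ord_pred j)) (phi i (xs u j)) (ps u j) v w = 0].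
Proof.
move=> eps0.
have Kg : (A + slope * (r1 + 1) - A + 1) / (slope + 1 - slope) + 2 = gbound + 2.
  by rewrite /gbound [slope + 1]addrC addrK divr1; ring.
have GP gam : Gam (e := e) delta rho g0 Far base_map gam -> continuous gam /\ forall y, X0 (gam y) by move=> [].
have st : exists2 gam, Gam (e := e) delta rho g0 Far base_map gam & forall y, D y -> F slope (gam y) <= A + slope * (r1 + 1).
  by exists base_map => //; split=> // y; exact: x0X.
have ss : slope < slope + 1 by rewrite ltrDl.
have cs s : slope <= s <= slope + 1 ->
    compact [set u | [/\ X0 u, actg u <= (A + slope * (r1 + 1) - A + 1) / (slope + 1 - slope) + 2 & A - eps <= F s u]].
  by move=> _; rewrite Kg; exact: compact_sub.
have cB : continuous actB by exact: actB_continuous.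
have cg : continuous actg by exact: actg_continuous.
have [s [u [{}ss Xu gu Fu crit]]] := minimax_critical cB cg (@actg_ge0 _ _ _ r1 N0) GP ss eps0 link st cs.
rewrite Kg in gu; exists s, u; split=> // j i v w dx vd.
have gu0 : actg u < gbound + 3 by move: gu; lra.
(* No admissible move lowers the action, so the differential is nonnegative in every permitted
   direction; the permitted directions are symmetric, hence it vanishes. *)
have neg v' w' : (v' = 0 \/ (`|e (xs u (ordS j)) - e (xs u j)| < delta /\ `|e (xs u j) - e (xs u (ord_pred j))| < delta)) ->
    0 <= dnode i h s (e (xs u (ordS j))) (ps u (ord_pred j)) (phi i (xs u j)) (ps u j) v' w'.
  move=> vd'; rewrite leNgt; apply/negP => lt.
  have [Phi adm dec] := exists_move cM Ce einj imm sH r10 rho0 trans far Xu dx gu0 vd' lt.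
  by have := crit Phi adm; rewrite leNgt dec.
have [d E] := node_hd Ce imm sH A a b r10 h s (e (xs u (ordS j))) (e (xs u (ord_pred j))) (ps u (ord_pred j)) (ps u j) (chart_imgP dx).
have opp : dnode i h s (e (xs u (ordS j))) (ps u (ord_pred j)) (phi i (xs u j)) (ps u j) (- v) (- w) =
    - dnode i h s (e (xs u (ordS j))) (ps u (ord_pred j)) (phi i (xs u j)) (ps u j) v w.
  have E1 := E (- v, - w); have E2 := E (v, w); rewrite /= in E1 E2.
  rewrite -E1 -E2 (_ : (- v, - w) = (-1) *: (v, w) + 0); last by rewrite scaleN1r addr0.
  by rewrite (derive_lin _ _ _ d) scaleN1r derive0 addr0.
apply/eqP; rewrite eq_le neg// andbT -oppr_ge0 -opp neg//.
by case: vd => [->|]; [left; rewrite oppr0|right].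
Qed.

End DiscreteCritical.

(** * Uniform bounds for critical sequences *)

Lemma sum_bounds (R : realType) (a1 a2 a3 a4 c6 c7 : R) : 0 <= a1 -> 0 <= a2 -> 0 <= a3 -> 0 <= a4 -> 0 <= c6 -> 0 <= c7 ->
  let C := (a1 + 1) + (a2 + 1) + (a3 + 1) + (a4 + 1) + c6 + c7 in
  [/\ a1 + 1 <= C, a2 + 1 <= C & a3 + 1 <= C] /\ [/\ a4 + 1 <= C, c6 <= C & c7 <= C].
Proof. by move=> ? ? ? ? ? ? C; rewrite /C; split; split; lra. Qed.

Section ChartConstants.
Context {R : realType} {n : nat} {M : topologicalType} {SM : smooth_manifold R n M}.
Context {K : nat} {e : M -> 'rV[R]_K}.
Local Notation dom := (@chart_dom _ _ SM).
Local Notation phi := (@chart_coord _ _ SM).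
Local Notation Pm := (Pm (SM := SM) (e := e)).
Hypotheses (cM : compact [set: M]) (Ce : CkM SM 2 e) (einj : injective e)
  (imm : forall (i : chart SM) x (v : 'rV[R]_n), dom i x -> 'D_v (in_chart i e) (phi i x) = 0 -> v = 0).
Local Notation cov := (cov Ce).
Variable H : cotangent SM -> R.
Hypothesis sH : smooth_function (cotangent_atlas SM) H.
Variables (A a b r1 : R).
Hypotheses (ab : a < b) (A0 : 0 < A) (r10 : 0 < r1).
Local Notation dE := (dE (SM := SM) (e := e)).
Hypothesis hr1 : forall z, H z <= b -> eucl (ell Ce imm z) < r1.
Implicit Types (i : chart SM) (x : M) (p : 'rV[R]_K).

Definition pos_force i x p : 'rV[R]_n := cutoff' A a b (H (cov x p)) *: ham_x H i (phi i x, ymap (SM := SM) (e := e) i (phi i x) p).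
Definition velocity i x p : 'rV[R]_n := cutoff' A a b (H (cov x p)) *: ham_y H i (phi i x, ymap (SM := SM) (e := e) i (phi i x) p).
Definition left_inv i (xi : 'rV[R]_n) : 'M[R]_(n, K) := invmx (gram (dE i xi)) *m dE i xi.

Lemma left_inv_Ck i (k : 'I_n) (l : 'I_K) : Ck_on 1 (img i) (fun xi => left_inv i xi k l).
Proof.
apply: Ck_on_mulmx; [exact: chart_img_open| |exact: dE_Ck].
apply: Ck_on_inv; [exact: chart_img_open| |].
  by move=> xi ixi; apply: gram_unit => v; exact: (dE_free' Ce imm ixi).
move=> k' l'; apply: Ck_on_mulmx; [exact: chart_img_open|exact: dE_Ck|].
by move=> j' m; rewrite (_ : (fun xi => _) = (fun xi : 'rV[R]_n => dE i xi m j')); [exact: dE_Ck|apply/funext => xi; rewrite mxE].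
Qed.

Lemma mul_left_inv i x (d : 'rV[R]_K) : dom i x -> d *m (dE i (phi i x))^T *m left_inv i (phi i x) = d *m Pm x.
Proof. by move=> dx; rewrite /left_inv (PmE Ce imm dx) /rowproj !mulmxA. Qed.

Lemma dE_left_inv i xi : img i xi -> dE i xi *m (left_inv i xi)^T = 1%:M.
Proof.
move=> ixi; rewrite /left_inv trmx_mul mulmxA -/(gram _) trmx_inv gram_sym mulmxV//.
by apply: gram_unit => v; exact: (dE_free' Ce imm ixi).
Qed.

Definition good i (C : R) x p := [/\ dom i x, `|pos_force i x p| <= C /\ `|velocity i x p| <= C,
  `|dE i (phi i x)| <= C /\ `|left_inv i (phi i x)| <= C,
  forall k l, `|'D_(delta_mx ord0 k) (erow (SM := SM) (e := e) i l) (phi i x)| <= C &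
  forall k m, `|'D_(delta_mx ord0 k) (prow (SM := SM) (e := e) i m) (phi i x)| <= C].

Lemma good_le i C C' x p : C <= C' -> good i C x p -> good i C' x p.
Proof.
move=> CC [d [g1 g2] [g3 g4] g5 g6]; split; [exact: d|split|split|move=> k l|move=> k m].
- exact: le_trans g1 CC.
- exact: le_trans g2 CC.
- exact: le_trans g3 CC.
- exact: le_trans g4 CC.
- exact: le_trans (g5 k l) CC.
- exact: le_trans (g6 k m) CC.
Qed.

Section Limits.
Context {T : Type} {G : set_system T} {FG : Filter G} (X : T -> M) (Q : T -> 'rV[R]_K) (i : chart SM) (x : M) (p : 'rV[R]_K).
Hypotheses (dx : dom i x) (cx : X t @[t --> G] --> x) (cp : Q t @[t --> G] --> p).

Lemma phi_cvg : phi i (X t) @[t --> G] --> phi i x.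
Proof. by have c := chart_continuous dx; exact: (cvg_comp _ _ cx c). Qed.

Lemma dE_phi_cvg : dE i (phi i (X t)) @[t --> G] --> dE i (phi i x).
Proof. have c := dE_cvg Ce (chart_imgP dx); exact: (cvg_comp _ _ phi_cvg c). Qed.

Lemma left_inv_cvg : left_inv i (phi i (X t)) @[t --> G] --> left_inv i (phi i x).
Proof.
apply: (@mx_cvg R _ G FG _ _ (fun t => left_inv i (phi i (X t)))) => k l.
have c : {for phi i x, continuous (fun xi => left_inv i xi k l)} := Ck_on_le (leq0n 1) (@left_inv_Ck i k l) _ (chart_imgP dx).
exact: (cvg_comp _ _ phi_cvg c).
Qed.

Lemma ham_cvg : H (cov (X t) (Q t)) @[t --> G] --> H (cov x p).
Proof.
have cc : cov (X t) (Q t) @[t --> G] --> cov x p by exact: (@cov_cvg _ _ _ _ _ _ Ce T G _ _ _ _ FG cx cp).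
have c : {for cov x p, continuous H} by exact: (ham_continuous Ce imm sH).
exact: (cvg_comp _ _ cc c).
Qed.

Lemma ymap_cvg : ymap (SM := SM) (e := e) i (phi i (X t)) (Q t) @[t --> G] --> ymap (SM := SM) (e := e) i (phi i x) p.
Proof.
have ct : (dE i (phi i (X t)))^T @[t --> G] --> (dE i (phi i x))^T by exact: trmx_cvg dE_phi_cvg.
exact: (mulmx_cvg cp ct).
Qed.

Lemma cutoff'_ham_cvg : cutoff' A a b (H (cov (X t) (Q t))) @[t --> G] --> cutoff' A a b (H (cov x p)).
Proof.
have c : {for H (cov x p), continuous (cutoff' A a b)} by exact: cutoff'_continuous.
exact: (cvg_comp _ _ ham_cvg c).
Qed.

Lemma force_cvg : pos_force i (X t) (Q t) @[t --> G] --> pos_force i x p.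
Proof.
have [_ c _] := ham_grad_cvg Ce imm sH FG (chart_imgP dx) phi_cvg ymap_cvg.
exact: (cvgZ cutoff'_ham_cvg c).
Qed.

Lemma velocity_cvg : velocity i (X t) (Q t) @[t --> G] --> velocity i x p.
Proof.
have [_ _ c] := ham_grad_cvg Ce imm sH FG (chart_imgP dx) phi_cvg ymap_cvg.
exact: (cvgZ cutoff'_ham_cvg c).
Qed.

End Limits.

Lemma good_local x p : exists C : R, \forall z \near (x, p), good (some_chart x) C z.1 z.2.
Proof.
have dx := some_chartP (SM := SM) x; set i := some_chart x in dx *.
pose FF := nbhs (x, p); have fF : Filter FF := nbhs_filter _.
have cx : fst z @[z --> FF] --> x by exact: cvg_fst.
have cp : snd z @[z --> FF] --> p by exact: cvg_snd.
have bd (V : normedModType R) (f : M * 'rV[R]_K -> V) l : f z @[z --> FF] --> l -> \forall z \near FF, `|f z| <= `|l| + 1.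
  move=> cf; have c : `|f z| @[z --> FF] --> `|l| by exact: cvg_norm.
  have lt : `|l| < `|l| + 1 by rewrite ltrDl.
  have c1 : \forall z \near FF, `|f z| < `|l| + 1 by exact: (cvgr_lt _ c _ lt).
  by apply: filterS c1 => z /ltW.
have bdm (m q : nat) (f : M * 'rV[R]_K -> 'M[R]_(m, q)) l : f z @[z --> FF] --> l -> \forall z \near FF, `|f z| <= `|l| + 1.
  exact: bd.
have n1 : \forall z \near FF, dom i z.1 by apply: cx; exact: chart_nbhs.
have n2 : \forall z \near FF, `|pos_force i z.1 z.2| <= `|pos_force i x p| + 1 by exact: (bdm _ _ _ _ (force_cvg dx cx cp)).
have n3 : \forall z \near FF, `|velocity i z.1 z.2| <= `|velocity i x p| + 1 by exact: (bdm _ _ _ _ (velocity_cvg dx cx cp)).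
have n4 : \forall z \near FF, `|dE i (phi i z.1)| <= `|dE i (phi i x)| + 1 by exact: (bdm _ _ _ _ (dE_phi_cvg dx cx)).
have n5 : \forall z \near FF, `|left_inv i (phi i z.1)| <= `|left_inv i (phi i x)| + 1 by exact: (bdm _ _ _ _ (left_inv_cvg dx cx)).
have n6 k l : \forall z \near FF, `|'D_(delta_mx ord0 k) (erow (SM := SM) (e := e) i l) (phi i z.1)| <=
    `|'D_(delta_mx ord0 k) (erow (SM := SM) (e := e) i l) (phi i x)| + 1.
  have c : 'D_(delta_mx ord0 k) (erow (SM := SM) (e := e) i l) (phi i z.1) @[z --> FF] --> 'D_(delta_mx ord0 k) (erow (SM := SM) (e := e) i l) (phi i x).
    exact: (derive_cvg fF (erow_Ck Ce i l) (chart_imgP dx) (phi_cvg dx cx)).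
  exact: (bdm _ _ _ _ c).
have n7 k m : \forall z \near FF, `|'D_(delta_mx ord0 k) (prow (SM := SM) (e := e) i m) (phi i z.1)| <=
    `|'D_(delta_mx ord0 k) (prow (SM := SM) (e := e) i m) (phi i x)| + 1.
  have c : 'D_(delta_mx ord0 k) (prow (SM := SM) (e := e) i m) (phi i z.1) @[z --> FF] --> 'D_(delta_mx ord0 k) (prow (SM := SM) (e := e) i m) (phi i x).
    exact: (derive_cvg fF (prow_Ck Ce imm i m) (chart_imgP dx) (phi_cvg dx cx)).
  exact: (bdm _ _ _ _ c).
have n6' : \forall z \near FF, forall k, forall l, `|'D_(delta_mx ord0 k) (erow (SM := SM) (e := e) i l) (phi i z.1)| <=
    `|'D_(delta_mx ord0 k) (erow (SM := SM) (e := e) i l) (phi i x)| + 1.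
  by apply: (@near_ord (M * 'rV[R]_K)%type (x, p)) => k; apply: (@near_ord (M * 'rV[R]_K)%type (x, p)) => l; exact: n6.
have n7' : \forall z \near FF, forall k, forall m, `|'D_(delta_mx ord0 k) (prow (SM := SM) (e := e) i m) (phi i z.1)| <=
    `|'D_(delta_mx ord0 k) (prow (SM := SM) (e := e) i m) (phi i x)| + 1.
  by apply: (@near_ord (M * 'rV[R]_K)%type (x, p)) => k; apply: (@near_ord (M * 'rV[R]_K)%type (x, p)) => m; exact: n7.
pose C6 := \sum_k \sum_l (`|'D_(delta_mx ord0 k) (erow (SM := SM) (e := e) i l) (phi i x)| + 1).
pose C7 := \sum_k \sum_m (`|'D_(delta_mx ord0 k) (prow (SM := SM) (e := e) i m) (phi i x)| + 1).
have sumle (m q : nat) (f : 'I_m -> 'I_q -> R) k l : (forall k l, 0 <= f k l) -> f k l <= \sum_k \sum_l f k l.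
  move=> f0; rewrite (bigD1 k)//= (bigD1 l)//= -addrA lerDl addr_ge0// sumr_ge0// => ? _; rewrite ?sumr_ge0//.
have C60 : 0 <= C6 by apply: sumr_ge0 => ? _; apply: sumr_ge0 => ? _; rewrite addr_ge0.
have C70 : 0 <= C7 by apply: sumr_ge0 => ? _; apply: sumr_ge0 => ? _; rewrite addr_ge0.
pose C := (`|pos_force i x p| + 1) + (`|velocity i x p| + 1) + (`|dE i (phi i x)| + 1) + (`|left_inv i (phi i x)| + 1) + C6 + C7.
have m1 := normr_ge0 (pos_force i x p); have m2 := normr_ge0 (velocity i x p).
have m3 := normr_ge0 (dE i (phi i x)); have m4 := normr_ge0 (left_inv i (phi i x)).
have nn := @filterI _ FF fF _ _ n1 (@filterI _ FF fF _ _ n2 (@filterI _ FF fF _ _ n3 (@filterI _ FF fF _ _ n4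
  (@filterI _ FF fF _ _ n5 (@filterI _ FF fF _ _ n6' n7'))))).
exists C; apply: (@filterS _ FF fF _ _ _ nn) => z [e1 [e2 [e3 [e4 [e5 [e6 e7]]]]]].
have [[b1 b2 b3] [b4 b5 b6]] : [/\ `|pos_force i x p| + 1 <= C, `|velocity i x p| + 1 <= C & `|dE i (phi i x)| + 1 <= C] /\
    [/\ `|left_inv i (phi i x)| + 1 <= C, C6 <= C & C7 <= C] := sum_bounds m1 m2 m3 m4 C60 C70.
split; [exact: e1|split|split|move=> k l|move=> k m].
- exact: le_trans e2 b1.
- exact: le_trans e3 b2.
- exact: le_trans e4 b3.
- exact: le_trans e5 b4.
- apply: le_trans (e6 k l) _; apply: le_trans b5.
  by apply: (@sumle _ _ (fun k l => `|'D_(delta_mx ord0 k) (erow (SM := SM) (e := e) i l) (phi i x)| + 1) k l) => ? ?; rewrite addr_ge0.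
- apply: le_trans (e7 k m) _; apply: le_trans b6.
  by apply: (@sumle _ _ (fun k m => `|'D_(delta_mx ord0 k) (prow (SM := SM) (e := e) i m) (phi i x)| + 1) k m) => ? ?; rewrite addr_ge0.
Qed.

Lemma cov_projE x p i : dom i x -> pos_force i x (p *m Pm x) = pos_force i x p /\ velocity i x (p *m Pm x) = velocity i x p.
Proof.
move=> dx; have E : ymap (SM := SM) (e := e) i (phi i x) (p *m Pm x) = ymap (SM := SM) (e := e) i (phi i x) p.
  by rewrite /ymap -mulmxA (Pm_dE Ce imm dx).
by rewrite /pos_force /velocity E (cov_proj Ce imm).
Qed.

(** The bounds hold for all momenta. Force and velocity depend on [p] only through its tangential
    part; where that part exceeds r1, H > b and both vanish, and the remaining pairs lie in the
    product of M with a compact cube. *)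
Lemma chart_constants : exists2 C : R, 0 < C & forall x p, exists2 i, good i C x p &
  (r1 < `|p *m Pm x| -> velocity i x p = 0).
Proof.
have /choice[C0 HC0] : forall z : M * 'rV[R]_K, exists C : R, \forall z' \near z, good (some_chart z.1) C z'.1 z'.2.
  by move=> [x p]; exact: good_local.
pose B : set 'rV[R]_K := [set p | forall k, `[- r1, r1]%classic (p ord0 k)].
have cB : compact B by apply: (@rV_compact R K (fun=> `[- r1, r1]%classic)) => k; exact: segment_compact.
have cMB : compact ([set: M] `*` B) by exact: compact_setX.
have [|l [_ lcov]] := compact_finite_cover (f := fun z => [set z' | good (some_chart z.1) (C0 z) z'.1 z'.2]) cMB.
  by move=> z _; exact: HC0.
pose C := \sum_(z <- l) `|C0 z| + 1.
have Cl z : z \in l -> C0 z <= C.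
  move=> zl; apply: le_trans (ler_norm _) _; rewrite /C (big_rem z)//= -addrA lerDl addr_ge0// sumr_ge0//.
have Cpos : 0 < C by rewrite /C ltr_pwDr// sumr_ge0.
have inB p : `|p| <= r1 -> B p.
  by move=> h k; rewrite /= in_itv /= -ler_norml; exact: le_trans (mx_entry_le _ _ _) h.
have step x p : `|p| <= r1 -> exists i, good i C x p.
  move=> pr; have [z zl gz] := lcov (x, p) (conj Logic.I (inB _ pr)).
  by exists (some_chart z.1); exact: good_le (Cl _ zl) gz.
exists C => // x p; have [pr|pr] := leP `|p *m Pm x| r1.
  have [i gi] := step x _ pr; exists i; last by [].
  have [dx g2 g3 g4 g5] := gi; have [E1 E2] := cov_projE p dx.
  by rewrite E1 E2 in g2.
have [i gi] := step x 0 (ltac:(by rewrite normr0 ltW)).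
have [dx g2 g3 g4 g5] := gi.
have c0 : cutoff' A a b (H (cov x p)) = 0.
  have [[ha [_ ->]]//|[_ [_ ->]]//|[/andP[_ hb] _ _ _]] := cutoff_cases (a := a) (b := b) A0 ab (H (cov x p)).
  have := hr1 (ltW hb); rewrite (ell_cov Ce imm) => /ltW /(le_trans (norm_le_eucl _)).
  by rewrite leNgt pr.
exists i; last by rewrite /velocity c0 scale0r.
split; [exact: dx| |exact: g3|exact: g4|exact: g5].
have z1 : pos_force i x p = 0 by rewrite /pos_force c0 scale0r.
have z2 : velocity i x p = 0 by rewrite /velocity c0 scale0r.
by rewrite z1 z2 !normr0; split; exact: ltW Cpos.
Qed.

End ChartConstants.

Ltac nonneg := repeat (first [apply: mulr_ge0 | apply: addr_ge0 | exact: ltW | exact: ler0n | exact: ler01 | exact: normr_ge0 | done]).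

Lemma pairing_scale_mul (R : realType) (m k : nat) (c : R) (u : 'rV[R]_m) (D : 'M[R]_(m, k)) (w : 'rV[R]_k) :
  pairing ((c *: u) *m D) w = c * pairing u (w *m D^T).
Proof. by rewrite -scalemxAl pairingZl pairing_mulmx. Qed.

Lemma momentum_identity (R : realType) (n K : nat) (p q w a' r pg : 'rV[R]_K) (D : 'M[R]_(n, K)) (hx hy : 'rV[R]_n) (c h s : R) :
  pairing w a' - pairing p (0 *m D) + pairing q (0 *m D) -
    h * (c * (pairing hx 0 + pairing hy (w *m D^T + 0)) + (pairing w r - pairing 0 r) + s * pairing pg w) = 0 ->
  pairing a' w = pairing (h *: ((c *: hy) *m D + r + s *: pg)) w.
Proof.
rewrite [w *m D^T + 0]addr0 mul0mx !pairing0r pairing0l pairingZl !pairingDl pairingZl pairing_scale_mul.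
rewrite [pairing a' w]pairingC [pairing r w]pairingC => E.
by apply/eqP; rewrite -subr_eq0 -[X in _ == X]E; apply/eqP; ring.
Qed.

Lemma position_identity (R : realType) (n K : nat) (p q a' r pg : 'rV[R]_K) (D : 'M[R]_(n, K)) (hx hy v dy : 'rV[R]_n) (dr : 'rV[R]_K)
  (c h s : R) : pairing 0 a' - pairing p (v *m D) + pairing q (v *m D) -
    h * (c * (pairing hx v + pairing hy (0 *m D^T + dy)) + (pairing 0 r - pairing dr r) + s * pairing pg 0) = 0 ->
  pairing (q - p) (v *m D) = h * (pairing (c *: hx) v + pairing (c *: hy) dy - pairing dr r).
Proof.
rewrite mul0mx [0 + dy]add0r !pairing0r !pairing0l pairingBl !pairingZl => E.
by apply/eqP; rewrite -subr_eq0 -[X in _ == X]E; apply/eqP; ring.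
Qed.

Lemma affine_le (R : realType) (x y p : R) : 0 <= x -> 0 <= y -> 0 <= p -> x + y * p <= (x + y) * (1 + p).
Proof. by move=> x0 y0 p0; have := mulr_ge0 x0 p0; lra. Qed.

Section CriticalBounds.
Context {R : realType} {n : nat} {M : topologicalType} {SM : smooth_manifold R n M}.
Context {K : nat} {e : M -> 'rV[R]_K}.
Local Notation dom := (@chart_dom _ _ SM).
Local Notation phi := (@chart_coord _ _ SM).
Local Notation Pm := (Pm (SM := SM) (e := e)).
Hypotheses (cM : compact [set: M]) (Ce : CkM SM 2 e) (einj : injective e)
  (imm : forall (i : chart SM) x (v : 'rV[R]_n), dom i x -> 'D_v (in_chart i e) (phi i x) = 0 -> v = 0).
Variable H : cotangent SM -> R.
Hypothesis sH : smooth_function (cotangent_atlas SM) H.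
Variables (A a b r1 : R).
Hypotheses (ab : a < b) (A0 : 0 < A) (r10 : 0 < r1).
Local Notation dE := (dE (SM := SM) (e := e)).
Hypothesis hr1 : forall z, H z <= b -> eucl (ell Ce imm z) < r1.
Implicit Types (i : chart SM) (x : M) (p : 'rV[R]_K).

Local Notation vel := (velocity (SM := SM) Ce H A a b).
Local Notation frc := (pos_force (SM := SM) Ce H A a b).
Local Notation nrm := (normal_part (SM := SM) (e := e)).
Local Notation dymap := (dymap (SM := SM) (e := e)).
Local Notation drem := (drem (SM := SM) (e := e)).
Local Notation good := (good (SM := SM) Ce H A a b).
Local Notation dnode := (dnode (SM := SM) (e := e) H A a b r1).

Lemma dymap0 i xi p : dymap i xi p 0 = 0.
Proof. by apply/rowP => k; rewrite dymap_entry derive0 pairing0r mxE. Qed.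

Lemma drem0 i xi p : drem i xi p 0 = 0.
Proof. by apply/rowP => k; rewrite drem_entry derive0 pairing0r mxE. Qed.

(** The Euler-Lagrange equation in the momentum of one node; it determines the chord to the next
    node. *)
Lemma dnode_momentum i (h s : R) (a' q : 'rV[R]_K) x p : dom i x ->
  (forall w, dnode i h s a' q (phi i x) p 0 w = 0) ->
  a' - e x = h *: (vel i x p *m dE i (phi i x) + nrm x p + s *: pen_grad r1 p).
Proof.
move=> dx crit; apply: pairing_inj => w; have := crit w.
rewrite /dnode /dpot dymap0 drem0 (ham_chart_cov Ce imm H p dx) (rem_normal Ce imm p dx) in_chartE//.
exact: momentum_identity.
Qed.

Lemma dnode_position i (h s : R) (a' q : 'rV[R]_K) x p v : dom i x ->
  dnode i h s a' q (phi i x) p v 0 = 0 ->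
  pairing (q - p) (v *m dE i (phi i x)) =
  h * (pairing (frc i x p) v + pairing (vel i x p) (dymap i (phi i x) p v) -
       pairing (drem i (phi i x) p v) (nrm x p)).
Proof.
move=> dx; rewrite /dnode /dpot (ham_chart_cov Ce imm H p dx) (rem_normal Ce imm p dx).
exact: position_identity.
Qed.

(** Projecting on the normal space kills the velocity, and the penalty gradient is a nonnegative
    multiple of [p], so its normal part only reinforces that of [p]. *)
Lemma momentum_normal i (h s : R) (d : 'rV[R]_K) x p : 0 <= s -> 0 < h -> dom i x ->
  d = h *: (vel i x p *m dE i (phi i x) + nrm x p + s *: pen_grad r1 p) ->
  `|nrm x p| <= h^-1 * `|d *m (1%:M - Pm x)|.
Proof.
move=> s0 h0 dx ->.
have np : nrm x p *m (1%:M - Pm x) = nrm x p.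
  by rewrite /nrm mulmxBr mulmx1 mulmxBl -mulmxA (Pm_idem Ce imm) subrr subr0.
have [c c0 cE] := pen_grad_scale r1 p.
have pp : p *m (1%:M - Pm x) = nrm x p by rewrite mulmxBr mulmx1.
move: np pp; set r := nrm x p; clearbody r => np pp.
rewrite -scalemxAl !mulmxDl -mulmxA mulmxBr mulmx1 (dE_Pm Ce imm dx) subrr mulmx0 add0r np cE scalerA -scalemxAl pp.
rewrite -[X in X + _]scale1r -scalerDl normrZ gtr0_norm// mulrA mulVf ?gt_eqF// mul1r normrZ.
have h1 : 0 <= s * c by exact: mulr_ge0.
by rewrite ger0_norm ?addr_ge0// mulrDl mul1r lerDl mulr_ge0.
Qed.

Lemma velocity_bound i (C : R) x p : good i C x p -> `|vel i x p *m dE i (phi i x)| <= n%:R * (C * C).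
Proof.
move=> [_ [_ g1] [g2 _] _ _]; apply: (le_trans (mulmx_norm_le _ _)).
by apply: ler_wpM2l => //; apply: ler_pM.
Qed.

Definition force_const (C : R) : R := n%:R * ((C + n%:R * (C * (K%:R * ((r1 + 1) * C))) + K%:R * (K%:R * C)) * C).

(** The force is bounded, the velocity vanishes unless the tangential momentum is at most r1, and
    the variation of the projection costs |p| times the normal part, itself at most 1. So the bound
    is affine in |p| and can be summed knowing only the mean of |p|. *)
Lemma momentum_step i (C h : R) x p (q : 'rV[R]_K) : 0 < h -> 0 < C -> good i C x p -> (r1 < `|p *m Pm x| -> vel i x p = 0) ->
  `|nrm x p| <= 1 ->
  (forall v, pairing (q - p) (v *m dE i (phi i x)) =
  h * (pairing (frc i x p) v + pairing (vel i x p) (dymap i (phi i x) p v) -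
       pairing (drem i (phi i x) p v) (nrm x p))) ->
  `|(q - p) *m Pm x| <= h * (force_const C * (1 + `|p|)).
Proof.
move=> h0 C0 [dx [g1 g2] [g3 g4] g5 g6] gv nr E.
have KC0 : 0 <= K%:R * C by rewrite mulr_ge0// ltW.
have dyb k : `|dymap i (phi i x) p (delta_mx ord0 k)| <= K%:R * (`|p| * C).
  apply: mx_norm_le => [|a' l]; first by rewrite !mulr_ge0// ltW.
  rewrite (ord1 a') dymap_entry; apply: (le_trans (pairing_norm_le _ _)).
  by apply: ler_wpM2l => //; apply: ler_wpM2l => //; exact: g5.
have drb k : `|drem i (phi i x) p (delta_mx ord0 k)| <= K%:R * (`|p| * C).
  apply: mx_norm_le => [|a' l]; first by rewrite !mulr_ge0// ltW.
  rewrite (ord1 a') drem_entry; apply: (le_trans (pairing_norm_le _ _)).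
  by apply: ler_wpM2l => //; apply: ler_wpM2l => //; exact: g6.
set C4 := C + n%:R * (C * (K%:R * ((r1 + 1) * C))) + K%:R * (K%:R * C).
have t1 k : `|pairing (frc i x p) (delta_mx ord0 k)| <= C.
  by rewrite pairing_delta; exact: le_trans (mx_entry_le _ _ _) g1.
have t2 k : `|pairing (vel i x p) (dymap i (phi i x) p (delta_mx ord0 k))| <= n%:R * (C * (K%:R * ((r1 + 1) * C))).
  have r0 : 0 <= n%:R * (C * (K%:R * ((r1 + 1) * C))) by nonneg.
  have [/gv ->|pr] := ltP r1 `|p *m Pm x|; first by rewrite pairing0l normr0.
  apply: (le_trans (pairing_norm_le _ _)); apply: ler_wpM2l => //; apply: ler_pM => //.
  apply: (le_trans (dyb k)); apply: ler_wpM2l => //; apply: ler_wpM2r; first exact: ltW.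
  have -> : p = p *m Pm x + nrm x p by rewrite /normal_part addrC subrK.
  exact: le_trans (ler_normD _ _) (lerD pr nr).
have t3 k : `|pairing (drem i (phi i x) p (delta_mx ord0 k)) (nrm x p)| <= K%:R * (K%:R * (`|p| * C)).
  apply: (le_trans (pairing_norm_le _ _)); apply: ler_wpM2l => //.
  by rewrite -[leRHS]mulr1; apply: ler_pM.
have p1 : 0 <= `|p| by [].
have C40 : 0 <= n%:R * (C * (K%:R * ((r1 + 1) * C))) by nonneg.
have yb : `|(q - p) *m (dE i (phi i x))^T| <= h * (C4 * (1 + `|p|)).
  have C4p : 0 <= h * (C4 * (1 + `|p|)).
    by rewrite /C4; nonneg.
  apply: mx_norm_le => // a' k; rewrite (ord1 a') -pairing_delta pairing_mulmx trmxK E normrM gtr0_norm// ler_pM2l//.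
  apply: le_trans (ler_normB _ _) _.
  have h1 := le_trans (ler_normD _ _) (lerD (t1 k) (t2 k)).
  apply: (le_trans (lerD h1 (t3 k))).
  have -> : K%:R * (K%:R * (`|p| * C)) = K%:R * (K%:R * C) * `|p| by ring.
  by apply: affine_le => //; nonneg.
rewrite -(mul_left_inv Ce imm _ dx); apply: (le_trans (mulmx_norm_le _ _)).
have -> : h * (force_const C * (1 + `|p|)) = n%:R * (h * (C4 * (1 + `|p|)) * C) by rewrite /force_const -/C4; ring.
by apply: ler_wpM2l => //; apply: ler_pM.
Qed.

Lemma telescope_bound (V : normedModType R) (m : nat) (f : nat -> V) (c : nat -> R) (k l : nat) :
  (forall j, (j.+1 < m)%N -> `|f j.+1 - f j| <= c j.+1) -> (forall j, 0 <= c j) -> (k < m)%N -> (l < m)%N ->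
  `|f k - f l| <= \sum_(j < m) c j.
Proof.
move=> H1 c0; wlog kl : k l / (l <= k)%N.
  by move=> W; case: (leqP l k) => [|/ltnW] h h1 h2; [exact: W|rewrite distrC; exact: W].
move=> km lm; have S q : (q < m)%N -> \sum_(0 <= j < q.+1) c j <= \sum_(j < m) c j.
  move=> qm; rewrite big_mkord (big_ord_widen _ c qm) [leRHS](bigID (fun j : 'I_m => (j < q.+1)%N)) /= lerDl.
  by apply: sumr_ge0.
apply: le_trans (S k km).
elim: k kl km => [|k IH].
  by rewrite leqn0 => /eqP -> _; rewrite subrr normr0 sumr_ge0.
rewrite leq_eqVlt => /orP[/eqP -> _|lk km]; first by rewrite subrr normr0 sumr_ge0.
rewrite big_nat_recr//= -(subrKA (f k)); apply: le_trans (ler_normD _ _) _.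
rewrite [leRHS]addrC; apply: lerD; first exact: H1.
by apply: IH => //; exact: ltnW.
Qed.

End CriticalBounds.

Lemma mulmx_diff (R : realType) (m k : nat) (a b : 'rV[R]_m) (P Q : 'M[R]_(m, k)) :
  a *m Q - b *m P = (a - b) *m P + a *m (Q - P).
Proof. by rewrite mulmxBl mulmxBr [RHS]addrC addrA subrK. Qed.

Section Arithmetic.
Context {R : realType}.
Implicit Types x y z c d g : R.

Lemma affine_bound_ge0 x y : 0 <= x -> 0 <= y -> 0 <= x + 1 + y * (1 + 2 * x) + 1.
Proof. by move=> x0 y0; have := mulr_ge0 y0 x0; lra. Qed.

Lemma affine_coef_ge0 x y : 0 <= x -> 0 <= y -> 0 <= y * (1 + 2 * x).
Proof. by move=> x0 y0; have := mulr_ge0 y0 x0; lra. Qed.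

Lemma absorb_half z c d : z <= d * c + d * z -> d * z <= 1 / 2 * z -> d * (2 * c) <= 1 -> z <= 1.
Proof. lra. Qed.

Lemma affine_combine x y c d : 0 <= c * x -> 0 <= d -> 0 <= d * y -> c * (1 + y) + d * x <= (c + d) * (1 + x + y).
Proof. lra. Qed.

Lemma affine_double_mono z g : z <= g -> 1 + z + z <= 1 + 2 * g.
Proof. lra. Qed.

Lemma summands_le x y c : 0 <= x -> 0 <= y -> 0 <= c -> x <= c + 1 + x + y /\ y <= c + 1 + x + y.
Proof. by move=> *; split; lra. Qed.

Lemma affine_pair_mono x y c : x <= c -> y <= c -> 1 + x + y <= 1 + 2 * c.
Proof. lra. Qed.

Lemma action_summand x y z c d : x - c * y - d * (c * z) = x - c * (y + d * z).
Proof. by ring. Qed.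

Lemma mean_const (m : nat) c : m.+1%:R^-1 * \sum_(j < m.+1) c = c.
Proof. by rewrite sumr_const card_ord -[X in _ * X]mulr_natl mulrA mulVf ?mul1r// pnatr_eq0. Qed.

End Arithmetic.

Section CriticalSequences.
Context {R : realType} {n : nat} {M : topologicalType} {SM : smooth_manifold R n M}.
Context {K : nat} {e : M -> 'rV[R]_K}.
Local Notation dom := (@chart_dom _ _ SM).
Local Notation phi := (@chart_coord _ _ SM).
Local Notation Pm := (Pm (SM := SM) (e := e)).
Hypotheses (cM : compact [set: M]) (Ce : CkM SM 2 e) (einj : injective e)
  (imm : forall (i : chart SM) x (v : 'rV[R]_n), dom i x -> 'D_v (in_chart i e) (phi i x) = 0 -> v = 0).
Local Notation cov := (cov Ce).
Variable H : cotangent SM -> R.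
Hypothesis sH : smooth_function (cotangent_atlas SM) H.
Variables (A a b r1 : R).
Hypotheses (ab : a < b) (A0 : 0 < A) (r10 : 0 < r1).
Local Notation dE := (dE (SM := SM) (e := e)).
Hypothesis hr1 : forall z, H z <= b -> eucl (ell Ce imm z) < r1.
Implicit Types (i : chart SM) (x : M) (p : 'rV[R]_K).

Local Notation vel := (velocity (SM := SM) Ce H A a b).
Local Notation frc := (pos_force (SM := SM) Ce H A a b).
Local Notation nrm := (normal_part (SM := SM) (e := e)).
Local Notation dymap := (dymap (SM := SM) (e := e)).
Local Notation drem := (drem (SM := SM) (e := e)).

Hypothesis H0 : forall x, H (cov x 0) <= a.
Local Notation potM := (potM (SM := SM) Ce H A a b).
Variables (g0 : R -> M) (rho : R).
Hypothesis rho0 : 0 < rho.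

(* Critical points of the discrete action, written as N-periodic sequences. *)
Record critical_seq (N : nat) (s C : R) (x : int -> M) (p : int -> 'rV[R]_K) : Prop := CriticalSeq {
  cs_x : forall k, x (k + N%:Z) = x k;
  cs_p : forall k, p (k + N%:Z) = p k;
  cs_class : discrete_class (e := e) g0 rho N x;
  cs_step : forall k i, dom i (x k) -> e (x (k + 1)) - e (x k) =
    N%:R^-1 *: (vel i (x k) (p k) *m dE i (phi i (x k)) + nrm (x k) (p k) + s *: pen_grad r1 (p k));
  cs_mom : forall k i v, dom i (x k) -> pairing (p (k - 1) - p k) (v *m dE i (phi i (x k))) =
    N%:R^-1 * (pairing (frc i (x k) (p k)) v + pairing (vel i (x k) (p k)) (dymap i (phi i (x k)) (p k) v) -
      pairing (drem i (phi i (x k)) (p k) v) (nrm (x k) (p k)));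
  cs_dx : forall k, `|e (x (k + 1)) - e (x k)| <= C / N%:R;
  cs_pC : forall k, `|p k| <= C;
  cs_dq : forall k, `|p (k + 1) *m Pm (x (k + 1)) - p k *m Pm (x k)| <= C / N%:R;
  cs_nrm : forall k, `|nrm (x k) (p k)| <= N%:R * `|(e (x (k + 1)) - e (x k)) *m (1%:M - Pm (x k))|;
  cs_action : A - N%:R^-1 <= \sum_(j < N) (pairing (p j%:Z) (e (x (j%:Z + 1)) - e (x j%:Z)) -
    N%:R^-1 * (potM (x j%:Z) (p j%:Z) + s * pen r1 (p j%:Z)))
}.

Section Existence.
Variables (m : nat) (Lc : R).
Hypotheses (m0 : (0 < m)%N) (Lc0 : 0 <= Lc).
Hypothesis samples : forall l, (0 < l)%N ->
  exists y : int -> M, [/\ discrete_class (e := e) g0 rho (m * l) y, forall k, y (k + (m * l)%N%:Z) = y k &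
    forall k, `|e (y (k + 1)) - e (y k)| <= Lc / (m * l)%N%:R].
Hypothesis trans : exists2 delta : R, 0 < delta & forall N y y', discrete_class (e := e) g0 rho N y ->
    (forall k, `|e (y k) - e (y' k)| <= rho) -> (forall k, y' (k + N%:Z) = y' k) ->
    (forall k, `|e (y' (k + 1)) - e (y' k)| <= delta) -> discrete_class (e := e) g0 rho N y'.

Local Notation slope := (@slope R K Lc).
Local Notation gbound := (@gbound R K r1 Lc).

(** The monotonicity trick bounds only the mean of the penalty, hence that of |p|. Some node then
    has bounded momentum, and the increments of the tangential momentum sum up to a uniform bound
    because their sum involves nothing but that mean. The normal part is at most 1 by
    [momentum_normal] and [chord_tangent]. *)
Lemma critical_loops : exists C : R, exists l0 : nat, forall l, (l0 <= l)%N ->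
  exists s (x : int -> M) (p : int -> 'rV[R]_K), critical_seq (m * l) s C x p /\ 0 <= s <= slope + 1.
Proof.
have [Cg Cg0 HCg] := chart_constants cM sH ab A0 r10 hr1.
have [dP dP0 HdP] := Pm_lip cM Ce einj imm.
have slope0 : 0 < slope by rewrite ltr_pwDr// mulr_ge0.
pose C1 := n%:R * (Cg * Cg); have C10 : 0 <= C1 by rewrite /C1; nonneg.
pose C2 := C1 + (slope + 1); have C20 : 0 < C2 by rewrite /C2 ltr_wpDl// addr_gt0.
(* With this accuracy in [chord_tangent] the normal part z satisfies z <= eps0 (C2 + z), where eps0
   and eps0 C2 are at most 1/2; hence z <= 1. *)
pose eps0 : R := Num.min (1 / 2) (2 * C2)^-1.
have eps00 : 0 < eps0 by rewrite lt_min; apply/andP; split; [lra|rewrite invr_gt0; apply: mulr_gt0].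
have [eps01 eps02] : eps0 <= 1 / 2 /\ eps0 * (2 * C2) <= 1.
  split; first by rewrite /eps0 ge_min lexx.
  by rewrite -ler_pdivlMr ?mulr_gt0// div1r /eps0 ge_min lexx orbT.
have [d0 d00 Hd0] := chord_tangent cM Ce einj imm eps00.
have [delta1 delta10 Htr] := trans.
pose delta := Num.min delta1 (Num.min (d0 / 2) (dP / 2)).
have delta0 : 0 < delta by rewrite !lt_min delta10 !divr_gt0.
have [de1 [de2 de3]] : delta <= delta1 /\ (delta <= d0 / 2 /\ delta <= dP / 2).
  by split; [|split]; rewrite /delta !ge_min lexx ?orbT.
pose C5 := force_const (n := n) (K := K) r1 Cg.
have C50 : 0 <= C5 by rewrite /C5 /force_const; nonneg.
pose C6 := C5 + K%:R * (dP^-1 * (C2 + 1)).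
have C60 : 0 <= C6 by rewrite /C6; nonneg; rewrite ?invr_ge0; nonneg.
pose G := gbound + 2 + r1 + 1.
have gb0 : 0 <= gbound by rewrite /gbound; nonneg.
have G0 : 0 <= G by rewrite /G; nonneg.
pose Cp := G + 1 + C6 * (1 + 2 * G) + 1.
have Cp0 : 0 <= Cp by exact: affine_bound_ge0.
pose C := C2 + 1 + Cp + C6 * (1 + 2 * Cp).
have CC : 0 <= C6 * (1 + 2 * Cp) by exact: affine_coef_ge0.
have C5E : C5 = force_const (n := n) (K := K) r1 Cg by [].
have C6E : C6 = C5 + K%:R * (dP^-1 * (C2 + 1)) by [].
have GE : G = gbound + 2 + r1 + 1 by [].
have CpE : Cp = G + 1 + C6 * (1 + 2 * G) + 1 by [].
have CE : C = C2 + 1 + Cp + C6 * (1 + 2 * Cp) by [].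
clearbody C Cp G C6 C5.
exists C.
(* For such N the chords, of length at most (C2 + 1) / N, are strictly shorter than [delta]: the
   constraint of [X0] is inactive and the Euler-Lagrange equation in the positions holds. Likewise
   the reference loop is admissible. *)
pose l0 := ((Num.bound ((C2 + 1) / delta)) + (Num.bound (Lc / delta)) + 2)%N.
exists l0 => l ll.
have ml : (l <= m * l)%N by rewrite leq_pmull.
have l00 : (0 < l)%N by apply: leq_trans ll; rewrite /l0 addn2.
have [N0 NE] : exists N0, (m * l)%N = N0.+2.
  have : (2 <= m * l)%N by apply: leq_trans (leq_trans ll ml); rewrite /l0 leq_addl.
  by case: (m * l)%N => [|[|N0]]// _; exists N0.
have [y [cy py Ly]] := samples l00.
rewrite NE in cy py Ly *.
set N := N0.+2 in cy py Ly *.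
have N00 : (0 : R) < N%:R by rewrite ltr0Sn.
have big c : 0 <= c -> (Num.bound (c / delta) <= l0)%N -> c / N%:R < delta.
  move=> c0 cl; rewrite ltr_pdivrMr// mulrC -ltr_pdivrMr//.
  apply: lt_le_trans (archi_boundP (divr_ge0 c0 (ltW delta0))) _.
  by rewrite ler_nat /N -NE (leq_trans cl)// (leq_trans ll ml).
have LN : Lc / N%:R < delta by apply: big => //; rewrite /l0 -addnA addnCA leq_addr.
have CN : (C2 + 1) / N%:R < delta by apply: big; [nonneg|rewrite /l0 -addnA leq_addr].
pose x0 (j : 'I_N) := y (j : nat)%:Z.
have yid k : y k = x0 (idx N0 k).
  have NN : N%:Z != 0 by [].
  rewrite /x0 /idx inordK; last by rewrite -ltz_nat gez0_abs ?modz_ge0// ltz_pmod.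
  rewrite gez0_abs ?modz_ge0// {1}(divz_eq k N%:Z).
  have per (q : nat) k' : y (k' + (q%:Z * N%:Z)) = y k'.
    by elim: q k' => [|q IH] k'; [rewrite mul0r addr0|rewrite -addn1 PoszD mulrDl mul1r addrA py].
  case: (k %/ N%:Z)%Z => q; first by rewrite addrC per.
  by rewrite NegzE mulNr addrC -[in RHS](subrK (q.+1%:Z * N%:Z) (k %% N%:Z)%Z) per.
have idn (j : 'I_N) : idx N0 (j : nat)%:Z = j.
  apply: val_inj; rewrite /idx /= modz_small; first by rewrite absz_nat inordK.
  by rewrite lez_nat ltz_nat ltn_ord.
have x0S j : x0 (ordS j) = y ((j : nat)%:Z + 1).
  rewrite yid; congr (x0 _); rewrite idxS; congr (ordS _).
  by rewrite idn.
have x0L j : `|e (x0 (ordS j)) - e (x0 j)| <= Lc / N%:R by rewrite x0S; exact: Ly.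
have x0X : (forall j, `|e (x0 (ordS j)) - e (x0 j)| <= delta) /\ discrete_class (e := e) g0 rho N (fun k => x0 (idx N0 k)).
  split=> [j|]; first exact: le_trans (x0L j) (ltW LN).
  by rewrite (_ : (fun k => _) = y)//; apply/funext => k; rewrite yid.
have tr' y1 y2 : discrete_class (e := e) g0 rho N y1 -> (forall k, `|e (y1 k) - e (y2 k)| <= rho) ->
    (forall k, y2 (k + N%:Z) = y2 k) -> (forall k, `|e (y2 (k + 1)) - e (y2 k)| <= delta) -> discrete_class (e := e) g0 rho N y2.
  by move=> c1 c2 c3 c4; apply: (Htr N y1 y2 c1 c2 c3) => k; exact: le_trans (c4 k) de1.
have hN : 0 < N%:R^-1 :> R by rewrite invr_gt0.
have [s [u [/andP[s1 s2] Xu gu Fu crit]]] := discrete_critical cM einj imm sH ab A0 r10 rho0 tr' x0X x0L Lc0 H0 hN.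
have s0 : 0 <= s by exact: le_trans (ltW slope0) s1.
pose x (k : int) := xs u (idx N0 k); pose p (k : int) := ps u (idx N0 k).
have xS k : x (k + 1) = xs u (ordS (idx N0 k)) by rewrite /x idxS.
have pP k : idx N0 (k - 1) = ord_pred (idx N0 k) by rewrite -[LHS]ordSK -idxS subrK.
have step k i : dom i (x k) -> e (x (k + 1)) - e (x k) =
    N%:R^-1 *: (vel i (x k) (p k) *m dE i (phi i (x k)) + nrm (x k) (p k) + s *: pen_grad r1 (p k)).
  move=> dx; rewrite xS; apply: (dnode_momentum Ce imm dx) => w; apply: crit => //; by left.
have Dx k : `|e (x (k + 1)) - e (x k)| <= delta by rewrite xS; exact: Xu.1.
have nb k : `|nrm (x k) (p k)| <= N%:R * `|(e (x (k + 1)) - e (x k)) *m (1%:M - Pm (x k))|.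
  have dx := some_chartP (SM := SM) (x k).
  by have := momentum_normal imm s0 hN dx (step k _ dx); rewrite invrK.
have dxb k : `|nrm (x k) (p k)| <= 1 /\ `|e (x (k + 1)) - e (x k)| <= (C2 + 1) / N%:R.
  have [i gi gv] := HCg (x k) (p k); have [dx _ _ _ _] := gi.
  have b1 := velocity_bound gi; have b2 := pen_grad_norm r1 (p k).
  have bd : `|e (x (k + 1)) - e (x k)| <= N%:R^-1 * (C2 + `|nrm (x k) (p k)|).
    rewrite (step k i dx) normrZ gtr0_norm// ler_pM2l//.
    apply: le_trans (ler_normD _ _) _.
    have b3 := ler_normD (vel i (x k) (p k) *m dE i (phi i (x k))) (nrm (x k) (p k)).
    have b4 : `|s *: pen_grad r1 (p k)| <= slope + 1.
      by rewrite normrZ ger0_norm//; rewrite -[leRHS]mulr1; apply: ler_pM.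
    apply: le_trans (lerD (le_trans b3 (lerD b1 (lexx _))) b4) _.
    by rewrite /C2 -/C1 addrAC.
  have n1 : `|nrm (x k) (p k)| <= 1.
    have Dk : `|e (x (k + 1)) - e (x k)| < d0 by apply: le_lt_trans (Dx k) (le_lt_trans de2 _); rewrite ltr_pdivrMr// ltr_pMr// ltr1n.
    have := le_trans (nb k) (_ : _ <= N%:R * (eps0 * (N%:R^-1 * (C2 + `|nrm (x k) (p k)|)))).
    rewrite [X in _ -> X]/=; set z := `|nrm _ _|.
    have z0 : 0 <= z by rewrite /z.
    have -> : N%:R * (eps0 * (N%:R^-1 * (C2 + z))) = eps0 * C2 + eps0 * z by field; rewrite gt_eqF.
    move=> hz; have {}hz : z <= eps0 * C2 + eps0 * z.
      apply: hz; rewrite -[X in _ <= X](_ : N%:R * (eps0 * (N%:R^-1 * (C2 + z))) = _); last by field; rewrite gt_eqF.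
      by rewrite ler_pM2l//; apply: le_trans (Hd0 _ _ Dk) _; rewrite ler_pM2l.
    have h2 : eps0 * z <= 1 / 2 * z by rewrite ler_wpM2r.
    exact: absorb_half hz h2 eps02.
  split=> //; apply: le_trans bd _; rewrite mulrC ler_pM2r// lerD2l.
  exact: n1.
have strict k : `|e (x (k + 1)) - e (x k)| < delta by have [_ h1] := dxb k; exact: le_lt_trans h1 CN.
have mom k i v : dom i (x k) -> pairing (p (k - 1) - p k) (v *m dE i (phi i (x k))) =
    N%:R^-1 * (pairing (frc i (x k) (p k)) v + pairing (vel i (x k) (p k)) (dymap i (phi i (x k)) (p k) v) -
      pairing (drem i (phi i (x k)) (p k) v) (nrm (x k) (p k))).
  move=> dx; rewrite {1}/p pP; apply: (dnode_position Ce imm dx (h := N%:R^-1) (s := s) (a' := e (xs u (ordS (idx N0 k))))).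
  apply: crit => //; right; split; first by rewrite -xS; exact: strict.
  by rewrite -pP; have := strict (k - 1); rewrite subrK.
have Pb k : `|(p (k - 1) - p k) *m Pm (x k)| <= N%:R^-1 * (C5 * (1 + `|p k|)).
  have [i gi gv] := HCg (x k) (p k); have [dx _ _ _ _] := gi.
  rewrite C5E; by apply: (momentum_step imm r10 hN Cg0 gi gv) => [|v]; [have [] := dxb k|exact: mom].
pose q k := p k *m Pm (x k).
have qb k : `|q (k - 1) - q k| <= N%:R^-1 * (C6 * (1 + `|p (k - 1)| + `|p k|)).
  have E : q (k - 1) - q k = (p (k - 1) - p k) *m Pm (x k) + p (k - 1) *m (Pm (x (k - 1)) - Pm (x k)).
    exact: mulmx_diff.
  rewrite E; apply: le_trans (ler_normD _ _) _.
  have h1 := Pb k.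
  have h2 : `|p (k - 1) *m (Pm (x (k - 1)) - Pm (x k))| <= N%:R^-1 * (K%:R * (dP^-1 * (C2 + 1)) * `|p (k - 1)|).
    apply: (le_trans (mulmx_norm_le _ _)).
    have st : `|e (x k) - e (x (k - 1))| < dP.
      by have := strict (k - 1); rewrite subrK => /lt_le_trans; apply; apply: le_trans de3 _; rewrite ler_pdivrMr// ler_pMr// ler1n.
    have st2 : `|e (x k) - e (x (k - 1))| <= (C2 + 1) / N%:R by have [_] := dxb (k - 1); rewrite subrK.
    have h3 := HdP _ _ st; rewrite distrC in h3.
    have -> : N%:R^-1 * (K%:R * (dP^-1 * (C2 + 1)) * `|p (k - 1)|) = K%:R * (`|p (k - 1)| * (dP^-1 * ((C2 + 1) / N%:R))) by ring.
    apply: ler_wpM2l => //; apply: ler_wpM2l => //; apply: le_trans h3 _.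
    by rewrite ler_pM2l ?invr_gt0.
  apply: le_trans (lerD h1 h2) _; rewrite -mulrDr ler_pM2l// C6E.
  have t1 : 0 <= C5 * `|p (k - 1)| by rewrite mulr_ge0.
  have t2 : 0 <= K%:R * (dP^-1 * (C2 + 1)) by nonneg; rewrite invr_ge0 ltW.
  have t3 : 0 <= K%:R * (dP^-1 * (C2 + 1)) * `|p k| by rewrite mulr_ge0.
  exact: affine_combine.
have nm k : `|nrm (x k) (p k)| <= 1 by have [] := dxb k.
have pq k : `|p k| <= `|q k| + 1.
  have -> : p k = q k + nrm (x k) (p k) by rewrite /normal_part /q addrC subrK.
  by apply: le_trans (ler_normD _ _) _; rewrite lerD2l.
have qp k : `|q k| <= `|p k| + 1.
  have -> : q k = p k - nrm (x k) (p k) by rewrite /normal_part /q opprB addrC subrK.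
  by apply: le_trans (ler_normB _ _) _; rewrite lerD2l.
have mean : N%:R^-1 * \sum_(j < N) `|ps u j| <= G.
  have h1 : \sum_(j < N) `|ps u j| <= \sum_(j < N) (pen r1 (ps u j) + (r1 + 1)).
    by apply: ler_sum => j _; have := pen_ge r1 (ps u j); lra.
  apply: le_trans (_ : N%:R^-1 * \sum_(j < N) (pen r1 (ps u j) + (r1 + 1)) <= _); first by rewrite ler_pM2l.
  rewrite big_split /= mulrDr mean_const.
  by rewrite GE -[leRHS]addrA lerD2r; exact: gu.
have [l1 Hl1] : exists j, `|ps u j| <= G.
  apply: contrapT => no; have no' j : G < `|ps u j| by rewrite ltNge; apply/negP => h; apply: no; exists j.
  have : N%:R^-1 * \sum_(j < N) G < N%:R^-1 * \sum_(j < N) `|ps u j|.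
    rewrite ltr_pM2l//; apply: ltr_sum => //; by apply/hasP; exists ord0; rewrite ?mem_index_enum.
  rewrite mean_const => /lt_le_trans/(_ mean).
  by rewrite ltxx.
have qbound k : `|q k| <= G + 1 + C6 * (1 + 2 * G).
  pose f (j : nat) := q j%:Z.
  pose c (j : nat) := N%:R^-1 * (C6 * (1 + `|p (j%:Z - 1)| + `|p j%:Z|)).
  have qk : q k = f (idx N0 k) by rewrite /f /q /p /x idn.
  have c0 j : 0 <= c j.
    have t0 : 0 <= 1 + `|p (j%:Z - 1)| + `|p j%:Z| by rewrite !addr_ge0.
    exact: mulr_ge0 (ltW hN) (mulr_ge0 C60 t0).
  have ff (j : nat) : (j.+1 < N)%N -> `|f j.+1 - f j| <= c j.+1.
    move=> _; have hq := qb j.+1%:Z; have jE : j.+1%:Z - 1 = j%:Z :> int by rewrite -addn1 PoszD addrK.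
    by rewrite jE in hq; rewrite distrC /f /c jE; exact: hq.
  have := telescope_bound ff c0 (ltn_ord (idx N0 k)) (ltn_ord l1).
  have -> : \sum_(j < N) c j = C6 * (1 + N%:R^-1 * \sum_(j < N) `|ps u j| + N%:R^-1 * \sum_(j < N) `|ps u j|).
    rewrite /c -mulr_sumr -mulr_sumr !big_split /= mulrCA.
    congr (_ * _); rewrite !mulrDr mean_const; congr (_ + _ + _).
    - congr (_ * _); rewrite [RHS](reindex_inj (@ord_pred_inj N)) /=; apply: eq_bigr => j _.
      by rewrite /p pP idn.
    - by congr (_ * _); apply: eq_bigr => j _; rewrite /p idn.
  have sb : C6 * (1 + N%:R^-1 * \sum_(j < N) `|ps u j| + N%:R^-1 * \sum_(j < N) `|ps u j|) <= C6 * (1 + 2 * G).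
    exact: (ler_wpM2l C60 (affine_double_mono mean)).
  move=> /le_trans/(_ sb) h1; rewrite qk.
  have h2 : `|f l1| <= G + 1 by rewrite /f; apply: le_trans (qp _) _; rewrite lerD2r /p idn.
  by rewrite -(subrK (f l1) (f _)); apply: le_trans (ler_normD _ _) _; rewrite addrC; exact: lerD.
have pb k : `|p k| <= Cp by apply: le_trans (pq k) _; rewrite CpE lerD2r; exact: qbound.
exists s, x, p; split; last by rewrite s0.
have Cle1 : C2 + 1 <= C by rewrite CE -[leRHS]addrA lerDl addr_ge0.
have Cle2 : Cp <= C by rewrite CE; exact: (summands_le Cp0 CC (ltW C20)).1.
have Cle3 : C6 * (1 + 2 * Cp) <= C by rewrite CE; exact: (summands_le Cp0 CC (ltW C20)).2.
split=> //.
- by move=> k; rewrite /x idxN.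
- by move=> k; rewrite /p idxN.
- exact: Xu.2.
- by move=> k; have [_ h1] := dxb k; apply: le_trans h1 _; rewrite ler_pM2r.
- by move=> k; exact: le_trans (pb k) Cle2.
- move=> k; have hq := qb (k + 1); rewrite addrK distrC in hq; apply: le_trans hq _.
  rewrite [leRHS]mulrC ler_pM2l//; apply: le_trans Cle3; apply: ler_wpM2l => //.
  exact: affine_pair_mono (pb k) (pb (k + 1)).
- apply: le_trans Fu _; rewrite /action_at /actB /actg !mulr_sumr -sumrB le_eqVlt; apply/orP; left; apply/eqP.
  by apply: eq_bigr => j _; rewrite /x /p idxS idn; exact: action_summand.
Qed.

End Existence.
End CriticalSequences.

(** * Limits of step functions *)

Section Telescope.
Context {R : realType} {V : normedModType R}.

Lemma nat_telescope (f : int -> V) (g : V) (c : R) (j : int) (m : nat) :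
  (forall k : int, j <= k -> k < j + m%:Z -> `|f (k + 1) - f k - g| <= c) ->
  `|f (j + m%:Z) - f j - m%:R *: g| <= m%:R * c.
Proof.
elim: m => [|m IH] Hf; first by rewrite addr0 subrr scale0r mul0r subrr normr0.
have h1 : `|f (j + m%:Z) - f j - m%:R *: g| <= m%:R * c.
  by apply: IH => k k1 k2; apply: Hf => //; apply: lt_trans k2 _; rewrite ltrD2l ltz_nat.
have h2 : `|f (j + m%:Z + 1) - f (j + m%:Z) - g| <= c.
  by apply: Hf; [rewrite lerDl|rewrite ltrD2l ltz_nat].
have -> : f (j + m.+1%:Z) - f j - m.+1%:R *: g =
    (f (j + m%:Z) - f j - m%:R *: g) + (f (j + m%:Z + 1) - f (j + m%:Z) - g).
  rewrite -[m.+1]addn1 PoszD natrD scalerDl scale1r (addrA j).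
  set u := f _; set v := f _; set w := f _; set y := _ *: g.
  by rewrite opprD [RHS]addrACA; congr (_ + _); rewrite addrC subrKA.
apply: le_trans (ler_normD _ _) _; apply: le_trans (lerD h1 h2) _.
by rewrite -[X in _ <= X * _]natr1 mulrDl mul1r.
Qed.

Lemma int_telescope (f : int -> V) (g : V) (c : R) (j k : int) :
  (forall i : int, Num.min j k <= i -> i < Num.max j k -> `|f (i + 1) - f i - g| <= c) ->
  `|f k - f j - (k - j)%:~R *: g| <= `|(k - j)%:~R| * c.
Proof.
wlog jk : j k / j <= k.
  move=> W Hf; case: (leP j k) => [/W|/ltW kj]; first exact.
  have := W k j kj; rewrite minC maxC => /(_ Hf).
  have E : (j - k)%:~R = - (k - j)%:~R :> R by rewrite -mulrNz opprB.
  rewrite E normrN (_ : f j - f k - _ = - (f k - f j - (k - j)%:~R *: g)) ?normrN//.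
  by rewrite scaleNr !opprD !opprK; congr (_ + _); rewrite addrC.
have [m mE] : exists m : nat, k = j + m%:Z.
  by exists `|k - j|%N; rewrite gez0_abs ?subr_ge0// [RHS]addrC subrK.
rewrite mE [j + _]addrC addrK [m%:Z + j]addrC => Hf.
rewrite -pmulrn ger0_norm//; apply: nat_telescope => i i1 i2; apply: Hf.
- by apply: le_trans i1; rewrite ge_min lexx.
- by apply: lt_le_trans i2 _; rewrite le_max lexx orbT.
Qed.

End Telescope.

Section Ultralimits.
Context {R : realType} {F : set_system nat} {UF : UltraFilter F}.

Lemma ultra_fmap (T : Type) (f : nat -> T) : UltraFilter (f @ F).
Proof.
have FF : Filter F by exact: ultra_proper.
split; first exact: fmap_proper_filter.
move=> G GF sG; rewrite predeqE => A; split; last exact: sG.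
move=> GA; have [//|FnA] := in_ultra_setVsetC (f @^-1` A) UF.
have GnA : G (~` A) by exact: sG.
by have /filter_ex[? []] : G (A `&` ~` A) by exact: filterI.
Qed.

Lemma ultra_cvg (T : topologicalType) (a : nat -> T) : compact [set: T] -> exists L : T, a l @[l --> F] --> L.
Proof.
rewrite compact_ultra => /(_ (a @ F) (ultra_fmap _)) [].
  exact: filterT.
by move=> L [_ HL]; exists L.
Qed.

Lemma ultra_bounded (K : nat) (a : nat -> 'rV[R]_K) (C : R) :
  (\forall l \near F, `|a l| <= C) -> exists L : 'rV[R]_K, a l @[l --> F] --> L.
Proof.
move=> aC; have FF : Filter F by exact: ultra_proper.
have H k : exists y : R, a l ord0 k @[l --> F] --> y.
  have := @segment_compact R (- C) C; rewrite compact_ultra => /(_ ((fun l => a l ord0 k) @ F) (ultra_fmap _)) [].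
    apply: filterS aC => l al /=; rewrite in_itv /= -ler_norml.
    exact: le_trans (mx_entry_le _ _ _) al.
  by move=> y [_ Hy]; exists y.
have [y Hy] := choice H; exists (\row_k y k).
by apply: mx_cvg => i k; rewrite ord1 mxE; exact: Hy.
Qed.

End Ultralimits.

Section DiscreteTime.
Context {R : realType} {F : set_system nat} {PF : ProperFilter F} (N_ : nat -> nat).
Hypotheses (N_pos : \forall l \near F, (0 < N_ l)%N) (N_inv : (N_ l)%:R^-1 @[l --> F] --> (0 : R)).

Definition step_at (l : nat) (t : R) : int := Num.floor ((N_ l)%:R * t).

(* The times [j / N_ l] close to [t], for most [l]. *)
Definition near_node (t : R) : set_system (nat * int) :=
  [set S | exists2 eta : R, 0 < eta & \forall l \near F, forall j : int,
    `|j%:~R - (N_ l)%:R * t| <= eta * (N_ l)%:R -> S (l, j)].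

#[export] Instance near_node_filter t : Filter (near_node t).
Proof.
split.
- by exists 1 => //; near=> l.
- move=> P Q [e1 e10 H1] [e2 e20 H2]; exists (Num.min e1 e2); first by rewrite lt_min e10.
  apply: filterS2 H1 H2 => l h1 h2 j hj; split.
  + by apply: h1; apply: le_trans hj _; rewrite ler_wpM2r// ge_min lexx.
  + by apply: h2; apply: le_trans hj _; rewrite ler_wpM2r// ge_min lexx orbT.
- move=> P Q PQ [e1 e10 H1]; exists e1 => //.
  by apply: filterS H1 => l h1 j hj; apply: PQ; exact: h1.
Unshelve. all: by end_near. Qed.

Lemma N_large (c : R) : 0 < c -> \forall l \near F, (0 < N_ l)%N /\ 1 <= c * (N_ l)%:R.
Proof.
move=> c0; move/cvgrPdist_lt : N_inv => /(_ c c0) H.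
apply: filterS2 H N_pos => l h1 h2; split=> //; move: h1.
rewrite sub0r normrN ger0_norm ?invr_ge0// => /ltW.
by rewrite -[_^-1]div1r ler_pdivrMr ?ltr0n.
Qed.

Lemma step_at_bounds l (t : R) : (step_at l t)%:~R <= (N_ l)%:R * t < (step_at l t)%:~R + 1.
Proof. by have := floor_itv ((N_ l)%:R * t); rewrite intrD mulr1z. Qed.

Lemma step_at_dist l (t : R) : `|(step_at l t)%:~R - (N_ l)%:R * t| <= 1.
Proof. by have /andP[h1 h2] := step_at_bounds l t; rewrite ler_norml; apply/andP; split; lra. Qed.

Lemma near_node_step_at t : (fun l => (l, step_at l t)) @ F --> near_node t.
Proof.
move=> S [eta eta0 HS]; rewrite /nbhs/=; near=> l.
have hS : forall j : int, `|j%:~R - (N_ l)%:R * t| <= eta * (N_ l)%:R -> S (l, j) by near: l.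
apply: hS; apply: le_trans (step_at_dist _ _) _.
by have [] : (0 < N_ l)%N /\ 1 <= eta * (N_ l)%:R by near: l; exact: N_large.
Unshelve. all: by end_near. Qed.

Lemma near_node_shift t (d : int) : (fun z : nat * int => (z.1, z.2 + d)) @ near_node t --> near_node t.
Proof.
move=> S [eta eta0 HS]; exists (eta / 2); first by rewrite divr_gt0.
have c0 : 0 < eta / 2 / (1 + `|d%:~R|) by rewrite !divr_gt0// ltr_pwDl.
near=> l => j hj /=.
have hS : forall j : int, `|j%:~R - (N_ l)%:R * t| <= eta * (N_ l)%:R -> S (l, j) by near: l.
have [_ Nl] : (0 < N_ l)%N /\ 1 <= eta / 2 / (1 + `|d%:~R|) * (N_ l)%:R by near: l; exact: N_large.
apply: hS; rewrite intrD addrAC; apply: le_trans (ler_normD _ _) _.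
have h : `|d%:~R| <= eta / 2 * (N_ l)%:R.
  move: Nl; rewrite mulrAC ler_pdivlMr ?ltr_pwDl// mul1r; apply: le_trans.
  by rewrite lerDr.
by have := lerD hj h; rewrite -mulrDl; congr (_ <= _ * _); field.
Unshelve. all: by end_near. Qed.

Lemma near_node_time t : (z.2)%:~R / (N_ z.1)%:R @[z --> near_node t] --> t.
Proof.
apply/cvgrPdist_le => eps eps0; exists eps => //; near=> l => j hj /=.
have N0 : 0 < (N_ l)%:R :> R by rewrite ltr0n; near: l.
rewrite distrC -(@ler_pM2r _ (N_ l)%:R)//; apply: le_trans hj.
by rewrite -{2}(ger0_norm (ltW N0)) -normrM mulrBl mulfVK ?gt_eqF// [t * _]mulrC.
Unshelve. all: by end_near. Qed.

Lemma step_time t : (step_at l t)%:~R / (N_ l)%:R @[l --> F] --> t.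
Proof. exact: (cvg_comp _ _ (@near_node_step_at t) (@near_node_time t)). Qed.

Lemma near_node_uniform (S : set (nat * int)) : (forall t : R, 0 <= t <= 1 -> near_node t S) ->
  \forall l \near F, forall j : int, 0 <= j <= (N_ l)%:Z -> S (l, j).
Proof.
move=> HS; have /compact_near_coveringP/(_ nat F (fun l t => S (l, step_at l t)) _) H := @segment_compact R 0 1.
have {}H : \forall l \near F, `[0, 1]%classic `<=` (fun t : R => S (l, step_at l t)).
  apply: H => t /= t01; rewrite in_itv /= in t01; have [eta eta0 He] := HS t t01.
  have e20 : 0 < eta / 2 by rewrite divr_gt0.
  exists ([set t' | `|t - t'| < eta / 2],
    [set l | ((0 < N_ l)%N /\ 1 <= eta / 2 * (N_ l)%:R) /\ forall j : int, `|j%:~R - (N_ l)%:R * t| <= eta * (N_ l)%:R -> S (l, j)]).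
    split; first by apply/nbhs_ballP; exists (eta / 2).
    exact: filterI (N_large e20) He.
  case=> t' l /= [tt' [[Nl0 Nl] hS]]; apply: hS.
  rewrite -(subrK ((N_ l)%:R * t') (step_at l t')%:~R) -addrA -mulrBr.
  apply: le_trans (ler_normD _ _) _; rewrite normrM (@ger0_norm _ (N_ l)%:R)//.
  apply: le_trans (_ : eta / 2 * (N_ l)%:R + (N_ l)%:R * (eta / 2) <= _); last by rewrite [X in _ + X]mulrC -mulrDl -splitr.
  apply: lerD; first exact: le_trans (step_at_dist _ _) Nl.
  by rewrite ler_wpM2l// distrC ltW.
apply: filterS2 H N_pos => l Hl Nl j /andP[j0 jN].
have N0 : 0 < (N_ l)%:R :> R by rewrite ltr0n.
have := Hl (j%:~R / (N_ l)%:R); rewrite /step_at [_ * (_ / _)]mulrC mulfVK ?gt_eqF// intrKfloor; apply.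
by rewrite /= in_itv /= divr_ge0 ?ler0z//= ler_pdivrMr// mul1r -[(N_ l)%:R]/((N_ l)%:Z%:~R) ler_int.
Qed.

Section StepFunctions.
Context {V : normedModType R}.
Variables (a : nat -> int -> V).

(** The difference quotients at all nodes near [t] are close to [g]; telescoping between two times
    gives a first-order estimate for [a], which passes to the limit in [l]. *)
Lemma discrete_ode (alpha : R -> V) (t : R) (g : V) :
  (\forall t' \near t, a l (step_at l t') @[l --> F] --> alpha t') ->
  (N_ z.1)%:R *: (a z.1 (z.2 + 1) - a z.1 z.2) @[z --> near_node t] --> g ->
  is_derive t 1 alpha g.
Proof.
move=> ca cg.
have key eps : 0 < eps -> exists2 d : R, 0 < d & forall h, `|h| < d -> `|alpha (t + h) - alpha t - h *: g| <= eps * `|h|.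
  move=> eps0; move/cvgrPdist_le : cg => /(_ eps eps0) [eta eta0 He].
  have [d1 /= d10 Hd1] := (nbhs_ballP _ _).1 ca.
  (* One half of [eta] is for the distance from [t], the other for rounding times to nodes. *)
  exists (Num.min d1 (eta / 2)); first by rewrite lt_min d10 divr_gt0.
  move=> h; rewrite lt_min => /andP[h1 h2].
  have c1 : a l (step_at l (t + h)) @[l --> F] --> alpha (t + h).
    by apply: Hd1; rewrite -ball_normE /= opprD addNKr normrN.
  have c0 : a l (step_at l t) @[l --> F] --> alpha t by apply: Hd1; exact: ballxx.
  pose u l : R := ((step_at l (t + h)) - step_at l t)%:~R / (N_ l)%:R.
  have cu : u l @[l --> F] --> h.
    have E1 := @step_time (t + h); have E0 := @step_time t.
    rewrite (_ : u = fun l => (step_at l (t + h))%:~R / (N_ l)%:R - (step_at l t)%:~R / (N_ l)%:R).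
      have -> : nbhs h = nbhs (t + h - t) by rewrite [t + h]addrC addrK.
      by apply: cvgB; [exact: E1|exact: E0].
    by apply/funext => l; rewrite /u intrB mulrBl.
  have L1 : `|a l (step_at l (t + h)) - a l (step_at l t) - u l *: g| @[l --> F] --> `|alpha (t + h) - alpha t - h *: g|.
    by apply: cvg_norm; apply: cvgB; [exact: cvgB|exact: cvgZr_tmp].
  have L2 : eps * `|u l| @[l --> F] --> eps * `|h|.
    by apply: cvgMl_tmp; exact: cvg_norm.
  apply: (ler_cvg_to L1 L2).
  have e40 : 0 < eta / 2 by rewrite divr_gt0.
  apply: filterS2 He (N_large e40) => l Hl [Nl0 Nl].
  have N0 : 0 < (N_ l)%:R :> R by rewrite ltr0n.
  have := @int_telescope R V (a l) ((N_ l)%:R^-1 *: g) ((N_ l)%:R^-1 * eps) (step_at l t) (step_at l (t + h)).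
  rewrite scalerA -/(u l) /u normrM => H.
  apply: le_trans (H _) _; last first.
    by rewrite (@ger0_norm _ (_^-1)) ?invr_ge0// mulrA [leRHS]mulrC.
  move=> i i1 i2.
  have /andP[b1 b2] := step_at_bounds l t; have /andP[b3 b4] := step_at_bounds l (t + h).
  have hb : `|(N_ l)%:R * h| <= eta / 2 * (N_ l)%:R.
    by rewrite normrM (@ger0_norm _ (N_ l)%:R)// mulrC ler_pM2r// ltW.
  have hi : `|i%:~R - (N_ l)%:R * t| <= eta * (N_ l)%:R.
    move: hb; rewrite !ler_norml => /andP[hb1 hb2].
    rewrite mulrDr in b3 b4.
    have ee : eta * (N_ l)%:R = eta / 2 * (N_ l)%:R + eta / 2 * (N_ l)%:R by rewrite -mulrDl -splitr.
    have i1' : Num.min (step_at l t)%:~R (step_at l (t + h))%:~R <= i%:~R :> R.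
      by move: i1; rewrite !ge_min => /orP[] h0; apply/orP; [left|right]; rewrite ler_int.
    have i2' : i%:~R <= Num.max (step_at l t)%:~R (step_at l (t + h))%:~R :> R.
      by move: i2; rewrite !lt_max !le_max => /orP[] /ltW h0; apply/orP; [left|right]; rewrite ler_int.
    move: i1' i2'; rewrite ge_min le_max ee => /orP[] i1' /orP[] i2'; apply/andP; split; lra.
  have := Hl i hi; rewrite /= distrC => hi'.
  rewrite -(@ler_pM2l _ (N_ l)%:R)// mulrA divff ?gt_eqF// mul1r.
  apply: le_trans hi'; rewrite -{1}(ger0_norm (ltW N0)) -normrZ scalerBr scalerA divff ?gt_eqF// scale1r.
  exact: lexx.
have c : h^-1 *: ((alpha \o shift t) (h *: 1) - alpha t) @[h --> (0:R)^'] --> g.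
  apply/cvgrPdist_le => eps eps0; have [d d0 Hd] := key eps eps0.
  apply/nbhs_ballP; exists d => // h; rewrite /= -ball_normE /= sub0r normrN => hd h0.
  have hn : 0 < `|h| by rewrite normr_gt0.
  rewrite -(@ler_pM2l _ `|h|)// -normrZ scalerBr scalerA divff// scale1r [h *: 1]mulr1 distrC.
  by rewrite mulrC [h + t]addrC; exact: Hd.
by split; [apply/cvg_ex; exists g|exact: cvg_lim c].
Qed.

Variables (C : R) (alpha : R -> V).
Hypotheses (aC : \forall l \near F, forall k, `|a l (k + 1) - a l k| <= C / (N_ l)%:R)
  (ca : forall t, a l (step_at l t) @[l --> F] --> alpha t).

Lemma step_dist : \forall l \near F, forall j k : int, `|a l k - a l j| <= C * (`|(k - j)%:~R| / (N_ l)%:R).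
Proof.
apply: filterS aC => l Hl j k.
have := @int_telescope R V (a l) 0 (C / (N_ l)%:R) j k.
rewrite scaler0 subr0 mulrCA; apply => i _ _; rewrite subr0; exact: Hl.
Qed.

Lemma step_const_ge0 : 0 <= C.
Proof.
have [l [Nl Hl]] : exists l, (0 < N_ l)%N /\ forall k, `|a l (k + 1) - a l k| <= C / (N_ l)%:R.
  by have [l [h1 h2]] := @filter_ex _ F PF _ (filterI N_pos aC); exists l.
have := le_trans (normr_ge0 _) (Hl 0).
by rewrite pmulr_lge0// invr_gt0 ltr0n.
Qed.

Lemma near_node_step t : a z.1 z.2 @[z --> near_node t] --> alpha t.
Proof.
apply/cvgrPdist_le => eps eps0; have C0 := step_const_ge0.
have c0 : 0 < eps / 4 / (1 + C) by rewrite !divr_gt0// ltr_pwDl.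
exists (eps / 4 / (1 + C)) => //.
have /cvgrPdist_le/(_ (eps / 2)) c1 := @ca t.
near=> l => j hj /=.
have h1 : `|alpha t - a l (step_at l t)| <= eps / 2 by near: l; apply: c1; rewrite divr_gt0.
have h2 : `|a l (step_at l t) - a l j| <= C * (`|(step_at l t - j)%:~R| / (N_ l)%:R) by move: (j) (step_at l t); near: l; exact: step_dist.
have [Nl0 Nl] : (0 < N_ l)%N /\ 1 <= eps / 4 / (1 + C) * (N_ l)%:R by near: l; exact: N_large.
have N0 : 0 < (N_ l)%:R :> R by rewrite ltr0n.
rewrite -(subrK (a l (step_at l t)) (alpha t)) -addrA; apply: le_trans (ler_normD _ _) _.
rewrite [leRHS]splitr lerD//; apply: le_trans h2 _.
have h3 : `|(step_at l t - j)%:~R| / (N_ l)%:R <= eps / 2 / (1 + C).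
  rewrite ler_pdivrMr// intrB -(subrK ((N_ l)%:R * t) (step_at l t)%:~R) -addrA.
  apply: le_trans (ler_normD _ _) _; rewrite distrC in hj.
  apply: le_trans (lerD (le_trans (step_at_dist l t) Nl) hj) _.
  rewrite -mulrDl ler_pM2r// le_eqVlt; apply/orP; left; apply/eqP; field.
  by rewrite gt_eqF// ltr_pwDl.
apply: le_trans (ler_wpM2l C0 h3) _.
have h0 : 0 <= eps / 2 by rewrite ltW// divr_gt0.
rewrite mulrCA ler_piMr//.
by rewrite ler_pdivrMr ?ltr_pwDl// mul1r lerDr.
Unshelve. all: by end_near. Qed.

Lemma step_limit_lip t t' : `|alpha t' - alpha t| <= C * `|t' - t|.
Proof.
have L1 : `|a l (step_at l t') - a l (step_at l t)| @[l --> F] --> `|alpha t' - alpha t|.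
  by apply: cvg_norm; apply: cvgB; exact: ca.
have L2 : C * (`|(step_at l t' - step_at l t)%:~R / (N_ l)%:R|) @[l --> F] --> C * `|t' - t|.
  apply: cvgMl_tmp; have c1 : (step_at l t' - step_at l t)%:~R / (N_ l)%:R @[l --> F] --> t' - t; last exact: (cvg_norm c1).
  have E1 := @step_time t'; have E0 := @step_time t.
  rewrite (_ : (fun l => _) = fun l => (step_at l t')%:~R / (N_ l)%:R - (step_at l t)%:~R / (N_ l)%:R).
    by apply: cvgB; [exact: E1|exact: E0].
  by apply/funext => l; rewrite intrB mulrBl.
apply: (ler_cvg_to L1 L2); apply: filterS step_dist => l Hl.
by rewrite normrM (@ger0_norm _ (_^-1)) ?invr_ge0//; exact: Hl.
Qed.

Lemma step_limit_continuous : continuous alpha.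
Proof.
move=> t; apply/cvgrPdist_le => eps eps0; have C0 := step_const_ge0.
near=> t'; rewrite distrC; apply: le_trans (step_limit_lip t t') _.
have h : `|t' - t| <= eps / (1 + C).
  by rewrite distrC; near: t'; apply: cvgr_dist_le; [exact: cvg_id|rewrite divr_gt0// ltr_pwDl].
apply: le_trans (ler_wpM2l C0 h) _; rewrite mulrCA ler_piMr ?ltW//.
by rewrite ltr_pdivrMr ?ltr_pwDl// mul1r ltrDr.
Unshelve. all: by end_near. Qed.

End StepFunctions.
End DiscreteTime.

Lemma half_absorb (R : realType) (z q : R) : z <= q + 2^-1 * z -> z <= 2 * q.
Proof. lra. Qed.

(** * Difference quotients of C^1 maps along a filter *)

Section DifferenceQuotients.
Context {R : realType} {n K : nat} {T : Type} {G : set_system T} {FG : Filter G}.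
Variables (D : set 'rV[R]_n) (f : 'rV[R]_n -> 'rV[R]_K) (xi : 'rV[R]_n).
Hypotheses (oD : open D) (Cf : Ck_on 1 D f) (Dxi : D xi).
Variables (u u' : T -> 'rV[R]_n) (c : T -> R).
Hypotheses (cu : u t @[t --> G] --> xi) (cu' : u' t @[t --> G] --> xi).

Lemma C1_quotient_error (eps : R) : 0 < eps ->
  \forall t \near G, `|c t *: (f (u' t) - f (u t)) - 'D_(c t *: (u' t - u t)) f xi| <= eps * `|c t *: (u' t - u t)|.
Proof.
move=> eps0; have df := Ck_diff Cf Dxi.
have [r [r0 Hr]] : exists r : R, 0 < r /\ forall y y', ball xi r y -> ball xi r y' ->
    `|f y' - f y - 'D_(y' - y) f xi| <= eps * `|y' - y|.
  have H := C1_unif_center oD Cf Dxi eps0.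
  have H0 : \forall r \near (0:R)^'+, 0 < r by exact: nbhs_right_gt.
  have [r [h1 h2]] := @filter_ex _ _ _ _ (filterI H H0).
  by exists r; split=> //; exact: h1.2.
have n1 : \forall t \near G, ball xi r (u t) by apply: cu; exact: nbhsx_ballx.
have n2 : \forall t \near G, ball xi r (u' t) by apply: cu'; exact: nbhsx_ballx.
apply: (@filterS2 _ G FG _ _ _ _ n1 n2) => t b1 b2.
rewrite (deriveE (c t *: _) df) linearZ /= -(deriveE _ df) -scalerBr !normrZ mulrCA.
by rewrite ler_wpM2l// Hr.
Qed.

Lemma derive_dir_cvg (w : T -> 'rV[R]_n) (v : 'rV[R]_n) : w t @[t --> G] --> v ->
  'D_(w t) f xi @[t --> G] --> 'D_v f xi.
Proof.
move=> cw; have df := Ck_diff Cf Dxi.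
rewrite (_ : (fun t => 'D_(w t) f xi) = fun t => 'd f xi (w t)); last by apply/funext => t; rewrite deriveE.
rewrite deriveE//; have c0 : {for v, continuous ('d f xi)} by exact: diff_continuous.
exact: (cvg_comp _ _ cw c0).
Qed.

Lemma C1_quotient (v : 'rV[R]_n) : c t *: (u' t - u t) @[t --> G] --> v ->
  c t *: (f (u' t) - f (u t)) @[t --> G] --> 'D_v f xi.
Proof.
move=> cw; apply/cvgrPdist_le => eps eps0.
have cD := derive_dir_cvg cw.
have e0 : 0 < eps / 2 / (`|v| + 1) by rewrite !divr_gt0// ltr_wpDl.
have h1 := C1_quotient_error e0.
have h2 : \forall t \near G, `|v - c t *: (u' t - u t)| <= 1 by move/cvgrPdist_le : cw; apply.
have h3 : \forall t \near G, `|'D_v f xi - 'D_(c t *: (u' t - u t)) f xi| <= eps / 2.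
  by move/cvgrPdist_le : cD; apply; rewrite divr_gt0.
apply: (@filterS3 _ G FG _ _ _ _ _ h1 h2 h3) => t a1 a2 a3.
rewrite -(subrK ('D_(c t *: (u' t - u t)) f xi) ('D_v f xi)) -addrA.
apply: le_trans (ler_normD _ _) _; rewrite [leRHS]splitr; apply: lerD => //.
rewrite distrC; apply: le_trans a1 _.
have a4 : `|c t *: (u' t - u t)| <= `|v| + 1.
  rewrite -[X in `|X|](subrK v) addrC; apply: le_trans (ler_normD _ _) _.
  by rewrite lerD2l distrC.
apply: le_trans (ler_wpM2l (ltW e0) a4) _.
by rewrite mulfVK// gt_eqF// ltr_wpDl.
Qed.

(** The quotients of [u] are not known to be bounded. The left inverse [L] recovers them from those
    of [f] up to a small multiple of themselves; absorbing it bounds them, and then the error tends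
    to 0. *)
Lemma C1_quotient_inv (L : 'M[R]_(K, n)) (w : 'rV[R]_K) : (forall v, 'D_v f xi *m L = v) ->
  c t *: (f (u' t) - f (u t)) @[t --> G] --> w -> c t *: (u' t - u t) @[t --> G] --> w *m L.
Proof.
move=> HL cw.
pose k := K%:R * `|L| + 1; have k0 : 0 < k by rewrite ltr_wpDl// mulr_ge0.
have est (x : 'rV[R]_K) : `|x *m L| <= k * `|x|.
  apply: le_trans (mulmx_norm_le _ _) _; rewrite /k mulrDl mul1r [`|x| * _]mulrC mulrA.
  by rewrite lerDl.
have cwL : (c t *: (f (u' t) - f (u t))) *m L @[t --> G] --> w *m L.
  by apply: mulmx_cvg => //; exact: cvg_cst.
apply/cvgrPdist_le => eps eps0.
pose W := `|w| + 1; have W0 : 0 < W by rewrite ltr_wpDl.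
(* The first bound absorbs half of [|y|], whence |y| <= 2 k W; the second makes the remaining error
   at most eps / 2. *)
pose d := Num.min (2^-1 / k) (eps / 2 / (k * (2 * k * W))).
have kW : 0 < k * (2 * k * W) by rewrite !mulr_gt0.
have d0 : 0 < d by rewrite lt_min !divr_gt0// invr_gt0.
have [d1 d2] : k * d <= 2^-1 /\ d * (k * (2 * k * W)) <= eps / 2.
  split; first by rewrite mulrC -ler_pdivlMr// /d ge_min lexx.
  by rewrite -ler_pdivlMr// /d ge_min lexx orbT.
have h1 := C1_quotient_error d0.
have h2 : \forall t \near G, `|w - c t *: (f (u' t) - f (u t))| <= 1 by move/cvgrPdist_le : cw; apply.
have h3 : \forall t \near G, `|w *m L - (c t *: (f (u' t) - f (u t))) *m L| <= eps / 2.
  by move/cvgrPdist_le : cwL; apply; rewrite divr_gt0.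
apply: (@filterS3 _ G FG _ _ _ _ _ h1 h2 h3) => t.
set x := c t *: (f _ - f _); set y := c t *: (u' t - u t) => a1 a2 a3.
have a4 : `|x| <= W.
  rewrite -[x](subrK w) addrC; apply: le_trans (ler_normD _ _) _.
  by rewrite lerD2l distrC.
have a5 : `|x *m L - y| <= k * (d * `|y|).
  rewrite -{1}(HL y) -mulmxBl; apply: le_trans (est _) _.
  by rewrite ler_pM2l.
have y0 : 0 <= `|y| by [].
have a6 : `|y| <= 2 * k * W.
  have h4 : `|y| <= `|x *m L| + `|x *m L - y|.
    by rewrite -{1}[y](subKr (x *m L)); exact: ler_normB.
  have h5 : k * (d * `|y|) <= 2^-1 * `|y| by rewrite mulrA ler_wpM2r.
  have h6 : `|x *m L| <= k * W by apply: le_trans (est _) _; rewrite ler_pM2l.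
  move: (le_trans h4 (lerD h6 (le_trans a5 h5))).
  by rewrite -[2 * k * W]mulrA; exact: half_absorb.
rewrite -(subrK (x *m L) (w *m L)) -addrA.
apply: le_trans (ler_normD _ _) _; rewrite [leRHS]splitr; apply: lerD => //.
apply: le_trans a5 _; apply: le_trans d2; rewrite mulrCA; apply: ler_wpM2l; first exact: ltW.
by rewrite ler_pM2l.
Qed.

End DifferenceQuotients.

Section MixedDerivatives.
Context {R : realType} {n : nat} {M : topologicalType} {SM : smooth_manifold R n M}.
Context {K : nat} {e : M -> 'rV[R]_K}.
Hypothesis (Ce : CkM SM 2 e).
Implicit Types (i : chart SM).
Local Notation erow := (erow (SM := SM) (e := e)).

Lemma erow_sym i xi k m : img i xi -> 'D_(delta_mx ord0 k) (erow i m) xi = 'D_(delta_mx ord0 m) (erow i k) xi.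
Proof.
move=> ixi; apply/rowP => l.
pose f xi := in_chart i e xi ord0 l.
have Cf : Ck_on 2 (img i) f by exact: ((Ck_on_rVP 2 (in_chart i e) (chart_img_open i)).1 (Ce i) l).
have E k' m' : ('D_(delta_mx ord0 k') (erow i m') xi) ord0 l = 'D_(delta_mx ord0 k') (fun y => 'D_(delta_mx ord0 m') f y) xi.
  rewrite derive_rV; last exact: (Ck_diff (erow_Ck Ce i m') ixi).
  apply: near_eq_derive; have : \forall y \near xi, img i y by apply: open_nbhs_nbhs; split=> //; exact: chart_img_open.
  apply: filterS => y iy; rewrite !mxE /f derive_rV//; exact: e_diff.
by rewrite !E (schwarz _ _ (chart_img_open i) Cf ixi).
Qed.

(** By symmetry of the second derivatives of [e], the term of the momentum equation that contains
    them is the derivative of the rows of [dE] along [v]; the two cancel in [Dy_cvg]. *)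
Lemma dymap_sym i xi (p : 'rV[R]_K) (v : 'rV[R]_n) k : img i xi ->
  pairing v (dymap (SM := SM) (e := e) i xi p (delta_mx ord0 k)) = pairing p ('D_v (erow i k) xi).
Proof.
move=> ixi; rewrite (derive_rV_sum v (Ck_diff (erow_Ck Ce i k) ixi)) pairingC.
have -> : pairing p (\sum_i0 v ord0 i0 *: 'D_(delta_mx ord0 i0) (erow i k) xi) =
    \sum_i0 v ord0 i0 * pairing p ('D_(delta_mx ord0 i0) (erow i k) xi).
  rewrite pairingE linear_sum /= mulmx_sumr summxE; apply: eq_bigr => m _.
  by rewrite linearZ /= -scalemxAr mxE -pairingE.
by rewrite pairingC /pairing; apply: eq_bigr => m _; rewrite dymap_entry erow_sym.
Qed.

End MixedDerivatives.

(** * The limit of critical sequences *)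

Lemma cancel_identity (R : realType) (u v w z f g : R) : w = u -> v = f -> z = 0 -> g = - f -> u - (v + w - z) = g.
Proof. by move=> -> -> -> ->; rewrite subr0 opprD addrCA subrr addr0. Qed.

Lemma quotient_identity (R : realType) (n K : nat) (N z : R) (p p' d d' : 'rV[R]_K) (y y' : 'rV[R]_n) k :
  y' ord0 k = pairing p' d' -> y ord0 k = pairing p d -> z = N * pairing (p - p') d' ->
  (N *: (y' - y)) ord0 k = pairing p (N *: (d' - d)) - z.
Proof. by rewrite !mxE => -> -> ->; rewrite pairingZr pairingBr pairingBl; ring. Qed.

Section ScalarDomain.
Context {R : realType} {V : normedModType R}.

Lemma hd_of_is_derive (f : R -> V) (t : R) (g : V) : is_derive t 1 f g -> has_derivative f t (fun v => v *: g).
Proof.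
move=> [d1 d2]; have df := (derivable1_diffP f t).1 d1; split=> // v.
have E : 'd f t (v *: (1 : R)) = v *: 'd f t 1 by rewrite linearZ.
by rewrite -d2 !deriveE// -E; congr ('d f t _); rewrite [RHS]mulr1.
Qed.

Lemma is_derive_of_hd (f : R -> V) (t : R) (L : R -> V) : has_derivative f t L -> is_derive t 1 f (L 1).
Proof. by move=> [d1 d2]; split; [exact/derivable1_diffP|exact: d2]. Qed.

End ScalarDomain.

Lemma energy_identity (R : realType) (n : nat) (v f hx hy : 'rV[R]_n) (c : R) : v = c *: hy -> f = c *: hx ->
  pairing hx (1 *: v) + pairing hy (1 *: - f) = 0.
Proof.
by move=> -> ->; rewrite !scale1r -scaleNr !pairingZr (pairingC hy) -mulrDl subrr mul0r.
Qed.

Lemma density_bound (R : realType) (c k r s eps : R) : `|c - k| <= eps / 2 -> 0 <= r -> 0 <= s -> c - eps / 2 <= k + 2^-1 * r + s.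
Proof. rewrite ler_norml => /andP[_ h1] r0 s0; lra. Qed.

Lemma total_bound (R : realType) (A d T W c eps : R) : A - d <= T - W -> c - eps / 2 <= W -> d <= eps / 2 -> A + c - eps <= T.
Proof. lra. Qed.

Lemma action_density_bound (R : realType) (u v s S d p r k eps r1 : R) : 0 <= s -> s <= S -> 0 <= r1 -> d - p <= r1 + 1 -> 0 <= r ->
  `|0 - u| <= eps / 3 -> `|0 - v| <= eps / 3 -> `|0 - k| <= eps / 3 ->
  u + v + s * d - (k + 2^-1 * r + s * p) <= S * (r1 + 1) + eps.
Proof.
move=> s0 sS r10 dp r0; rewrite !ler_norml => /andP[h1 _] /andP[h2 _] /andP[_ h3].
have h4 : s * (d - p) <= S * (r1 + 1).
  apply: le_trans (ler_wpM2l s0 dp) _; apply: ler_wpM2r => //; lra.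
rewrite mulrBr in h4; lra.
Qed.

Section LimitOrbit.
Context {R : realType} {n : nat} {M : topologicalType} {SM : smooth_manifold R n M}.
Context {K : nat} {e : M -> 'rV[R]_K}.
Local Notation dom := (@chart_dom _ _ SM).
Local Notation phi := (@chart_coord _ _ SM).
Local Notation Pm := (Pm (SM := SM) (e := e)).
Hypotheses (cM : compact [set: M]) (Ce : CkM SM 2 e) (einj : injective e)
  (imm : forall (i : chart SM) x (v : 'rV[R]_n), dom i x -> 'D_v (in_chart i e) (phi i x) = 0 -> v = 0).
Local Notation cov := (cov Ce).
Variable H : cotangent SM -> R.
Hypothesis sH : smooth_function (cotangent_atlas SM) H.
Variables (A a b r1 : R).
Hypotheses (ab : a < b) (A0 : 0 < A) (r10 : 0 < r1).
Local Notation dE := (dE (SM := SM) (e := e)).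
Hypothesis hr1 : forall z, H z <= b -> eucl (ell Ce imm z) < r1.
Implicit Types (i : chart SM).

Local Notation vel := (velocity (SM := SM) Ce H A a b).
Local Notation frc := (pos_force (SM := SM) Ce H A a b).
Local Notation left_inv := (left_inv (SM := SM) (e := e)).
Local Notation nrm := (normal_part (SM := SM) (e := e)).
Local Notation dymap := (dymap (SM := SM) (e := e)).
Local Notation ymap := (ymap (SM := SM) (e := e)).
Local Notation erow := (erow (SM := SM) (e := e)).
Local Notation prow := (prow (SM := SM) (e := e)).
Local Notation drem := (drem (SM := SM) (e := e)).

Variables (g0 : R -> M) (rho : R).
Context {F : set_system nat} {UF : UltraFilter F}.
Let PF : ProperFilter F := ultra_proper.
Let FF : Filter F := PF.
#[local] Existing Instance FF.
Variables (N_ : nat -> nat) (s_ : nat -> R) (X : nat -> int -> M) (P : nat -> int -> 'rV[R]_K) (C S : R).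
Hypotheses (N_pos : \forall l \near F, (0 < N_ l)%N) (N_inv : (N_ l)%:R^-1 @[l --> F] --> (0 : R)).
Hypothesis crit : \forall l \near F, critical_seq Ce H A a b r1 g0 rho (N_ l) (s_ l) C (X l) (P l).
Hypothesis sS : \forall l \near F, 0 <= s_ l <= S.
Local Notation nn := (near_node (R := R) (F := F) N_).
Local Notation step_at := (step_at (R := R) N_).

Lemma near_nodeT t (Q : nat -> int -> Prop) : (\forall l \near F, forall k, Q l k) ->
  \forall z \near nn t, Q z.1 z.2.
Proof. by move=> H1; exists 1 => //; apply: filterS H1 => l Hl j _; exact: Hl. Qed.

(** By [cs_nrm] the normal part is at most N times the normal part of a chord; the chord has length
    at most C / N and is tangent up to an arbitrarily small proportion. *)
Lemma normal_small (eps : R) : 0 < eps -> \forall l \near F, forall k, `|nrm (X l k) (P l k)| <= eps.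
Proof.
move=> eps0.
have [l0 [c0 Nl0]] := @filter_ex _ F _ _ (filterI crit N_pos).
have C0 : 0 <= C by apply: le_trans (cs_pC c0 0); exact: normr_ge0.
have e1 : 0 < eps / (C + 1) by rewrite divr_gt0// ltr_wpDl.
have [d d0 Hd] := chord_tangent cM Ce einj imm e1.
have d1 : 0 < d / (C + 1) by rewrite divr_gt0// ltr_wpDl.
apply: (@filterS2 _ F _ _ _ _ _ crit (N_large (PF := PF) N_pos N_inv d1)) => l cl [Nl0' Nl] k.
have N0 : 0 < (N_ l)%:R :> R by rewrite ltr0n.
have h1 := cs_dx cl k.
have CN : C / (N_ l)%:R < d.
  rewrite ltr_pdivrMr//; move: Nl; rewrite mulrAC ler_pdivlMr ?ltr_wpDl// mul1r.
  by apply: lt_le_trans; rewrite ltrDl.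
have h2 := Hd _ _ (le_lt_trans h1 CN).
apply: le_trans (cs_nrm cl k) _; rewrite -ler_pdivlMl//; apply: le_trans h2 _.
apply: le_trans (ler_wpM2l (ltW e1) h1) _.
rewrite mulrA [leRHS]mulrC ler_pM2r ?invr_gt0//.
by rewrite mulrAC ler_pdivrMr ?ltr_wpDl// mulrDr mulr1 lerDl ltW.
Qed.

Lemma normal_cvg t : nrm (X z.1 z.2) (P z.1 z.2) @[z --> nn t] --> (0 : 'rV[R]_K).
Proof.
apply/cvgrPdist_le => eps eps0; apply: (@near_nodeT t (fun l k => `|0 - nrm (X l k) (P l k)| <= eps)).
apply: filterS (normal_small eps0) => l Hl k; rewrite sub0r normrN; exact: Hl.
Qed.

Variables (x : R -> M) (q : R -> 'rV[R]_K).
Hypotheses (cX : forall t, X l (step_at l t) @[l --> F] --> x t)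
  (cQ : forall t, P l (step_at l t) *m Pm (X l (step_at l t)) @[l --> F] --> q t).

Lemma eX_step : \forall l \near F, forall k, `|e (X l (k + 1)) - e (X l k)| <= C / (N_ l)%:R.
Proof. by apply: filterS crit => l cl k; exact: (cs_dx cl). Qed.

Lemma eX_limit t : e (X l (step_at l t)) @[l --> F] --> e (x t).
Proof. exact: (cvg_comp _ _ (@cX t) (@e_continuous _ _ _ _ _ _ Ce (x t))). Qed.

Lemma q_step : \forall l \near F, forall k, `|P l (k + 1) *m Pm (X l (k + 1)) - P l k *m Pm (X l k)| <= C / (N_ l)%:R.
Proof. by apply: filterS crit => l cl k; exact: (cs_dq cl). Qed.

Lemma ex_lip t t' : `|e (x t') - e (x t)| <= C * `|t' - t|.
Proof. exact: (step_limit_lip (PF := PF) N_pos N_inv (a := fun l k => e (X l k)) eX_step eX_limit). Qed.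

Lemma x_continuous : continuous x.
Proof.
have ce := step_limit_continuous (PF := PF) N_pos N_inv (a := fun l k => e (X l k)) eX_step eX_limit.
move=> t U xU; have [r r0 Hr] := e_nbhs cM Ce einj xU.
have : \forall t' \near t, `|e (x t) - e (x t')| < r by move/cvgrPdist_lt : (ce t); apply.
by apply: filterS => t' h; apply: Hr; rewrite distrC.
Qed.

Lemma q_continuous : continuous q.
Proof. exact: (step_limit_continuous (PF := PF) N_pos N_inv (a := fun l k => P l k *m Pm (X l k)) q_step cQ). Qed.

Lemma X_cvg t : X z.1 z.2 @[z --> nn t] --> x t.
Proof.
have ce := near_node_step (PF := PF) N_pos N_inv (a := fun l k => e (X l k)) eX_step eX_limit (t := t).
move=> U xU; have [r r0 Hr] := e_nbhs cM Ce einj xU.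
have h1 : \forall z \near nn t, `|e (x t) - e (X z.1 z.2)| < r by move/cvgrPdist_lt : ce; apply.
by apply: (@filterS _ (nn t) _ _ _ _ h1) => z h; apply: Hr; rewrite distrC.
Qed.

Lemma P_cvg t : P z.1 z.2 @[z --> nn t] --> q t.
Proof.
have cq := near_node_step (PF := PF) N_pos N_inv (a := fun l k => P l k *m Pm (X l k)) q_step cQ (t := t).
have c := cvgD cq (@normal_cvg t); rewrite addr0 in c.
rewrite (_ : (fun z => P z.1 z.2) = fun z => P z.1 z.2 *m Pm (X z.1 z.2) + nrm (X z.1 z.2) (P z.1 z.2)).
  exact: c.
by apply/funext => z; rewrite /normal_part addrC subrK.
Qed.

Lemma q_proj t : q t *m Pm (x t) = q t.
Proof.
have c1 : P l (step_at l t) *m Pm (X l (step_at l t)) *m Pm (X l (step_at l t)) @[l --> F] --> q t *m Pm (x t).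
  apply: mulmx_cvg; first exact: cQ.
  exact: (cvg_comp _ _ (@cX t) (@Pm_cvg _ _ _ _ _ _ Ce imm (x t))).
have c2 : P l (step_at l t) *m Pm (X l (step_at l t)) @[l --> F] --> q t *m Pm (x t).
  rewrite (_ : (fun l => _) = fun l => P l (step_at l t) *m Pm (X l (step_at l t)) *m Pm (X l (step_at l t))).
    exact: c1.
  by apply/funext => l; rewrite -mulmxA (Pm_idem Ce imm).
exact: (cvg_unique _ c2 (@cQ t)).
Qed.

Lemma q_small t : H (cov (x t) (q t)) <= b -> eucl (q t) < r1.
Proof. by move=> /hr1; rewrite ell_cov q_proj. Qed.

Lemma X_cvgS t (d : int) : X z.1 (z.2 + d) @[z --> nn t] --> x t.
Proof. exact: (cvg_comp _ _ (@near_node_shift R F PF N_ N_pos N_inv t d) (@X_cvg t)). Qed.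

Lemma P_cvgS t (d : int) : P z.1 (z.2 + d) @[z --> nn t] --> q t.
Proof. exact: (cvg_comp _ _ (@near_node_shift R F PF N_ N_pos N_inv t d) (@P_cvg t)). Qed.

Lemma normal_cvgS t (d : int) : nrm (X z.1 (z.2 + d)) (P z.1 (z.2 + d)) @[z --> nn t] --> (0 : 'rV[R]_K).
Proof. exact: (cvg_comp _ _ (@near_node_shift R F PF N_ N_pos N_inv t d) (@normal_cvg t)). Qed.

Lemma dom_near t i (d : int) : dom i (x t) -> \forall z \near nn t, dom i (X z.1 (z.2 + d)).
Proof. by move=> dx; apply: (@X_cvgS t d); exact: chart_nbhs. Qed.

Section Equations.
Variables (t : R) (i : chart SM).
Hypotheses (dx : dom i (x t)) (Hb : H (cov (x t) (q t)) <= b).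
Local Notation xi := (phi i (x t)).

Lemma crit_near : \forall z \near nn t, (0 < N_ z.1)%N /\ critical_seq Ce H A a b r1 g0 rho (N_ z.1) (s_ z.1) C (X z.1) (P z.1).
Proof.
apply: (@near_nodeT t (fun l _ => (0 < N_ l)%N /\ critical_seq Ce H A a b r1 g0 rho (N_ l) (s_ l) C (X l) (P l))).
by apply: (@filterS2 _ F _ _ _ _ _ N_pos crit) => l h1 h2 _.
Qed.

(** As H <= b at the limit point, the limit momentum is shorter than r1, so the penalty gradient
    vanishes at the nearby nodes; the normal part tends to 0 and only the velocity remains. *)
Lemma De_cvg : (N_ z.1)%:R *: (e (X z.1 (z.2 + 1)) - e (X z.1 z.2)) @[z --> nn t] --> vel i (x t) (q t) *m dE i xi.
Proof.
have c1 : vel i (X z.1 z.2) (P z.1 z.2) *m dE i (phi i (X z.1 z.2)) + nrm (X z.1 z.2) (P z.1 z.2) @[z --> nn t] --> vel i (x t) (q t) *m dE i xi.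
  have v1 : vel i (X z.1 z.2) (P z.1 z.2) @[z --> nn t] --> vel i (x t) (q t).
    exact: (velocity_cvg imm sH dx (@X_cvg t) (@P_cvg t)).
  have v2 : dE i (phi i (X z.1 z.2)) @[z --> nn t] --> dE i xi by exact: (dE_phi_cvg Ce dx (@X_cvg t)).
  have v3 : vel i (X z.1 z.2) (P z.1 z.2) *m dE i (phi i (X z.1 z.2)) @[z --> nn t] --> vel i (x t) (q t) *m dE i xi by exact: (mulmx_cvg v1 v2).
  have c2 := cvgD v3 (@normal_cvg t).
  by rewrite addr0 in c2; exact: c2.
apply: cvg_trans c1; apply: near_eq_cvg.
have n1 : \forall z \near nn t, eucl (P z.1 z.2) < r1.
  have c3 : eucl (P z.1 z.2) @[z --> nn t] --> eucl (q t) by exact: (cvg_comp _ _ (@P_cvg t) (@eucl_continuous R K (q t))).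
  have o : nbhs (eucl (q t)) [set y : R | y < r1] by apply: open_nbhs_nbhs; split; [exact: open_lt|exact: q_small].
  exact: (c3 _ o).
have n2 := dom_near 0 dx.
apply: (@filterS3 _ (nn t) _ _ _ _ _ _ n1 n2 crit_near) => z h1 h2 [N0 cl].
rewrite addr0 in h2.
by rewrite (cs_step cl h2) (pen_zero (ltW h1)).2 scaler0 addr0 scalerA mulfV ?scale1r// pnatr_eq0 -lt0n.
Qed.

Let ixi : img i xi := chart_imgP dx.
Let cxi0 : phi i (X z.1 z.2) @[z --> nn t] --> xi := phi_cvg dx (@X_cvg t).
Let cxi1 : phi i (X z.1 (z.2 + 1)) @[z --> nn t] --> xi := phi_cvg dx (@X_cvgS t 1).

Lemma Dxi_cvg : (N_ z.1)%:R *: (phi i (X z.1 (z.2 + 1)) - phi i (X z.1 z.2)) @[z --> nn t] --> vel i (x t) (q t).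
Proof.
have HL v : 'D_v (in_chart i e) xi *m (left_inv i xi)^T = v.
  by rewrite -(dE_mul Ce _ ixi) -mulmxA (dE_left_inv Ce imm ixi) mulmx1.
have c1 : (N_ z.1)%:R *: (in_chart i e (phi i (X z.1 (z.2 + 1))) - in_chart i e (phi i (X z.1 z.2))) @[z --> nn t] --> vel i (x t) (q t) *m dE i xi.
  apply: cvg_trans De_cvg; apply: near_eq_cvg.
  have n2 := dom_near 0 dx; have n3 := dom_near 1 dx.
  by apply: (@filterS2 _ (nn t) _ _ _ _ _ n2 n3) => z; rewrite addr0 => h1 h2; rewrite !in_chartE.
have c2 := C1_quotient_inv (chart_img_open i) (Ck_onS (Ce i)) ixi cxi0 cxi1 HL c1.
rewrite -mulmxA (dE_left_inv Ce imm ixi) mulmx1 in c2; exact: c2.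
Qed.

(** A discrete product rule: the quotient of the k-th component is that of the k-th row of [dE],
    paired with [P], plus that of [P], paired with this row at the next node. The latter is given by
    [cs_mom], the second derivatives of [e] cancel by [dymap_sym], and the normal term tends to
    0. *)
Lemma Dy_cvg : (N_ z.1)%:R *: (ymap i (phi i (X z.1 (z.2 + 1))) (P z.1 (z.2 + 1)) - ymap i (phi i (X z.1 z.2)) (P z.1 z.2))
  @[z --> nn t] --> - frc i (x t) (q t).
Proof.
apply: (@mx_cvg R _ (nn t) _ _ _ (fun z => (N_ z.1)%:R *: (ymap i (phi i (X z.1 (z.2 + 1))) (P z.1 (z.2 + 1)) - ymap i (phi i (X z.1 z.2)) (P z.1 z.2)))) => j k.
rewrite (ord1 j) {j}.
pose w : 'rV[R]_n := delta_mx ord0 k.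
pose Y z := X z.1 (z.2 + 1); pose Q z := P z.1 (z.2 + 1).
have cY : Y z @[z --> nn t] --> x t := @X_cvgS t 1.
have cQ1 : Q z @[z --> nn t] --> q t := @P_cvgS t 1.
have c1 : pairing (frc i (Y z) (Q z)) w + pairing (vel i (Y z) (Q z)) (dymap i (phi i (Y z)) (Q z) w) -
    pairing (drem i (phi i (Y z)) (Q z) w) (nrm (Y z) (Q z)) @[z --> nn t] -->
    pairing (frc i (x t) (q t)) w + pairing (vel i (x t) (q t)) (dymap i xi (q t) w) - pairing (drem i xi (q t) w) 0.
  have f1 : pairing (frc i (Y z) (Q z)) w @[z --> nn t] --> pairing (frc i (x t) (q t)) w.
    by apply: pairing_cvg; [exact: force_cvg|exact: cvg_cst].
  have f2 : dymap i (phi i (Y z)) (Q z) w @[z --> nn t] --> dymap i xi (q t) w.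
    apply: (@mx_cvg R _ (nn t) _ _ _ (fun z => dymap i (phi i (Y z)) (Q z) w)) => j m; rewrite (ord1 j) [X in _ --> X]dymap_entry.
    rewrite (_ : (fun z => _) = fun z => pairing (Q z) ('D_w (erow i m) (phi i (Y z)))).
      exact: (pairing_cvg cQ1 (derive_cvg (v := w) _ (@erow_Ck _ _ _ _ _ _ Ce i m) ixi cxi1)).
    by apply/funext => z; rewrite dymap_entry.
  have f3 : drem i (phi i (Y z)) (Q z) w @[z --> nn t] --> drem i xi (q t) w.
    apply: (@mx_cvg R _ (nn t) _ _ _ (fun z => drem i (phi i (Y z)) (Q z) w)) => j m; rewrite (ord1 j) [X in _ --> X]drem_entry.
    rewrite (_ : (fun z => _) = fun z => pairing (Q z) ('D_w (prow i m) (phi i (Y z)))).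
      exact: (pairing_cvg cQ1 (derive_cvg (v := w) _ (@prow_Ck _ _ _ _ _ _ Ce imm i m) ixi cxi1)).
    by apply/funext => z; rewrite drem_entry.
  have v1 : vel i (Y z) (Q z) @[z --> nn t] --> vel i (x t) (q t).
    exact: (velocity_cvg imm sH dx cY cQ1).
  have f4 : pairing (vel i (Y z) (Q z)) (dymap i (phi i (Y z)) (Q z) w) @[z --> nn t] --> pairing (vel i (x t) (q t)) (dymap i xi (q t) w).
    exact: (pairing_cvg v1 f2).
  have f5 : pairing (drem i (phi i (Y z)) (Q z) w) (nrm (Y z) (Q z)) @[z --> nn t] --> pairing (drem i xi (q t) w) 0.
    exact: (pairing_cvg f3 (@normal_cvgS t 1)).
  exact: (cvgB (cvgD f1 f4) f5).
have c2 : pairing (P z.1 z.2) ((N_ z.1)%:R *: (erow i k (phi i (Y z)) - erow i k (phi i (X z.1 z.2)))) @[z --> nn t] -->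
    pairing (q t) ('D_(vel i (x t) (q t)) (erow i k) xi).
  apply: pairing_cvg; first exact: P_cvg.
  exact: (C1_quotient (chart_img_open i) (@erow_Ck _ _ _ _ _ _ Ce i k) ixi cxi0 cxi1 Dxi_cvg).
have c3 := cvgB (FF := @near_node_filter R F PF N_ t) c2 c1.
have E : pairing (q t) ('D_(vel i (x t) (q t)) (erow i k) xi) - (pairing (frc i (x t) (q t)) w +
    pairing (vel i (x t) (q t)) (dymap i xi (q t) w) - pairing (drem i xi (q t) w) 0) = (- frc i (x t) (q t)) ord0 k.
  have h := dymap_sym Ce (q t) (vel i (x t) (q t)) k ixi; rewrite -/w in h.
  have hw : pairing (frc i (x t) (q t)) w = frc i (x t) (q t) ord0 k by exact: pairing_delta.
  have hn : (- frc i (x t) (q t)) ord0 k = - (frc i (x t) (q t) ord0 k) by rewrite mxE.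
  have h0 : pairing (drem i xi (q t) w) 0 = 0 by exact: pairing0r.
  exact: (cancel_identity h hw h0 hn).
rewrite E in c3; apply: cvg_trans c3; apply: (@near_eq_cvg _ _ (nn t) (@near_node_filter R F PF N_ t)).
have n3 := dom_near 1 dx.
apply: (@filterS2 _ (nn t) _ _ _ _ _ n3 crit_near) => z h2 [N0 cl].
have := cs_mom cl w h2; rewrite addrK => mom.
have N1 : (N_ z.1)%:R != 0 :> R by rewrite pnatr_eq0 -lt0n.
have {}mom : pairing (frc i (Y z) (Q z)) w + pairing (vel i (Y z) (Q z)) (dymap i (phi i (Y z)) (Q z) w) -
    pairing (drem i (phi i (Y z)) (Q z) w) (nrm (Y z) (Q z)) = (N_ z.1)%:R * pairing (P z.1 z.2 - Q z) (erow i k (phi i (Y z))).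
  by rewrite /erow rowE mom mulrA mulfV// mul1r.
have E1 := ymap_entry (SM := SM) (e := e) i (phi i (Y z)) (Q z) k.
have E0' := ymap_entry (SM := SM) (e := e) i (phi i (X z.1 z.2)) (P z.1 z.2) k.
apply/esym; exact: (quotient_identity E1 E0' mom).
Qed.

Lemma position_ode : is_derive t 1 (fun t => phi i (x t)) (vel i (x t) (q t)).
Proof.
apply: (discrete_ode (PF := PF) N_pos N_inv (a := fun l k => phi i (X l k))); last exact: Dxi_cvg.
have nd : \forall t' \near t, dom i (x t') by apply: x_continuous; exact: chart_nbhs.
by apply: filterS nd => t' d'; exact: (phi_cvg d' (@cX t')).
Qed.

Lemma P_limit t' : P l (step_at l t') @[l --> F] --> q t'.
Proof. exact: (cvg_comp _ _ (near_node_step_at (PF := PF) N_pos N_inv (t := t')) (@P_cvg t')). Qed.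

Lemma momentum_ode : is_derive t 1 (fun t => ymap i (phi i (x t)) (q t)) (- frc i (x t) (q t)).
Proof.
apply: (discrete_ode (PF := PF) N_pos N_inv (a := fun l k => ymap i (phi i (X l k)) (P l k))); last exact: Dy_cvg.
have nd : \forall t' \near t, dom i (x t') by apply: x_continuous; exact: chart_nbhs.
by apply: filterS nd => t' d'; exact: (ymap_cvg Ce d' (@cX t') (@P_limit t')).
Qed.

Lemma embedding_ode : is_derive t 1 (fun t => e (x t)) (vel i (x t) (q t) *m dE i xi).
Proof.
apply: (discrete_ode (PF := PF) N_pos N_inv (a := fun l k => e (X l k))); last exact: De_cvg.
by apply: (@filterE _ (nbhs t) (nbhs_filter t)) => t'; exact: eX_limit.
Qed.

End Equations.

Lemma x_periodic t : x (t + 1) = x t.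
Proof.
apply: einj; have c1 := @eX_limit (t + 1); have c0 := @eX_limit t.
have c2 : e (X l (step_at l (t + 1))) @[l --> F] --> e (x t).
  apply: cvg_trans c0; apply: near_eq_cvg.
  by apply: filterS crit => l cl; rewrite /step_at floor_mul_shift (cs_x cl).
exact: (cvg_unique _ c1 c2).
Qed.

Lemma q_periodic t : q (t + 1) = q t.
Proof.
have c1 := @cQ (t + 1); have c0 := @cQ t.
have c2 : P l (step_at l (t + 1)) *m Pm (X l (step_at l (t + 1))) @[l --> F] --> q t.
  apply: cvg_trans c0; apply: near_eq_cvg.
  by apply: filterS crit => l cl; rewrite /step_at floor_mul_shift (cs_x cl) (cs_p cl).
exact: (cvg_unique _ c1 c2).
Qed.

Local Notation h := (fun t => H (cov (x t) (q t))).

Lemma energy_continuous : continuous h.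
Proof.
move=> t; have cx : x t' @[t' --> t] --> x t by exact: x_continuous.
have cq : q t' @[t' --> t] --> q t by exact: q_continuous.
exact: (@ham_cvg _ _ _ _ _ _ Ce imm _ sH _ _ (nbhs_filter t) x q (x t) (q t) cx cq).
Qed.

Lemma phase_ode t i : dom i (x t) -> h t <= b ->
  has_derivative (fun t => (phi i (x t), ymap i (phi i (x t)) (q t))) t
    (fun v => (v *: vel i (x t) (q t), v *: - frc i (x t) (q t))).
Proof.
move=> dx hb; apply: hd_pair; apply: hd_of_is_derive.
- exact: position_ode.
- exact: momentum_ode.
Qed.

Lemma energy_derive t : h t <= b -> is_derive t 1 h 0.
Proof.
move=> hb; have dx := some_chartP (SM := SM) (x t); set i := some_chart (SM := SM) (x t) in dx.
have hz := phase_ode dx hb.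
have hH := ham_chart_hd Ce imm sH (ymap i (phi i (x t)) (q t)) (chart_imgP dx).
have hc := is_derive_of_hd (hd_comp hz hH).
have E0 : \forall t' \near t, (ham_chart H i \o (fun t => (phi i (x t), ymap i (phi i (x t)) (q t)))) t' = h t'.
  have nd : \forall t' \near t, dom i (x t') by apply: x_continuous; exact: chart_nbhs.
  apply: filterS nd => t' d' /=.
  have -> : ymap i (phi i (x t')) (q t') = components (cov (x t') (q t')) i by rewrite cov_comp.
  exact: (in_chart_cot Ce imm H (z := cov (x t') (q t')) d').
have hd := near_eq_is_derive E0 hc.
apply: is_derive_eq hd _ => /=.
exact: energy_identity erefl erefl.
Qed.

(* The derivative of the energy is known to vanish only where the energy is at most [b], whence the
   detour by the square of the positive part of [b - energy]. *)
Lemma energy_const t0 : h t0 < b -> forall t, h t = h t0.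
Proof.
move=> h0 t.
have D0 (t' : R) : is_derive t' (1 : R) (fun t : R => pospow 2 (b - h t)) (0 : R).
  have [hb|hb] := leP (h t') b.
    have d1 := hd_of_is_derive (energy_derive hb).
    have d2 := hd_sub (hd_cst (b : R) (t' : R)) d1.
    have [p1 p2] : has_derivative (pospow 2) (b - h t') (fun v => v * (2%:R * pospow 1 (b - h t'))).
      split; first by have [] := pospow_derive 0 (b - h t') 0.
      by move=> v; have [] := pospow_derive 0 (b - h t') v.
    have d3 := is_derive_of_hd (hd_comp d2 (conj p1 p2)).
    by apply: is_derive_eq d3 _ => /=; rewrite scaler0 subr0 mul0r.
  have E0 : \forall t'' \near t', cst 0 t'' = pospow 2 (b - h t'') :> R.
    have n0 : \forall t'' \near t', b < h t''.
      have o : nbhs (h t') [set y : R | b < y] by apply: open_nbhs_nbhs; split; [exact: open_gt|].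
      exact: (@energy_continuous t' _ o).
    apply: filterS n0 => t'' ht; rewrite pospow_eq0//; by rewrite subr_le0 ltW.
  exact: (near_eq_is_derive E0 (is_derive_cst _ _ _)).
have := is_derive_0_is_cst t t0 D0; rewrite [RHS]pospow_pos; last by rewrite subr_ge0 ltW.
have [hb|hb] := leP (h t) b.
  rewrite pospow_pos ?subr_ge0// => /eqP; rewrite eqrXn2 ?subr_ge0 ?(ltW h0)// => /eqP.
  by move=> /(congr1 (fun u => b - u)); rewrite !subKr.
rewrite pospow_eq0; last by rewrite subr_le0 ltW.
by move=> /esym/eqP; rewrite expf_eq0 /= subr_eq0 => /eqP E1; move: h0; rewrite -E1 ltxx.
Qed.

Local Notation chord l j := (pairing (P l j) (e (X l (j + 1)) - e (X l j))).
Local Notation potential := (potM (SM := SM) Ce H A a b).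

Lemma action_bound (B : R) :
  (forall t, \forall z \near nn t, (N_ z.1)%:R * chord z.1 z.2 - (potential (X z.1 z.2) (P z.1 z.2) + s_ z.1 * pen r1 (P z.1 z.2)) <= B) ->
  A <= B.
Proof.
move=> HB; have U := near_node_uniform (PF := PF) N_pos N_inv (fun t _ => HB t).
have c0 : A - (N_ l)%:R^-1 @[l --> F] --> A.
  have c1 := cvgB (FF := FF) (@cvg_cst _ A _ F FF) N_inv.
  by rewrite subr0 in c1; exact: c1.
apply: (ler_cvg_to c0 (@cvg_cst _ B _ F FF)).
apply: (@filterS3 _ F FF _ _ _ _ _ U crit N_pos) => l Hl cl Nl.
have N0 : 0 < (N_ l)%:R :> R by rewrite ltr0n.
apply: le_trans (cs_action cl) _.
apply: le_trans (_ : \sum_(j < N_ l) (N_ l)%:R^-1 * B <= _); last first.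
  by rewrite sumr_const card_ord -[leLHS]mulr_natl mulrA mulfV ?gt_eqF// mul1r.
have N1 : (N_ l)%:R != 0 :> R by rewrite gt_eqF.
apply: ler_sum => j _; rewrite -[leLHS](mulKf N1) ler_pM2l ?invr_gt0//.
rewrite mulrBr mulrA mulfV ?gt_eqF// mul1r; apply: (Hl (j : nat)%:Z).
by rewrite le0z_nat /= lez_nat ltnW.
Qed.

(** Along a curve in {H >= b} the cutoff and its derivative vanish. In the limit the action density
    is then at most s (<grad pen, p> - pen) minus a nonnegative normal term, and [pen_euler] bounds
    this by S (r1 + 1). *)
Lemma energy_below : S * (r1 + 1) < A -> exists t, h t < b.
Proof.
move=> SA; apply: contrapT => no.
have hb t : b <= h t by rewrite leNgt; apply/negP => hlt; apply: no; exists t.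
suff : A <= S * (r1 + 1) by rewrite leNgt SA.
apply/ler_addgt0Pr => eps eps0; apply: action_bound => t.
have dx := some_chartP (SM := SM) (x t); set i := some_chart (SM := SM) (x t) in dx.
have [c'0 c0] : cutoff' A a b (h t) = 0 /\ cutoff A a b (h t) = 0.
  have [[h1 _]|[_ [h1 h2]]|[/andP[_ h1] _ _ _]] := cutoff_cases (a := a) (b := b) A0 ab (h t); split=> //.
  - by move: (lt_le_trans ab (le_trans (hb t) h1)); rewrite ltxx.
  - by move: (lt_le_trans ab (le_trans (hb t) h1)); rewrite ltxx.
  - by move: (lt_le_trans h1 (hb t)); rewrite ltxx.
  - by move: (lt_le_trans h1 (hb t)); rewrite ltxx.
have v0 : vel i (x t) (q t) = 0 by rewrite /velocity c'0 scale0r.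
have c1 : pairing (P z.1 z.2) (vel i (X z.1 z.2) (P z.1 z.2) *m dE i (phi i (X z.1 z.2))) @[z --> nn t] --> (0 : R).
  have v1 : vel i (X z.1 z.2) (P z.1 z.2) @[z --> nn t] --> vel i (x t) (q t).
    exact: (velocity_cvg imm sH dx (@X_cvg t) (@P_cvg t)).
  have v2 : dE i (phi i (X z.1 z.2)) @[z --> nn t] --> dE i (phi i (x t)) by exact: (dE_phi_cvg Ce dx (@X_cvg t)).
  have v3 := pairing_cvg (FF := @near_node_filter R F PF N_ t) (@P_cvg t) (mulmx_cvg v1 v2).
  by rewrite v0 mul0mx pairing0r in v3; exact: v3.
have c2 : pairing (P z.1 z.2) (nrm (X z.1 z.2) (P z.1 z.2)) @[z --> nn t] --> (0 : R).
  have v3 := pairing_cvg (FF := @near_node_filter R F PF N_ t) (@P_cvg t) (@normal_cvg t).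
  by rewrite pairing0r in v3; exact: v3.
have c3 : cutoff A a b (H (cov (X z.1 z.2) (P z.1 z.2))) @[z --> nn t] --> (0 : R).
  rewrite -c0; have cc : {for h t, continuous (cutoff A a b)}.
    exact: differentiable_continuous (cutoff_derive A a b (h t) 0).1.
  exact: (cvg_comp _ _ (ham_cvg imm sH (@X_cvg t) (@P_cvg t)) cc).
have e3 : 0 < eps / 3 by rewrite divr_gt0.
have n1 : \forall z \near nn t, `|0 - pairing (P z.1 z.2) (vel i (X z.1 z.2) (P z.1 z.2) *m dE i (phi i (X z.1 z.2)))| <= eps / 3.
  by move/cvgrPdist_le : c1; apply.
have n2 : \forall z \near nn t, `|0 - pairing (P z.1 z.2) (nrm (X z.1 z.2) (P z.1 z.2))| <= eps / 3.
  by move/cvgrPdist_le : c2; apply.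
have n3 : \forall z \near nn t, `|0 - cutoff A a b (H (cov (X z.1 z.2) (P z.1 z.2)))| <= eps / 3.
  by move/cvgrPdist_le : c3; apply.
have n4 := dom_near 0 dx.
have n5 : \forall z \near nn t, 0 <= s_ z.1 <= S.
  by apply: (@near_nodeT t (fun l _ => 0 <= s_ l <= S)); apply: filterS sS.
have NF := @near_node_filter R F PF N_ t.
have n6 := @filterI _ (nn t) NF _ _ n4 n5; have n7 := @filterI _ (nn t) NF _ _ n6 (crit_near t).
have n8 := @filterI _ (nn t) NF _ _ n1 (@filterI _ (nn t) NF _ _ n2 n3).
apply: (@filterS2 _ (nn t) _ _ _ _ _ n7 n8) => z [[d1 /andP[s0 s1]] [N0 cl]] [m1 [m2 m3]].
rewrite addr0 in d1.
have N1 : (N_ z.1)%:R != 0 :> R by rewrite pnatr_eq0 -lt0n.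
have E1 : (N_ z.1)%:R * chord z.1 z.2 = pairing (P z.1 z.2) (vel i (X z.1 z.2) (P z.1 z.2) *m dE i (phi i (X z.1 z.2))) +
    pairing (P z.1 z.2) (nrm (X z.1 z.2) (P z.1 z.2)) + s_ z.1 * pairing (pen_grad r1 (P z.1 z.2)) (P z.1 z.2).
  by rewrite (cs_step cl d1) pairingZr mulrA mulfV// mul1r !pairingDr pairingZr [pairing (pen_grad _ _) _]pairingC.
have E2 := pen_euler r10 (P z.1 z.2).
have E3 : 0 <= pairing (nrm (X z.1 z.2) (P z.1 z.2)) (nrm (X z.1 z.2) (P z.1 z.2)) by exact: pairing_ge0.
rewrite E1 /potM; exact: action_density_bound s0 s1 (ltW r10) E2 E3 m1 m2 m3.
Qed.

(** Partial sums of the discrete integral of y dx. They start one period early, at -N, so that the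
    limit has a two-sided derivative at 0; [absz] makes them meaningful for k >= -N. *)
Let sig l (k : int) : R := \sum_(i < absz (k + (N_ l)%:Z)) chord l ((i : nat)%:Z - (N_ l)%:Z).

Lemma sig_step l k : - (N_ l)%:Z <= k -> sig l (k + 1) - sig l k = chord l k.
Proof.
move=> kN; have k0 : 0 <= k + (N_ l)%:Z by rewrite -lerBlDr sub0r.
have E : absz (k + 1 + (N_ l)%:Z) = (absz (k + (N_ l)%:Z)).+1 by move: k0; clear; lia.
rewrite /sig E big_ord_recr /= addrAC subrr add0r.
by rewrite gez0_abs// addrK.
Qed.

Lemma sig_total l : sig l (N_ l)%:Z - sig l 0 = \sum_(j < N_ l) chord l (j : nat)%:Z.
Proof.
rewrite /sig add0r -PoszD !absz_nat big_split_ord /= addrAC subrr add0r.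
by apply: eq_bigr => j _; rewrite PoszD [X in X - _]addrC addrK.
Qed.

Lemma chord_le : exists2 B : R, 0 <= B & \forall l \near F, forall k, `|chord l k| <= B / (N_ l)%:R.
Proof.
have [l00 c0] := @filter_ex _ F PF _ crit.
have C0 : 0 <= C by apply: le_trans (cs_pC c0 0); exact: normr_ge0.
exists (K%:R * (C * C)); first by rewrite !mulr_ge0.
apply: filterS crit => l cl k; apply: le_trans (pairing_norm_le _ _) _.
rewrite -!mulrA; apply: ler_wpM2l => //; apply: ler_pM => //; [exact: (cs_pC cl)|exact: (cs_dx cl)].
Qed.

Lemma sig_limit t : exists y : R, sig l (step_at l t) @[l --> F] --> y.
Proof.
have [B B0 HB] := chord_le.
have [L HL] : exists L : 'rV[R]_1, (const_mx (sig l (step_at l t)) : 'rV[R]_1) @[l --> F] --> L.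
  apply: (@ultra_bounded R F UF 1 _ (B * (`|t| + 2))).
  apply: (@filterS2 _ F FF _ _ _ _ HB N_pos) => l Hl Nl.
  have N0 : 0 < (N_ l)%:R :> R by rewrite ltr0n.
  have t0 : 0 <= `|t| by [].
  apply: mx_norm_le => [|i j]; first by rewrite mulr_ge0// addr_ge0.
  rewrite mxE /sig; apply: le_trans (ler_norm_sum _ _ _) _.
  apply: le_trans (_ : \sum_(i < absz (step_at l t + (N_ l)%:Z)) (B / (N_ l)%:R) <= _).
    by apply: ler_sum => k _; exact: Hl.
  rewrite sumr_const card_ord -[leLHS]mulr_natl mulrCA; apply: ler_wpM2l => //.
  rewrite ler_pdivrMr// -[X in X <= _]/((absz _)%:Z%:~R) abszE intr_norm intrD.
  apply: le_trans (ler_normD _ _) _.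
  have h1 : `|(step_at l t)%:~R| <= `|(N_ l)%:R * t| + 1.
    rewrite -(subrK ((N_ l)%:R * t) (step_at l t)%:~R) addrC; apply: le_trans (ler_normD _ _) _.
    by rewrite lerD2l; exact: step_at_dist.
  have h2 : 1 <= (N_ l)%:R :> R by rewrite ler1n.
  apply: le_trans (lerD h1 (lexx _)) _; rewrite normrM (@ger0_norm _ (N_ l)%:R)//.
  rewrite -?[((N_ l)%:Z)%:~R]/((N_ l)%:R : R) ?(@ger0_norm _ (N_ l)%:R)//.
  by rewrite mulrDl [`|t| * _]mulrC; move: h2; lra.
exists (L ord0 ord0); have := @mx_entry_cvg R _ F _ _ _ L ord0 ord0 HL.
by under eq_fun do rewrite mxE.
Qed.

(** [Sg] is the limit of the partial sums [sig]. The normal and penalty terms are nonnegative and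
    drop out of the lower bound for its increment, and the cutoff converges uniformly over the nodes
    of a period because the energy is constant. *)
Lemma action_limit h0 : (forall t, h t = h0) -> h0 <= b -> exists Sg : R -> R,
  (forall t i, - 2^-1 <= t -> dom i (x t) -> is_derive t 1 Sg (pairing (q t) (vel i (x t) (q t) *m dE i (phi i (x t))))) /\
  A + cutoff A a b h0 <= Sg 1 - Sg 0.
Proof.
move=> hc hb; have [Sg cS] := choice sig_limit; exists Sg; split.
  move=> t i t0 dx.
  apply: (discrete_ode (PF := PF) N_pos N_inv (a := sig)); first by apply: (@filterE _ (nbhs t) (nbhs_filter t)) => t'; exact: cS.
  have htb : h t <= b by rewrite hc.
  have c1 := pairing_cvg (FF := @near_node_filter R F PF N_ t) (@P_cvg t) (De_cvg dx htb).
  apply: cvg_trans c1; apply: near_eq_cvg.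
  exists 2^-1; first by rewrite invr_gt0.
  apply: filterS N_pos => l Nl j hj /=.
  have N0 : 0 < (N_ l)%:R :> R by rewrite ltr0n.
  rewrite sig_step; first by rewrite pairingZr.
  rewrite -(ler_int R) mulrNz; move: hj; rewrite ler_norml => /andP[hj _].
  have h1 : (N_ l)%:R * (- 2^-1) <= (N_ l)%:R * t by rewrite ler_pM2l.
  by rewrite -[(N_ l)%:~R]/((N_ l)%:R); move: hj h1; lra.
have L0 : sig l (N_ l)%:Z - sig l 0 @[l --> F] --> Sg 1 - Sg 0.
  have c1 : sig l (N_ l)%:Z @[l --> F] --> Sg 1.
    rewrite (_ : (fun l => _) = fun l => sig l (step_at l 1)); first exact: cS.
    by apply/funext => l; rewrite /step_at mulr1 -[(N_ l)%:R]/((N_ l)%:Z%:~R) intrKfloor.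
  have c0 : sig l 0 @[l --> F] --> Sg 0.
    rewrite (_ : (fun l => _) = fun l => sig l (step_at l 0)); first exact: cS.
    by apply/funext => l; rewrite /step_at mulr0 floor0.
  exact: (cvgB c1 c0).
apply/ler_addgt0Pr => eps eps0.
have e2 : 0 < eps / 2 by rewrite divr_gt0.
have U : \forall l \near F, forall j : int, 0 <= j <= (N_ l)%:Z -> `|cutoff A a b h0 - cutoff A a b (H (cov (X l j) (P l j)))| <= eps / 2.
  apply: (@near_node_uniform R F PF N_ N_pos N_inv [set z | `|cutoff A a b h0 - cutoff A a b (H (cov (X z.1 z.2) (P z.1 z.2)))| <= eps / 2]) => t _.
  have c3 : cutoff A a b (H (cov (X z.1 z.2) (P z.1 z.2))) @[z --> nn t] --> cutoff A a b h0.
    rewrite -(hc t); have cc : {for h t, continuous (cutoff A a b)}.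
      exact: differentiable_continuous (cutoff_derive A a b (h t) 0).1.
    exact: (cvg_comp _ _ (ham_cvg imm sH (@X_cvg t) (@P_cvg t)) cc).
  by move/cvgrPdist_le : c3; apply.
have n1 : \forall l \near F, (0 < N_ l)%N /\ 1 <= eps / 2 * (N_ l)%:R by exact: (N_large (PF := PF) N_pos N_inv e2).
have c0 : A + cutoff A a b h0 - eps @[l --> F] --> A + cutoff A a b h0 - eps by exact: cvg_cst.
rewrite -lerBlDr; apply: (ler_cvg_to c0 L0).
apply: (@filterS2 _ F FF _ _ _ _ (filterI U sS) (filterI n1 crit)) => l [Ul /andP[s0 _]] [[Nl n2] cl].
have N0 : 0 < (N_ l)%:R :> R by rewrite ltr0n.
rewrite sig_total.
have := cs_action cl; rewrite sumrB -mulr_sumr => h1.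
have h2 : (N_ l)%:R^-1 * \sum_(j < N_ l) (cutoff A a b h0 - eps / 2) <= (N_ l)%:R^-1 * \sum_(j < N_ l) (potential (X l j%:Z) (P l j%:Z) + s_ l * pen r1 (P l j%:Z)).
  apply: ler_wpM2l; first by rewrite invr_ge0 ltW.
  apply: ler_sum => j _.
  have h3 : `|cutoff A a b h0 - cutoff A a b (H (cov (X l j%:Z) (P l j%:Z)))| <= eps / 2.
    by apply: Ul; rewrite le0z_nat /= lez_nat ltnW.
  have h4 : 0 <= pairing (nrm (X l j%:Z) (P l j%:Z)) (nrm (X l j%:Z) (P l j%:Z)) by exact: pairing_ge0.
  have h5 : 0 <= s_ l * pen r1 (P l j%:Z) by rewrite mulr_ge0// pen_ge0.
  rewrite /potM; exact: density_bound h3 h4 h5.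
rewrite sumr_const card_ord -[X in _ * X <= _]mulr_natl mulrA mulVf ?gt_eqF// mul1r in h2.
have h6 : (N_ l)%:R^-1 <= eps / 2 by rewrite -div1r ler_pdivrMr.
exact: total_bound h1 h2 h6.
Qed.

Section Class.
Hypothesis (rho0 : 0 < rho).
Hypothesis close : forall g k : R -> M, loop g -> loop k -> (forall t, `|e (g t) - e (k t)| <= 3 * rho) -> homotopic g k.

(** For most [l] the limit is within [rho] of the nodes, uniformly in time, and so is the loop that
    follows them; the two loops are then within 2 rho of each other. *)
Lemma limit_class : homotopic g0 x.
Proof.
have [l00 [c0 _]] := @filter_ex _ F PF _ (filterI crit N_pos).
have C0 : 0 <= C by apply: le_trans (cs_pC c0 0); exact: normr_ge0.
have d0 : 0 < rho / 4 / (C + 1) by rewrite !divr_gt0// ltr_wpDl.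
pose Q := [set z : nat * int | forall t', `|(N_ z.1)%:R * t' - z.2%:~R| <= 1 -> `|e (x t') - e (X z.1 z.2)| <= rho].
have U : \forall l \near F, forall j : int, 0 <= j <= (N_ l)%:Z -> Q (l, j).
  apply: (near_node_uniform N_pos N_inv) => t _.
  have ce := cvg_comp _ _ (@X_cvg t) (@e_continuous _ _ _ _ _ _ Ce (x t)).
  have n1 : \forall z \near nn t, `|e (x t) - e (X z.1 z.2)| <= rho / 2.
    by move/cvgrPdist_le : ce; apply; rewrite divr_gt0.
  have n2 : \forall z \near nn t, `|t - z.2%:~R / (N_ z.1)%:R| <= rho / 4 / (C + 1).
    by have /cvgrPdist_le := @near_node_time R F PF N_ N_pos t; apply.
  have n3 : \forall z \near nn t, (0 < N_ z.1)%N /\ 1 <= rho / 4 / (C + 1) * (N_ z.1)%:R.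
    apply: (@near_nodeT t (fun l _ => (0 < N_ l)%N /\ 1 <= rho / 4 / (C + 1) * (N_ l)%:R)).
    by apply: filterS (N_large (PF := PF) N_pos N_inv d0).
  apply: (@filterS3 _ (nn t) _ _ _ _ _ _ n1 n2 n3) => z m1 m2 [N1 m3] t' ht.
  have N0 : 0 < (N_ z.1)%:R :> R by rewrite ltr0n.
  have m4 : `|t' - t| <= rho / 2 / (C + 1).
    have m5 : `|t' - z.2%:~R / (N_ z.1)%:R| <= rho / 4 / (C + 1).
      rewrite -(ler_pM2r N0); apply: le_trans m3; rewrite -{2}(ger0_norm (ltW N0)) -normrM mulrBl mulfVK ?gt_eqF//.
      by rewrite mulrC.
    rewrite -(subrK (z.2%:~R / (N_ z.1)%:R) t') -addrA; apply: le_trans (ler_normD _ _) _.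
    rewrite distrC in m2; apply: le_trans (lerD m5 m2) _; rewrite -mulrDl.
    by rewrite ler_pM2r ?invr_gt0 ?ltr_wpDl//; lra.
  rewrite -(subrK (e (x t)) (e (x t'))) -addrA; apply: le_trans (ler_normD _ _) _.
  rewrite [leRHS]splitr; apply: lerD => //; apply: le_trans (ex_lip t t') _.
  apply: le_trans (ler_wpM2l C0 m4) _; rewrite mulrCA ler_piMr ?divr_ge0 ?(ltW rho0)//.
  by rewrite ler_pdivrMr ?ltr_wpDl// mul1r lerDl.
have [l [Ul [cl Nl]]] := @filter_ex _ F PF _ (filterI U (filterI crit N_pos)).
have N0 : 0 < (N_ l)%:R :> R by rewrite ltr0n.
have [k [lk hk fk]] := cs_class cl.
apply: homotopic_trans hk _; apply: close => //; first by split; [exact: x_continuous|exact: x_periodic].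
move=> t; pose u := t - (Num.floor t)%:~R.
have /andP[u0 u1] := frac_bounds t; rewrite -/u in u0 u1.
have kt : k t = k u by rewrite /u -mulrNz periodic_int//; case: lk.
have xt : x t = x u by rewrite /u -mulrNz periodic_int//; exact: x_periodic.
rewrite kt xt -(subrK (e (X l (step_at l u))) (e (k u))) -addrA.
have j0 : 0 <= step_at l u <= (N_ l)%:Z.
  apply/andP; split; first by rewrite floor_ge0 mulr_ge0// ltW.
  have /andP[b1 _] := step_at_bounds N_ l u.
  by rewrite -(ler_int R); apply: le_trans b1 _; rewrite -[leRHS]mulr1 ler_pM2l.
have q1 : `|e (x u) - e (X l (step_at l u))| <= rho.
  by apply: (Ul _ j0 u); rewrite distrC; exact: step_at_dist.
apply: le_trans (ler_normD _ _) _; rewrite distrC in q1.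
apply: le_trans (lerD (fk u) q1) _.
by rewrite -mulr2n -[leLHS]mulr_natl ler_pM2r// ler_nat.
Qed.

End Class.

End LimitOrbit.

(** * Reparametrization and the periodic orbit *)

Section AutonomousSystems.
Context {R : realType} {E : normedModType R} {I : finType}.
Variables (b : I -> E) (D' : set E) (Y : I -> E -> R) (D : set R) (c : I -> R -> R).
Hypotheses (oD : open D) (DD' : forall s, D s -> D' (\sum_i c i s *: b i)) (CY : forall i k, Ck_on k D' (Y i))
  (ode : forall s, D s -> forall i, is_derive s 1 (c i) (Y i (\sum_i c i s *: b i))).

(* Bootstrapping: if the solution is C^k, so is its derivative. *)
Lemma autonomous_smooth k i : Ck_on k D (c i).
Proof.
elim: k i => [|k IH] i /=.
  by move=> s Ds; apply: differentiable_continuous; exact: (hd_of_is_derive (ode Ds i)).1.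
split=> [s Ds|v]; first exact: (hd_of_is_derive (ode Ds i)).1.
apply: (Ck_on_ext oD (f := fun s => v * Y i (\sum_i c i s *: b i))).
  by move=> s Ds; rewrite (hd_of_is_derive (ode Ds i)).2.
apply: (Ck_onM oD); first exact: Ck_on_cst.
exact: (Ck_comp oD DD' IH (CY i k)).
Qed.

End AutonomousSystems.

Section PairBasis.
Context {R : realType} {n : nat}.
Implicit Types z : 'rV[R]_n * 'rV[R]_n.

Definition pair_basis (i : 'I_n + 'I_n) : 'rV[R]_n * 'rV[R]_n :=
  match i with inl k => (delta_mx ord0 k, 0) | inr k => (0, delta_mx ord0 k) end.

Definition pair_coord z (i : 'I_n + 'I_n) : R :=
  match i with inl k => z.1 ord0 k | inr k => z.2 ord0 k end.

Lemma pair_basisE z : z = \sum_i pair_coord z i *: pair_basis i.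
Proof.
rewrite big_sumType /=.
have H1 (f : 'I_n -> 'rV[R]_n) : \sum_k (f k, 0 : 'rV[R]_n) = (\sum_k f k, 0).
  apply: (big_ind2 (fun (z : 'rV[R]_n * 'rV[R]_n) u => z = (u, 0))) => // _ u _ u' -> ->.
  by have -> : (u, 0 : 'rV[R]_n) + (u', 0) = (u + u', 0 + 0) by []; rewrite addr0.
have H2 (f : 'I_n -> 'rV[R]_n) : \sum_k (0 : 'rV[R]_n, f k) = (0, \sum_k f k).
  apply: (big_ind2 (fun (z : 'rV[R]_n * 'rV[R]_n) u => z = (0, u))) => // _ u _ u' -> ->.
  by have -> : (0 : 'rV[R]_n, u) + (0, u') = (0 + 0, u + u') by []; rewrite addr0.
have -> : \sum_(i < n) z.1 ord0 i *: (delta_mx ord0 i, 0 : 'rV[R]_n) = (z.1, 0).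
  rewrite [in RHS](matrix_sum_delta z.1) big_ord1 -H1; apply: eq_bigr => k _.
  by congr (_, _); rewrite scaler0.
have -> : \sum_(i < n) z.2 ord0 i *: (0 : 'rV[R]_n, delta_mx ord0 i) = (0, z.2).
  rewrite [in RHS](matrix_sum_delta z.2) big_ord1 -H2; apply: eq_bigr => k _.
  by congr (_, _); rewrite scaler0.
by case: z => u v; congr (_, _); rewrite ?addr0 ?add0r.
Qed.

End PairBasis.

Lemma is_derive_rescale (R : realType) (V : normedModType R) (f : R -> V) (T s : R) (g : V) : T != 0 ->
  is_derive (T^-1 * s) 1 f (T *: g) -> is_derive s 1 (fun s => f (T^-1 * s)) g.
Proof.
move=> T0 df; have h1 := hd_scale T^-1 (hd_id (s : R)).
have h2 := is_derive_of_hd (hd_comp h1 (hd_of_is_derive df)).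
by apply: is_derive_eq h2 _ => /=; rewrite scalerA [_ *: 1]mulr1 mulVf// scale1r.
Qed.

Section LimitLoops.
Context {R : realType} {n : nat} {M : topologicalType} {SM : smooth_manifold R n M}.
Context {K : nat} {e : M -> 'rV[R]_K}.
Local Notation dom := (@chart_dom _ _ SM).
Local Notation phi := (@chart_coord _ _ SM).
Local Notation Pm := (Pm (SM := SM) (e := e)).
Hypotheses (cM : compact [set: M]) (Ce : CkM SM 2 e) (einj : injective e)
  (imm : forall (i : chart SM) x (v : 'rV[R]_n), dom i x -> 'D_v (in_chart i e) (phi i x) = 0 -> v = 0).
Local Notation cov := (cov Ce).
(** Shrink the covectors of [g] to zero, follow the homotopy of base loops in the zero section, then
    let the covectors grow to those of [q]. *)
Lemma homotopic_cov (g : R -> cotangent SM) (g0 x : R -> M) (q : R -> 'rV[R]_K) : loop g -> (forall t, base (g t) = g0 t) ->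
  homotopic g0 x -> loop x -> loop q -> homotopic g (fun t => cov (x t) (q t)).
Proof.
move=> [cg pg] bg [Fh [cF pF F0 F1]] [lx lxp] [lq lqp].
have h1 : homotopic g (fun t => cov (g0 t) 0).
  exists (fun p : R * R => cov (base (g p.2)) ((1 - p.1) *: ell Ce imm (g p.2))); split.
  - move=> p; have c2 : p'.2 @[p' --> p] --> p.2 by exact: cvg_snd.
    have c1 : p'.1 @[p' --> p] --> p.1 by exact: cvg_fst.
    have cg2 : g p'.2 @[p' --> p] --> g p.2 by exact: (cvg_comp _ _ c2 (cg p.2)).
    apply: (@cov_cvg _ _ _ _ _ _ Ce _ (nbhs p) _ _ _ _ (nbhs_filter p)).
      exact: (cvg_comp _ _ cg2 (@base_continuous _ _ _ SM (g p.2))).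
    apply: cvgZ; first by apply: cvgB; [exact: cvg_cst|exact: c1].
    exact: (cvg_comp _ _ cg2 (@ell_continuous _ _ _ _ _ _ Ce imm (g p.2))).
  - by move=> u t /=; rewrite pg.
  - by move=> t /=; rewrite subr0 scale1r cov_ell.
  - by move=> t /=; rewrite subrr scale0r bg.
have h2 : homotopic (fun t => cov (g0 t) 0) (fun t => cov (x t) 0).
  exists (fun p => cov (Fh p) 0); split.
  - move=> p; apply: (@cov_cvg _ _ _ _ _ _ Ce _ (nbhs p) _ _ _ _ (nbhs_filter p)); [exact: cF|exact: cvg_cst].
  - by move=> u t /=; rewrite (pF u t).
  - by move=> t; rewrite F0.
  - by move=> t; rewrite F1.
have h3 : homotopic (fun t => cov (x t) 0) (fun t => cov (x t) (q t)).
  exists (fun p : R * R => cov (x p.2) (p.1 *: q p.2)); split.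
  - move=> p; have c2 : p'.2 @[p' --> p] --> p.2 by exact: cvg_snd.
    have c1 : p'.1 @[p' --> p] --> p.1 by exact: cvg_fst.
    apply: (@cov_cvg _ _ _ _ _ _ Ce _ (nbhs p) _ _ _ _ (nbhs_filter p)).
      exact: (cvg_comp _ _ c2 (lx p.2)).
    apply: cvgZ; first exact: c1.
    exact: (cvg_comp _ _ c2 (lq p.2)).
  - by move=> u t /=; rewrite lxp lqp.
  - by move=> t /=; rewrite scale0r.
  - by move=> t /=; rewrite scale1r.
exact: homotopic_trans h1 (homotopic_trans h2 h3).
Qed.

Variable H : cotangent SM -> R.
Hypothesis sH : smooth_function (cotangent_atlas SM) H.
Variables (A a b r1 : R).
Hypotheses (ab : a < b) (A0 : 0 < A) (r10 : 0 < r1).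
Local Notation dE := (dE (SM := SM) (e := e)).
Hypothesis hr1 : forall z, H z <= b -> eucl (ell Ce imm z) < r1.
Implicit Types (i : chart SM).

Local Notation vel := (velocity (SM := SM) Ce H A a b).
Local Notation frc := (pos_force (SM := SM) Ce H A a b).
Local Notation ymap := (ymap (SM := SM) (e := e)).

Record limit_loop (g0 : R -> M) (h0 : R) (x : R -> M) (q : R -> 'rV[R]_K) : Prop := LimitLoop {
  ll_x : continuous x;
  ll_q : continuous q;
  ll_xp : forall t, x (t + 1) = x t;
  ll_qp : forall t, q (t + 1) = q t;
  ll_class : homotopic g0 x;
  ll_hb : h0 < b;
  ll_energy : forall t, H (cov (x t) (q t)) = h0;
  ll_pos : forall t i, dom i (x t) -> is_derive t 1 (fun t => phi i (x t)) (vel i (x t) (q t));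
  ll_mom : forall t i, dom i (x t) -> is_derive t 1 (fun t => ymap i (phi i (x t)) (q t)) (- frc i (x t) (q t));
  ll_emb : forall t i, dom i (x t) -> is_derive t 1 (fun t => e (x t)) (vel i (x t) (q t) *m dE i (phi i (x t)));
  ll_action : exists Sg : R -> R,
    (forall t i, - 2^-1 <= t -> dom i (x t) -> is_derive t 1 Sg (pairing (q t) (vel i (x t) (q t) *m dE i (phi i (x t))))) /\
    A + cutoff A a b h0 <= Sg 1 - Sg 0
}.

Variables (g0 : R -> M) (rho : R).
Hypothesis rho0 : 0 < rho.

Section Existence.
Variables (m : nat) (Lc : R).
Hypotheses (H0 : forall x, H (cov x 0) <= a) (m0 : (0 < m)%N) (Lc0 : 0 <= Lc).
Hypothesis samples : forall l, (0 < l)%N ->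
  exists y : int -> M, [/\ discrete_class (e := e) g0 rho (m * l) y, forall k, y (k + (m * l)%N%:Z) = y k &
    forall k, `|e (y (k + 1)) - e (y k)| <= Lc / (m * l)%N%:R].
Hypothesis trans : exists2 delta : R, 0 < delta & forall N y y', discrete_class (e := e) g0 rho N y ->
    (forall k, `|e (y k) - e (y' k)| <= rho) -> (forall k, y' (k + N%:Z) = y' k) ->
    (forall k, `|e (y' (k + 1)) - e (y' k)| <= delta) -> discrete_class (e := e) g0 rho N y'.
Hypothesis close : forall g k : R -> M, loop g -> loop k -> (forall t, `|e (g t) - e (k t)| <= 3 * rho) -> homotopic g k.
Hypothesis Abig : (@slope R K Lc + 1) * (r1 + 1) < A.

Lemma limit_loop_exists : exists h0 x q, limit_loop g0 h0 x q.
Proof.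
have [C [l0 crit]] := critical_loops cM einj sH ab A0 r10 hr1 H0 rho0 m0 Lc0 samples trans.
(* Multiples of [m] beyond the threshold [l0]; the summand l + 1 makes them positive and
   unbounded. *)
pose N_ l := (m * (l0 + l.+1))%N.
have /choice[d Hd] : forall l, exists d : R * (int -> M) * (int -> 'rV[R]_K),
    critical_seq Ce H A a b r1 g0 rho (N_ l) d.1.1 C d.1.2 d.2 /\ 0 <= d.1.1 <= @slope R K Lc + 1.
  move=> l; have [s [x [p Hp]]] := crit (l0 + l.+1)%N (leq_addr _ _).
  by exists (s, x, p).
pose s_ l := (d l).1.1; pose X l := (d l).1.2; pose P l := (d l).2.
have [F [UF leF]] := ultraFilterLemma (eventually_filter : ProperFilter \oo).
have PF : ProperFilter F := ultra_proper.
have FF : Filter F by exact: ultra_proper.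
have all (Q : nat -> Prop) : (forall l, Q l) -> \forall l \near F, Q l by move=> HQ; apply: filterE.
have N_pos : \forall l \near F, (0 < N_ l)%N.
  by apply: all => l; rewrite /N_ muln_gt0 m0 addnS.
have N_inv : (N_ l)%:R^-1 @[l --> F] --> (0 : R).
  apply/cvgrPdist_le => eps eps0; apply: leF; exists (Num.bound eps^-1) => // l /= ll.
  have N0 : 0 < (N_ l)%:R :> R by rewrite ltr0n /N_ muln_gt0 m0 addnS.
  rewrite sub0r normrN ger0_norm ?invr_ge0 ?(ltW N0)// -[leRHS]invrK lef_pV2 ?posrE ?invr_gt0//.
  apply: le_trans (ltW (archi_boundP _)) _; first by rewrite invr_ge0 ltW.
  rewrite ler_nat; apply: leq_trans ll _; rewrite /N_; apply: leq_trans (leq_pmull _ m0).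
  by rewrite addnS leqW// leq_addl.
have crit' : \forall l \near F, critical_seq Ce H A a b r1 g0 rho (N_ l) (s_ l) C (X l) (P l).
  by apply: all => l; exact: (Hd l).1.
have sS : \forall l \near F, 0 <= s_ l <= @slope R K Lc + 1 by apply: all => l; exact: (Hd l).2.
have /choice[x cX] : forall t : R, exists x : M, X l (step_at (R := R) N_ l t) @[l --> F] --> x.
  by move=> t; exact: ultra_cvg.
have /choice[q cQ] : forall t : R, exists q : 'rV[R]_K, P l (step_at (R := R) N_ l t) *m Pm (X l (step_at (R := R) N_ l t)) @[l --> F] --> q.
  move=> t; apply: (@ultra_bounded R F UF K _ (C + 1)).
  have sm := normal_small (UF := UF) cM einj imm N_pos N_inv crit' (ltr01 : 0 < (1 : R)).
  apply: (@filterS2 _ F FF _ _ _ _ sm crit') => l sl cl.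
  rewrite -[X in `|X|](subKr (P l (step_at N_ l t))); apply: le_trans (ler_normB _ _) _.
  by apply: lerD; [exact: (cs_pC cl)|exact: sl].
have [t0 ht0] := energy_below cM einj imm sH ab A0 r10 N_pos N_inv crit' sS cX cQ Abig.
have hc := energy_const (UF := UF) cM einj sH hr1 N_pos N_inv crit' cX cQ ht0.
have hb t : H (cov (x t) (q t)) <= b by rewrite hc ltW.
exists (H (cov (x t0) (q t0))), x, q; split.
- exact: (x_continuous cM einj N_pos N_inv crit' cX).
- exact: (q_continuous N_pos N_inv crit' cQ).
- exact: (x_periodic einj crit' cX).
- exact: (q_periodic crit' cQ).
- exact: (limit_class cM einj N_pos N_inv crit' cX rho0 close).
- exact: ht0.
- exact: hc.
- by move=> t i dx; exact: (position_ode cM einj sH hr1 N_pos N_inv crit' cX cQ dx (hb t)).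
- by move=> t i dx; exact: (momentum_ode cM einj sH hr1 N_pos N_inv crit' cX cQ dx (hb t)).
- by move=> t i dx; exact: (embedding_ode cM einj sH hr1 N_pos N_inv crit' cX cQ dx (hb t)).
- have hb' : H (cov (x t0) (q t0)) <= b := hb t0.
  exact: (action_limit cM einj sH hr1 N_pos N_inv crit' sS cX cQ hc hb').
Qed.

End Existence.

Section Orbit.
Variables (h0 : R) (x : R -> M) (q : R -> 'rV[R]_K).
Hypothesis lim : limit_loop g0 h0 x q.
Hypothesis nontriv : ~ exists p, homotopic g0 (fun=> p).
Local Notation T := (cutoff' A a b h0).

(** If the energy were at most [a], the derivative of the cutoff would vanish there, the base curve
    would have zero velocity and be constant, against the nontriviality of the class. *)
Lemma energy_range : a < h0 < b.
Proof.
rewrite (ll_hb lim) andbT ltNge; apply/negP => h0a; apply: nontriv; exists (x 0).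
suff xE : x = fun=> x 0 by rewrite -xE; exact: ll_class lim.
have c0 : T = 0.
  have [[_ [_ ->]]|[_ [_ ->]]|[/andP[h1 _] _ _ _]]// := cutoff_cases (a := a) (b := b) A0 ab h0.
  by move: (lt_le_trans h1 h0a); rewrite ltxx.
apply/funext => t; apply: einj; apply/rowP => j.
apply: (is_derive_0_is_cst (f := fun t => e (x t) ord0 j)) => t'.
have dx := some_chartP (SM := SM) (x t').
have d1 := is_derive_of_hd (hd_entry j (hd_of_is_derive (ll_emb lim dx))).
apply: is_derive_eq d1 _ => /=.
by rewrite /velocity (ll_energy lim) c0 scale0r mul0mx scaler0 mxE.
Qed.

Lemma period_gt0 : 0 < T.
Proof.
have /andP[h1 h2] := energy_range.
have [[h3 _]|[h3 _]|[_ _ _ //]] := cutoff_cases (a := a) (b := b) A0 ab h0.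
- by move: (lt_le_trans h1 h3); rewrite ltxx.
- by move: (lt_le_trans h2 h3); rewrite ltxx.
Qed.

(** At energy h0 the Hamiltonian vector field of f(H) is f'(h0) times that of H. With T = f'(h0),
    the curve of period 1 becomes an orbit of H of period T. *)
Definition limit_curve (s : R) : cotangent SM := cov (x (T^-1 * s)) (q (T^-1 * s)).
Let Tn0 : T != 0 := lt0r_neq0 period_gt0.

Lemma orbit_continuous : continuous limit_curve.
Proof.
move=> s; have cs : T^-1 * s' @[s' --> s] --> T^-1 * s by apply: cvgMl_tmp; exact: cvg_id.
apply: (@cov_cvg _ _ _ _ _ _ Ce R (nbhs s) _ _ _ _ (nbhs_filter s)).
- exact: (cvg_comp _ _ cs (@ll_x _ _ _ _ lim (T^-1 * s))).
- exact: (cvg_comp _ _ cs (@ll_q _ _ _ _ lim (T^-1 * s))).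
Qed.

Lemma orbit_position s i : dom i (base (limit_curve s)) ->
  is_derive s 1 (fun s => phi i (base (limit_curve s))) (ham_y H i (phi i (base (limit_curve s)), components (limit_curve s) i)).
Proof.
move=> dx; apply: (is_derive_rescale (f := fun t => phi i (x t)) Tn0).
apply: is_derive_eq (ll_pos lim dx) _.
by rewrite /velocity (ll_energy lim) (cov_comp Ce _ dx).
Qed.

Lemma orbit_components s i : dom i (base (limit_curve s)) ->
  {near s, (fun s => ymap i (phi i (x (T^-1 * s))) (q (T^-1 * s))) =1 (fun s => components (limit_curve s) i)}.
Proof.
move=> dx; have nd : \forall s' \near s, dom i (base (limit_curve s')).
  have cb : {for s, continuous (fun s => base (limit_curve s))}.
    exact: (cvg_comp _ _ (@orbit_continuous s) (@base_continuous _ _ _ SM (limit_curve s))).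
  by apply: cb; exact: chart_nbhs.
by apply: filterS nd => s' d'; rewrite (cov_comp Ce _ d').
Qed.

Lemma orbit_momentum s i : dom i (base (limit_curve s)) ->
  is_derive s 1 (fun s => components (limit_curve s) i) (- ham_x H i (phi i (base (limit_curve s)), components (limit_curve s) i)).
Proof.
move=> dx; apply: (near_eq_is_derive (orbit_components dx)).
apply: (is_derive_rescale (f := fun t => ymap i (phi i (x t)) (q t)) Tn0).
apply: is_derive_eq (ll_mom lim dx) _.
by rewrite /pos_force (ll_energy lim) (cov_comp Ce _ dx) scalerN.
Qed.

(** In a bundle chart the curve solves an autonomous system with smooth right side;
    [autonomous_smooth] is applied to its 2n scalar coordinates. *)
Lemma orbit_smooth : smooth_curve (cotangent_atlas SM) limit_curve.
Proof.
split; first exact: orbit_continuous.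
move=> i k; set D := limit_curve @^-1` _.
have oD : open D.
  rewrite openE => s Ds; have cb : {for s, continuous (fun s => base (limit_curve s))}.
    exact: (cvg_comp _ _ (@orbit_continuous s) (@base_continuous _ _ _ SM (limit_curve s))).
  by apply: cb; exact: chart_nbhs.
pose zeta s : 'rV[R]_n * 'rV[R]_n := (phi i (base (limit_curve s)), components (limit_curve s) i).
pose c j s := pair_coord (zeta s) j.
pose Y (j : 'I_n + 'I_n) (z : 'rV[R]_n * 'rV[R]_n) : R := match j with
  | inl k => 'D_(0, delta_mx ord0 k) (ham_chart H i) z | inr k => - 'D_(delta_mx ord0 k, 0) (ham_chart H i) z end.
have zE s : \sum_j c j s *: pair_basis j = zeta s by rewrite -pair_basisE.
pose D' := @chart_coord _ _ (cotangent_atlas SM) i @` @chart_dom _ _ (cotangent_atlas SM) i.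
have oD' : open D' by exact: cot_img_open.
have Cc : forall k j, Ck_on k D (c j).
  move=> k' j; apply: (@autonomous_smooth R _ _ pair_basis D' Y D c oD).
  - by move=> s Ds; rewrite zE; exists (limit_curve s).
  - move=> [l|l] k''; first exact: (Ck_der _ (sH i k''.+1)).
    by apply: Ck_onN => //; exact: (Ck_der _ (sH i k''.+1)).
  - move=> s Ds [l|l]; rewrite zE.
    + have d1 := is_derive_of_hd (hd_entry l (hd_of_is_derive (orbit_position Ds))).
      by apply: is_derive_eq d1 _; rewrite scale1r mxE.
    + have d1 := is_derive_of_hd (hd_entry l (hd_of_is_derive (orbit_momentum Ds))).
      by apply: is_derive_eq d1 _; rewrite scale1r !mxE.
apply: (Ck_on_ext oD (f := fun s => \sum_j c j s *: pair_basis j)); first by move=> s _; rewrite zE.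
by apply: (Ck_on_sum _ oD) => j _; apply: (Ck_onZl _ oD); exact: Cc.
Qed.

Lemma orbit_hamiltonian : periodic_orbit H T limit_curve.
Proof.
split.
- exact: period_gt0.
- by move=> s; rewrite /limit_curve mulrDr mulVf// (ll_xp lim) (ll_qp lim).
- exact: orbit_smooth.
move=> s i dx w.
have h1 := hd_of_is_derive (orbit_position dx).
have h2 := hd_of_is_derive (orbit_momentum dx).
have h3 := is_derive_of_hd (hd_pair h1 h2).
have -> : derive1 (@chart_coord _ _ (cotangent_atlas SM) i \o limit_curve) s =
    (ham_y H i (phi i (base (limit_curve s)), components (limit_curve s) i), - ham_x H i (phi i (base (limit_curve s)), components (limit_curve s) i)).
  rewrite derive1E; rewrite (_ : _ \o limit_curve = fun s => (phi i (base (limit_curve s)), components (limit_curve s) i))//.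
  by rewrite (@derive_val _ _ _ _ _ _ _ h3) !scale1r.
have ixi : img i (phi i (base (limit_curve s))) by exact: chart_imgP.
rewrite (ham_chart_hd Ce imm sH (components (limit_curve s) i) ixi).2.
rewrite /canonical_symplectic_form /exterior_derivative /liouville_form.
have D v u : 'D_u (fun z : 'rV[R]_n * 'rV[R]_n => pairing z.2 v) (@chart_coord _ _ (cotangent_atlas SM) i (limit_curve s)) = pairing u.2 v.
  by rewrite (hd_pairing (hd_snd _) (hd_cst v _)).2 /= pairing0r addr0.
by rewrite !D /= pairingNl opprB opprK addrC [pairing w.2 _]pairingC.
Qed.

Lemma orbit_velocity s i : dom i (base (limit_curve s)) ->
  derive1 (phi i \o (@base R n M SM \o limit_curve)) s = ham_y H i (phi i (base (limit_curve s)), components (limit_curve s) i).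
Proof. by move=> dx; rewrite derive1E; exact: (@derive_val _ _ _ _ _ _ _ (orbit_position dx)). Qed.

(** The integrand is the derivative of the rescaled [Sg], so the integral is at least A + f(h0),
    which is positive because h0 lies in (a, b). *)
Lemma orbit_action : 0 < \int[lebesgue_measure]_(t in `[0, T]) pairing_velocity limit_curve t.
Proof.
have T0 := period_gt0; have [Sg [dS SA]] := ll_action lim.
pose G s := Sg (T^-1 * s).
have dG s i : - (T / 2) <= s -> dom i (base (limit_curve s)) -> is_derive s 1 G
    (pairing (components (limit_curve s) i) (ham_y H i (phi i (base (limit_curve s)), components (limit_curve s) i))).
  move=> s0 dx; apply: (is_derive_rescale (f := Sg) Tn0).
  have t0 : - 2^-1 <= T^-1 * s.
    by rewrite mulrC ler_pdivlMr// mulNr mulrC.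
  apply: is_derive_eq (dS _ _ t0 dx) _.
  by rewrite (cov_comp Ce _ dx) pairing_mulmx trmxK /velocity (ll_energy lim) -scalemxAl pairingZr.
have pvE s : - (T / 2) <= s -> is_derive s 1 G (pairing_velocity limit_curve s).
  move=> s0; rewrite /pairing_velocity; set i := projT1 _.
  have dx : dom i (base (limit_curve s)) by rewrite /i; case: cid.
  by rewrite orbit_velocity//; exact: dG.
have cpv s : 0 <= s -> {for s, continuous (pairing_velocity limit_curve)}.
  move=> s0; have dx := some_chartP (SM := SM) (base (limit_curve s)); set i := some_chart (SM := SM) _ in dx.
  have cb : {for s, continuous (fun s => base (limit_curve s))}.
    exact: (cvg_comp _ _ (@orbit_continuous s) (@base_continuous _ _ _ SM (limit_curve s))).
  have n1 : \forall s' \near s, dom i (base (limit_curve s')) by apply: cb; exact: chart_nbhs.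
  have n2 : \forall s' \near s, - (T / 2) < s'.
    by apply: open_nbhs_nbhs; split; [exact: open_gt|rewrite /= (lt_le_trans _ s0)// oppr_lt0 divr_gt0].
  have cx : phi i (base (limit_curve s')) @[s' --> s] --> phi i (base (limit_curve s)).
    by exact: (cvg_comp _ _ cb (chart_continuous dx)).
  have cy : components (limit_curve s') i @[s' --> s] --> components (limit_curve s) i.
    exact: differentiable_continuous (hd_of_is_derive (orbit_momentum dx)).1.
  have [_ _ ch] := ham_grad_cvg Ce imm sH (nbhs_filter s) (chart_imgP dx) cx cy.
  have c1 := pairing_cvg (FF := nbhs_filter s) cy ch.
  (* [pairing_velocity] uses a chart that varies with the point. In every chart its value is the
     derivative of [G], so near [s] it agrees with its expression in one fixed chart, which is
     continuous. *)
  have E1 (s' : R) : - (T / 2) < s' -> dom i (base (limit_curve s')) -> pairing_velocity limit_curve s' =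
      pairing (components (limit_curve s') i) (ham_y H i (phi i (base (limit_curve s')), components (limit_curve s') i)).
    move=> h1 h2; rewrite -(@derive_val _ _ _ _ _ _ _ (pvE _ (ltW h1))).
    exact: (@derive_val _ _ _ _ _ _ _ (dG _ _ (ltW h1) h2)).
  have es := E1 s (nbhs_singleton n2) dx; suff : pairing_velocity limit_curve s' @[s' --> s] --> pairing_velocity limit_curve s by [].
  rewrite es.
  apply: cvg_trans c1; apply: (@near_eq_cvg _ _ (nbhs s) (nbhs_filter s)).
  by apply: (@filterS2 _ (nbhs s) (nbhs_filter s) _ _ _ _ n1 n2) => s' h1 h2; exact: esym (E1 _ h2 h1).
have T2 : - (T / 2) <= 0 by rewrite oppr_le0 divr_ge0// ltW.
have cG s : 0 <= s -> {for s, continuous G}.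
  move=> s0; apply: differentiable_continuous.
  exact: (hd_of_is_derive (pvE s (le_trans T2 s0))).1.
rewrite /Rintegral (continuous_FTC2 (F := G) T0).
- rewrite /= /G mulr0 mulVf//.
  have /andP[h1 h2] := energy_range.
  have [[h3 _]|[h3 _]|[_ h3 _ _]] := cutoff_cases (a := a) (b := b) A0 ab h0.
  + by move: (lt_le_trans h1 h3); rewrite ltxx.
  + by move: (lt_le_trans h2 h3); rewrite ltxx.
  by apply: lt_le_trans SA; rewrite -ltrBlDl sub0r.
- apply: continuous_in_subspaceT => s; rewrite inE /= in_itv /= => /andP[s0 _]; exact: cpv.
- split.
  + move=> s; rewrite in_itv /= => /andP[s0 _]; have [] := pvE s (le_trans T2 (ltW s0)) => d _; exact: d.
  + by apply: cvg_at_right_filter; exact: cG.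
  + by apply: cvg_at_left_filter; apply: cG; exact: ltW.
- move=> s; rewrite in_itv /= => /andP[s0 _].
  by rewrite derive1E; exact: (@derive_val _ _ _ _ _ _ _ (pvE s (le_trans T2 (ltW s0)))).
Qed.

Lemma orbit_class (g : R -> cotangent SM) : loop g -> (forall t, base (g t) = g0 t) -> homotopic g (fun s => limit_curve (T * s)).
Proof.
move=> lg bg; have -> : (fun s => limit_curve (T * s)) = fun s => cov (x s) (q s).
  by apply/funext => s; rewrite /limit_curve mulrA mulVf// mul1r.
apply: (homotopic_cov lg bg (ll_class lim)).
- by split; [exact: ll_x lim|exact: ll_xp lim].
- by split; [exact: ll_q lim|exact: ll_qp lim].
Qed.

End Orbit.
End LimitLoops.

Section Density.
Context {R : realType} {n : nat} {M : topologicalType} {SM : smooth_manifold R n M}.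
Variable H : cotangent SM -> R.
Hypotheses (cM : compact [set: M]) (sH : smooth_function (cotangent_atlas SM) H)
  (H_proper : forall K : set R, compact K -> compact (H @^-1` K)) (H_lbound : has_lbound (range H)).
Variable g : R -> cotangent SM.
Hypotheses (lg : loop g) (nontriv : forall p : cotangent SM, ~ homotopic g (fun=> p)).

(** Properness and the lower bound make {H <= b} compact, which gives [r1]; the sampled loop gives
    the slope. Neither depends on [A], which is chosen last. *)
Lemma orbit_between (a b : R) : (forall x, H (zero_section SM x) <= a) -> a < b ->
  exists s T (z : R -> cotangent SM), [/\ a < s < b, periodic_orbit H T z, forall t, H (z t) = s,
    homotopic g (fun t => z (T * t)) & 0 < \int[lebesgue_measure]_(t in `[0, T]) pairing_velocity z t].
Proof.
move=> H0 ab; have [K [e [einj Ce imm]]] := embedding SM cM.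
pose g0 t := base (g t).
have lg0 : loop g0.
  split; first by move=> t; exact: (cvg_comp _ _ (lg.1 t) (@base_continuous _ _ _ SM (g t))).
  by move=> t; rewrite /g0 lg.2.
have [rho [rho0 Hrho]] := discrete_loops cM Ce einj imm.
have [close [delta delta0 trans] samples0] := Hrho rho rho0 (lexx rho).
have [m [L0 [m0 samples]]] := samples0 g0 lg0.
pose Lc := `|L0|.
have samples' l : (0 < l)%N -> exists y : int -> M, [/\ discrete_class (e := e) g0 rho (m * l) y,
    forall k, y (k + (m * l)%N%:Z) = y k & forall k, `|e (y (k + 1)) - e (y k)| <= Lc / (m * l)%N%:R].
  move=> l0; have [y [y1 y2 y3]] := samples l l0; exists y; split=> // k.
  apply: le_trans (y3 k) _; apply: ler_wpM2r; first by rewrite invr_ge0.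
  exact: ler_norm.
have trans' : exists2 delta : R, 0 < delta & forall N y y', discrete_class (e := e) g0 rho N y ->
    (forall k, `|e (y k) - e (y' k)| <= rho) -> (forall k, y' (k + N%:Z) = y' k) ->
    (forall k, `|e (y' (k + 1)) - e (y' k)| <= delta) -> discrete_class (e := e) g0 rho N y'.
  by exists delta => // N y y'; exact: trans.
have [lb lbP] := H_lbound.
have [r1 r10 hr1] : exists2 r1 : R, 0 < r1 & forall z, H z <= b -> eucl (ell Ce imm z) < r1.
  have cz : compact (H @^-1` `[lb, b]) by apply: H_proper; exact: segment_compact.
  have cf : continuous (fun z => eucl (ell Ce imm z)).
    by move=> z; exact: (cvg_comp _ _ (@ell_continuous _ _ _ _ _ _ Ce imm z) (@eucl_continuous R K _)).
  have ci : compact ((fun z => eucl (ell Ce imm z)) @` (H @^-1` `[lb, b])).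
    by apply: continuous_compact => //; exact: continuous_subspaceT.
  have [B [_ HB]] := compact_bounded ci.
  exists (`|B| + 2); first by rewrite ltr_wpDl.
  move=> z Hz; have : `|eucl (ell Ce imm z)| <= `|B| + 1.
    apply: (HB (`|B| + 1)); first by rewrite (le_lt_trans (ler_norm _))// ltrDl.
    exists z => //; rewrite /= in_itv /= Hz andbT; apply: lbP; by exists z.
  rewrite ger0_norm; last exact: eucl_ge0.
  by move=> /le_lt_trans; apply; rewrite ltrD2l ltr1n.
pose A := (@slope R K Lc + 1) * (r1 + 1) + 1.
have s0 : 0 <= @slope R K Lc.
  by apply: addr_ge0 => //; apply: mulr_ge0; [exact: ler0n|exact: normr_ge0].
have A0 : 0 < A by rewrite ltr_wpDl// mulr_ge0// addr_ge0// ltW.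
have HA : (@slope R K Lc + 1) * (r1 + 1) < A by rewrite ltrDl.
have H0' x : H (cov Ce x 0) <= a by rewrite cov0.
have [h0 [x [q lim]]] := limit_loop_exists cM einj sH ab A0 r10 hr1 rho0 H0' m0 (normr_ge0 _) samples' trans' close HA.
(* A contraction of the base loop would yield one of [g] by [homotopic_cov] with zero momenta. *)
have nt : ~ exists p, homotopic g0 (fun=> p).
  move=> [p hp]; apply: (nontriv (p := cov Ce p 0)).
  apply: (homotopic_cov Ce imm lg (fun=> erefl) hp (x := fun=> p) (q := fun=> 0)).
  - by split=> [t|t] //; exact: cvg_cst.
  - by split=> [t|t] //; exact: cvg_cst.
exists h0, (cutoff' A a b h0), (limit_curve Ce A a b h0 x q); split.
- exact: (energy_range einj ab A0 lim nt).
- exact: (orbit_hamiltonian einj imm sH ab A0 lim nt).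
- by move=> t; exact: (ll_energy lim).
- exact: (orbit_class einj imm ab A0 lim nt lg (fun=> erefl)).
- exact: (orbit_action einj imm sH ab A0 lim nt).
Qed.

End Density.

Theorem theorem2 (R : realType) (n : nat) (M : topologicalType)
    (SM : smooth_manifold R n M)
    (M_compact : compact [set: M]) (M_connected : connected [set: M])
    (H : cotangent SM -> R)
    (H_smooth : smooth_function (cotangent_atlas SM) H)
    (H_proper : forall K : set R, compact K -> compact (H @^-1` K))
    (H_bounded_below : has_lbound (range H))
    (c : R)
    (H_zero_section : range (@zero_section R n M SM) `<=` [set z | H z < c])
    (alpha : set (R -> cotangent SM))
    (alpha_class : free_homotopy_class alpha)
    (alpha_nontrivial : nontrivial_class alpha) :
  exists S_alpha : set R,
    [/\ S_alpha `<=` `]c, +oo[%classic,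
        `]c, +oo[%classic `<=` closure S_alpha &
        forall s : R, S_alpha s ->
          exists (tau : R) (z : R -> cotangent SM),
            [/\ periodic_orbit H tau z,
                range z `<=` [set p | H p = s],
                represents tau z alpha &
                0 < \int[lebesgue_measure]_(t in `[0, tau]) pairing_velocity z t]].

Proof.
have [g lg alphaE] := alpha_class.
have nontriv (p : cotangent SM) : ~ homotopic g (fun=> p).
  move=> hp; apply: (alpha_nontrivial p); rewrite alphaE; split; last exact: homotopic_freely.
  by split=> [t|t] //; exact: cvg_cst.
pose orbit_at (s : R) := exists (tau : R) (z : R -> cotangent SM), [/\ periodic_orbit H tau z,
  range z `<=` [set p | H p = s], represents tau z alpha &
  0 < \int[lebesgue_measure]_(t in `[0, tau]) pairing_velocity z t].
(* All levels above [c] that carry such an orbit are taken, so that only density remains to be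
   proved. *)
exists [set s | c < s /\ orbit_at s]; split.
- by move=> s [cs _]; rewrite /= in_itv /= cs.
- move=> s /=; rewrite in_itv /= andbT => cs B /nbhs_ballP[eps /= eps0 HB].
  (* [orbit_between] is applied to a subinterval of (s, s + eps); its left end exceeds [c], hence
     bounds H on the zero section. *)
  have ab : s + eps / 3 < s + eps / 2 by rewrite ltrD2l ltr_pM2l// ltf_pV2 ?posrE// ltr_nat.
  have e3 : 0 < eps / 3 by rewrite divr_gt0.
  have H0 x : H (zero_section SM x) <= s + eps / 3.
    have h1 : H (zero_section SM x) < c by apply: H_zero_section; exists x.
    by rewrite ltW// (lt_trans h1)// (lt_trans cs)// ltrDl.
  have [s' [T [z [/andP[h1 h2] pz Hz hz iz]]]] := orbit_between M_compact H_smooth H_proper H_bounded_below lg nontriv H0 ab.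
  exists s'; split.
    split; first by rewrite (lt_trans cs)// (lt_trans _ h1)// ltrDl.
    exists T, z; split=> //; first by move=> _ [t _ <-]; exact: Hz.
    have [T0 perz [cz _] _] := pz.
    rewrite /represents alphaE; split; last exact: homotopic_freely.
    split; last by move=> t; rewrite mulrDr mulr1 perz.
    move=> t; have ct : T * t' @[t' --> t] --> T * t by apply: cvgMl_tmp; exact: cvg_id.
    exact: (cvg_comp _ _ ct (cz (T * t))).
  apply: HB; rewrite -ball_normE /= distrC ger0_norm; last by rewrite subr_ge0 ltW// (lt_trans _ h1)// ltrDl.
  by rewrite ltrBlDl (lt_trans h2)// ltrD2l ltr_pdivrMr// ltr_pMr// ltr1n.
- by move=> s [].
Qed.
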